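(* Let $\lambda>0$, let $\delta\ge 2$ be an integer, let $g\in\mathcal L^+$ (with exponential parameter $\alpha$ in its product representation) and let $\tau\in I(g)$. Then for every $n\in\mathbb N$ and $\theta\ge 0$ the Cauchy problem $$\frac{\partial f_n(t,z)}{\partial t}=\tau(\Delta_\theta f_n)(t,z),\quad t\in[0,1],\ z\in\mathbb C,\qquad f_n(0,z)=\left[f_{n-1}(1,z\delta^{-1-\lambda})\right]^\delta,$$ where $f_0(1,z)=g(z)$, has a unique solution $f_n$, which belongs to $\mathcal L^+_\alpha$.
   Context: Let $\mathcal E$ be the set of entire functions $\mathbb C\to\mathbb C$. For $b>0$ put $\|f\|_b=\sup_{k\ge 0} b^{-k}|f^{(k)}(0)|$. For $a\ge 0$, $\mathcal A_a=\{f\in\mathcal E: \|f\|_b<\infty\ \forall b>a\}$, a Fréchet space with the topology given by the norms $\|\cdot\|_b$, $b>a$. $\mathcal L$ (Laguerre entire functions) is the set of entire functions of the form $f(z)=Cz^m\exp(\alpha z)\prod_{j=1}^\infty(1+\gamma_j z)$ with $C\in\mathbb C$, $m\in\mathbb N_0$, $\alpha\ge 0$, $\gamma_j\ge\gamma_{j+1}\ge 0$, $\sum_j\gamma_j<\infty$. Put $\mathcal L^+=\{f\in\mathcal L: f(0)>0\}$ and $\mathcal L^+_a=\mathcal L^+\cap\mathcal A_a$. For $g\in\mathcal L^+$, $\alpha$ denotes its parameter in this representation, and $I(g)=[0,(\delta^\lambda-1)/\alpha]$ if $\alpha>0$, $I(g)=[0,\infty)$ if $\alpha=0$. For $\theta\ge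 0$, $(\Delta_\theta f)(z)=\theta f'(z)+z f''(z)$ (derivatives in $z$).
   Formalization: Solutions are sought among families whose members f(t,·), t in [0,1], all lie in one space A_a for some a ≥ 0, and uniqueness is asserted in that class; without a growth condition it fails (Tychonoff solutions, e.g. θ = 1/2). *)

(* Defs.v *)
From Stdlib Require Import Reals.
From Coquelicot Require Import Coquelicot.
Open Scope R_scope.

Definition entire (f : C -> C) : Prop := forall z : C, ex_derive f z.

(* [C_derive] is a total operator (a limit along the horizontal direction); it
   is the complex derivative wherever the function is complex differentiable.
   It is only used below on entire functions. *)
Fixpoint C_derive_n (f : C -> C) (k : nat) : C -> C :=
  match k with
  | O => f
  | S k' => C_derive (C_derive_n f k')
  end.

Definition norm_E (b : R) (f : C -> C) : Rbar :=
  Sup_seq (fun k : nat => Finite (Cmod (C_derive_n f k (RtoC 0)) / b ^ k)).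

Definition space_A (a : R) (f : C -> C) : Prop :=
  entire f /\ forall b : R, a < b -> Rbar_lt (norm_E b f) p_infty.

Definition Cexp (z : C) : C :=
  (exp (Re z) * cos (Im z), exp (Re z) * sin (Im z)).

Fixpoint Cprod_n (u : nat -> C) (n : nat) : C :=
  match n with
  | O => RtoC 1
  | S n' => Cmult (Cprod_n u n') (u n')
  end.

Definition is_Cprod (u : nat -> C) (p : C) : Prop :=
  filterlim (Cprod_n u) eventually (locally p).

(* The parameters gamma_1 >= gamma_2 >= ... are indexed from 0. *)
Definition laguerre_with (alpha : R) (f : C -> C) : Prop :=
  entire f /\
  exists (c : C) (m : nat) (gamma : nat -> R) (P : C -> C),
    0 <= alpha /\
    (forall j : nat, 0 <= gamma (S j) <= gamma j) /\
    ex_series gamma /\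
    (forall z : C, is_Cprod (fun j => (1 + RtoC (gamma j) * z)%C) (P z)) /\
    (forall z : C, f z = (c * z ^ m * Cexp (RtoC alpha * z) * P z)%C).

Definition laguerre (f : C -> C) : Prop :=
  exists alpha : R, laguerre_with alpha f.

Definition pos_at_0 (f : C -> C) : Prop :=
  exists r : R, 0 < r /\ f (RtoC 0) = RtoC r.

Definition laguerre_plus (f : C -> C) : Prop := laguerre f /\ pos_at_0 f.

Definition laguerre_plus_in (a : R) (f : C -> C) : Prop :=
  laguerre_plus f /\ space_A a f.

Definition interval_I (lambda : R) (delta : nat) (alpha tau : R) : Prop :=
  0 <= tau /\
  (0 < alpha -> tau <= (Rpower (INR delta) lambda - 1) / alpha).

Definition Delta (theta : R) (f : C -> C) (z : C) : C :=
  (RtoC theta * C_derive_n f 1 z + z * C_derive_n f 2 z)%C.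

Definition unit_time (t : R) : Prop := 0 <= t <= 1.

(* Derivative at [t] relative to [0,1], hence one-sided at the end points. *)
Definition is_derive_unit_time (u : R -> C) (t : R) (l : C) : Prop :=
  @filterdiff R_AbsRing R_NormedModule C_R_NormedModule
    u (within unit_time (locally t)) (fun s : R => scal s l).

(* The Cauchy problem is posed in the spaces A_a: for some a >= 0, all f(t, .)
   lie in A_a.  Without such a growth condition uniqueness fails, because the
   equation has nonzero Tychonoff-type solutions that vanish at t = 0 (for
   theta = 1/2 and z = x^2 it is the heat equation for even functions of x). *)
Definition cauchy_solution (tau theta : R) (init : C -> C) (f : R -> C -> C)
    : Prop :=
  (exists a : R, 0 <= a /\ forall t : R, unit_time t -> space_A a (f t)) /\
  (forall (t : R) (z : C), unit_time t ->
     is_derive_unit_time (fun s : R => f s z) t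
       (RtoC tau * Delta theta (f t) z)%C) /\
  (forall z : C, f 0 z = init z).

Definition rescaled_power (lambda : R) (delta : nat) (f : C -> C) (z : C) : C :=
  Cpow (f (z * RtoC (Rpower (INR delta) (-1 - lambda)))%C) delta.

(* Main.v *)
(** Polynomials with nonnegative coefficients and only negative zeros are stable
    under [p |-> p + s (theta p' + z p'')] for [s >= 0]: where [p' = 0] on the
    negative axis, [p p'' <= 0], so [p] and its image have equal signs at the
    critical points and the intermediate value theorem locates all zeros of the
    image.  Iterating with [s = r / n] gives [exp (r Delta_theta)] in the limit, so
    this operator preserves limits of such polynomials, which, under a bound of
    exponential type, are exactly the Laguerre functions positive at 0.  The
    condition on [tau] is what keeps the exponential type at most [alpha]: rescaling
    and taking powers changes it from [alpha] to [beta = alpha delta^(-lambda)], and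
    [exp (r Delta_theta)] changes [beta] to [beta / (1 - r beta)].

    For uniqueness, a difference of two solutions is locally given by the evolution
    of its Taylor coefficients wherever it is locally bounded in the norm of some
    exponential type.  No uniformity in time is assumed, so the set of bad times is
    treated by Baire's theorem. *)

Require Import Defs.
From Stdlib Require Import Reals Lra Lia Psatz Factorial FunctionalExtensionality Classical ClassicalEpsilon List.
From Coquelicot Require Import Coquelicot.
From mathcomp Require all_boot all_order all_algebra polyrcf Rstruct ring lra zify.
Open Scope R_scope.

(** [entire] provides only pointwise complex differentiability, whereas every later argument runs on
    Taylor coefficients; hence Goursat's bisection and integrals over circles. In the coordinates
    [d k = k! c k] the operator Delta_theta is the weighted shift [(theta + k) d (k + 1)], so exp (r
    Delta_theta) is the series sum_m r^m / m! (theta + k)_m d (k + m). For d k of size b^k the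
    negative binomial series sums this to b^k (1 - r b)^(- theta - k): this is the origin of the
    type b / (1 - r b) and of the restriction r b < 1. Since tau alpha <= delta^lambda - 1 gives tau
    beta < 1 and beta / (1 - tau beta) <= alpha, one alpha serves at every stage of the iteration.
    The obstacle is that strict sign alternation needs simple zeros, while powers create multiple
    ones and limits can merge zeros or push infinitely many of them to infinity. The class is
    therefore described by approximating lists of parameters: nonnegative ones survive powers, and a
    small decrease makes them positive and distinct before the polynomial theorem is applied. *)

Lemma fun_choice {A B : Type} (P : A -> B -> Prop) :
  (forall x, exists y, P x y) -> exists f, forall x, P x (f x).
Proof.
  intros H.
  exists (fun x => proj1_sig (constructive_indefinite_description _ (H x))).
  intros x. apply (proj2_sig (constructive_indefinite_description _ (H x))).
Qed.

(** * Limits in the complex plane along filters *)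

Lemma locally_Cmod (z : C) (P : C -> Prop) :
  locally z P <-> exists d, 0 < d /\ forall w, Cmod (w - z) < d -> P w.
Proof.
  split.
  - intros H.
    pose proof (locally_norm_le_locally (V := C_NormedModule) z P H) as [d Hd].
    exists d; split; [apply cond_pos|].
    intros w Hw. apply Hd. exact Hw.
  - intros (d & Hd & H). apply (locally_le_locally_norm (V := C_NormedModule) z P).
    exists (mkposreal d Hd). intros w0 Hw. set (w := w0 : C) in *. apply H. exact Hw.
Qed.

(** One epsilon form of convergence for sequences, times and complex points. Properness of the
    filter is asked for separately, because the punctured neighbourhood of a time relative to an
    interval may be empty. *)
Definition clim {T : Type} (F : (T -> Prop) -> Prop) (u : T -> C) (l : C) : Prop :=
  forall eps, 0 < eps -> F (fun i => Cmod (u i - l) < eps).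

Lemma clim_filterlim {T : Type} (F : (T -> Prop) -> Prop) {FF : Filter F} (u : T -> C) (l : C) :
  clim F u l <-> filterlim u F (locally l).
Proof.
  split.
  - intros H P HP. apply locally_Cmod in HP. destruct HP as (d & Hd & HP).
    unfold filtermap. eapply filter_imp; [|apply (H d Hd)]. simpl. auto.
  - intros H eps He. apply (H (fun w => Cmod (w - l) < eps)).
    apply locally_Cmod. exists eps; auto.
Qed.

Lemma Cmod_minus_sym (a b : C) : Cmod (a - b) = Cmod (b - a).
Proof. rewrite <- Cmod_opp. f_equal. ring. Qed.

Lemma Cmod_minus_le (a b : C) : Cmod (a - b) <= Cmod a + Cmod b.
Proof.
  unfold Cminus. eapply Rle_trans; [apply Cmod_triangle|]. rewrite Cmod_opp. lra.
Qed.

Lemma Cmod_sub_triangle (a b c : C) : Cmod (a - c) <= Cmod (a - b) + Cmod (b - c).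
Proof.
  replace (a - c)%C with ((a - b) + (b - c))%C by ring. apply Cmod_triangle.
Qed.

Lemma Cmod_le_sub (a b : C) : Cmod a <= Cmod b + Cmod (a - b).
Proof.
  replace a with (b + (a - b))%C at 1 by ring. apply Cmod_triangle.
Qed.

Lemma Cmod_small_eq (a b : C) : (forall eps, 0 < eps -> Cmod (a - b) <= eps) -> a = b.
Proof.
  intros H. apply Ceq_minus. apply Cmod_eq_0.
  destruct (Rle_lt_or_eq_dec 0 (Cmod (a - b)) (Cmod_ge_0 _)) as [Hp|]; auto.
  specialize (H (Cmod (a - b) / 2)). lra.
Qed.

Lemma Im_le_Cmod (z : C) : Rabs (Im z) <= Cmod z.
Proof. eapply Rle_trans; [|apply Rmax_Cmod]. apply Rmax_r. Qed.

Lemma Cmod_le_ReIm (z : C) : Cmod z <= Rabs (Re z) + Rabs (Im z).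
Proof.
  destruct z as [x y]. unfold Re, Im; simpl.
  assert (E : (x, y) = (RtoC x + Ci * RtoC y)%C).
  { unfold RtoC, Cplus, Cmult, Ci; simpl. f_equal; ring. }
  rewrite E. eapply Rle_trans; [apply Cmod_triangle|].
  rewrite Cmod_mult, Cmod_Ci, !Cmod_R. lra.
Qed.

Lemma Re_minus (a b : C) : Re (a - b) = Re a - Re b. Proof. reflexivity. Qed.
Lemma Im_minus (a b : C) : Im (a - b) = Im a - Im b. Proof. reflexivity. Qed.

Lemma Re_Im_eq (a b : C) : Re a = Re b -> Im a = Im b -> a = b.
Proof. destruct a, b; unfold Re, Im; simpl; intros; subst; auto. Qed.

Lemma RtoC_pow (x : R) (n : nat) : RtoC (x ^ n) = (RtoC x ^ n)%C.
Proof.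
  induction n as [|n IH]; simpl; auto. rewrite RtoC_mult, IH. auto.
Qed.

Lemma Cmod_RtoC_nonneg (x : R) : 0 <= x -> Cmod (RtoC x) = x.
Proof. intros. rewrite Cmod_R. apply Rabs_right. lra. Qed.

Section Limits.
Context {T : Type} (F : (T -> Prop) -> Prop) {FF : Filter F}.

Lemma clim_const (l : C) : clim F (fun _ => l) l.
Proof.
  intros eps He. apply filter_forall. intros _. unfold Cminus. rewrite Cplus_opp_r, Cmod_0. auto.
Qed.

Lemma clim_ext (u v : T -> C) (l : C) : (forall i, u i = v i) -> clim F u l -> clim F v l.
Proof.
  intros E H eps He. eapply filter_imp; [|apply (H eps He)]. simpl. intros i Hi.
  rewrite <- E. auto.
Qed.

Lemma clim_plus (u v : T -> C) (l m : C) :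
  clim F u l -> clim F v m -> clim F (fun i => u i + v i)%C (l + m)%C.
Proof.
  intros Hu Hv eps He.
  assert (He2 : 0 < eps / 2) by lra.
  eapply filter_imp; [|apply (filter_and _ _ (Hu _ He2) (Hv _ He2))].
  simpl. intros i [H1 H2].
  replace (u i + v i - (l + m))%C with ((u i - l) + (v i - m))%C by ring.
  eapply Rle_lt_trans; [apply Cmod_triangle|]. lra.
Qed.

Lemma clim_bounded (u : T -> C) (l : C) :
  clim F u l -> F (fun i => Cmod (u i) <= Cmod l + 1).
Proof.
  intros H. eapply filter_imp; [|apply (H 1 Rlt_0_1)]. simpl. intros i Hi.
  pose proof (Cmod_le_sub (u i) l). lra.
Qed.

Lemma clim_mult (u v : T -> C) (l m : C) :
  clim F u l -> clim F v m -> clim F (fun i => u i * v i)%C (l * m)%C.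
Proof.
  intros Hu Hv eps He.
  pose proof (Cmod_ge_0 l). pose proof (Cmod_ge_0 m).
  set (A := Cmod l + Cmod m + 1).
  assert (HA : 0 < A) by (unfold A; lra).
  assert (He2 : 0 < eps / (2 * A)) by (apply Rdiv_lt_0_compat; lra).
  eapply filter_imp; [|apply (filter_and _ _ (clim_bounded v m Hv)
     (filter_and _ _ (Hu _ He2) (Hv _ He2)))].
  simpl. intros i (H1 & H2 & H3).
  replace (u i * v i - l * m)%C with ((u i - l) * v i + l * (v i - m))%C by ring.
  eapply Rle_lt_trans; [apply Cmod_triangle|]. rewrite !Cmod_mult.
  assert (eps = eps / (2 * A) * A + A * (eps / (2 * A))) by (field; lra).
  set (e := eps / (2 * A)) in *.
  pose proof (Cmod_ge_0 (u i - l)). pose proof (Cmod_ge_0 (v i)).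
  assert (Cmod (u i - l) * Cmod (v i) <= e * (Cmod m + 1)).
  { apply Rmult_le_compat; lra. }
  assert (Cmod l * Cmod (v i - m) <= Cmod l * e).
  { apply Rmult_le_compat_l; lra. }
  assert (0 < e * A) by (apply Rmult_lt_0_compat; auto).
  rewrite H4. unfold A. nra.
Qed.

Lemma clim_scal (c : C) (u : T -> C) (l : C) :
  clim F u l -> clim F (fun i => c * u i)%C (c * l)%C.
Proof. intros. apply clim_mult; auto. apply clim_const. Qed.

Lemma clim_minus (u v : T -> C) (l m : C) :
  clim F u l -> clim F v m -> clim F (fun i => u i - v i)%C (l - m)%C.
Proof.
  intros Hu Hv. apply clim_ext with (fun i => u i + (RtoC (-1)) * v i)%C.
  - intros. ring.
  - replace (l - m)%C with (l + RtoC (-1) * m)%C by (ring).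
    apply clim_plus; auto. apply clim_scal; auto.
Qed.

Lemma clim_pow (u : T -> C) (l : C) (n : nat) :
  clim F u l -> clim F (fun i => u i ^ n)%C (l ^ n)%C.
Proof.
  intros H. induction n as [|n IH]; simpl.
  - apply clim_const.
  - apply clim_mult; auto.
Qed.
End Limits.

Section ProperLimits.
Context {T : Type} (F : (T -> Prop) -> Prop) {FF : ProperFilter F}.

Lemma clim_unique (u : T -> C) (l m : C) : clim F u l -> clim F u m -> l = m.
Proof.
  intros Hu Hv. apply Cmod_small_eq. intros eps He.
  assert (He2 : 0 < eps / 2) by lra.
  destruct (filter_ex _ (filter_and _ _ (Hu _ He2) (Hv _ He2))) as [i [H1 H2]].
  pose proof (Cmod_sub_triangle l (u i) m).
  rewrite (Cmod_minus_sym l (u i)) in H. lra.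
Qed.

Lemma clim_le (u : T -> C) (l : C) (M : R) :
  clim F u l -> F (fun i => Cmod (u i) <= M) -> Cmod l <= M.
Proof.
  intros Hu HM. apply Rnot_lt_le. intros Hlt.
  assert (He : 0 < Cmod l - M) by lra.
  destruct (filter_ex _ (filter_and _ _ (Hu _ He) HM)) as [i [H1 H2]].
  pose proof (Cmod_le_sub l (u i)). rewrite Cmod_minus_sym in H. lra.
Qed.
End ProperLimits.

(** * Absolutely convergent complex series *)

Definition Cser (a : nat -> C) : C :=
  (Series (fun k => Re (a k)), Series (fun k => Im (a k))).

Definition asum (a : nat -> C) : Prop := ex_series (fun k => Cmod (a k)).

Lemma asum_Re (a : nat -> C) : asum a -> ex_series (fun k => Re (a k)).
Proof.
  intros H. apply (ex_series_le (V := R_CompleteNormedModule)) with (2 := H).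
  intros n. apply re_le_Cmod.
Qed.

Lemma asum_Im (a : nat -> C) : asum a -> ex_series (fun k => Im (a k)).
Proof.
  intros H. apply (ex_series_le (V := R_CompleteNormedModule)) with (2 := H).
  intros n. apply Im_le_Cmod.
Qed.

Lemma ex_series_nonneg_le (a b : nat -> R) :
  (forall k, 0 <= a k <= b k) -> ex_series b -> ex_series a.
Proof.
  intros H Hb. apply (ex_series_le (V := R_CompleteNormedModule)) with (2 := Hb).
  intros n. change (Rabs (a n) <= b n). rewrite Rabs_right; apply H || apply Rle_ge; apply H.
Qed.

Lemma asum_le (a : nat -> C) (b : nat -> R) :
  (forall k, Cmod (a k) <= b k) -> ex_series b -> asum a.
Proof.
  intros H Hb. apply ex_series_nonneg_le with (2 := Hb). intros; split; auto. apply Cmod_ge_0.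
Qed.

Lemma asum_ext (a b : nat -> C) : (forall k, a k = b k) -> asum a -> asum b.
Proof. intros E. apply ex_series_ext. intros; rewrite E; auto. Qed.

Lemma asum_plus (a b : nat -> C) : asum a -> asum b -> asum (fun k => a k + b k)%C.
Proof.
  intros Ha Hb. apply asum_le with (fun k => Cmod (a k) + Cmod (b k)).
  - intros; apply Cmod_triangle.
  - apply (ex_series_plus (V := R_NormedModule)); auto.
Qed.

Lemma asum_scal (c : C) (a : nat -> C) : asum a -> asum (fun k => c * a k)%C.
Proof.
  intros Ha. apply asum_le with (fun k => Cmod c * Cmod (a k)).
  - intros; rewrite Cmod_mult; lra.
  - apply (ex_series_scal (V := R_NormedModule)); auto.
Qed.

Lemma asum_incr (a : nat -> C) : asum a -> asum (fun k => a (S k)).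
Proof. intros H. apply ex_series_incr_1 in H. exact H. Qed.

Lemma Cser_ext (a b : nat -> C) : (forall k, a k = b k) -> Cser a = Cser b.
Proof. intros E. unfold Cser. f_equal; apply Series_ext; intros; rewrite E; auto. Qed.

Lemma Cser_plus (a b : nat -> C) : asum a -> asum b ->
  Cser (fun k => a k + b k)%C = (Cser a + Cser b)%C.
Proof.
  intros Ha Hb. unfold Cser, Cplus; simpl. f_equal.
  - apply (Series_plus (fun k => Re (a k)) (fun k => Re (b k))); apply asum_Re; auto.
  - apply (Series_plus (fun k => Im (a k)) (fun k => Im (b k))); apply asum_Im; auto.
Qed.

Lemma Cser_scal (c : C) (a : nat -> C) : asum a ->
  Cser (fun k => c * a k)%C = (c * Cser a)%C.
Proof.
  intros Ha. destruct c as [x y]. unfold Cser, Cmult; simpl.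
  pose proof (asum_Re a Ha). pose proof (asum_Im a Ha). unfold Re, Im in *.
  f_equal.
  - rewrite Series_minus; [|apply (ex_series_scal (V := R_NormedModule)); auto ..].
    rewrite !Series_scal_l. auto.
  - rewrite Series_plus; [|apply (ex_series_scal (V := R_NormedModule)); auto ..].
    rewrite !Series_scal_l. auto.
Qed.

Lemma Cser_minus (a b : nat -> C) : asum a -> asum b ->
  Cser (fun k => a k - b k)%C = (Cser a - Cser b)%C.
Proof.
  intros Ha Hb. replace (Cser a - Cser b)%C with (Cser a + RtoC (-1) * Cser b)%C
    by (ring).
  rewrite <- Cser_scal, <- Cser_plus; auto using asum_scal.
  apply Cser_ext. intros. ring.
Qed.

Lemma asum_minus (a b : nat -> C) : asum a -> asum b -> asum (fun k => a k - b k)%C.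
Proof.
  intros Ha Hb. apply asum_ext with (fun k => a k + RtoC (-1) * b k)%C.
  - intros. ring.
  - apply asum_plus; auto using asum_scal.
Qed.

Lemma Cser_incr (a : nat -> C) : asum a -> Cser a = (a O + Cser (fun k => a (S k)))%C.
Proof.
  intros Ha. unfold Cser, Cplus; simpl.
  rewrite (Series_incr_1 (fun k => Re (a k))) by (apply asum_Re; auto).
  rewrite (Series_incr_1 (fun k => Im (a k))) by (apply asum_Im; auto). auto.
Qed.

Lemma Series_nonneg (a : nat -> R) : (forall k, 0 <= a k) -> ex_series a -> 0 <= Series a.
Proof.
  intros H Ha. replace 0 with (Series (fun _ => 0 * 0)).
  - apply Series_le; auto. intros; split; [lra|]. rewrite Rmult_0_l. auto.
  - rewrite (Series_scal_l 0). ring.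
Qed.

(** Multiplying by the conjugate of the sum S makes |S|^2 the real part of a series with terms
    bounded by |S| |a_k|; dividing by |S| gives the claim. *)
Lemma Cser_mod (a : nat -> C) : asum a -> Cmod (Cser a) <= Series (fun k => Cmod (a k)).
Proof.
  intros Ha. set (S := Cser a).
  assert (HS : Cmod S * Cmod S <= Cmod S * Series (fun k => Cmod (a k))).
  { assert (E : Cmod S * Cmod S = Re (Cser (fun k => Cconj S * a k)%C)).
    { rewrite Cser_scal by auto. fold S. destruct S as [x y].
      unfold Cmod, Cconj, Cmult, Re; simpl. rewrite sqrt_sqrt; [ring|nra]. }
    rewrite E. change (Series (fun k => Re (Cconj S * a k)%C) <= Cmod S * Series (fun k => Cmod (a k))).
    rewrite <- Series_scal_l.
    pose proof (asum_scal (Cconj S) a Ha) as H.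
    eapply Rle_trans; [apply Rle_abs|].
    eapply Rle_trans; [apply Series_Rabs|].
    - apply ex_series_nonneg_le with (2 := H).
      intros; split; [apply Rabs_pos|apply re_le_Cmod].
    - apply Series_le.
      + intros n; split; [apply Rabs_pos|]. eapply Rle_trans; [apply re_le_Cmod|].
        rewrite Cmod_mult.
        replace (Cmod (Cconj S)) with (Cmod S); [lra|].
        destruct S as [x y]; unfold Cmod, Cconj; simpl. f_equal; ring.
      + apply (ex_series_scal (V := R_NormedModule)); auto. }
  pose proof (Cmod_ge_0 S).
  destruct H as [H|H].
  - apply Rmult_le_reg_l with (Cmod S); auto.
  - rewrite <- H. apply Series_nonneg; auto. intros; apply Cmod_ge_0.
Qed.

Lemma Cser_le (a : nat -> C) (b : nat -> R) :
  (forall k, Cmod (a k) <= b k) -> ex_series b -> Cmod (Cser a) <= Series b.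
Proof.
  intros H Hb. eapply Rle_trans; [apply Cser_mod; eapply asum_le; eauto|].
  apply Series_le; auto. intros; split; auto. apply Cmod_ge_0.
Qed.

Lemma Cser_0 (a : nat -> C) : (forall k, a k = RtoC 0) -> Cser a = RtoC 0.
Proof.
  intros H. unfold Cser, RtoC. f_equal.
  - rewrite (Series_ext _ (fun _ => 0 * 0)).
    + rewrite (Series_scal_l 0). ring.
    + intros; rewrite H; unfold RtoC, Re; simpl; ring.
  - rewrite (Series_ext _ (fun _ => 0 * 0)).
    + rewrite (Series_scal_l 0). ring.
    + intros; rewrite H; unfold RtoC, Im; simpl; ring.
Qed.

Lemma Series_tail (b : nat -> R) : ex_series b ->
  forall eps, 0 < eps -> exists n, Rabs (Series (fun k => b (n + k)%nat)) < eps.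
Proof.
  intros Hb eps He.
  pose proof (Series_correct b Hb) as H.
  assert (H' : is_lim_seq (sum_n b) (Series b)) by exact H.
  apply is_lim_seq_spec in H'. destruct (H' (mkposreal eps He)) as [N HN].
  exists (S N). specialize (HN N (Nat.le_refl _)). simpl in HN.
  rewrite (Series_incr_n b (S N)) in HN; [|lia|auto].
  simpl pred in HN. rewrite <- sum_n_Reals in HN.
  replace (sum_n b N - (sum_n b N + Series (fun k : nat => b (S N + k)%nat)))
    with (- Series (fun k : nat => b (S N + k)%nat)) in HN by ring.
  rewrite Rabs_Ropp in HN. auto.
Qed.

Lemma asum_incr_n (a : nat -> C) (n : nat) : asum a -> asum (fun k => a (n + k)%nat).
Proof. intros H. apply (ex_series_incr_n (V := R_NormedModule) _ n) in H. exact H. Qed.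

(* Tannery's theorem, along an arbitrary filter. *)
Lemma Cser_dominated {T : Type} (F : (T -> Prop) -> Prop) {FF : Filter F}
  (a : T -> nat -> C) (l : nat -> C) (b : nat -> R) :
  ex_series b -> F (fun i => forall k, Cmod (a i k) <= b k) ->
  (forall k, Cmod (l k) <= b k) ->
  (forall k, clim F (fun i => a i k) (l k)) -> clim F (fun i => Cser (a i)) (Cser l).
Proof.
  intros Hb Ha Hl Hlim eps He.
  destruct (Series_tail b Hb (eps / 4)) as [n Hn]; [lra|].
  assert (Ha' : F (fun i => asum (a i))).
  { eapply filter_imp; [|apply Ha]. simpl. intros i Hi. apply asum_le with b; auto. }
  assert (Hl' : asum l) by (apply asum_le with b; auto).
  (* The difference of the sums minus the difference of their tails after [m] terms tends to 0, by
     induction on [m]. At [m = n] each tail is below eps / 4 by the majorant. *)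
  assert (Hhead : forall m e, 0 < e ->
    F (fun i => Cmod (Cser (a i) - Cser l - (Cser (fun k => a i (m + k)%nat)
       - Cser (fun k => l (m + k)%nat))) < e)).
  { induction m as [|m IH]; intros e He'.
    - apply filter_forall. intros i.
      change (fun k => a i (0 + k)%nat) with (a i). change (fun k => l (0 + k)%nat) with l.
      match goal with |- Cmod ?z < _ => replace z with (RtoC 0) by ring end.
      rewrite Cmod_0. lra.
    - assert (He2 : 0 < e / 2) by lra.
      eapply filter_imp; [|apply (filter_and _ _ Ha' (filter_and _ _ (IH _ He2) (Hlim m _ He2)))].
      simpl. intros i (H1 & H2 & H3).
      rewrite (Cser_incr (fun k => a i (m + k)%nat)) in H2 by (apply asum_incr_n; auto).
      rewrite (Cser_incr (fun k => l (m + k)%nat)) in H2 by (apply asum_incr_n; auto).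
      rewrite Nat.add_0_r in H2.
      rewrite (Cser_ext (fun k => a i (S (m + k))) (fun k => a i (m + S k)%nat))
        by (intros; f_equal; lia).
      rewrite (Cser_ext (fun k => l (S (m + k))) (fun k => l (m + S k)%nat))
        by (intros; f_equal; lia).
      replace e with (e / 2 + e / 2) by field.
      eapply Rle_lt_trans; [|apply (Rplus_lt_compat _ _ _ _ H2 H3)].
      eapply Rle_trans; [|apply Cmod_triangle]. apply Req_le. f_equal. ring. }
  assert (He4 : 0 < eps / 4) by lra.
  eapply filter_imp; [|apply (filter_and _ _ Ha (Hhead n _ He4))].
  simpl. intros i [H1 H2].
  assert (Hbn : ex_series (fun k => b (n + k)%nat)).
  { apply (ex_series_incr_n (V := R_NormedModule)). auto. }
  assert (H3 : Cmod (Cser (fun k => a i (n + k)%nat)) <= Series (fun k => b (n + k)%nat))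
    by (apply Cser_le; auto).
  assert (H4 : Cmod (Cser (fun k => l (n + k)%nat)) <= Series (fun k => b (n + k)%nat))
    by (apply Cser_le; auto).
  pose proof (Rle_abs (Series (fun k : nat => b (n + k)%nat))).
  set (X := Cser (fun k => a i (n + k)%nat)) in *. set (Y := Cser (fun k => l (n + k)%nat)) in *.
  replace (Cser (a i) - Cser l)%C with ((Cser (a i) - Cser l - (X - Y)) + (X - Y))%C by ring.
  eapply Rle_lt_trans; [apply Cmod_triangle|].
  pose proof (Cmod_minus_le X Y). lra.
Qed.

(** * Complex differentiability and power series *)

Definition cderiv (f : C -> C) (z l : C) : Prop :=
  forall eps, 0 < eps -> exists d, 0 < d /\ forall h, Cmod h < d ->
    Cmod (f (z + h) - f z - l * h)%C <= eps * Cmod h.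

Lemma cderiv_is_derive (f : C -> C) (z l : C) :
  cderiv f z l <-> @is_derive C_AbsRing C_NormedModule f z l.
Proof.
  split.
  - intros H. split.
    + apply (is_linear_scal_l (K := C_AbsRing) (V := C_NormedModule)).
    + intros x Hx. apply (is_filter_lim_locally_unique (K := C_AbsRing) (V := AbsRing_NormedModule C_AbsRing)) in Hx.
      subst x. intros eps. destruct (H eps (cond_pos eps)) as (d & Hd & Hh).
      exists (mkposreal d Hd). intros w0 Hw. set (w := w0 : C) in *.
      change (Cmod (w - z) < d) in Hw.
      specialize (Hh (w - z)%C Hw). replace (z + (w - z))%C with w in Hh by ring.
      change (Cmod (f w - f z - (w - z) * l)%C <= eps * Cmod (w - z)).
      rewrite (Cmult_comm (w - z) l). auto.
  - intros [_ H] eps He. specialize (H z (fun P HP => HP) (mkposreal eps He)).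
    destruct H as [d H]. exists d; split; [apply cond_pos|].
    intros h Hh. assert (Hb : Cmod (z + h - z) < d) by (replace (z + h - z)%C with h by ring; auto).
    specialize (H (z + h)%C Hb).
    change (Cmod (f (z + h) - f z - (z + h - z) * l)%C <= eps * Cmod (z + h - z)) in H.
    replace (z + h - z)%C with h in H by ring. rewrite (Cmult_comm l h). auto.
Qed.

Lemma cderiv_C_derive (f : C -> C) (z l : C) : cderiv f z l -> C_derive f z = l.
Proof. intros H. apply is_C_derive_unique. apply cderiv_is_derive. auto. Qed.

Lemma entire_cderiv (f : C -> C) (z : C) : entire f -> exists l, cderiv f z l.
Proof. intros H. destruct (H z) as [l Hl]. exists l. apply cderiv_is_derive. auto. Qed.

Lemma cderiv_entire (f : C -> C) : (forall z, exists l, cderiv f z l) -> entire f.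
Proof. intros H z. destruct (H z) as [l Hl]. exists l. apply cderiv_is_derive. auto. Qed.

(* The coefficient sequences of entire functions. *)
Definition fastc (c : nat -> C) : Prop :=
  forall r, 0 < r -> exists M, forall k, Cmod (c k) * r ^ k <= M.

Definition cps (c : nat -> C) (z : C) : C := Cser (fun k => c k * z ^ k)%C.

Definition dc (c : nat -> C) (k : nat) : C := (RtoC (INR (S k)) * c (S k))%C.

Lemma ex_series_half (M : R) : ex_series (fun k => M * (/ 2) ^ k).
Proof.
  apply (ex_series_scal (V := R_NormedModule) M). apply ex_series_geom.
  rewrite Rabs_right; lra.
Qed.

Lemma fastc_sum (c : nat -> C) (r : R) : fastc c -> 0 <= r ->
  ex_series (fun k => Cmod (c k) * r ^ k).
Proof.
  (* The doubled radius leaves the geometric majorant M / 2^k; adding 1 keeps the radius positive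
     when [r = 0]. *)
  intros H Hr. destruct (H (2 * (r + 1))) as [M HM]; [lra|].
  apply ex_series_nonneg_le with (fun k => M * (/ 2) ^ k); [|apply ex_series_half].
  intros k. split.
  - apply Rmult_le_pos; [apply Cmod_ge_0|apply pow_le; lra].
  - specialize (HM k). rewrite Rpow_mult_distr in HM.
    assert (0 < 2 ^ k) by (apply pow_lt; lra).
    rewrite pow_inv.
    apply Rmult_le_reg_r with (2 ^ k); auto.
    rewrite Rmult_assoc, (Rmult_assoc M), Rinv_l by lra.
    assert (r ^ k <= (r + 1) ^ k) by (apply pow_incr; lra).
    assert (Cmod (c k) * (r ^ k * 2 ^ k) <= Cmod (c k) * (2 ^ k * (r + 1) ^ k)).
    { apply Rmult_le_compat_l; [apply Cmod_ge_0|]. rewrite Rmult_comm. apply Rmult_le_compat_l; lra. }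
    lra.
Qed.

Lemma cps_asum (c : nat -> C) (z : C) : fastc c -> asum (fun k => c k * z ^ k)%C.
Proof.
  intros H. apply asum_le with (fun k => Cmod (c k) * Cmod z ^ k).
  - intros. rewrite Cmod_mult, Cmod_pow. lra.
  - apply fastc_sum; auto. apply Cmod_ge_0.
Qed.

Lemma INR_le_pow2 (k : nat) : INR k <= 2 ^ k.
Proof.
  induction k as [|k IH]; [simpl; lra|]. rewrite S_INR. simpl.
  assert (1 <= 2 ^ k) by (apply pow_R1_Rle; lra). lra.
Qed.

Lemma fastc_dc (c : nat -> C) : fastc c -> fastc (dc c).
Proof.
  intros H r Hr. destruct (H (2 * (r + 1))) as [M HM]; [lra|]. exists M. intros k.
  eapply Rle_trans; [|apply (HM (S k))].
  unfold dc. rewrite Cmod_mult, Cmod_RtoC_nonneg by apply pos_INR.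
  rewrite Rpow_mult_distr.
  pose proof (INR_le_pow2 (S k)). pose proof (Cmod_ge_0 (c (S k))).
  assert (0 <= r ^ k <= (r + 1) ^ S k).
  { split; [apply pow_le; lra|]. simpl. assert (r ^ k <= (r + 1) ^ k) by (apply pow_incr; lra).
    assert (0 <= (r + 1) ^ k) by (apply pow_le; lra). nra. }
  rewrite (Rmult_comm (INR (S k))), Rmult_assoc.
  apply Rmult_le_compat_l; auto. apply Rmult_le_compat; try tauto. apply pos_INR.
Qed.

(** A crude second-order remainder. The condition [1 <= rho] lets every lower power of [rho] be
    absorbed into the top one, so that the induction closes. *)
Lemma pow_taylor2 (z h : C) (rho : R) (k : nat) :
  1 <= rho -> Cmod z + Cmod h <= rho ->
  Cmod ((z + h) ^ (S k) - z ^ (S k) - RtoC (INR (S k)) * h * z ^ k)%C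
  <= INR (S k) ^ 2 * rho ^ (S k) * Cmod h ^ 2.
Proof.
  intros Hr Hz. pose proof (Cmod_ge_0 z). pose proof (Cmod_ge_0 h).
  induction k as [|k IH].
  - simpl Cpow. replace ((z + h) * 1 - z * 1 - RtoC (INR 1) * h * 1)%C with (RtoC 0)
      by (simpl INR; ring).
    rewrite Cmod_0. apply Rmult_le_pos; [apply Rmult_le_pos|]; apply pow_le; auto; [apply pos_INR|lra].
  - replace ((z + h) ^ S (S k) - z ^ S (S k) - RtoC (INR (S (S k))) * h * z ^ S k)%C
      with ((z + h) * ((z + h) ^ S k - z ^ S k - RtoC (INR (S k)) * h * z ^ k)
            + RtoC (INR (S k)) * (h * h) * z ^ k)%C.
    2: { rewrite !(S_INR (S k)), RtoC_plus. simpl Cpow. ring. }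
    eapply Rle_trans; [apply Cmod_triangle|]. rewrite !Cmod_mult, Cmod_pow.
    rewrite Cmod_RtoC_nonneg by apply pos_INR.
    set (X := Cmod ((z + h) ^ S k - z ^ S k - RtoC (INR (S k)) * h * z ^ k)) in *.
    assert (Cmod (z + h) <= rho) by (eapply Rle_trans; [apply Cmod_triangle|auto]).
    assert (0 <= X) by apply Cmod_ge_0. pose proof (Cmod_ge_0 (z + h)).
    assert (Cmod z ^ k <= rho ^ k) by (apply pow_incr; lra).
    assert (0 < rho ^ k) by (apply pow_lt; lra).
    assert (H6 : Cmod z ^ k <= rho ^ (S (S k))) by (eapply Rle_trans; [eassumption|]; apply Rle_pow; [lra|lia]).
    set (n := INR (S k)) in *. assert (0 <= n) by apply pos_INR.
    assert (B1 : Cmod (z + h) * X <= rho * (n ^ 2 * rho ^ S k * Cmod h ^ 2))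
      by (apply Rmult_le_compat; auto).
    assert (B2 : n * (Cmod h * Cmod h) * Cmod z ^ k <= n * (Cmod h * Cmod h) * rho ^ S (S k)).
    { apply Rmult_le_compat_l; auto. apply Rmult_le_pos; auto. apply Rmult_le_pos; auto. }
    replace (INR (S (S k))) with (n + 1) by (unfold n; rewrite (S_INR (S k)); auto).
    assert (0 <= rho ^ S (S k)) by (apply pow_le; lra).
    replace (rho * (n ^ 2 * rho ^ S k * Cmod h ^ 2)) with (n ^ 2 * (rho ^ S (S k) * Cmod h ^ 2)) in B1 by (simpl; ring).
    replace (n * (Cmod h * Cmod h) * rho ^ S (S k)) with (n * (rho ^ S (S k) * Cmod h ^ 2)) in B2 by (simpl; ring).
    replace ((n + 1) ^ 2 * rho ^ S (S k) * Cmod h ^ 2) with ((n + 1) ^ 2 * (rho ^ S (S k) * Cmod h ^ 2)) by (simpl; ring).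
    set (Y := rho ^ S (S k) * Cmod h ^ 2) in *.
    assert (0 <= Y) by (apply Rmult_le_pos; auto; apply pow_le; auto).
    assert (0 <= (n + 1) * Y) by (apply Rmult_le_pos; lra).
    replace ((n + 1) ^ 2 * Y) with (n ^ 2 * Y + n * Y + (n + 1) * Y) by ring. lra.
Qed.

Lemma fastc_sq_sum (c : nat -> C) (rho : R) : fastc c -> 1 <= rho ->
  ex_series (fun k => Cmod (c (S k)) * (INR (S k) ^ 2 * rho ^ (S k))).
Proof.
  intros Hc Hr.
  assert (H : ex_series (fun k => Cmod (c (S k)) * (4 * rho) ^ (S k))).
  { apply (ex_series_incr_1 (V := R_NormedModule) (fun k => Cmod (c k) * (4 * rho) ^ k)).
    apply fastc_sum; auto; lra. }
  apply ex_series_nonneg_le with (2 := H). intros k.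
  assert (0 <= rho ^ (S k)) by (apply pow_le; lra).
  pose proof (pos_INR (S k)). pose proof (INR_le_pow2 (S k)). pose proof (Cmod_ge_0 (c (S k))).
  assert (INR (S k) ^ 2 <= 4 ^ (S k)).
  { replace (4 ^ S k) with ((2 ^ S k) ^ 2). apply pow_incr; lra.
    rewrite <- pow_mult, Nat.mul_comm, pow_mult. f_equal; lra. }
  assert (0 <= INR (S k) ^ 2) by (apply pow_le; auto).
  split.
  - apply Rmult_le_pos; auto. apply Rmult_le_pos; auto.
  - rewrite Rpow_mult_distr. apply Rmult_le_compat_l; auto. apply Rmult_le_compat_r; auto.
Qed.

(** Differentiation term by term: for |h| <= 1 the second-order remainders are summed at radius |z|
    + 1, giving K |h|^2, which is below eps |h| once |h| <= eps / (K + 1). *)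
Lemma cps_cderiv (c : nat -> C) (z : C) : fastc c -> cderiv (cps c) z (cps (dc c) z).
Proof.
  intros Hc eps He.
  set (rho := Cmod z + 1).
  assert (Hrho : 1 <= rho) by (unfold rho; pose proof (Cmod_ge_0 z); lra).
  pose proof (fastc_sq_sum c rho Hc Hrho) as Hs.
  set (K := Series (fun k => Cmod (c (S k)) * (INR (S k) ^ 2 * rho ^ (S k)))) in *.
  assert (HK : 0 <= K).
  { apply Series_nonneg; auto. intros k. apply Rmult_le_pos; [apply Cmod_ge_0|].
    apply Rmult_le_pos; apply pow_le; [apply pos_INR|lra]. }
  exists (Rmin 1 (eps / (K + 1))). split.
  { apply Rmin_pos; [lra|apply Rdiv_lt_0_compat; lra]. }
  intros h Hh.
  pose proof (Rmin_l 1 (eps / (K + 1))). pose proof (Rmin_r 1 (eps / (K + 1))).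
  assert (Hh1 : Cmod h <= 1) by lra. assert (Hh2 : Cmod h <= eps / (K + 1)) by lra.
  unfold cps.
  assert (E : (Cser (fun k => c k * (z + h) ^ k) - Cser (fun k => c k * z ^ k)
     - Cser (fun k => dc c k * z ^ k) * h)%C =
     Cser (fun k => c (S k) * ((z + h) ^ (S k) - z ^ (S k) - RtoC (INR (S k)) * h * z ^ k))%C).
  { rewrite (Cser_incr (fun k => c k * (z + h) ^ k)%C) by (apply cps_asum; auto).
    rewrite (Cser_incr (fun k => c k * z ^ k)%C) by (apply cps_asum; auto).
    rewrite (Cmult_comm _ h), <- Cser_scal by (apply cps_asum, fastc_dc; auto).
    pose proof (asum_incr _ (cps_asum c (z + h) Hc)) as A1.
    pose proof (asum_incr _ (cps_asum c z Hc)) as A2.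
    pose proof (asum_scal h _ (cps_asum (dc c) z (fastc_dc c Hc))) as A3.
    replace (c 0%nat * (z + h) ^ 0)%C with (c 0%nat * z ^ 0)%C by (simpl; ring).
    match goal with |- (?a + ?s1 - (?a + ?s2) - ?s3)%C = _ =>
      replace (a + s1 - (a + s2) - s3)%C with (s1 - s2 - s3)%C by ring end.
    rewrite <- Cser_minus; auto. rewrite <- Cser_minus; auto; [|apply asum_minus; auto].
    apply Cser_ext. intros k. unfold dc. ring. }
  rewrite E.
  eapply Rle_trans.
  - apply Cser_le with (b := fun k => Cmod h ^ 2 * (Cmod (c (S k)) * (INR (S k) ^ 2 * rho ^ (S k)))).
    + intros k. rewrite Cmod_mult.
      replace (Cmod h ^ 2 * (Cmod (c (S k)) * (INR (S k) ^ 2 * rho ^ S k))) with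
        (Cmod (c (S k)) * (INR (S k) ^ 2 * rho ^ S k * Cmod h ^ 2)) by ring.
      apply Rmult_le_compat_l; [apply Cmod_ge_0|]. apply pow_taylor2; auto. unfold rho; lra.
    + apply (ex_series_scal (V := R_NormedModule)); auto.
  - rewrite Series_scal_l. fold K.
    assert (Cmod h * (K + 1) <= eps).
    { apply Rmult_le_reg_r with (/ (K + 1)); [apply Rinv_0_lt_compat; lra|].
      rewrite Rmult_assoc, Rinv_r by lra. unfold Rdiv in Hh2. lra. }
    pose proof (Cmod_ge_0 h). simpl. nra.
Qed.

Lemma cps_entire (c : nat -> C) : fastc c -> entire (cps c).
Proof. intros H. apply cderiv_entire. intros z. eexists. apply cps_cderiv; auto. Qed.

Lemma fastc_iter (c : nat -> C) (n : nat) : fastc c -> fastc (Nat.iter n dc c).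
Proof. intros H. induction n; simpl; auto. apply fastc_dc; auto. Qed.

Lemma C_derive_n_cps (c : nat -> C) (n : nat) : fastc c ->
  C_derive_n (cps c) n = cps (Nat.iter n dc c).
Proof.
  intros H. induction n as [|n IH]; simpl; auto.
  apply functional_extensionality. intros z. rewrite IH.
  apply cderiv_C_derive, cps_cderiv, fastc_iter; auto.
Qed.

Lemma iter_dc (c : nat -> C) (n j : nat) :
  Nat.iter n dc c j = (RtoC (INR (fact (n + j)) / INR (fact j)) * c (n + j)%nat)%C.
Proof.
  revert j. induction n as [|n IH]; intros j; simpl Nat.iter.
  - simpl. replace (INR (fact j) / INR (fact j)) with 1; [ring|]. field. apply INR_fact_neq_0.
  - unfold dc at 1. rewrite IH. replace (n + S j)%nat with (S n + j)%nat by lia.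
    rewrite Cmult_assoc. f_equal. rewrite <- RtoC_mult. f_equal.
    replace (fact (S j)) with (S j * fact j)%nat by reflexivity. rewrite mult_INR.
    field. split; [apply INR_fact_neq_0|apply not_0_INR; lia].
Qed.

Lemma cps_0 (c : nat -> C) : fastc c -> cps c (RtoC 0) = c O.
Proof.
  intros H. unfold cps. rewrite Cser_incr by (apply cps_asum; auto).
  rewrite Cser_0; [simpl; ring|]. intros k. simpl. ring.
Qed.

Lemma C_derive_n_cps_0 (c : nat -> C) (n : nat) : fastc c ->
  C_derive_n (cps c) n (RtoC 0) = (RtoC (INR (fact n)) * c n)%C.
Proof.
  intros H. rewrite C_derive_n_cps by auto. rewrite cps_0 by (apply fastc_iter; auto).
  rewrite iter_dc, Nat.add_0_r. simpl. rewrite Rdiv_1_r. auto.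
Qed.

(** * Integrals of complex-valued functions of a real variable *)

Definition CInt (f : R -> C) (a b : R) : C :=
  (RInt (fun x => Re (f x)) a b, RInt (fun x => Im (f x)) a b).

Definition rcont (f : R -> C) : Prop := forall x : R, clim (locally x) f (f x).

Lemma rcont_Re (f : R -> C) (x : R) : rcont f -> continuous (fun t => Re (f t)) x.
Proof.
  intros H. apply filterlim_locally. intros eps.
  eapply filter_imp; [|apply (H x eps (cond_pos eps))]. simpl. intros y Hy.
  change (Rabs (Re (f y) - Re (f x)) < eps). rewrite <- Re_minus.
  eapply Rle_lt_trans; [apply re_le_Cmod|auto].
Qed.

Lemma rcont_Im (f : R -> C) (x : R) : rcont f -> continuous (fun t => Im (f t)) x.
Proof.
  intros H. apply filterlim_locally. intros eps.
  eapply filter_imp; [|apply (H x eps (cond_pos eps))]. simpl. intros y Hy.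
  change (Rabs (Im (f y) - Im (f x)) < eps). rewrite <- Im_minus.
  eapply Rle_lt_trans; [apply Im_le_Cmod|auto].
Qed.

Lemma rcont_ex_Re (f : R -> C) (a b : R) : rcont f -> ex_RInt (fun t => Re (f t)) a b.
Proof.
  intros H. apply (ex_RInt_continuous (V := R_CompleteNormedModule)).
  intros z _. apply (rcont_Re f z H).
Qed.

Lemma rcont_ex_Im (f : R -> C) (a b : R) : rcont f -> ex_RInt (fun t => Im (f t)) a b.
Proof.
  intros H. apply (ex_RInt_continuous (V := R_CompleteNormedModule)).
  intros z _. apply (rcont_Im f z H).
Qed.

Lemma CInt_ext (f g : R -> C) (a b : R) : (forall x, f x = g x) -> CInt f a b = CInt g a b.
Proof. intros E. unfold CInt. f_equal; apply RInt_ext; intros; rewrite E; auto. Qed.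

Lemma CInt_Chasles (f : R -> C) (a b c : R) : rcont f ->
  (CInt f a b + CInt f b c)%C = CInt f a c.
Proof.
  intros H. unfold CInt, Cplus; simpl. f_equal.
  - apply (RInt_Chasles (V := R_CompleteNormedModule)); apply rcont_ex_Re; auto.
  - apply (RInt_Chasles (V := R_CompleteNormedModule)); apply rcont_ex_Im; auto.
Qed.

Lemma CInt_plus (f g : R -> C) (a b : R) : rcont f -> rcont g ->
  CInt (fun x => f x + g x)%C a b = (CInt f a b + CInt g a b)%C.
Proof.
  intros Hf Hg. unfold CInt, Cplus; simpl. f_equal.
  - apply (RInt_plus (V := R_CompleteNormedModule) (fun x => Re (f x)) (fun x => Re (g x)));
      apply rcont_ex_Re; auto.
  - apply (RInt_plus (V := R_CompleteNormedModule) (fun x => Im (f x)) (fun x => Im (g x)));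
      apply rcont_ex_Im; auto.
Qed.

Lemma CInt_scal (c : C) (f : R -> C) (a b : R) : rcont f ->
  CInt (fun x => c * f x)%C a b = (c * CInt f a b)%C.
Proof.
  intros Hf. destruct c as [u v]. unfold CInt, Cmult; simpl.
  pose proof (rcont_ex_Re f a b Hf) as H1. pose proof (rcont_ex_Im f a b Hf) as H2.
  unfold Re, Im in *.
  assert (S1 : forall l, RInt (fun x => l * fst (f x)) a b = l * RInt (fun x => fst (f x)) a b).
  { intros l. apply (RInt_scal (V := R_CompleteNormedModule) (fun x => fst (f x)) a b l H1). }
  assert (S2 : forall l, RInt (fun x => l * snd (f x)) a b = l * RInt (fun x => snd (f x)) a b).
  { intros l. apply (RInt_scal (V := R_CompleteNormedModule) (fun x => snd (f x)) a b l H2). }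
  assert (E1 : forall l, ex_RInt (fun x => l * fst (f x)) a b).
  { intros l. apply (ex_RInt_scal (V := R_NormedModule) (fun x => fst (f x)) a b l H1). }
  assert (E2 : forall l, ex_RInt (fun x => l * snd (f x)) a b).
  { intros l. apply (ex_RInt_scal (V := R_NormedModule) (fun x => snd (f x)) a b l H2). }
  f_equal.
  - rewrite <- S1, <- S2.
    apply (RInt_minus (V := R_CompleteNormedModule) (fun x => u * fst (f x)) (fun x => v * snd (f x))); auto.
  - rewrite <- S1, <- S2.
    apply (RInt_plus (V := R_CompleteNormedModule) (fun x => u * snd (f x)) (fun x => v * fst (f x))); auto.
Qed.

Lemma CInt_const (c : C) (a b : R) : CInt (fun _ => c) a b = (RtoC (b - a) * c)%C.
Proof.
  unfold CInt. rewrite !RInt_const. destruct c as [u v].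
  unfold RtoC, Cmult, scal; simpl. unfold mult; simpl. f_equal; ring.
Qed.

(** The factor 2 comes from bounding real and imaginary parts separately. It reappears in all Cauchy
    estimates below, where it affects constants and never an exponential type. *)
Lemma CInt_bound (f : R -> C) (a b M : R) : a <= b -> rcont f ->
  (forall x, a <= x <= b -> Cmod (f x) <= M) -> Cmod (CInt f a b) <= 2 * ((b - a) * M).
Proof.
  intros Hab Hf HM. eapply Rle_trans; [apply Cmod_le_ReIm|].
  unfold CInt, Re at 1, Im at 1; simpl.
  assert (Rabs (RInt (fun x => Re (f x)) a b) <= (b - a) * M).
  { apply abs_RInt_le_const; auto using rcont_ex_Re. intros t Ht.
    eapply Rle_trans; [apply re_le_Cmod|auto]. }
  assert (Rabs (RInt (fun x => Im (f x)) a b) <= (b - a) * M).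
  { apply abs_RInt_le_const; auto using rcont_ex_Im. intros t Ht.
    eapply Rle_trans; [apply Im_le_Cmod|auto]. }
  lra.
Qed.

Lemma rcont_plus (f g : R -> C) : rcont f -> rcont g -> rcont (fun x => f x + g x)%C.
Proof. intros Hf Hg x. apply clim_plus; auto. apply locally_filter. Qed.

Lemma rcont_scal (c : C) (f : R -> C) : rcont f -> rcont (fun x => c * f x)%C.
Proof. intros Hf x. apply clim_scal; auto. apply locally_filter. Qed.

Lemma rcont_const (c : C) : rcont (fun _ => c).
Proof. intros x. apply clim_const. apply locally_filter. Qed.

Lemma rcont_ext (f g : R -> C) : (forall x, f x = g x) -> rcont f -> rcont g.
Proof.
  intros E H x. rewrite <- E. eapply clim_ext; [apply locally_filter| |apply H]. auto.
Qed.

Lemma rcont_minus (f g : R -> C) : rcont f -> rcont g -> rcont (fun x => f x - g x)%C.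
Proof. intros Hf Hg x. apply clim_minus; auto; apply locally_filter. Qed.

Definition ccont (f : C -> C) (z : C) : Prop :=
  clim (@locally C_UniformSpace z) f (f z).

Lemma ccont_eps (f : C -> C) (z : C) :
  ccont f z <-> forall eps, 0 < eps -> exists d, 0 < d /\
    forall w, Cmod (w - z) < d -> Cmod (f w - f z) < eps.
Proof.
  split; intros H eps He; specialize (H eps He); apply locally_Cmod; auto.
Qed.

Lemma cderiv_ccont (f : C -> C) (z l : C) : cderiv f z l -> ccont f z.
Proof.
  intros H. apply ccont_eps. intros eps He.
  destruct (H 1 Rlt_0_1) as (d & Hd & Hh).
  pose proof (Cmod_ge_0 l).
  exists (Rmin d (eps / (Cmod l + 1))). split.
  { apply Rmin_pos; auto. apply Rdiv_lt_0_compat; lra. }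
  intros w Hw. pose proof (Rmin_l d (eps / (Cmod l + 1))). pose proof (Rmin_r d (eps / (Cmod l + 1))).
  specialize (Hh (w - z)%C). replace (z + (w - z))%C with w in Hh by ring.
  specialize (Hh ltac:(lra)).
  replace (f w - f z)%C with ((f w - f z - l * (w - z)) + l * (w - z))%C by ring.
  eapply Rle_lt_trans; [apply Cmod_triangle|]. rewrite Cmod_mult.
  assert (Cmod (w - z) * (Cmod l + 1) < eps).
  { apply Rmult_lt_reg_r with (/ (Cmod l + 1)); [apply Rinv_0_lt_compat; lra|].
    rewrite Rmult_assoc, Rinv_r by lra. unfold Rdiv in *. lra. }
  lra.
Qed.

Lemma Cmod_pair (x y : R) : Cmod (x, y) <= Rabs x + Rabs y.
Proof. apply Cmod_le_ReIm. Qed.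

Lemma rcont_hline (G : C -> C) (c : R) : (forall w, ccont G w) -> rcont (fun x => G (x, c)).
Proof.
  intros H x eps He. destruct (proj1 (ccont_eps G (x, c)) (H _) eps He) as (d & Hd & Hw).
  exists (mkposreal d Hd). intros y Hy. apply Hw.
  eapply Rle_lt_trans; [apply Cmod_pair|]. simpl.
  replace (c + - c) with 0 by ring. rewrite Rabs_R0.
  change (Rabs (y - x) < d) in Hy. unfold Rminus in Hy. lra.
Qed.

Lemma rcont_vline (G : C -> C) (c : R) : (forall w, ccont G w) -> rcont (fun y => G (c, y)).
Proof.
  intros H x eps He. destruct (proj1 (ccont_eps G (c, x)) (H _) eps He) as (d & Hd & Hw).
  exists (mkposreal d Hd). intros y Hy. apply Hw.
  eapply Rle_lt_trans; [apply Cmod_pair|]. simpl.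
  replace (c + - c) with 0 by ring. rewrite Rabs_R0.
  change (Rabs (y - x) < d) in Hy. unfold Rminus in Hy. lra.
Qed.

(** * Goursat's theorem on rectangles *)

(** The counterclockwise contour integral around [a, b] x [c, d], with opposite sides paired in one
    integral and [Ci] standing for the vertical direction. *)
Definition bdint (G : C -> C) (a b c d : R) : C :=
  (CInt (fun x => G (x, c) - G (x, d)) a b + Ci * CInt (fun y => G (b, y) - G (a, y)) c d)%C.

Section Goursat.
Variable G : C -> C.
Hypothesis Gc : forall w, ccont G w.

Let hl c := rcont_hline G c Gc.
Let vl c := rcont_vline G c Gc.

Lemma bdint_split_x (a m b c d : R) :
  bdint G a b c d = (bdint G a m c d + bdint G m b c d)%C.
Proof.
  unfold bdint. rewrite <- (CInt_Chasles _ a m b) by (apply rcont_minus; apply hl).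
  rewrite (CInt_ext (fun y => G (b, y) - G (a, y))%C
    (fun y => (G (b, y) - G (m, y)) + (G (m, y) - G (a, y)))%C) by (intros; ring).
  rewrite CInt_plus by (apply rcont_minus; apply vl). ring.
Qed.

Lemma bdint_split_y (a b c m d : R) :
  bdint G a b c d = (bdint G a b c m + bdint G a b m d)%C.
Proof.
  unfold bdint. rewrite <- (CInt_Chasles _ c m d) by (apply rcont_minus; apply vl).
  rewrite (CInt_ext (fun x => G (x, c) - G (x, d))%C
    (fun x => (G (x, c) - G (x, m)) + (G (x, m) - G (x, d)))%C) by (intros; ring).
  rewrite CInt_plus by (apply rcont_minus; apply hl). ring.
Qed.

(* The boundary integral of [A + l w] vanishes, so only the error of the affine
   approximation contributes. *)
Lemma bdint_local (A l w0 : C) (a b c d K : R) : a <= b -> c <= d ->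
  (forall x y, a <= x <= b -> c <= y <= d -> Cmod (G (x, y) - (A + l * ((x, y) - w0))) <= K) ->
  Cmod (bdint G a b c d) <= 4 * ((b - a) + (d - c)) * K.
Proof.
  intros Hab Hcd HK.
  set (T := fun w : C => (A + l * (w - w0))%C).
  assert (E : bdint G a b c d =
    (CInt (fun x => (G (x, c) - T (x, c)) - (G (x, d) - T (x, d))) a b
     + Ci * CInt (fun y => (G (b, y) - T (b, y)) - (G (a, y) - T (a, y))) c d)%C).
  { rewrite (CInt_ext (fun x => (G (x, c) - T (x, c)) - (G (x, d) - T (x, d)))%C
      (fun x => (G (x, c) - G (x, d)) + l * (Ci * RtoC (d - c)))%C).
    2: { intros x. unfold T. replace (Ci * RtoC (d - c))%C with ((x, d) - (x, c))%C; [ring|].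
         unfold Cminus, Cplus, Copp, Cmult, Ci, RtoC; simpl. f_equal; ring. }
    rewrite (CInt_ext (fun y => (G (b, y) - T (b, y)) - (G (a, y) - T (a, y)))%C
      (fun y => (G (b, y) - G (a, y)) + l * RtoC (a - b))%C).
    2: { intros y. unfold T. replace (RtoC (a - b))%C with ((a, y) - (b, y))%C; [ring|].
         unfold Cminus, Cplus, Copp, Cmult, Ci, RtoC; simpl. f_equal; ring. }
    rewrite !CInt_plus, !CInt_const; try apply rcont_minus; try apply hl; try apply vl;
      try apply rcont_const.
    unfold bdint. rewrite !RtoC_minus. ring. }
  assert (B1 : Cmod (CInt (fun x => (G (x, c) - T (x, c)) - (G (x, d) - T (x, d)))%C a b)
     <= 2 * ((b - a) * (2 * K))).
  { apply CInt_bound; auto.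
    - apply rcont_ext with (fun x => (G (x, c) - G (x, d)) + l * (Ci * RtoC (d - c)))%C.
      + intros x. unfold T. replace (Ci * RtoC (d - c))%C with ((x, d) - (x, c))%C; [ring|].
         unfold Cminus, Cplus, Copp, Cmult, Ci, RtoC; simpl. f_equal; ring.
      + apply rcont_plus; [apply rcont_minus; apply hl|apply rcont_const].
    - intros x Hx. eapply Rle_trans; [apply Cmod_minus_le|].
      pose proof (HK x c Hx ltac:(lra)). pose proof (HK x d Hx ltac:(lra)). unfold T. lra. }
  assert (B2 : Cmod (CInt (fun y => (G (b, y) - T (b, y)) - (G (a, y) - T (a, y)))%C c d)
     <= 2 * ((d - c) * (2 * K))).
  { apply CInt_bound; auto.
    - apply rcont_ext with (fun y => (G (b, y) - G (a, y)) + l * RtoC (a - b))%C.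
      + intros y. unfold T. replace (RtoC (a - b))%C with ((a, y) - (b, y))%C; [ring|].
         unfold Cminus, Cplus, Copp, Cmult, Ci, RtoC; simpl. f_equal; ring.
      + apply rcont_plus; [apply rcont_minus; apply vl|apply rcont_const].
    - intros y Hy. eapply Rle_trans; [apply Cmod_minus_le|].
      pose proof (HK b y ltac:(lra) Hy). pose proof (HK a y ltac:(lra) Hy). unfold T. lra. }
  rewrite E. eapply Rle_trans; [apply Cmod_triangle|]. rewrite Cmod_mult, Cmod_Ci. lra.
Qed.

(** Pigeonhole over the four quarters; the pair found is the lower left corner of a quarter that
    carries at least its share of the modulus. *)
Lemma bdint_quarter (a c L M : R) :
  exists p : R * R, (fst p = a \/ fst p = a + L / 2) /\ (snd p = c \/ snd p = c + M / 2) /\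
    Cmod (bdint G a (a + L) c (c + M)) / 4 <=
    Cmod (bdint G (fst p) (fst p + L / 2) (snd p) (snd p + M / 2)).
Proof.
  set (B := fun x y => bdint G x (x + L / 2) y (y + M / 2)).
  assert (E : bdint G a (a + L) c (c + M) =
     (B a c + B a (c + M / 2)%R + (B (a + L / 2)%R c + B (a + L / 2)%R (c + M / 2)%R))%C).
  { unfold B. rewrite (bdint_split_x a (a + L / 2)).
    rewrite (bdint_split_y a (a + L / 2) c (c + M / 2)).
    rewrite (bdint_split_y (a + L / 2) (a + L) c (c + M / 2)).
    replace (a + L / 2 + L / 2) with (a + L) by field.
    replace (c + M / 2 + M / 2) with (c + M) by field. auto. }
  assert (Hle : Cmod (bdint G a (a + L) c (c + M)) <= Cmod (B a c) + Cmod (B a (c + M / 2)) +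
     (Cmod (B (a + L / 2) c) + Cmod (B (a + L / 2) (c + M / 2)))).
  { rewrite E. eapply Rle_trans; [apply Cmod_triangle|].
    apply Rplus_le_compat; apply Cmod_triangle. }
  set (t := Cmod (bdint G a (a + L) c (c + M))) in *.
  destruct (Rle_dec (t / 4) (Cmod (B a c))) as [H1|H1]; [exists (a, c); simpl; auto|].
  destruct (Rle_dec (t / 4) (Cmod (B a (c + M / 2)))) as [H2|H2];
    [exists (a, c + M / 2); simpl; auto|].
  destruct (Rle_dec (t / 4) (Cmod (B (a + L / 2) c))) as [H3|H3];
    [exists (a + L / 2, c); simpl; auto|].
  exists (a + L / 2, c + M / 2); simpl. split; auto. split; auto. unfold B in *. lra.
Qed.
End Goursat.

(** Nested intervals: [u n] is the left end of the interval kept after n bisections of an interval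
    of length [L]. *)
Lemma dichotomy_limit (u : nat -> R) (L : R) : 0 <= L ->
  (forall n, u (S n) = u n \/ u (S n) = u n + L / 2 ^ n / 2) ->
  exists x, forall n, u n <= x <= u n + L / 2 ^ n.
Proof.
  intros HL H.
  assert (P2 : forall n, 0 < 2 ^ n) by (intros; apply pow_lt; lra).
  assert (Hp : forall n, 0 <= L / 2 ^ n).
  { intros n. apply Rmult_le_pos; auto. left. apply Rinv_0_lt_compat; auto. }
  assert (Hh : forall n, L / 2 ^ S n = L / 2 ^ n / 2).
  { intros n. simpl. field. apply Rgt_not_eq, P2. }
  assert (Hi : forall n, u n <= u (S n)).
  { intros n. specialize (Hp n). destruct (H n) as [E|E]; rewrite E; lra. }
  assert (Hd : forall n, u (S n) + L / 2 ^ S n <= u n + L / 2 ^ n).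
  { intros n. rewrite Hh. specialize (Hp n). destruct (H n) as [E|E]; rewrite E; lra. }
  assert (Hdk : forall n k, u (n + k)%nat + L / 2 ^ (n + k) <= u n + L / 2 ^ n).
  { intros n k. induction k as [|k IH].
    - rewrite Nat.add_0_r. lra.
    - rewrite Nat.add_succ_r. specialize (Hd (n + k)%nat). lra. }
  assert (Hik : forall n k, u n <= u (n + k)%nat).
  { intros n k. induction k as [|k IH].
    - rewrite Nat.add_0_r. lra.
    - rewrite Nat.add_succ_r. specialize (Hi (n + k)%nat). lra. }
  destruct (ex_finite_lim_seq_incr u (u O + L / 2 ^ O)) as [x Hx]; auto.
  { intros n. specialize (Hdk O n). specialize (Hp n). simpl in *. lra. }
  exists x. intros n. split.
  - apply is_lim_seq_incr_compare; auto.
  - assert (Hx' : is_lim_seq (fun k => u (k + n)%nat) x) by (apply is_lim_seq_incr_n with (N := n) in Hx; auto).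
    assert (Rbar_le x (u n + L / 2 ^ n)).
    { apply (is_lim_seq_le (fun k => u (k + n)%nat) (fun _ => u n + L / 2 ^ n)); auto.
      - intros k. specialize (Hdk n k). specialize (Hp (n + k)%nat). rewrite (Nat.add_comm k n). lra.
      - apply is_lim_seq_const. }
    auto.
Qed.

Lemma pow2_large (K eps : R) : 0 < eps -> exists n, K / 2 ^ n < eps.
Proof.
  intros He. destruct (Rle_dec K 0) as [HK|HK].
  - exists O. simpl. lra.
  - destruct (pow_lt_1_zero (/ 2) ltac:(rewrite Rabs_right; lra) (eps / K)) as [N HN].
    { apply Rdiv_lt_0_compat; lra. }
    exists N. specialize (HN N (Nat.le_refl _)). rewrite Rabs_right in HN.
    + rewrite pow_inv in HN. unfold Rdiv.
      apply Rmult_lt_compat_l with (r := K) in HN; [|lra].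
      replace (K * (eps / K)) with eps in HN by (field; lra). auto.
    + apply Rle_ge, pow_le; lra.
Qed.

(** Continuity is global but differentiability is asked only on the closed rectangle, because the
    theorem will be applied on both sides of a circle on which a difference quotient is merely
    continuous. *)
Theorem goursat (G : C -> C) (a b c d : R) : (forall w, ccont G w) -> a <= b -> c <= d ->
  (forall x y, a <= x <= b -> c <= y <= d -> exists l, cderiv G (x, y) l) ->
  bdint G a b c d = RtoC 0.
Proof.
  intros Gc Hab Hcd Hol. apply Cmod_eq_0.
  destruct (Rle_lt_or_eq_dec 0 (Cmod (bdint G a b c d)) (Cmod_ge_0 _)) as [Hp|]; auto.
  exfalso. set (eta := Cmod (bdint G a b c d)) in *.
  set (L := b - a). set (M := d - c).
  destruct (fun_choice _ (fun q : R * R * (R * R) =>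
     bdint_quarter G Gc (fst (fst q)) (snd (fst q)) (fst (snd q)) (snd (snd q)))) as [nx Hnx].
  set (sz := fun n : nat => (L / 2 ^ n, M / 2 ^ n)).
  set (P := fix P (n : nat) : R * R := match n with O => (a, c) | S n => nx (P n, sz n) end).
  assert (P2 : forall n, 0 < 2 ^ n) by (intros; apply pow_lt; lra).
  assert (Hh : forall (X : R) n, X / 2 ^ S n = X / 2 ^ n / 2).
  { intros X n. simpl. field. apply Rgt_not_eq, P2. }
  destruct (dichotomy_limit (fun n => fst (P n)) L) as [x Hx]; [unfold L; lra| |].
  { intros n. destruct (Hnx (P n, sz n)) as [H1 _]. exact H1. }
  destruct (dichotomy_limit (fun n => snd (P n)) M) as [y Hy]; [unfold M; lra| |].
  { intros n. destruct (Hnx (P n, sz n)) as (_ & H1 & _). exact H1. }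
  assert (Hbig : forall n, eta / 4 ^ n <=
     Cmod (bdint G (fst (P n)) (fst (P n) + L / 2 ^ n) (snd (P n)) (snd (P n) + M / 2 ^ n))).
  { induction n as [|n IH].
    - simpl. replace (a + L / 1) with b by (unfold L; field).
      replace (c + M / 1) with d by (unfold M; field). fold eta. lra.
    - destruct (Hnx (P n, sz n)) as (_ & _ & H1). simpl fst in H1; simpl snd in H1.
      rewrite !Hh. change (P (S n)) with (nx (P n, sz n)).
      eapply Rle_trans; [|exact H1].
      replace (eta / 4 ^ S n) with (eta / 4 ^ n / 4); [unfold Rdiv at 1 3; apply Rmult_le_compat_r; [lra|exact IH]|].
      simpl. field. apply pow_nonzero. lra. }
  destruct (Hol x y) as [l Hl].
  { specialize (Hx O). simpl in Hx. unfold L in Hx. lra. }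
  { specialize (Hy O). simpl in Hy. unfold M in Hy. lra. }
  set (S := L + M). assert (HS : 0 <= S) by (unfold S, L, M; lra).
  (* In the n-th rectangle the sides and the affine error both carry a factor 2^(-n); their product
     matches the factor 4^(-n) of the lower bound, so n disappears and [eps] remains. *)
  assert (Hbound : forall eps, 0 < eps -> eta <= 4 * S * S * eps).
  { intros eps He. destruct (Hl eps He) as (dl & Hdl & Hh').
    destruct (pow2_large S dl Hdl) as [n Hn].
    specialize (Hx n). specialize (Hy n). specialize (Hbig n).
    assert (HLn : 0 <= L / 2 ^ n) by lra. assert (HMn : 0 <= M / 2 ^ n) by lra.
    assert (ES : L / 2 ^ n + M / 2 ^ n = S / 2 ^ n) by (unfold S; field; apply Rgt_not_eq, P2).
    assert (HK : forall x' y', fst (P n) <= x' <= fst (P n) + L / 2 ^ n ->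
      snd (P n) <= y' <= snd (P n) + M / 2 ^ n ->
      Cmod (G (x', y') - (G (x, y) + l * ((x', y') - (x, y)))) <= eps * (S / 2 ^ n)).
    { intros x' y' Hx' Hy'.
      assert (Hw : Cmod ((x', y') - (x, y)) <= S / 2 ^ n).
      { eapply Rle_trans; [apply Cmod_le_ReIm|]. simpl.
        assert (Rabs (x' + - x) <= L / 2 ^ n) by (apply Rabs_le; lra).
        assert (Rabs (y' + - y) <= M / 2 ^ n) by (apply Rabs_le; lra). lra. }
      specialize (Hh' ((x', y') - (x, y))%C ltac:(lra)).
      assert (Q : forall u v : C, (u + (v - u))%C = v) by (intros; ring).
      rewrite Q in Hh'.
      replace (G (x', y') - (G (x, y) + l * ((x', y') - (x, y))))%C with
        (G (x', y') - G (x, y) - l * ((x', y') - (x, y)))%C by ring.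
      eapply Rle_trans; [exact Hh'|]. apply Rmult_le_compat_l; lra. }
    assert (HB := bdint_local G Gc (G (x, y)) l (x, y) (fst (P n)) (fst (P n) + L / 2 ^ n)
      (snd (P n)) (snd (P n) + M / 2 ^ n) (eps * (S / 2 ^ n)) ltac:(lra) ltac:(lra) HK).
    pose proof (Rle_trans _ _ _ Hbig HB) as HB'. clear HB. rename HB' into HB.
    replace (fst (P n) + L / 2 ^ n - fst (P n) + (snd (P n) + M / 2 ^ n - snd (P n)))
        with (S / 2 ^ n) in HB by lra.
      replace (4 * (S / 2 ^ n) * (eps * (S / 2 ^ n))) with (4 * S * S * eps / 4 ^ n) in HB.
      + apply Rmult_le_reg_r with (/ 4 ^ n); [apply Rinv_0_lt_compat, pow_lt; lra|exact HB].
      + replace (4 ^ n) with (2 ^ n * 2 ^ n) by (rewrite <- Rpow_mult_distr; f_equal; lra).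
        field. apply Rgt_not_eq, P2. }
  assert (HSS : 0 <= 4 * S * S) by nra.
  specialize (Hbound (eta / (2 * (4 * S * S + 1)))).
  assert (Hq : 4 * S * S * (eta / (2 * (4 * S * S + 1))) = eta / 2 * (4 * S * S / (4 * S * S + 1))) by (field; lra).
  assert (4 * S * S / (4 * S * S + 1) <= 1).
  { apply Rmult_le_reg_r with (4 * S * S + 1); [lra|]. unfold Rdiv. rewrite Rmult_assoc, Rinv_l; lra. }
  rewrite Hq in Hbound. assert (0 < eta / (2 * (4 * S * S + 1))) by (apply Rdiv_lt_0_compat; lra).
  specialize (Hbound H0). nra.
Qed.

(** * The complex exponential *)

Lemma sin_Rabs_le (x : R) : Rabs (sin x) <= Rabs x.
Proof.
  destruct (MVT_gen sin 0 x cos) as (c & _ & Hc).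
  - intros; apply is_derive_Reals, derivable_pt_lim_sin.
  - intros; apply derivable_continuous_pt, derivable_pt_sin.
  - rewrite sin_0, !Rminus_0_r in Hc. rewrite Hc, Rabs_mult.
    pose proof (COS_bound c). pose proof (Rabs_pos x).
    assert (Rabs (cos c) <= 1) by (apply Rabs_le; lra). nra.
Qed.

Lemma cos_taylor (x : R) : Rabs (cos x - 1) <= x ^ 2 / 2.
Proof.
  pose proof (sin_Rabs_le (x / 2)). pose proof (Rabs_pos (sin (x / 2))).
  replace x with (2 * (x / 2)) at 1 by field.
  rewrite cos_2a_sin.
  replace (1 - 2 * sin (x / 2) * sin (x / 2) - 1) with (- (2 * sin (x / 2) ^ 2)) by ring.
  rewrite Rabs_Ropp, Rabs_right; [|apply Rle_ge, Rmult_le_pos; [lra|apply pow2_ge_0]].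
  rewrite <- pow2_abs. replace (x ^ 2 / 2) with (2 * (x / 2) ^ 2) by field.
  rewrite <- (pow2_abs (x / 2)).
  apply Rmult_le_compat_l; [lra|]. apply pow_incr; auto.
Qed.

Lemma sin_taylor (x : R) : Rabs (sin x - x) <= Rabs x * x ^ 2 / 2.
Proof.
  destruct (MVT_gen (fun t => sin t - t) 0 x (fun t => cos t - 1)) as (c & Hc' & Hc).
  - intros; auto_derive; auto. ring.
  - intros t _. apply derivable_continuous_pt. apply derivable_pt_minus.
    apply derivable_pt_sin. apply derivable_pt_id.
  - rewrite sin_0 in Hc. replace (sin x - x - (0 - 0)) with (sin x - x) in Hc by ring.
    rewrite Hc, Rabs_mult, Rminus_0_r. pose proof (cos_taylor c). pose proof (Rabs_pos x).
    assert (c ^ 2 <= x ^ 2).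
    { rewrite <- (pow2_abs c), <- (pow2_abs x). apply pow_incr. split; [apply Rabs_pos|].
      unfold Rmin, Rmax in Hc'. destruct (Rle_dec 0 x); unfold Rabs; destruct (Rcase_abs c), (Rcase_abs x); lra. }
    nra.
Qed.

(** The upper bound comes from exp (- x / 2) >= 1 - x / 2, squared and inverted; halving the
    argument keeps 1 - x / 2 away from 0 up to x = 1. *)
Lemma exp_taylor (x : R) : Rabs x <= 1 -> Rabs (exp x - 1 - x) <= 2 * x ^ 2.
Proof.
  intros Hx. apply Rabs_le_between in Hx.
  pose proof (exp_ineq1_le x). pose proof (exp_ineq1_le (- (x / 2))).
  pose proof (exp_pos x). pose proof (exp_pos (- (x / 2))).
  assert (E : exp x * (exp (- (x / 2)) * exp (- (x / 2))) = 1).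
  { rewrite <- !exp_plus. rewrite <- exp_0. f_equal. field. }
  assert (Hq : (1 - x / 2) * (1 - x / 2) <= exp (- (x / 2)) * exp (- (x / 2))).
  { apply Rmult_le_compat; lra. }
  assert (Hle : exp x * ((1 - x / 2) * (1 - x / 2)) <= 1).
  { eapply Rle_trans; [apply Rmult_le_compat_l; [left; eassumption|exact Hq]|lra]. }
  assert (Hd : 1 <= (1 + x + 2 * x ^ 2) * ((1 - x / 2) * (1 - x / 2))).
  { replace ((1 + x + 2 * x ^ 2) * ((1 - x / 2) * (1 - x / 2)))
      with (1 + x ^ 2 * ((1 - x) * (5 / 4 - x / 2))) by field.
    assert (0 <= x ^ 2 * ((1 - x) * (5 / 4 - x / 2))); [|lra].
    apply Rmult_le_pos; [apply pow2_ge_0|]. apply Rmult_le_pos; lra. }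
  assert (exp x <= 1 + x + 2 * x ^ 2).
  { apply Rmult_le_reg_r with ((1 - x / 2) * (1 - x / 2)); [apply Rmult_lt_0_compat; lra|lra]. }
  pose proof (pow2_ge_0 x). apply Rabs_le. lra.
Qed.

Lemma Cexp_plus (a b : C) : Cexp (a + b) = (Cexp a * Cexp b)%C.
Proof.
  unfold Cexp, Cmult, Cplus, Re, Im; simpl. rewrite exp_plus, cos_plus, sin_plus. f_equal; ring.
Qed.

Lemma Cexp_0 : Cexp (RtoC 0) = RtoC 1.
Proof. unfold Cexp, RtoC; simpl. rewrite exp_0, cos_0, sin_0. f_equal; ring. Qed.

Lemma Cmod_Cexp (z : C) : Cmod (Cexp z) = exp (Re z).
Proof.
  unfold Cexp, Cmod. simpl fst; simpl snd.
  replace ((exp (Re z) * cos (Im z)) ^ 2 + (exp (Re z) * sin (Im z)) ^ 2)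
    with (exp (Re z) ^ 2 * (Rsqr (sin (Im z)) + Rsqr (cos (Im z)))) by (unfold Rsqr; ring).
  rewrite sin2_cos2, Rmult_1_r. apply sqrt_pow2. left; apply exp_pos.
Qed.

Lemma Cexp_neq_0 (z : C) : Cexp z <> RtoC 0.
Proof. apply Cmod_gt_0. rewrite Cmod_Cexp. apply exp_pos. Qed.

Lemma Cmod_Cexp_le (z : C) : Cmod (Cexp z) <= exp (Cmod z).
Proof.
  rewrite Cmod_Cexp. pose proof (re_le_Cmod z). pose proof (Rle_abs (Re z)).
  destruct (Rle_lt_or_eq_dec (Re z) (Cmod z)) as [H1|H1]; [lra|left; apply exp_increasing; auto|rewrite H1; lra].
Qed.

Lemma Cmod_sqr (z : C) : Cmod z ^ 2 = Re z ^ 2 + Im z ^ 2.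
Proof. unfold Cmod. rewrite pow2_sqrt; auto. pose proof (pow2_ge_0 (fst z)). pose proof (pow2_ge_0 (snd z)). lra. Qed.

Lemma Cexp_taylor_small (z : C) : Cmod z <= 1 -> Cmod (Cexp z - 1 - z) <= 6 * Cmod z ^ 2.
Proof.
  intros Hz. pose proof (re_le_Cmod z) as Hx. pose proof (Im_le_Cmod z) as Hy.
  rewrite Cmod_sqr. eapply Rle_trans; [apply Cmod_le_ReIm|].
  destruct z as [x y]. unfold Cexp, Re, Im in *; simpl fst in *; simpl snd in *.
  replace (exp x * cos y + - (1) + - x) with (exp x * (cos y - 1) + (exp x - 1 - x)) by ring.
  replace (exp x * sin y + - 0 + - y) with (exp x * (sin y - y) + (exp x - 1) * y) by ring.
  pose proof (cos_taylor y) as H1. pose proof (sin_taylor y) as H2.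
  pose proof (exp_taylor x ltac:(lra)) as H3.
  assert (He : 0 < exp x <= 3).
  { split; [apply exp_pos|]. eapply Rle_trans; [|apply exp_le_3].
    assert (x <= 1) by (pose proof (Rle_abs x); lra).
    destruct H; [left; apply exp_increasing; auto|subst; lra]. }
  assert (H4 : Rabs (exp x - 1) <= 3 * Rabs x).
  { replace (exp x - 1) with ((exp x - 1 - x) + x) by ring.
    eapply Rle_trans; [apply Rabs_triang|]. rewrite <- pow2_abs in H3.
    pose proof (Rabs_pos x). assert (Rabs x <= 1) by lra. nra. }
  assert (B1 : Rabs (exp x * (cos y - 1) + (exp x - 1 - x)) <= 3 * (y ^ 2 / 2) + 2 * x ^ 2).
  { eapply Rle_trans; [apply Rabs_triang|]. apply Rplus_le_compat; auto.
    rewrite Rabs_mult. apply Rmult_le_compat; auto using Rabs_pos. rewrite Rabs_right; lra. }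
  assert (B2 : Rabs (exp x * (sin y - y) + (exp x - 1) * y) <= 3 * (y ^ 2 / 2) + 3 * Rabs x * Rabs y).
  { eapply Rle_trans; [apply Rabs_triang|]. apply Rplus_le_compat.
    - rewrite Rabs_mult. apply Rmult_le_compat; auto using Rabs_pos; [rewrite Rabs_right; lra|].
      eapply Rle_trans; [apply H2|]. pose proof (pow2_ge_0 y). assert (Rabs y <= 1) by lra. nra.
    - rewrite Rabs_mult. apply Rmult_le_compat_r; auto using Rabs_pos. }
  assert (B3 : 2 * (Rabs x * Rabs y) <= x ^ 2 + y ^ 2).
  { pose proof (pow2_ge_0 (Rabs x - Rabs y)). rewrite <- (pow2_abs x), <- (pow2_abs y). nra. }
  pose proof (pow2_ge_0 x). pose proof (pow2_ge_0 y).
  rewrite Rmult_assoc in B2. lra.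
Qed.

Lemma Cexp_taylor (z : C) : Cmod (1 + z - Cexp z) <= 6 * Cmod z ^ 2 * exp (Cmod z).
Proof.
  pose proof (Cmod_ge_0 z). pose proof (exp_ineq1_le (Cmod z)). pose proof (pow2_ge_0 (Cmod z)).
  destruct (Rle_dec (Cmod z) 1) as [H2|H2].
  - rewrite Cmod_minus_sym. replace (Cexp z - (1 + z))%C with (Cexp z - 1 - z)%C by ring.
    pose proof (Cexp_taylor_small z H2). nra.
  - eapply Rle_trans; [apply Cmod_minus_le|]. pose proof (Cmod_Cexp_le z).
    pose proof (Cmod_triangle 1 z). rewrite Cmod_1 in H4.
    assert (1 <= Cmod z ^ 2) by nra. nra.
Qed.

(** * Calculus of complex derivatives *)

(** Caratheodory's slope function turns the product and chain rules into algebra, and it is itself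
    the continuous quotient needed for the Taylor expansion. *)
Lemma cderiv_caratheodory (f : C -> C) (z l : C) : cderiv f z l <->
  exists phi : C -> C, phi z = l /\ ccont phi z /\ forall w, f w = (f z + phi w * (w - z))%C.
Proof.
  split.
  - intros H. exists (fun w => if Ceq_dec w z then l else ((f w - f z) / (w - z))%C).
    split; [destruct (Ceq_dec z z); tauto|]. split.
    + apply ccont_eps. intros eps He. destruct (H (eps / 2) ltac:(lra)) as (d & Hd & Hh).
      exists d; split; auto. intros w Hw. destruct (Ceq_dec z z) as [_|]; [|tauto].
      destruct (Ceq_dec w z) as [E|E].
      * unfold Cminus. rewrite Cplus_opp_r, Cmod_0; auto.
      * assert (E' : (w - z)%C <> RtoC 0) by (apply Cminus_eq_contra; auto).
        assert (Hp : 0 < Cmod (w - z)) by (apply Cmod_gt_0; auto).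
        specialize (Hh (w - z)%C Hw). replace (z + (w - z))%C with w in Hh by ring.
        replace ((f w - f z) / (w - z) - l)%C with ((f w - f z - l * (w - z)) / (w - z))%C by (field; auto).
        rewrite Cmod_div by auto.
        apply Rmult_lt_reg_r with (Cmod (w - z)); auto. unfold Rdiv at 1.
        rewrite Rmult_assoc, Rinv_l by lra. nra.
    + intros w. destruct (Ceq_dec w z) as [E|E].
      * subst. ring.
      * assert (E' : (w - z)%C <> RtoC 0) by (apply Cminus_eq_contra; auto). field; auto.
  - intros (phi & H1 & H2 & H3) eps He.
    destruct (proj1 (ccont_eps _ _) H2 eps He) as (d & Hd & Hh).
    exists d; split; auto. intros h Hm.
    rewrite (H3 (z + h)%C). replace (f z + phi (z + h) * (z + h - z) - f z - l * h)%C
      with ((phi (z + h) - phi z) * h)%C by (rewrite H1; ring).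
    rewrite Cmod_mult. apply Rmult_le_compat_r; [apply Cmod_ge_0|]. left. apply Hh.
    replace (z + h - z)%C with h by ring. auto.
Qed.

Lemma ccont_mult (f g : C -> C) (z : C) : ccont f z -> ccont g z -> ccont (fun w => f w * g w)%C z.
Proof. intros. apply clim_mult; auto. apply locally_filter. Qed.

Lemma ccont_plus (f g : C -> C) (z : C) : ccont f z -> ccont g z -> ccont (fun w => f w + g w)%C z.
Proof. intros. apply clim_plus; auto. apply locally_filter. Qed.

Lemma ccont_const (c z : C) : ccont (fun _ => c) z.
Proof. apply clim_const. apply locally_filter. Qed.

Lemma ccont_comp (f g : C -> C) (z : C) : ccont g z -> ccont f (g z) -> ccont (fun w => f (g w)) z.
Proof.
  intros Hg Hf. apply ccont_eps. intros eps He.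
  destruct (proj1 (ccont_eps _ _) Hf eps He) as (d & Hd & Hh).
  destruct (proj1 (ccont_eps _ _) Hg d Hd) as (d' & Hd' & Hh').
  exists d'; split; auto.
Qed.

Lemma cderiv_mult (f g : C -> C) (z l m : C) : cderiv f z l -> cderiv g z m ->
  cderiv (fun w => f w * g w)%C z (l * g z + f z * m)%C.
Proof.
  intros Hf Hg. pose proof (cderiv_ccont _ _ _ Hg) as Cg.
  apply cderiv_caratheodory in Hf. apply cderiv_caratheodory in Hg. apply cderiv_caratheodory.
  destruct Hf as (p & P1 & P2 & P3). destruct Hg as (q & Q1 & Q2 & Q3).
  exists (fun w => p w * g w + f z * q w)%C. rewrite P1, Q1. split; auto. split.
  - apply ccont_plus; apply ccont_mult; auto. apply ccont_const.
  - intros w. rewrite (P3 w). rewrite (Q3 w) at 1. rewrite (Q3 w). ring.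
Qed.

Lemma cderiv_comp (f g : C -> C) (z l m : C) : cderiv g z m -> cderiv f (g z) l ->
  cderiv (fun w => f (g w)) z (l * m)%C.
Proof.
  intros Hg Hf. pose proof (cderiv_ccont _ _ _ Hg) as Cg.
  apply cderiv_caratheodory in Hf. apply cderiv_caratheodory in Hg. apply cderiv_caratheodory.
  destruct Hf as (p & P1 & P2 & P3). destruct Hg as (q & Q1 & Q2 & Q3).
  exists (fun w => p (g w) * q w)%C. rewrite P1, Q1. split; auto. split.
  - apply ccont_mult; auto. apply ccont_comp; auto.
  - intros w. rewrite (P3 (g w)). rewrite (Q3 w) at 2. ring.
Qed.

Lemma cderiv_affine (a b z : C) : cderiv (fun w => a * w + b)%C z a.
Proof.
  intros eps He. exists 1. split; [lra|]. intros h _.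
  replace (a * (z + h) + b - (a * z + b) - a * h)%C with (RtoC 0) by ring.
  rewrite Cmod_0. apply Rmult_le_pos; [lra|apply Cmod_ge_0].
Qed.

Lemma cderiv_local (f g : C -> C) (z l : C) (r : R) : 0 < r ->
  (forall w, Cmod (w - z) < r -> f w = g w) -> cderiv f z l -> cderiv g z l.
Proof.
  intros Hr E H eps He. destruct (H eps He) as (d & Hd & Hh).
  exists (Rmin d r). split; [apply Rmin_pos; auto|].
  intros h Hm. pose proof (Rmin_l d r). pose proof (Rmin_r d r).
  rewrite <- !E; [apply Hh; lra| |].
  - unfold Cminus. rewrite Cplus_opp_r, Cmod_0. auto.
  - replace (z + h - z)%C with h by ring. lra.
Qed.

Lemma cderiv_const (a z : C) : cderiv (fun _ => a) z (RtoC 0).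
Proof.
  apply cderiv_local with (fun w => RtoC 0 * w + a)%C 1; [lra| |apply cderiv_affine].
  intros; ring.
Qed.

Lemma cderiv_inv (z : C) : z <> RtoC 0 -> cderiv Cinv z (- / (z * z))%C.
Proof.
  intros Hz. assert (Hp : 0 < Cmod z) by (apply Cmod_gt_0; auto).
  intros eps He.
  exists (Rmin (Cmod z / 2) (eps * Cmod z ^ 3 / 2)). split.
  { apply Rmin_pos; [lra|]. apply Rdiv_lt_0_compat; [|lra]. apply Rmult_lt_0_compat; auto. apply pow_lt; auto. }
  intros h Hh. pose proof (Rmin_l (Cmod z / 2) (eps * Cmod z ^ 3 / 2)).
  pose proof (Rmin_r (Cmod z / 2) (eps * Cmod z ^ 3 / 2)).
  assert (Hzh : Cmod z / 2 <= Cmod (z + h)).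
  { pose proof (Cmod_le_sub z (z + h)%C). replace (z - (z + h))%C with (- h)%C in H1 by ring.
    rewrite Cmod_opp in H1. lra. }
  assert (Hn : (z + h)%C <> RtoC 0) by (apply Cmod_gt_0; lra).
  replace (/ (z + h) - / z - - / (z * z) * h)%C with (h * h / (z * z * (z + h)))%C by (field; auto).
  assert (Hn2 : (z * z * (z + h))%C <> RtoC 0) by (repeat apply Cmult_neq_0; auto).
  rewrite Cmod_div, !Cmod_mult by auto.
  pose proof (Cmod_ge_0 h).
  assert (Hden : 0 < Cmod z * Cmod z * Cmod (z + h)) by (apply Rmult_lt_0_compat; nra).
  apply Rmult_le_reg_r with (Cmod z * Cmod z * Cmod (z + h)); auto.
  unfold Rdiv at 1. rewrite Rmult_assoc, Rinv_l, Rmult_1_r by lra.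
  replace (eps * Cmod h * (Cmod z * Cmod z * Cmod (z + h))) with (Cmod h * (eps * (Cmod z * Cmod z * Cmod (z + h)))) by ring.
  apply Rmult_le_compat_l; auto.
  apply Rle_trans with (eps * Cmod z ^ 3 / 2); [lra|].
  replace (eps * Cmod z ^ 3 / 2) with (eps * (Cmod z * Cmod z * (Cmod z / 2))) by field.
  apply Rmult_le_compat_l; [lra|]. apply Rmult_le_compat_l; [nra|auto].
Qed.

Lemma cderiv_pow (f : C -> C) (z : C) (n : nat) : (exists l, cderiv f z l) ->
  exists l, cderiv (fun w => f w ^ n)%C z l.
Proof.
  intros [l H]. induction n as [|n [m IH]]; simpl.
  - eexists. apply cderiv_const.
  - eexists. apply cderiv_mult; eauto.
Qed.

Lemma cderiv_Cexp (z : C) : cderiv Cexp z (Cexp z).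
Proof.
  intros eps He. pose proof (exp_pos (Re z)).
  exists (Rmin 1 (eps / (6 * exp (Re z)))). split.
  { apply Rmin_pos; [lra|]. apply Rdiv_lt_0_compat; lra. }
  intros h Hh. pose proof (Rmin_l 1 (eps / (6 * exp (Re z)))).
  pose proof (Rmin_r 1 (eps / (6 * exp (Re z)))).
  rewrite Cexp_plus. replace (Cexp z * Cexp h - Cexp z - Cexp z * h)%C with (Cexp z * (Cexp h - 1 - h))%C by ring.
  rewrite Cmod_mult, Cmod_Cexp. pose proof (Cexp_taylor_small h ltac:(lra)). pose proof (Cmod_ge_0 h).
  assert (Cmod h * (6 * exp (Re z)) <= eps).
  { apply Rmult_le_reg_r with (/ (6 * exp (Re z))); [apply Rinv_0_lt_compat; lra|].
    rewrite Rmult_assoc, Rinv_r by lra. unfold Rdiv in *. lra. }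
  assert (exp (Re z) * Cmod (Cexp h - 1 - h) <= exp (Re z) * (6 * Cmod h ^ 2)) by (apply Rmult_le_compat_l; lra).
  nra.
Qed.

(** The slope function at [z0] is continuous everywhere and holomorphic off [z0]. It plays the part
    of the Cauchy kernel in the Taylor expansion. *)
Lemma cderiv_quotient (f : C -> C) (z0 : C) : entire f ->
  exists g : C -> C, (forall w, f w = (f z0 + g w * (w - z0))%C) /\
    (forall w, ccont g w) /\ (forall w, w <> z0 -> exists l, cderiv g w l).
Proof.
  intros Hf. destruct (entire_cderiv f z0 Hf) as [l Hl]. apply cderiv_caratheodory in Hl.
  destruct Hl as (g & G1 & G2 & G3). exists g. split; auto.
  assert (Hd : forall w, w <> z0 -> exists l, cderiv g w l).
  { intros w Hw. assert (Hw' : (w - z0)%C <> RtoC 0) by (apply Cminus_eq_contra; auto).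
    destruct (entire_cderiv f w Hf) as [m Hm].
    eexists. apply cderiv_local with (f := fun u => ((1 * f u + - f z0) * / (1 * u + - z0))%C) (r := Cmod (w - z0)).
    - apply Cmod_gt_0; auto.
    - intros u Hu. assert (Hn : (u - z0)%C <> RtoC 0).
      { intros E. replace (u - w)%C with ((u - z0) - (w - z0))%C in Hu by ring. rewrite E in Hu.
        replace (0 - (w - z0))%C with (- (w - z0))%C in Hu by ring. rewrite Cmod_opp in Hu. lra. }
      rewrite (G3 u). field. replace (u + - z0)%C with (u - z0)%C by ring. auto.
    - apply cderiv_mult.
      + apply (cderiv_comp (fun u => 1 * u + - f z0)%C f); [apply Hm|apply cderiv_affine].
      + apply (cderiv_comp Cinv (fun u => 1 * u + - z0)%C); [apply cderiv_affine|].
        apply cderiv_inv. replace (1 * w + - z0)%C with (w - z0)%C by ring. auto. }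
  split; auto. intros w. destruct (Ceq_dec w z0) as [E|E]; [subst; auto|].
  destruct (Hd w E) as [m Hm]. eapply cderiv_ccont; eauto.
Qed.

(** * Taylor expansion of entire functions *)

(** An integral over the circle of radius exp s, not divided by 2 PI. Composition with [Cexp] turns
    circles into vertical segments, so Goursat on rectangles is all that is needed. *)
Definition Cmean (F : C -> C) (s : R) : C := CInt (fun t => F (Cexp (s, t))) 0 (2 * PI).

Section CircleMeans.
Variable F : C -> C.
Hypothesis Fc : forall w, w <> RtoC 0 -> ccont F w.

Lemma ccont_F_Cexp (w : C) : ccont (fun w => F (Cexp w)) w.
Proof.
  apply ccont_comp; [apply cderiv_ccont with (Cexp w), cderiv_Cexp|]. apply Fc, Cexp_neq_0.
Qed.

Lemma rcont_circle (s : R) : rcont (fun t => F (Cexp (s, t))).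
Proof. apply (rcont_vline (fun w => F (Cexp w))). apply ccont_F_Cexp. Qed.

Lemma Cexp_2PI (s : R) : Cexp (s, 2 * PI) = Cexp (s, 0).
Proof. unfold Cexp, Re, Im; simpl fst; simpl snd. rewrite cos_2PI, sin_2PI, cos_0, sin_0. auto. Qed.

(* Goursat's theorem for [F o Cexp] on the rectangle [[s1, s2] x [0, 2 PI]]: the
   horizontal sides cancel by periodicity. *)
Lemma Cmean_strip (s1 s2 : R) : s1 <= s2 ->
  (forall w, exp s1 <= Cmod w <= exp s2 -> exists l, cderiv F w l) -> Cmean F s1 = Cmean F s2.
Proof.
  intros Hs Hd. pose proof PI_RGT_0.
  assert (G := goursat (fun w => F (Cexp w)) s1 s2 0 (2 * PI) ccont_F_Cexp Hs ltac:(lra)).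
  assert (Hmono : forall x y, x <= y -> exp x <= exp y).
  { intros x y [Hxy|Hxy]; [left; apply exp_increasing; auto|subst; lra]. }
  assert (G' : bdint (fun w => F (Cexp w)) s1 s2 0 (2 * PI) = RtoC 0).
  { apply G. intros x y Hx Hy. destruct (Hd (Cexp (x, y))) as [l Hl].
    - rewrite Cmod_Cexp. unfold Re; simpl. split; apply Hmono; tauto.
    - eexists. apply cderiv_comp; [apply cderiv_Cexp|apply Hl]. }
  unfold bdint in G'.
  rewrite (CInt_ext _ (fun _ => RtoC 0)) in G' by (intros; rewrite Cexp_2PI; ring).
  rewrite CInt_const in G'.
  rewrite (CInt_ext _ (fun y => F (Cexp (s2, y)) + RtoC (-1) * F (Cexp (s1, y)))%C) in G' by (intros; ring).
  rewrite CInt_plus, CInt_scal in G'; auto using rcont_scal, rcont_circle.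
  fold (Cmean F s1) (Cmean F s2) in G'.
  assert (Hz : (Ci * (Cmean F s2 + RtoC (-1) * Cmean F s1))%C = RtoC 0) by (rewrite <- G'; ring).
  assert (Hz' : (Cmean F s2 + RtoC (-1) * Cmean F s1)%C = RtoC 0).
  { destruct (Ceq_dec (Cmean F s2 + RtoC (-1) * Cmean F s1) 0) as [E|E]; auto.
    exfalso. apply (Cmult_neq_0 Ci _ Ci_nz E). auto. }
  replace (Cmean F s2) with ((Cmean F s2 + RtoC (-1) * Cmean F s1) + Cmean F s1)%C by ring.
  rewrite Hz'. ring.
Qed.

Lemma Cmean_cont (s0 eps : R) : 0 < eps -> exists d, 0 < d /\
  forall s, Rabs (s - s0) < d -> Cmod (Cmean F s - Cmean F s0) <= eps.
Proof.
  intros He. pose proof PI_RGT_0.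
  assert (Hc : forall (part : C -> R), (forall w, Rabs (part w) <= Cmod w) ->
     (forall a b, part (a - b)%C = part a - part b) ->
     exists d : posreal, forall s t, 0 <= t <= 2 * PI -> Rabs (s - s0) < d ->
       Rabs (part (F (Cexp (s, t)) - F (Cexp (s0, t)))%C) < eps / (8 * PI)).
  { intros part Hp1 Hp2.
    assert (He' : 0 < eps / (8 * PI)) by (apply Rdiv_lt_0_compat; lra).
    destruct (uniform_continuity_2d_1d' (fun s t => part (F (Cexp (s, t)))) 0 (2 * PI) s0)
      with (eps := mkposreal _ He') as [d Hd].
    - intros t Ht e. destruct (proj1 (ccont_eps _ _) (ccont_F_Cexp (s0, t)) e (cond_pos e)) as (d & Hd & Hw).
      assert (Hd2 : 0 < d / 2) by lra. exists (mkposreal _ Hd2). simpl. intros u v Hu Hv.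
      rewrite <- Hp2. eapply Rle_lt_trans; [apply Hp1|]. apply Hw.
      eapply Rle_lt_trans; [apply Cmod_pair|]. unfold Rminus in *. simpl. lra.
    - exists d. intros s t Ht Hs. rewrite Hp2. apply Hd; auto.
      + pose proof (cond_pos d). lra.
      + apply Rabs_lt_between in Hs. lra.
      + rewrite Rminus_diag, Rabs_R0. apply cond_pos. }
  destruct (Hc Re re_le_Cmod Re_minus) as [d1 H1]. destruct (Hc Im Im_le_Cmod Im_minus) as [d2 H2].
  exists (Rmin d1 d2). split; [apply Rmin_pos; apply cond_pos|].
  intros s Hs. pose proof (Rmin_l d1 d2). pose proof (Rmin_r d1 d2).
  unfold Cmean.
  replace (CInt (fun t => F (Cexp (s, t))) 0 (2 * PI) - CInt (fun t => F (Cexp (s0, t))) 0 (2 * PI))%C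
    with (CInt (fun t => F (Cexp (s, t)) + RtoC (-1) * F (Cexp (s0, t)))%C 0 (2 * PI)).
  2: { rewrite CInt_plus, CInt_scal; auto using rcont_scal, rcont_circle. ring. }
  replace eps with (2 * ((2 * PI - 0) * (eps / (4 * PI)))) by (field; lra).
  apply CInt_bound; [lra| |].
  - apply rcont_plus; auto using rcont_scal, rcont_circle.
  - intros t Ht. replace (F (Cexp (s, t)) + RtoC (-1) * F (Cexp (s0, t)))%C
      with (F (Cexp (s, t)) - F (Cexp (s0, t)))%C by ring.
    eapply Rle_trans; [apply Cmod_le_ReIm|].
    specialize (H1 s t Ht ltac:(lra)). specialize (H2 s t Ht ltac:(lra)).
    replace (eps / (4 * PI)) with (eps / (8 * PI) + eps / (8 * PI)) by (field; lra). lra.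
Qed.

(** One circle |w| = rho may carry points where F is not differentiable. Goursat makes the mean
    constant on either side of it, and continuity of the mean in s joins the two sides. *)
Lemma Cmean_const (rho : R) :
  (forall w, w <> RtoC 0 -> Cmod w <> rho -> exists l, cderiv F w l) ->
  forall s1 s2, Cmean F s1 = Cmean F s2.
Proof.
  intros Hd.
  assert (Hmono : forall x y, x <= y -> exp x <= exp y).
  { intros x y [Hxy|Hxy]; [left; apply exp_increasing; auto|subst; lra]. }
  assert (Hstrip : forall s1 s2, s1 <= s2 -> (exp s2 < rho \/ rho < exp s1) -> Cmean F s1 = Cmean F s2).
  { intros s1 s2 Hs H. apply Cmean_strip; auto. intros w Hw. apply Hd.
    - apply Cmod_gt_0. pose proof (exp_pos s1). lra.
    - lra. }
  destruct (Rle_dec rho 0) as [Hr|Hr].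
  { assert (A1 : forall s1 s2, s1 <= s2 -> Cmean F s1 = Cmean F s2).
    { intros. apply Hstrip; auto. right. pose proof (exp_pos s1). lra. }
    intros s1 s2. destruct (Rle_dec s1 s2); [apply A1; auto|symmetry; apply A1; lra]. }
  assert (E : exp (ln rho) = rho) by (apply exp_ln; lra).
  assert (H0 : forall s, Cmean F s = Cmean F (ln rho)).
  { intros s. apply Cmod_small_eq. intros eps He.
    destruct (Cmean_cont (ln rho) eps He) as (d & Hdp & Hds).
    destruct (Rtotal_order s (ln rho)) as [Hlt|[Heq|Hgt]].
    - set (s' := Rmax s (ln rho - d / 2)).
      assert (s <= s') by apply Rmax_l. assert (ln rho - d / 2 <= s') by apply Rmax_r.
      assert (s' < ln rho) by (apply Rmax_lub_lt; lra).
      rewrite (Hstrip s s'); auto.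
      + apply Hds. apply Rabs_def1; lra.
      + left. rewrite <- E. apply exp_increasing; auto.
    - subst s. unfold Cminus. rewrite Cplus_opp_r, Cmod_0. lra.
    - set (s' := Rmin s (ln rho + d / 2)).
      assert (s' <= s) by apply Rmin_l. assert (s' <= ln rho + d / 2) by apply Rmin_r.
      assert (ln rho < s') by (apply Rmin_glb_lt; lra).
      rewrite <- (Hstrip s' s); auto.
      + apply Hds. apply Rabs_def1; lra.
      + right. rewrite <- E at 1. apply exp_increasing; auto. }
  intros s1 s2. rewrite (H0 s1), (H0 s2). auto.
Qed.

Lemma Cmean_bound (s M : R) : (forall w, Cmod w = exp s -> Cmod (F w) <= M) ->
  Cmod (Cmean F s) <= 4 * PI * M.
Proof.
  intros H. pose proof PI_RGT_0. unfold Cmean.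
  replace (4 * PI * M) with (2 * ((2 * PI - 0) * M)) by ring.
  apply CInt_bound; [lra|apply rcont_circle|].
  intros t _. apply H. rewrite Cmod_Cexp. auto.
Qed.
End CircleMeans.

Lemma RtoC_neq (x y : R) : x <> y -> RtoC x <> RtoC y.
Proof. intros H E. apply H, RtoC_inj, E. Qed.

Definition moment (g : C -> C) (k : nat) (w : C) : C := (g w * (/ w) ^ k)%C.

Lemma ccont_moment (g : C -> C) (k : nat) (w : C) : w <> RtoC 0 -> ccont g w -> ccont (moment g k) w.
Proof.
  intros Hw Hg. apply ccont_mult; auto.
  destruct (cderiv_pow Cinv w k) as [l Hl]; [eexists; apply cderiv_inv; auto|].
  eapply cderiv_ccont; eauto.
Qed.

Lemma cderiv_moment (g : C -> C) (k : nat) (w : C) : w <> RtoC 0 ->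
  (exists l, cderiv g w l) -> exists l, cderiv (moment g k) w l.
Proof.
  intros Hw [m Hm].
  destruct (cderiv_pow Cinv w k) as [l Hl]; [eexists; apply cderiv_inv; auto|].
  eexists. apply (cderiv_mult g (fun w => (/ w) ^ k)%C); eauto.
Qed.

Lemma Cmod_moment (g : C -> C) (k : nat) (w : C) (r M : R) : 0 < r -> Cmod w = r ->
  Cmod (g w) <= M -> Cmod (moment g k w) <= M / r ^ k.
Proof.
  intros Hr Hw HM. assert (w <> RtoC 0) by (apply Cmod_gt_0; lra).
  unfold moment. rewrite Cmod_mult, Cmod_pow, Cmod_inv by auto. rewrite Hw, pow_inv.
  apply Rmult_le_compat_r; auto. left. apply Rinv_0_lt_compat, pow_lt; auto.
Qed.

Lemma Cmean_moment_const (f : C -> C) (k : nat) : entire f ->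
  forall s1 s2, Cmean (moment f k) s1 = Cmean (moment f k) s2.
Proof.
  intros Hf. apply Cmean_const with 0.
  - intros w Hw. apply ccont_moment; auto. destruct (entire_cderiv f w Hf). eapply cderiv_ccont; eauto.
  - intros w Hw _. apply cderiv_moment; auto. apply entire_cderiv; auto.
Qed.

(** Cauchy's coefficient integral on the unit circle. Independence of the radius then yields the
    coefficient estimate on every circle. *)
Definition tcoef (f : C -> C) (k : nat) : C := (RtoC (/ (2 * PI)) * Cmean (moment f k) 0)%C.

Lemma entire_ccont (f : C -> C) (w : C) : entire f -> ccont f w.
Proof. intros Hf. destruct (entire_cderiv f w Hf). eapply cderiv_ccont; eauto. Qed.

Lemma tcoef_bound (f : C -> C) (k : nat) (r M : R) : entire f -> 0 < r ->
  (forall w, Cmod w = r -> Cmod (f w) <= M) -> Cmod (tcoef f k) * r ^ k <= 2 * M.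
Proof.
  intros Hf Hr HM. pose proof PI_RGT_0. unfold tcoef. rewrite Cmod_mult, Cmod_RtoC_nonneg.
  2: { left. apply Rinv_0_lt_compat; lra. }
  rewrite (Cmean_moment_const f k Hf 0 (ln r)).
  assert (B : Cmod (Cmean (moment f k) (ln r)) <= 4 * PI * (M / r ^ k)).
  { apply Cmean_bound.
    - intros w Hw. apply ccont_moment; auto. apply entire_ccont; auto.
    - intros w Hw. rewrite exp_ln in Hw by auto. apply Cmod_moment; auto. }
  assert (Hp : 0 < r ^ k) by (apply pow_lt; auto).
  apply Rle_trans with (/ (2 * PI) * (4 * PI * (M / r ^ k)) * r ^ k).
  - apply Rmult_le_compat_r; [lra|]. apply Rmult_le_compat_l; auto. left. apply Rinv_0_lt_compat; lra.
  - right. field. lra.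
Qed.

Lemma circle_bounded (f : C -> C) (r : R) : 0 < r -> (forall w, ccont f w) ->
  exists M, forall w, Cmod w = r -> Cmod (f w) <= M.
Proof.
  intros Hr Hf.
  assert (Hc : rcont (fun t => f (Cexp (ln r, t)))) by (apply rcont_circle; auto).
  destruct (bounded_continuity (fun t => Re (f (Cexp (ln r, t)))) (- PI) PI) as [M1 H1].
  { intros x _. apply (rcont_Re _ x Hc). }
  destruct (bounded_continuity (fun t => Im (f (Cexp (ln r, t)))) (- PI) PI) as [M2 H2].
  { intros x _. apply (rcont_Im _ x Hc). }
  exists (M1 + M2). intros w Hw.
  (* The angle is acos (Re w / r) or its opposite, according to the sign of Im w; this exhibits the
     circle as an image of the compact interval [-PI, PI]. *)
  assert (Hpol : exists t, - PI <= t <= PI /\ w = Cexp (ln r, t)).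
  { pose proof PI_RGT_0.
    assert (Hx : -1 <= Re w / r <= 1).
    { pose proof (re_le_Cmod w) as HR. rewrite Hw in HR. apply Rabs_le_between in HR.
      split; apply Rmult_le_reg_r with r; auto; unfold Rdiv; rewrite Rmult_assoc, Rinv_l; lra. }
    assert (Hsq : Re w ^ 2 + Im w ^ 2 = r ^ 2) by (rewrite <- Hw, Cmod_sqr; auto).
    pose proof (acos_bound (Re w / r)) as Hb.
    assert (Hs : r * sin (acos (Re w / r)) = Rabs (Im w)).
    { rewrite sin_acos by auto.
      replace r with (sqrt (r ^ 2)) at 1 by (apply sqrt_pow2; lra).
      rewrite <- sqrt_mult_alt by apply pow2_ge_0.
      replace (r ^ 2 * (1 - (Re w / r)²)) with (Im w ^ 2).
      - rewrite <- pow2_abs. apply sqrt_pow2, Rabs_pos.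
      - unfold Rsqr. field_simplify; [|lra]. lra. }
    assert (Hcos : r * cos (acos (Re w / r)) = Re w) by (rewrite cos_acos by auto; field; lra).
    destruct (Rle_dec 0 (Im w)) as [Hi|Hi].
    - exists (acos (Re w / r)). split; [lra|].
      unfold Cexp. simpl. rewrite exp_ln by auto. rewrite Hcos, Hs, Rabs_right by lra.
      destruct w; auto.
    - exists (- acos (Re w / r)). split; [lra|].
      unfold Cexp. simpl. rewrite exp_ln, cos_neg, sin_neg by auto.
      rewrite Hcos. replace (r * - sin (acos (Re w / r))) with (- (r * sin (acos (Re w / r)))) by ring.
      rewrite Hs, Rabs_left by lra. rewrite Ropp_involutive. destruct w; auto. }
  destruct Hpol as (t & Ht & ->).
  eapply Rle_trans; [apply Cmod_le_ReIm|].
  specialize (H1 t Ht). specialize (H2 t Ht). unfold norm in *; simpl in *. unfold abs in *; simpl in *. lra.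
Qed.

Lemma tcoef_fastc (f : C -> C) : entire f -> fastc (tcoef f).
Proof.
  intros Hf r Hr. destruct (circle_bounded f r Hr) as [M HM].
  - intros; apply entire_ccont; auto.
  - exists (2 * M). intros k. apply tcoef_bound; auto.
Qed.

(** For positive k no integral is computed: the mean does not depend on the radius r and is at most
    4 PI / r for r >= 1, so it vanishes. *)
Lemma Cmean_moment_one (k : nat) (s : R) :
  Cmean (moment (fun _ => RtoC 1) k) s = match k with O => RtoC (2 * PI) | _ => RtoC 0 end.
Proof.
  destruct k as [|k].
  - unfold Cmean, moment. rewrite (CInt_ext _ (fun _ => RtoC 1)) by (intros; simpl; ring).
    rewrite CInt_const. rewrite Rminus_0_r. ring.
  - assert (He : entire (fun _ => RtoC 1)).
    { apply cderiv_entire. intros; eexists; apply cderiv_const. }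
    pose proof PI_RGT_0.
    apply Cmod_small_eq. intros eps Heps.
    replace (Cmean (moment (fun _ => RtoC 1) (S k)) s - 0)%C
      with (Cmean (moment (fun _ => RtoC 1) (S k)) s) by ring.
    set (r := Rmax 1 (4 * PI / eps)).
    assert (Hr1 : 1 <= r) by apply Rmax_l. assert (Hr2 : 4 * PI / eps <= r) by apply Rmax_r.
    rewrite (Cmean_moment_const _ (S k) He s (ln r)).
    eapply Rle_trans.
    + apply Cmean_bound with (M := / r).
      * intros w Hw. apply ccont_moment; auto. apply ccont_const.
      * intros w Hw. rewrite exp_ln in Hw by lra.
        eapply Rle_trans; [apply Cmod_moment with (r := r) (M := 1); auto; [lra|rewrite Cmod_1; lra]|].
        unfold Rdiv. rewrite Rmult_1_l. apply Rinv_le_contravar; [lra|].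
        simpl. assert (1 <= r ^ k) by (apply pow_R1_Rle; auto). nra.
    + apply Rmult_le_reg_r with r; [lra|]. rewrite Rmult_assoc, Rinv_l, Rmult_1_r by lra.
      replace (4 * PI) with (eps * (4 * PI / eps)) by (field; lra).
      apply Rmult_le_compat_l; lra.
Qed.

Section Taylor.
Variable f : C -> C.
Variable z0 : C.
Hypothesis Hf : entire f.

(** Write f w = f z0 + g w (w - z0) and h w = g w w. With I k the k-th moment of h, the k-th moment
    of f is f z0 times that of 1, plus I k - z0 I (k + 1). Weighted with powers of z0 these
    telescope, leaving z0^(n + 2) I (n + 2). *)
Lemma taylor_remainder : exists K s : R, 0 <= K /\ Cmod z0 <= exp s / 2 /\
  forall n, Cmod (Cmean (moment f O) s - RtoC (2 * PI) * f z0 +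
     sum_n (fun k => z0 ^ (S k) * Cmean (moment f (S k)) s)%C n) <= K / 2 ^ n.
Proof.
  destruct (cderiv_quotient f z0 Hf) as (g & Hg & Hgc & Hgd).
  (* This radius makes |z0| / r at most 1/2, whence the geometric remainder. *)
  set (r := 2 * Cmod z0 + 1). pose proof (Cmod_ge_0 z0).
  assert (Hr : 0 < r) by (unfold r; lra).
  set (h := fun w => (g w * w)%C).
  assert (Hhc : forall w, ccont h w).
  { intros w. apply ccont_mult; auto. apply cderiv_ccont with (RtoC 1).
    apply cderiv_local with (fun w => 1 * w + 0)%C 1; [lra| |apply cderiv_affine]. intros; ring. }
  set (I := fun k => Cmean (moment h k) (ln r)).
  assert (Hrc : forall k, rcont (fun t => moment h k (Cexp (ln r, t)))).
  { intros k. apply rcont_circle. intros; apply ccont_moment; auto. }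
  (* The mean of h is the same on all circles, and on small ones it is small, because h is
     continuous with h 0 = 0. The exceptional circle is the one through z0. *)
  assert (Hzero : I O = RtoC 0).
  { assert (Hcst : forall s1 s2, Cmean h s1 = Cmean h s2).
    { apply Cmean_const with (Cmod z0); auto. intros w Hw Hw'.
      destruct (Hgd w) as [m Hm]; [intros E; subst; auto|].
      eexists. apply cderiv_mult; [apply Hm|].
      apply cderiv_local with (fun w => 1 * w + 0)%C 1; [lra| |apply cderiv_affine]. intros; ring. }
    unfold I, Cmean, moment. rewrite (CInt_ext _ (fun t => h (Cexp (ln r, t)))) by (intros; simpl; ring).
    apply Cmod_small_eq. intros eps Heps.
    change (Cmod (Cmean h (ln r) - 0) <= eps).
    replace (Cmean h (ln r) - 0)%C with (Cmean h (ln r)) by ring.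
    destruct (proj1 (ccont_eps _ _) (Hhc 0) (eps / (4 * PI))) as (d & Hd & Hw).
    { pose proof PI_RGT_0. apply Rdiv_lt_0_compat; lra. }
    rewrite (Hcst (ln r) (ln (d / 2))). pose proof PI_RGT_0.
    replace eps with (4 * PI * (eps / (4 * PI))) by (field; lra).
    apply Cmean_bound; auto. intros w Ew. rewrite exp_ln in Ew by lra.
    specialize (Hw w). replace (w - 0)%C with w in Hw by ring.
    replace (h w - h 0)%C with (h w) in Hw by (unfold h; ring). left; apply Hw; lra. }
  destruct (circle_bounded h r Hr Hhc) as [M HM].
  exists (4 * PI * Rabs M), (ln r). rewrite exp_ln by auto.
  split; [pose proof PI_RGT_0; apply Rmult_le_pos; [lra|apply Rabs_pos]|].
  split; [unfold r; lra|].
  assert (Hrec : forall k, Cmean (moment f k) (ln r) = (f z0 * Cmean (moment (fun _ => RtoC 1) k) (ln r) + I k - z0 * I (S k))%C).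
  { intros k. unfold I, Cmean.
    assert (R1 : rcont (fun t => moment (fun _ => RtoC 1) k (Cexp (ln r, t)))).
    { apply rcont_circle. intros; apply ccont_moment; auto. apply ccont_const. }
    replace (f z0 * CInt (fun t => moment (fun _ => RtoC 1) k (Cexp (ln r, t))) 0 (2 * PI) +
      CInt (fun t => moment h k (Cexp (ln r, t))) 0 (2 * PI) -
      z0 * CInt (fun t => moment h (S k) (Cexp (ln r, t))) 0 (2 * PI))%C with
      (f z0 * CInt (fun t => moment (fun _ => RtoC 1) k (Cexp (ln r, t))) 0 (2 * PI) +
      (CInt (fun t => moment h k (Cexp (ln r, t))) 0 (2 * PI) +
      (- z0) * CInt (fun t => moment h (S k) (Cexp (ln r, t))) 0 (2 * PI)))%C by ring.
    rewrite <- !CInt_scal by auto.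
    rewrite <- CInt_plus by (auto using rcont_scal).
    rewrite <- CInt_plus by (auto using rcont_scal, rcont_plus).
    apply CInt_ext. intros t. unfold moment, h.
    set (w := Cexp (ln r, t)). assert (w <> RtoC 0) by apply Cexp_neq_0.
    rewrite (Hg w). simpl Cpow. field. auto. }
  assert (Htel : forall n, (Cmean (moment f O) (ln r) - RtoC (2 * PI) * f z0 +
     sum_n (fun k => z0 ^ (S k) * Cmean (moment f (S k)) (ln r)) n)%C
     = (- (z0 ^ (S (S n)) * I (S (S n))))%C).
  { induction n as [|n IH].
    - rewrite sum_O. rewrite !Hrec, !Cmean_moment_one, Hzero. simpl Cpow. ring.
    - rewrite sum_Sn. unfold plus; simpl AbelianMonoid.plus.
      change (Cmean (moment f 0) (ln r) - RtoC (2 * PI) * f z0 +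
        ((sum_n (fun k => z0 ^ S k * Cmean (moment f (S k)) (ln r)) n) +
         z0 ^ S (S n) * Cmean (moment f (S (S n))) (ln r)) = - (z0 ^ S (S (S n)) * I (S (S (S n)))))%C.
      rewrite Cplus_assoc, IH, Hrec, Cmean_moment_one. simpl Cpow. ring. }
  intros n. rewrite Htel, Cmod_opp, Cmod_mult, Cmod_pow. pose proof PI_RGT_0.
  assert (HI : Cmod (I (S (S n))) <= 4 * PI * (Rabs M / r ^ (S (S n)))).
  { unfold I. apply (Cmean_bound (moment h (S (S n)))); [intros; apply ccont_moment; auto|].
    intros w Hw. rewrite exp_ln in Hw by auto. apply Cmod_moment; auto.
    eapply Rle_trans; [apply HM; auto|apply Rle_abs]. }
  assert (Hz : Cmod z0 ^ (S (S n)) <= (r / 2) ^ (S (S n))) by (apply pow_incr; unfold r; lra).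
  assert (Hp : 0 < r ^ S (S n)) by (apply pow_lt; auto).
  assert (Hp2 : 0 < 2 ^ n) by (apply pow_lt; lra).
  assert (0 <= Cmod z0 ^ S (S n)) by (apply pow_le; auto).
  eapply Rle_trans; [apply Rmult_le_compat; [auto|apply Cmod_ge_0|apply Hz|apply HI]|].
  unfold Rdiv at 1. rewrite Rpow_mult_distr, pow_inv.
  replace (r ^ S (S n) * / 2 ^ S (S n) * (4 * PI * (Rabs M / r ^ S (S n))))
    with (4 * PI * Rabs M * / 2 ^ n * / 4) by (simpl pow; field; repeat split; try lra; apply pow_nonzero; lra).
  unfold Rdiv. assert (0 <= 4 * PI * Rabs M * / 2 ^ n); [|lra].
  apply Rmult_le_pos; [|left; apply Rinv_0_lt_compat; auto].
  apply Rmult_le_pos; [lra|apply Rabs_pos].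
Qed.

Lemma clim_sum_Cser (a : nat -> C) : asum a -> clim eventually (fun n => sum_n a n) (Cser a).
Proof.
  intros Ha. assert (E : forall n, (sum_n a n = Cser a - Cser (fun k => a (S n + k)%nat))%C).
  { induction n as [|n IH].
    - rewrite sum_O, (Cser_incr a Ha). simpl. ring.
    - rewrite sum_Sn. change (sum_n a n + a (S n) = Cser a - Cser (fun k => a (S (S n) + k)%nat))%C.
      rewrite IH. rewrite (Cser_incr (fun k => a (S n + k)%nat)) by (apply asum_incr_n; auto).
      rewrite Nat.add_0_r. rewrite (Cser_ext (fun k => a (S n + S k)%nat) (fun k => a (S (S n) + k)%nat)).
      + ring.
      + intros; f_equal; lia. }
  pose proof (Series_correct _ Ha) as HS.
  assert (HS' : is_lim_seq (sum_n (fun k => Cmod (a k))) (Series (fun k => Cmod (a k)))) by exact HS.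
  apply is_lim_seq_spec in HS'. intros eps He. destruct (HS' (mkposreal eps He)) as [N HN].
  exists N. intros n Hn. specialize (HN n Hn). simpl in HN.
  rewrite E. replace (Cser a - Cser (fun k => a (S n + k)%nat) - Cser a)%C with (- Cser (fun k => a (S n + k)%nat))%C by ring.
  rewrite Cmod_opp. eapply Rle_lt_trans; [apply Cser_mod, asum_incr_n; auto|].
  rewrite (Series_incr_n (fun k => Cmod (a k)) (S n)) in HN by (auto; lia). simpl pred in HN.
  rewrite <- sum_n_Reals in HN. set (X := Series (fun k => Cmod (a (S n + k)%nat))) in *.
  replace (sum_n (fun k => Cmod (a k)) n - (sum_n (fun k => Cmod (a k)) n + X)) with (- X) in HN by ring.
  rewrite Rabs_Ropp in HN. pose proof (Rle_abs X). lra.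
Qed.

Lemma taylor_point : f z0 = cps (tcoef f) z0.
Proof.
  destruct taylor_remainder as (K & s & HK & Hs & HR).
  pose proof PI_RGT_0.
  set (a := fun k => (z0 ^ S k * Cmean (moment f (S k)) s)%C).
  pose proof (tcoef_fastc f Hf) as Hfast.
  assert (Ea : forall k, a k = (RtoC (2 * PI) * (tcoef f (S k) * z0 ^ S k))%C).
  { intros k. unfold a, tcoef. rewrite (Cmean_moment_const f (S k) Hf s 0).
    rewrite RtoC_inv by lra. field. apply RtoC_neq. lra. }
  pose proof (asum_incr _ (cps_asum _ z0 Hfast)) as A1. simpl in A1.
  assert (Ha : asum a).
  { eapply asum_ext; [intros; symmetry; apply Ea|]. apply asum_scal. apply A1. }
  assert (L1 : clim eventually (fun n => (Cmean (moment f O) s - RtoC (2 * PI) * f z0 + sum_n a n)%C)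
     (Cmean (moment f O) s - RtoC (2 * PI) * f z0 + Cser a)%C).
  { apply (clim_plus eventually); [apply clim_const; apply eventually_filter|apply clim_sum_Cser; auto]. }
  assert (L2 : clim eventually (fun n => (Cmean (moment f O) s - RtoC (2 * PI) * f z0 + sum_n a n)%C) 0).
  { intros eps He. destruct (pow2_large K eps He) as [N HN]. exists N. intros n Hn.
    cbv beta. match goal with |- Cmod (?u - _)%C < _ => replace (u - 0)%C with u by ring end.
    eapply Rle_lt_trans; [apply HR|]. eapply Rle_lt_trans; [|apply HN].
    apply Rmult_le_compat_l; auto. apply Rinv_le_contravar; [apply pow_lt; lra|]. apply Rle_pow; [lra|auto]. }
  pose proof (clim_unique eventually _ _ _ L1 L2) as E.
  unfold cps. rewrite Cser_incr by (apply cps_asum; auto).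
  rewrite (Cser_ext a (fun k => RtoC (2 * PI) * (tcoef f (S k) * z0 ^ S k))%C Ea) in E.
  rewrite Cser_scal in E by exact A1.
  assert (E0 : Cmean (moment f O) s = (RtoC (2 * PI) * tcoef f O)%C).
  { unfold tcoef. rewrite (Cmean_moment_const f O Hf s 0). rewrite RtoC_inv by lra. field. apply RtoC_neq; lra. }
  rewrite E0 in E.
  set (X := Cser (fun k => (tcoef f (S k) * z0 ^ S k)%C)) in *.
  assert (Hn : RtoC (2 * PI) <> RtoC 0) by (apply RtoC_neq; lra).
  replace (f z0) with (RtoC (2 * PI) * tcoef f 0%nat - (RtoC (2 * PI) * tcoef f 0%nat -
     RtoC (2 * PI) * f z0 + RtoC (2 * PI) * X) + RtoC (2 * PI) * X - RtoC (2 * PI) * f z0 + f z0)%C by ring.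
  rewrite E.
  assert (E2 : (RtoC (2 * PI) * (tcoef f 0%nat + X - f z0))%C = RtoC 0) by (rewrite <- E; ring).
  assert (E3 : (tcoef f 0%nat + X - f z0)%C = RtoC 0).
  { destruct (Ceq_dec (tcoef f 0%nat + X - f z0) 0) as [e|e]; auto.
    exfalso. apply (Cmult_neq_0 _ _ Hn e). auto. }
  simpl Cpow. apply Ceq_minus in E3. rewrite <- E3. ring.
Qed.
End Taylor.

Theorem entire_taylor (f : C -> C) : entire f -> fastc (tcoef f) /\ f = cps (tcoef f).
Proof.
  intros Hf. split; [apply tcoef_fastc; auto|]. apply functional_extensionality. intros z. apply taylor_point; auto.
Qed.

Lemma cps_inj (c d : nat -> C) : fastc c -> fastc d -> cps c = cps d -> forall k, c k = d k.
Proof.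
  intros Hc Hd E k.
  assert (E' : C_derive_n (cps c) k (RtoC 0) = C_derive_n (cps d) k (RtoC 0)) by (rewrite E; auto).
  rewrite !C_derive_n_cps_0 in E' by auto.
  assert (Hn : RtoC (INR (fact k)) <> RtoC 0) by (apply RtoC_neq, INR_fact_neq_0).
  replace (c k) with (/ RtoC (INR (fact k)) * (RtoC (INR (fact k)) * c k))%C by (field; auto).
  rewrite E'. field; auto.
Qed.

Lemma cps_cauchy (c : nat -> C) (k : nat) (r M : R) : fastc c -> 0 < r ->
  (forall w, Cmod w = r -> Cmod (cps c w) <= M) -> Cmod (c k) * r ^ k <= 2 * M.
Proof.
  intros Hc Hr HM. pose proof (cps_entire c Hc) as He.
  destruct (entire_taylor _ He) as [H1 H2].
  rewrite (cps_inj c (tcoef (cps c)) Hc H1 H2 k). apply tcoef_bound; auto.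
Qed.

(* Coefficients of the product of the factors [1 + g X], [g] in [l]. *)
Fixpoint ecoef (l : list R) (k : nat) : R :=
  match l with
  | nil => match k with O => 1 | S _ => 0 end
  | cons g l => ecoef l k + g * match k with O => 0 | S k' => ecoef l k' end
  end.

(** * Preservation of simple negative zeros *)

Module PolyRoots.
Set Implicit Arguments.
Unset Strict Implicit.
Import all_boot all_order all_algebra polyrcf Rstruct ring lra zify.
Import Order.TTheory GRing.Theory Num.Theory.
Local Open Scope ring_scope.

Section Generic.
Variable K : rcfType.
Implicit Types (rs : seq K) (x s th : K).

Definition rpoly rs : {poly K} := \prod_(r <- rs) ('X - r%:P).

Lemma seq_choice n (P : nat -> K -> Prop) : (forall i, (i < n)%N -> exists x, P i x) ->
  exists2 t : seq K, size t = n & forall i, (i < n)%N -> P i (nth 0 t i).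
Proof.
elim: n => [|n IHn] H; first by exists [::].
have [i lt_in|t szt Ht] := IHn; first by apply: H; apply: ltnW.
have [x Px] := H n (ltnSn n).
exists (rcons t x); first by rewrite size_rcons szt.
move=> i; rewrite ltnS leq_eqVlt => /orP[/eqP->|lt_in].
  by rewrite nth_rcons szt ltnn eqxx.
by rewrite nth_rcons szt lt_in; apply: Ht.
Qed.

Lemma rpoly_sign rs i x :
  (forall j, (j < i)%N -> (j < size rs)%N -> nth 0 rs j < x) ->
  (forall j, (i <= j)%N -> (j < size rs)%N -> x < nth 0 rs j) ->
  0 < (-1) ^+ (size rs - i) * (rpoly rs).[x].
Proof.
rewrite /rpoly; elim: rs i => [|r rs IHrs] i Hlt Hgt.
  by rewrite big_nil hornerC mulr1 sub0n expr0 ltr01.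
rewrite big_cons hornerM hornerXsubC; case: i Hlt Hgt => [|i] Hlt Hgt.
  have := Hgt 0%N isT isT; rewrite /= => xr.
  have := IHrs 0%N; rewrite subn0 => H.
  have {}H : 0 < (-1) ^+ size rs * (\prod_(r0 <- rs) ('X - r0%:P)).[x].
    by apply: H => // j _ lj; apply: (Hgt j.+1).
  rewrite subn0 /= [X in 0 < X](_ : _ =
    (r - x) * ((-1) ^+ size rs * (\prod_(j <- rs) ('X - j%:P)).[x])).
    by rewrite mulr_gt0 // subr_gt0.
  by rewrite exprS; ring.
have := Hlt 0%N isT isT; rewrite /= => rx; rewrite subSS mulrCA mulr_gt0 ?subr_gt0 //.
apply: IHrs => j lji lj; first by apply: (Hlt j.+1).
by apply: (Hgt j.+1).
Qed.

(** Logarithmic differentiation: with u = sum 1 / (x - r) and v = sum 1 / (x - r)^2 one has P' = P u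
    and P'' = P (u^2 - v). At a critical point off the zeros u = 0, hence P'' = - P v. *)
Lemma rpoly_derivs rs x : x \notin rs ->
  (rpoly rs)^`().[x] = (rpoly rs).[x] * \sum_(r <- rs) (x - r)^-1 /\
  (rpoly rs)^`()^`().[x] = (rpoly rs).[x] *
     ((\sum_(r <- rs) (x - r)^-1) ^+ 2 - \sum_(r <- rs) (x - r)^-1 ^+ 2).
Proof.
rewrite /rpoly; elim: rs => [|r rs IHrs].
  by rewrite !big_nil derivC horner0 deriv0 horner0 expr2 !mulr0 subr0 mulr0.
rewrite inE negb_or => /andP[xr /IHrs[]]; rewrite !big_cons.
set P := \prod_(j <- rs) _; set u := \sum_(j <- rs) _; set v := \sum_(j <- rs) _ ^+ 2.
move=> E1 E2; have d0 : x - r != 0 by rewrite subr_eq0.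
rewrite derivM derivXsubC mul1r derivD derivM derivXsubC mul1r !(hornerXsubC, hornerM, hornerD) E1 E2.
have F1 (p d : K) : d != 0 -> p + d * (p * u) = d * p * (d^-1 + u) by move=> ?; field.
have F2 (p d : K) : d != 0 -> p * u + (p * u + d * (p * (u ^+ 2 - v))) =
  d * p * ((d^-1 + u) ^+ 2 - (d^-1 ^+ 2 + v)) by move=> ?; field.
by split; [exact: F1|exact: F2].
Qed.

(** One explicit Euler step of length [s] for Delta_th, on polynomials. *)
Definition heat s th (p : {poly K}) : {poly K} :=
  p + s *: (th *: p^`() + 'X * p^`()^`()).

(* At a critical point [x < 0] one has [p p'' <= 0] by [rpoly_derivs], so [p] and
   its image have the same sign there; between consecutive critical points this
   yields a zero of the image. *)
Lemma heat_sign rs s th x : 0 <= s -> 0 <= th -> x \notin rs ->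
  (x < 0 /\ (rpoly rs)^`().[x] = 0) \/ (x = 0 /\ all (fun r => r < 0) rs) ->
  exists2 k, 0 < k & (heat s th (rpoly rs)).[x] = (rpoly rs).[x] * k.
Proof.
move=> s0 th0 xrs Hx; have [E1 E2] := rpoly_derivs xrs.
case: Hx => [[x0 D0]|[x0 neg]].
  exists (1 + s * (- x * \sum_(r <- rs) (x - r)^-1 ^+ 2)).
    apply: ltr_pwDl; first exact: ltr01.
    apply: mulr_ge0 => //; apply: mulr_ge0; first by rewrite oppr_ge0 ltW.
    by apply: sumr_ge0 => r _; exact: sqr_ge0.
  rewrite /heat !(hornerX, hornerZ, hornerM, hornerD) D0.
  have F (p u v : K) : p * u = 0 ->
      p + s * (th * 0 + x * (p * (u ^+ 2 - v))) = p * (1 + s * (- x * v)).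
    have -> : p + s * (th * 0 + x * (p * (u ^+ 2 - v))) =
      s * x * u * (p * u) + p * (1 + s * (- x * v)) by ring.
    by move=> ->; rewrite mulr0 add0r.
  by rewrite E2; apply: F; rewrite -E1.
(* At x = 0 the second-order term drops out, and P' / P is a sum of positive terms, all zeros being
   negative. *)
exists (1 + s * (th * \sum_(r <- rs) (x - r)^-1)).
  apply: ltr_pwDl; first exact: ltr01.
  apply: mulr_ge0 => //; apply: mulr_ge0 => //.
  rewrite big_seq; apply: sumr_ge0 => r rrs; rewrite invr_ge0 x0 sub0r oppr_ge0 ltW //.
  by move/allP: neg; apply.
rewrite /heat !(hornerX, hornerZ, hornerM, hornerD) E1.
have F (p u w : K) : p + s * (th * (p * u) + x * w) = p * (1 + s * (th * u)).
  by rewrite x0; ring.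
exact: F.
Qed.

(** Delta_th lowers the degree, so a step keeps degree and leading coefficient; this fixes the
    number of zeros to be found. *)
Lemma heat_monic rs s th : size (heat s th (rpoly rs)) = (size rs).+1 /\
  heat s th (rpoly rs) \is monic.
Proof.
have szP : size (rpoly rs) = (size rs).+1 by rewrite size_prod_XsubC.
have lt1 : (size (s *: (th *: (rpoly rs)^`() + 'X * (rpoly rs)^`()^`())) < size (rpoly rs))%N.
  rewrite (leq_ltn_trans (size_scale_leq _ _)) //.
  have sz1 : (size (rpoly rs)^`() <= size rs)%N.
    have P0 : rpoly rs != 0 by rewrite -size_poly_gt0 szP.
    by rewrite -ltnS -szP lt_size_deriv.
  rewrite (leq_ltn_trans (size_polyD _ _)) // gtn_max szP !ltnS.
  rewrite (leq_trans (size_scale_leq _ _)) //=.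
  have [->|D0] := eqVneq (rpoly rs)^`() 0; first by rewrite deriv0 mulr0 size_poly0.
  have := lt_size_deriv D0; set q := _^`()^`() => ltq.
  have [->|q0] := eqVneq q 0; first by rewrite mulr0 size_poly0.
  by rewrite mulrC size_mulX // (leq_trans ltq).
split; first by rewrite /heat size_polyDl.
by rewrite monicE /heat lead_coefDl // lead_coef_prod_XsubC.
Qed.

(** Replacing X by -X and normalising the sign gives leading coefficient 1, so the behaviour at
    minus infinity follows from that at plus infinity. *)
Lemma heat_minfty rs s th : exists M, forall x, x <= M ->
  0 < (-1) ^+ size rs * (heat s th (rpoly rs)).[x].
Proof.
have [sz mon] := heat_monic rs s th; set F := heat _ _ _ in sz mon *.
pose G := (-1) ^+ size rs *: (F \Po (- 'X)).
have lcG : lead_coef G = 1.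
  rewrite /G lead_coefZ lead_coef_comp ?size_polyN ?size_polyX // (monicP mon) sz /=.
  by rewrite lead_coefN lead_coefX mul1r -exprMn mulrNN mulr1 expr1n.
have [|M HM] := @poly_pinfty_gt_lc K G; first by rewrite lcG ltr01.
exists (- M) => x xM; have := HM (- x); rewrite lerNr => /(_ xM).
rewrite lcG /G hornerZ horner_comp hornerN hornerX opprK.
by apply: lt_le_trans; rewrite ltr01.
Qed.

Theorem heat_real_rooted rs s th : sorted <%R rs -> all (fun r => r < 0) rs ->
  0 <= s -> 0 <= th ->
  exists rs', [/\ sorted <%R rs', all (fun r => r < 0) rs' & heat s th (rpoly rs) = rpoly rs'].
Proof.
move=> srt neg s0 th0; set F := heat _ _ _; set n := size rs.
have nthlt i j : (i < j)%N -> (j < n)%N -> nth 0 rs i < nth 0 rs j.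
  move=> ij jn; rewrite (sorted_ltn_nth lt_trans) // ?inE //; exact: ltn_trans ij jn.
have nthneg i : (i < n)%N -> nth 0 rs i < 0.
  by move=> ilt; move/allP: neg; apply; rewrite mem_nth.
have notin x i : (forall j, (j < i)%N -> (j < n)%N -> nth 0 rs j < x) ->
  (forall j, (i <= j)%N -> (j < n)%N -> x < nth 0 rs j) -> x \notin rs.
  move=> H1 H2; apply/negP => /(nthP 0)[j jn xE]; have [ji|ij] := ltnP j i.
    by have := H1 j ji jn; rewrite xE ltxx.
  by have := H2 j ij jn; rewrite xE ltxx.
(* The n + 1 sample points are a point far to the left, a critical point in each gap between
   consecutive zeros, and 0. The signs of F alternate along them, which produces n zeros, one in
   each gap. *)
have Hc i : (i < n.+1)%N -> exists x,
  [/\ (0 < i)%N -> nth 0 rs i.-1 < x, (i < n)%N -> x < nth 0 rs i, x <= 0 &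
      0 < (-1) ^+ (n - i) * F.[x]].
  rewrite ltnS leq_eqVlt => /orP[/eqP->|lt_in].
    exists 0; split; rewrite ?ltnn //.
      by move=> n0; apply: nthneg; rewrite prednK.
    have H1 : forall j, (j < n)%N -> (j < n)%N -> nth 0 rs j < 0 by move=> j _; exact: nthneg.
    have H2 : forall j, (n <= j)%N -> (j < n)%N -> 0 < nth 0 rs j.
      by move=> j nj jn; rewrite leqNgt jn in nj.
    have [k k0 ->] := heat_sign s0 th0 (notin _ _ H1 H2) (or_intror (conj erefl neg)).
    by rewrite mulrA mulr_gt0 //; apply: rpoly_sign.
  case: i lt_in => [|i] lt_in.
    have [M HM] := heat_minfty rs s th.
    exists (Order.min M (nth 0 rs 0 - 1)); split => //.
      by move=> _; rewrite gt_min ltrBlDr ltrDl ltr01 orbT.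
      by rewrite ge_min lerBlDr (le_trans (ltW (nthneg _ lt_in))) ?orbT // addr_ge0 // ler01.
    by rewrite subn0; apply: HM; rewrite ge_min lexx.
  have [||c cin c0] := @rolle K (nth 0 rs i) (nth 0 rs i.+1) (rpoly rs).
  - exact: nthlt.
  - have rt j : (j < n)%N -> (rpoly rs).[nth 0 rs j] = 0.
      by move=> jn; apply/eqP; rewrite -/(root _ _) root_prod_XsubC mem_nth.
    by rewrite !rt // ltnW.
  move: cin; rewrite in_itv /= => /andP[ic ci].
  have H1 j : (j < i.+1)%N -> (j < n)%N -> nth 0 rs j < c.
    rewrite ltnS leq_eqVlt => /orP[/eqP->//|ji jn].
    by apply: lt_trans ic; apply: nthlt => //; apply: ltnW.
  have H2 j : (i.+1 <= j)%N -> (j < n)%N -> c < nth 0 rs j.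
    rewrite leq_eqVlt => /orP[/eqP<-//|ji jn].
    by apply: lt_trans ci _; apply: nthlt.
  have cneg : c < 0 by apply: lt_trans ci _; apply: nthneg.
  exists c; split => //; first exact: ltW.
  have [k k0 ->] := heat_sign s0 th0 (notin _ _ H1 H2) (or_introl (conj cneg c0)).
  by rewrite mulrA mulr_gt0 //; apply: rpoly_sign.
have [t szt Ht] := seq_choice Hc.
have Hr i : (i < n)%N -> exists x, [/\ nth 0 t i < x, x < nth 0 t i.+1 & root F x].
  move=> lt_in; have [_ A2 _ A3] := Ht i (ltnW lt_in : (i < n.+1)%N).
  have [B1 _ _ B3] := Ht i.+1 lt_in.
  have lt1 : nth 0 t i < nth 0 t i.+1 by apply: lt_trans (A2 lt_in) (B1 isT).
  have [|x] := @poly_ivtoo K F (nth 0 t i) (nth 0 t i.+1) (ltW lt1).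
    have E : (n - i)%N = (n - i.+1).+1 by rewrite subnSK.
    move: A3 B3; rewrite E exprS; set e := (-1) ^+ (n - i.+1) => A3 B3.
    have e2 : e ^+ 2 = 1 by rewrite /e sqrr_sign.
    have := mulr_gt0 A3 B3.
    have -> : -1 * e * F.[nth 0 t i] * (e * F.[nth 0 t i.+1]) =
      - (e ^+ 2 * (F.[nth 0 t i] * F.[nth 0 t i.+1])) by ring.
    by rewrite e2 mul1r oppr_gt0.
  by rewrite in_itv /= => /andP[a1 a2] a3; exists x.
have [rs' szr Hr'] := seq_choice Hr.
have srt' : sorted <%R rs'.
  apply/(sortedP 0) => i; rewrite szr => iS.
  have [_ a1 _] := Hr' i (ltnW iS); have [a2 _ _] := Hr' i.+1 iS.
  exact: lt_trans a1 a2.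
have [szF monF] := heat_monic rs s th.
exists rs'; split=> //.
  apply/allP => x /(nthP 0)[i]; rewrite szr => lt_in <-.
  have [_ a1 _] := Hr' i lt_in; apply: lt_le_trans a1 _.
  by have [_ _ C2 _] := Ht i.+1 lt_in.
(* Both polynomials are monic of degree n, so their difference has degree below n but vanishes at n
   distinct points. *)
apply/eqP; rewrite -subr_eq0; apply/eqP; apply: (@roots_geq_poly_eq0 _ _ rs').
- apply/allP => x xin; rewrite /root hornerD hornerN.
  have -> : (rpoly rs').[x] = 0 by apply/eqP; rewrite -/(root _ _) root_prod_XsubC.
  move: xin => /(nthP 0)[i]; rewrite szr => lt_in <-.
  by have [_ _ /eqP->] := Hr' i lt_in; rewrite subr0.
- by apply: lt_sorted_uniq.
rewrite szr; have szP' : size (rpoly rs') = n.+1 by rewrite size_prod_XsubC szr.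
have := size_polyD F (- rpoly rs'); rewrite size_polyN szF szP' maxnn => le1.
rewrite -ltnS ltn_neqAle le1 andbT; apply/eqP => E.
have : lead_coef (F - rpoly rs') = 0.
  rewrite lead_coefE E /= coefB.
  have := monicP monF; rewrite lead_coefE szF /= => ->.
  have : lead_coef (rpoly rs') = 1 by rewrite lead_coef_prod_XsubC.
  by rewrite lead_coefE szP' /= => ->; rewrite subrr.
by move/eqP; rewrite lead_coef_eq0 => /eqP E0; move: E; rewrite E0 size_poly0.
Qed.
End Generic.

(** * Transfer to lists of real parameters *)

Local Notation R := Rdefinitions.R.
Implicit Types (l : seq R).

Definition epoly l : {poly R} := \prod_(g <- l) (1 + g *: 'X).

Lemma coef_epoly l k : (epoly l)`_k = ecoef l k.
Proof.
rewrite /epoly; elim: l k => [|g l IHl] k.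
  by rewrite big_nil coef1; case: k.
rewrite big_cons mulrDl mul1r -scalerAl coefD coefZ coefXM IHl /=.
by case: k => [|k] //=; rewrite IHl.
Qed.

Lemma epoly_rpoly l : all (fun g => 0 < g) l ->
  epoly l = (\prod_(g <- l) g) *: rpoly [seq - g^-1 | g <- l].
Proof.
rewrite /epoly /rpoly big_map; elim: l => [|g l IHl] /=; first by rewrite !big_nil scale1r.
case/andP=> g0 /IHl E; rewrite !big_cons E -scalerAr [g * _]mulrC -scalerA.
congr (_ *: _); rewrite scalerAl; congr (_ * _).
by rewrite polyCN opprK scalerDr -mul_polyC -mul_polyC -polyCM mulfV ?gt_eqF // addrC.
Qed.

Lemma NoDup_uniq l : List.NoDup l -> uniq l.
Proof.
elim: l => [|g l IHl] //= H; inversion H as [|g' l' nin nd]; subst.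
rewrite IHl // andbT; apply/negP => gl; apply: nin.
elim: l gl {IHl H nd} => [|h l IHl] //; rewrite inE => /orP[/eqP->|/IHl]; by [left|right].
Qed.

Lemma uniq_NoDup l : uniq l -> List.NoDup l.
Proof.
elim: l => [|g l IHl] /=; first by constructor.
case/andP=> gl /IHl nd; constructor=> //; move: gl; clear.
elim: l => [|h l IHl]; first by move=> _ [].
by rewrite inE negb_or => /andP[gh /IHl ni] [e|//]; rewrite e eqxx in gh.
Qed.

Lemma Forall_all l : List.Forall (Rlt 0) l <-> all (fun g => 0 < g) l.
Proof.
elim: l => [|g l IHl] /=; first by split.
split; first by move=> H; inversion H; subst; apply/andP; split; [apply/RltP|apply/IHl].
by case/andP=> /RltP g0 /IHl; constructor.
Qed.

Lemma nth_nth l j : List.nth j l 0 = nth 0 l j.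
Proof. by elim: l j => [|g l IHl] [|j] //=. Qed.

Lemma coef_heat (s th : R) (p : {poly R}) k :
  (heat s th p)`_k = p`_k + s * ((k%:R + 1) * (k%:R + th) * p`_k.+1).
Proof.
rewrite /heat coefD coefZ coefD coefZ coefXM !coef_deriv.
case: k => [|k] /=; first by rewrite mulr1n; ring.
rewrite -(mulr_natr (_ *+ k.+2)) -(mulr_natr p`_k.+2) -[k.+2%:R]natr1 -[k.+1%:R]natr1.
by ring.
Qed.

(** The factor 1 + g X has the zero -1 / g, and [c] is the quotient of the two products of
    parameters, by which the monic forms differ. The new zeros come in increasing order, as do the
    corresponding g; reversing the list makes it decreasing. *)
Theorem heat_ecoef l (s th : R) : List.NoDup l -> List.Forall (Rlt 0) l ->
  Rle 0 s -> Rle 0 th ->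
  exists l' (c : R), [/\ Rlt 0 c, List.NoDup l', List.Forall (Rlt 0) l',
    forall j, Rle (List.nth (S j) l' 0) (List.nth j l' 0) &
    forall k, Rplus (ecoef l k) (Rmult s (Rmult (Rmult (Rplus (INR k) 1) (Rplus (INR k) th))
       (ecoef l (S k)))) = Rmult c (ecoef l' k)].
Proof.
move=> /NoDup_uniq ul /Forall_all pl /RleP s0 /RleP th0.
set rs := sort <=%R [seq - g^-1 | g <- l].
have prs : perm_eq rs [seq - g^-1 | g <- l] by rewrite perm_sort.
have srt : sorted <%R rs.
  by rewrite sort_lt_sorted map_inj_uniq // => x y /oppr_inj /invr_inj.
have neg : all (fun r => r < 0) rs.
  rewrite (perm_all _ prs) all_map; apply: sub_all pl => g /= g0.
  by rewrite oppr_lt0 invr_gt0.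
have [rs' [srt' neg' E]] := heat_real_rooted srt neg s0 th0.
set l' := rev [seq - r^-1 | r <- rs'].
have pl' : all (fun g => 0 < g) l'.
  rewrite all_rev all_map; apply: sub_all neg' => r /= r0.
  by rewrite oppr_gt0 invr_lt0.
have srtl : sorted <%R [seq - r^-1 | r <- rs'].
  move: srt' neg'; clear; elim: rs' => [|r rs IHrs] //=; case: rs IHrs => [|r' rs] //= IHrs.
  case/andP=> lt1 p /and3P[r0 r'0 neg].
  apply/andP; split; last by apply: IHrs; rewrite //= r'0.
  by rewrite ltrN2 ltf_nV2 ?negrE.
have rl' : rpoly rs' = rpoly [seq - g^-1 | g <- l'].
  rewrite /rpoly /l' map_rev -map_comp.
  rewrite [RHS](perm_big [seq - (- r^-1)^-1 | r <- rs']); last first.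
    by rewrite perm_rev; exact: perm_refl.
  by rewrite big_map; apply: eq_bigr => r _; rewrite invrN invrK opprK.
have pos (t : seq R) : all (fun g => 0 < g) t -> 0 < \prod_(g <- t) g.
  by move=> /allP H; rewrite big_seq; apply: prodr_gt0 => g; apply: H.
exists l', ((\prod_(g <- l) g) / (\prod_(g <- l') g)); split.
- by apply/RltP; rewrite divr_gt0 ?pos.
- apply: uniq_NoDup; rewrite rev_uniq; exact: lt_sorted_uniq.
- by apply/Forall_all.
- move=> j; rewrite !nth_nth; apply/RleP.
  have [lt_j|] := ltnP j.+1 (size l'); last first.
    move=> le_j; rewrite nth_default //; have [jl|jl] := ltnP j (size l').
      by apply: ltW; move/allP: pl'; apply; rewrite mem_nth.
    by rewrite nth_default.
  have : sorted >%R l' by rewrite /l' rev_sorted.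
  by move/(sortedP 0) => /(_ j lt_j) /ltW.
move=> k; rewrite INRE -!coef_epoly.
transitivity (heat s th (epoly l))`_k; first by symmetry; exact: coef_heat.
rewrite !epoly_rpoly // -rl' -E.
have -> : rpoly [seq - g^-1 | g <- l] = rpoly rs by rewrite /rpoly; apply: perm_big; rewrite perm_sym.
set a := \prod_(g <- l) g; set b := \prod_(g <- l') g.
have b0 : b != 0 by rewrite gt_eqF // pos.
have -> : heat s th (a *: rpoly rs) = a *: heat s th (rpoly rs).
  rewrite /heat !derivZ !scalerDr -!scalerAr !scalerA.
  by rewrite [a * s]mulrC [a * (s * th)]mulrCA -?mulrA [a * th]mulrC.
by rewrite !coefZ RmultE mulrA divfK.
Qed.
End PolyRoots.

(** * Coefficients of pointwise limits *)

Lemma half_sum_bound (v : nat -> C) (M x : R) : (forall k, Cmod (v k) <= M) -> 0 <= x <= / 2 ->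
  asum (fun k => v k * RtoC x ^ k)%C /\ Cmod (Cser (fun k => v k * RtoC x ^ k)%C) <= 2 * M.
Proof.
  intros HM Hx.
  assert (Hb : forall k, Cmod (v k * RtoC x ^ k) <= M * (/ 2) ^ k).
  { intros k. rewrite Cmod_mult, Cmod_pow, Cmod_RtoC_nonneg by lra.
    apply Rmult_le_compat; auto using Cmod_ge_0; [apply pow_le; lra|apply pow_incr; lra]. }
  split.
  - apply asum_le with (1 := Hb). apply ex_series_half.
  - eapply Rle_trans; [apply Cser_le with (1 := Hb); apply ex_series_half|].
    rewrite Series_scal_l, Series_geom by (rewrite Rabs_right; lra).
    right. field.
Qed.

(** With coefficients bounded by M, the value of the series at x differs from its constant term by
    at most 2 M x, so x is chosen of order eps before the limit is taken. *)
Lemma coef_clim_head {T : Type} (F : (T -> Prop) -> Prop) {FF : Filter F} (v : T -> nat -> C) (M : R) :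
  F (fun i => forall k, Cmod (v i k) <= M) ->
  (forall x, 0 < x <= / 2 -> clim F (fun i => Cser (fun k => v i k * RtoC x ^ k)%C) (RtoC 0)) ->
  clim F (fun i => v i O) (RtoC 0).
Proof.
  intros HM Hx eps He.
  set (x := Rmin (/ 2) (eps / (4 * (Rabs M + 1)))).
  pose proof (Rabs_pos M) as HMp.
  assert (Hx0 : 0 < x). { apply Rmin_pos; [lra|]. apply Rdiv_lt_0_compat; lra. }
  assert (Hx1 : x <= / 2) by apply Rmin_l.
  assert (Hx2 : x * (4 * (Rabs M + 1)) <= eps).
  { apply Rmult_le_reg_r with (/ (4 * (Rabs M + 1))); [apply Rinv_0_lt_compat; lra|].
    rewrite Rmult_assoc, Rinv_r, Rmult_1_r by lra. apply Rmin_r. }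
  eapply filter_imp; [|apply (filter_and _ _ HM (Hx x (conj Hx0 Hx1) (eps / 2) ltac:(lra)))].
  simpl. intros i [H1 H2].
  destruct (half_sum_bound (v i) M x H1 ltac:(lra)) as [A1 _].
  destruct (half_sum_bound (fun k => v i (S k)) M x (fun k => H1 (S k)) ltac:(lra)) as [A2 B2].
  rewrite Cser_incr in H2 by auto.
  rewrite (Cser_ext (fun k => v i (S k) * RtoC x ^ S k)%C (fun k => RtoC x * (v i (S k) * RtoC x ^ k))%C) in H2
    by (intros; simpl; ring).
  rewrite Cser_scal in H2 by auto.
  set (Y := Cser (fun k => (v i (S k) * RtoC x ^ k)%C)) in *.
  replace (v i O * RtoC x ^ 0 + RtoC x * Y - 0)%C with (v i O + RtoC x * Y)%C in H2 by (simpl; ring).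
  replace (v i O - 0)%C with ((v i O + RtoC x * Y) - RtoC x * Y)%C by ring.
  eapply Rle_lt_trans; [apply Cmod_minus_le|]. rewrite Cmod_mult, (Cmod_RtoC_nonneg x) by lra.
  assert (x * Cmod Y <= x * (2 * M)) by (apply Rmult_le_compat_l; lra).
  pose proof (Rle_abs M). nra.
Qed.

(** A substitute for Vitali's theorem: bounded coefficients and pointwise convergence on a real
    segment suffice. The induction passes to (V x - v 0) / x, whose coefficients are shifted by
    one. *)
Lemma coef_clim_0 {T : Type} (F : (T -> Prop) -> Prop) {FF : Filter F} (v : T -> nat -> C) (M : R) (k : nat) :
  F (fun i => forall k, Cmod (v i k) <= M) ->
  (forall x, 0 < x <= / 2 -> clim F (fun i => Cser (fun k => v i k * RtoC x ^ k)%C) (RtoC 0)) ->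
  clim F (fun i => v i k) (RtoC 0).
Proof.
  revert v. induction k as [|k IH]; intros v HM Hx.
  - apply coef_clim_head with M; auto.
  - pose proof (coef_clim_head F v M HM Hx) as H0.
    apply (IH (fun i k => v i (S k))).
    + eapply filter_imp; [|apply HM]. simpl. auto.
    + intros x Hxx.
      assert (Hn : RtoC x <> RtoC 0) by (apply RtoC_neq; lra).
      assert (H1 : clim F (fun i => / RtoC x * (Cser (fun k => v i k * RtoC x ^ k) - v i O))%C (/ RtoC x * (0 - 0))%C).
      { apply clim_scal; auto. apply clim_minus; auto. }
      replace (/ RtoC x * (0 - 0))%C with (RtoC 0) in H1 by ring.
      intros eps He. eapply filter_imp; [|apply (filter_and _ _ HM (H1 eps He))].
      simpl. intros i [H2 H3].
      destruct (half_sum_bound (v i) M x H2 ltac:(lra)) as [A1 _].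
      destruct (half_sum_bound (fun k => v i (S k)) M x (fun k => H2 (S k)) ltac:(lra)) as [A2 _].
      rewrite Cser_incr in H3 by auto.
      rewrite (Cser_ext (fun k => v i (S k) * RtoC x ^ S k)%C (fun k => RtoC x * (v i (S k) * RtoC x ^ k))%C) in H3
        by (intros; simpl; ring).
      rewrite Cser_scal in H3 by auto.
      eapply Rle_lt_trans; [|apply H3]. apply Req_le. f_equal. simpl. field. auto.
Qed.

Lemma fastc_minus (c d : nat -> C) : fastc c -> fastc d -> fastc (fun k => c k - d k)%C.
Proof.
  intros Hc Hd r Hr. destruct (Hc r Hr) as [M1 H1]. destruct (Hd r Hr) as [M2 H2].
  exists (M1 + M2). intros k. specialize (H1 k). specialize (H2 k).
  assert (0 < r ^ k) by (apply pow_lt; auto). pose proof (Cmod_minus_le (c k) (d k)). nra.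
Qed.

Lemma cps_minus (c d : nat -> C) (z : C) : fastc c -> fastc d ->
  cps (fun k => c k - d k)%C z = (cps c z - cps d z)%C.
Proof.
  intros Hc Hd. unfold cps. rewrite <- Cser_minus by (apply cps_asum; auto).
  apply Cser_ext. intros; ring.
Qed.

Lemma cps_coef_clim {T : Type} (F : (T -> Prop) -> Prop) {FF : Filter F}
  (c : T -> nat -> C) (d : nat -> C) (K : R) :
  F (fun i => fastc (c i)) -> fastc d ->
  F (fun i => forall z, Cmod z = 1 -> Cmod (cps (c i) z) <= K) ->
  (forall z, Cmod z <= 1 -> clim F (fun i => cps (c i) z) (cps d z)) ->
  forall k, clim F (fun i => c i k) (d k).
Proof.
  intros Hc Hd HK Hz k.
  destruct (circle_bounded (cps d) 1 Rlt_0_1) as [K' HK'].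
  { intros; apply entire_ccont, cps_entire; auto. }
  assert (H : clim F (fun i => (c i k - d k)%C) (RtoC 0)).
  (* Cauchy's estimate at radius 1 bounds all coefficients of the difference by 2 (K + K'). *)
  { apply (coef_clim_0 F (fun i k => c i k - d k)%C (2 * (K + K'))).
    - eapply filter_imp; [|apply (filter_and _ _ Hc HK)]. simpl. intros i [Hci Hi] j.
      pose proof (fastc_minus _ _ Hci Hd) as Hf.
      pose proof (cps_cauchy (fun k => c i k - d k)%C j 1 (K + K') Hf Rlt_0_1) as HB.
      rewrite pow1, Rmult_1_r in HB. apply HB.
      intros w Hw. rewrite cps_minus by auto. eapply Rle_trans; [apply Cmod_minus_le|].
      specialize (Hi w Hw). specialize (HK' w Hw). lra.
    - intros x Hx eps He.
      eapply filter_imp; [|apply (filter_and _ _ Hc (Hz (RtoC x) ltac:(rewrite Cmod_RtoC_nonneg; lra) eps He))].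
      simpl. intros i [Hci Hi].
      change (Cmod (cps (fun k => c i k - d k)%C (RtoC x) - 0) < eps).
      rewrite cps_minus by auto.
      replace (cps (c i) (RtoC x) - cps d (RtoC x) - 0)%C with (cps (c i) (RtoC x) - cps d (RtoC x))%C by ring.
      auto. }
  intros eps He. eapply filter_imp; [|apply (H eps He)]. simpl. intros i Hi.
  replace (c i k - d k)%C with (c i k - d k - 0)%C by ring. auto.
Qed.

(** * Finite products *)

Fixpoint lprod (l : list R) (z : C) : C :=
  match l with
  | nil => RtoC 1
  | cons g l => ((1 + RtoC g * z) * lprod l z)%C
  end.

Fixpoint lsum (l : list R) : R :=
  match l with nil => 0 | cons g l => g + lsum l end.

Lemma lsum_nonneg (l : list R) : List.Forall (Rle 0) l -> 0 <= lsum l.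
Proof. induction 1; simpl; lra. Qed.

Lemma lprod_bound (l : list R) (z : C) : List.Forall (Rle 0) l -> Cmod (lprod l z) <= exp (Cmod z * lsum l).
Proof.
  induction 1 as [|g l Hg Hl IH]; simpl.
  - rewrite Cmod_1, Rmult_0_r, exp_0. lra.
  - rewrite Cmod_mult, Rmult_plus_distr_l, exp_plus.
    apply Rmult_le_compat; auto using Cmod_ge_0.
    eapply Rle_trans; [apply Cmod_triangle|]. rewrite Cmod_1, Cmod_mult, Cmod_RtoC_nonneg by auto.
    pose proof (exp_ineq1_le (Cmod z * g)). lra.
Qed.

(** Factors are replaced one at a time; 1 + g z and exp (g z) differ by order g^2 <= m g, so the
    errors add up to [m] times the sum of the parameters. *)
Lemma lprod_exp (l : list R) (m : R) (z : C) : 0 <= m -> List.Forall (fun g => 0 <= g <= m) l ->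
  Cmod (lprod l z - Cexp (RtoC (lsum l) * z)) <=
  6 * Cmod z ^ 2 * m * lsum l * exp (Cmod z * lsum l).
Proof.
  intros Hm H. pose proof (Cmod_ge_0 z) as Hz. induction H as [|g l Hg Hl IH]; simpl lsum; simpl lprod.
  - replace (RtoC 0 * z)%C with (RtoC 0) by ring. rewrite Cexp_0.
    unfold Cminus. rewrite Cplus_opp_r, Cmod_0. lra.
  - assert (Hl' : List.Forall (Rle 0) l) by (eapply Forall_impl; [|apply Hl]; simpl; tauto).
    pose proof (lsum_nonneg l Hl') as Hs. pose proof (lprod_bound l z Hl') as HB.
    replace (RtoC (g + lsum l) * z)%C with (RtoC g * z + RtoC (lsum l) * z)%C by (rewrite RtoC_plus; ring).
    rewrite Cexp_plus.
    replace ((1 + RtoC g * z) * lprod l z - Cexp (RtoC g * z) * Cexp (RtoC (lsum l) * z))%C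
      with ((1 + RtoC g * z - Cexp (RtoC g * z)) * lprod l z +
        Cexp (RtoC g * z) * (lprod l z - Cexp (RtoC (lsum l) * z)))%C by ring.
    eapply Rle_trans; [apply Cmod_triangle|]. rewrite !Cmod_mult.
    pose proof (Cexp_taylor (RtoC g * z)) as HT. pose proof (Cmod_Cexp_le (RtoC g * z)) as HE.
    rewrite Cmod_mult, Cmod_RtoC_nonneg in HT, HE by tauto.
    replace (Cmod z * (g + lsum l)) with (Cmod z * g + Cmod z * lsum l) by ring.
    rewrite exp_plus.
    set (e1 := exp (Cmod z * g)) in *. set (e2 := exp (Cmod z * lsum l)) in *.
    replace (exp (g * Cmod z)) with e1 in * by (unfold e1; f_equal; ring).
    assert (He1 : 0 < e1) by apply exp_pos. assert (He2 : 0 < e2) by apply exp_pos.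
    set (a := Cmod z ^ 2) in *. assert (Ha : 0 <= a) by (apply pow_le; auto).
    assert (T1 : Cmod (1 + RtoC g * z - Cexp (RtoC g * z)) * Cmod (lprod l z) <= 6 * a * m * g * (e1 * e2)).
    { replace (6 * a * m * g * (e1 * e2)) with (6 * a * m * g * e1 * e2) by ring.
      apply Rmult_le_compat; auto using Cmod_ge_0.
      eapply Rle_trans; [apply HT|].
      replace (6 * (g * Cmod z) ^ 2 * e1) with (6 * a * (g * g) * e1) by (unfold a; ring).
      replace (6 * a * m * g * e1) with (6 * a * (m * g) * e1) by ring.
      apply Rmult_le_compat_r; [lra|]. apply Rmult_le_compat_l; [lra|]. apply Rmult_le_compat_r; tauto. }
    assert (T2 : Cmod (Cexp (RtoC g * z)) * Cmod (lprod l z - Cexp (RtoC (lsum l) * z)) <=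
      e1 * (6 * a * m * lsum l * e2)).
    { apply Rmult_le_compat; auto using Cmod_ge_0. }
    lra.
Qed.

Lemma fastc_ecoef (l : list R) : fastc (fun k => RtoC (ecoef l k)).
Proof.
  intros r Hr. induction l as [|g l [M IH]].
  - exists 1. intros [|k]; simpl; rewrite ?Cmod_1, ?Cmod_0; lra.
  - exists (M + Rabs g * (r * Rabs M)). intros k. simpl.
    rewrite RtoC_plus, RtoC_mult.
    assert (0 < r ^ k) by (apply pow_lt; auto).
    eapply Rle_trans; [apply Rmult_le_compat_r; [lra|apply Cmod_triangle]|].
    rewrite Cmod_mult, (Cmod_R g), Rmult_plus_distr_r. apply Rplus_le_compat; auto.
    rewrite Rmult_assoc. apply Rmult_le_compat_l; [apply Rabs_pos|].
    destruct k as [|k].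
    + rewrite Cmod_0. pose proof (Rabs_pos M). nra.
    + simpl. specialize (IH k). pose proof (Rle_abs M). nra.
Qed.

Lemma lprod_cps (l : list R) (z : C) : lprod l z = cps (fun k => RtoC (ecoef l k)) z.
Proof.
  induction l as [|g l IH]; simpl lprod.
  - unfold cps. rewrite Cser_incr by (apply (cps_asum _ z (fastc_ecoef nil))).
    rewrite Cser_0; simpl; [ring|]. intros; simpl; ring.
  - rewrite IH. unfold cps.
    pose proof (cps_asum _ z (fastc_ecoef l)) as A1. pose proof (cps_asum _ z (fastc_ecoef (g :: l))) as A2.
    rewrite (Cser_incr (fun k => RtoC (ecoef (g :: l) k) * z ^ k)%C) by auto.
    rewrite (Cser_ext (fun k => RtoC (ecoef (g :: l) (S k)) * z ^ S k)%C
      (fun k => (RtoC (ecoef l (S k)) * z ^ S k) + (RtoC g * z) * (RtoC (ecoef l k) * z ^ k))%C).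
    2: { intros k. simpl ecoef. rewrite RtoC_plus, RtoC_mult. simpl Cpow. ring. }
    rewrite Cser_plus, Cser_scal; auto; [|apply (asum_incr _ A1)|apply asum_scal; auto].
    rewrite (Cser_incr (fun k => RtoC (ecoef l k) * z ^ k)%C) by auto.
    simpl ecoef. rewrite Rmult_0_r, Rplus_0_r. simpl Cpow. ring.
Qed.

Lemma ecoef_0 (l : list R) : ecoef l 0 = 1.
Proof. induction l as [|g l IH]; simpl; auto. rewrite IH. ring. Qed.

Lemma ecoef_1 (l : list R) : ecoef l 1 = lsum l.
Proof. induction l as [|g l IH]; simpl; auto. rewrite IH, ecoef_0. ring. Qed.

(** The sum of the first [n] terms, empty for [n = 0], whereas [sum_n] includes the term of index
    [n]. *)
Fixpoint psum (u : nat -> R) (n : nat) : R :=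
  match n with O => 0 | S n => psum u n + u n end.

(** Beyond the end of the list the default 0 of [nth] contributes the factor 1 and the summand 0, so
    [J] may exceed the length. *)
Lemma lprod_skipn (l : list R) (J : nat) (z : C) :
  lprod l z = (Cprod_n (fun j => 1 + RtoC (nth j l 0) * z) J * lprod (skipn J l) z)%C /\
  lsum l = psum (fun j => nth j l 0) J + lsum (skipn J l).
Proof.
  induction J as [|J [IH1 IH2]].
  - simpl. split; [ring|lra].
  - assert (E : lprod (skipn J l) z = ((1 + RtoC (nth J l 0) * z) * lprod (skipn (S J) l) z)%C /\
      lsum (skipn J l) = nth J l 0 + lsum (skipn (S J) l)).
    { clear. revert l. induction J as [|J IH]; intros [|g l]; simpl; try (split; [ring|lra]).
      apply IH. }
    destruct E as [E1 E2]. simpl Cprod_n. simpl psum. rewrite IH1, IH2, E1, E2. split; [ring|lra].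
Qed.

Definition lsorted (l : list R) : Prop := forall j, nth (S j) l 0 <= nth j l 0.

Lemma lsorted_skipn (l : list R) (J : nat) (x : R) : lsorted l -> In x (skipn J l) -> x <= nth J l 0.
Proof.
  intros Hs Hx.
  assert (Hk : forall k, nth (J + k) l 0 <= nth J l 0).
  { induction k as [|k IH]; [rewrite Nat.add_0_r; lra|]. rewrite Nat.add_succ_r.
    specialize (Hs (J + k)%nat). lra. }
  apply (In_nth _ _ 0) in Hx. destruct Hx as (k & Hk1 & <-).
  rewrite nth_skipn. apply Hk.
Qed.

Lemma nth_nonneg (l : list R) (j : nat) : List.Forall (Rle 0) l -> 0 <= nth j l 0.
Proof.
  intros H. destruct (nth_in_or_default j l 0) as [Hin|E].
  - rewrite Forall_forall in H. apply H; auto.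
  - rewrite E; lra.
Qed.

(** The J + 1 leading parameters are all at least the one of index J, so the latter is at most the
    total divided by J + 1. *)
Lemma lsorted_nth_le (l : list R) (J : nat) : List.Forall (Rle 0) l -> lsorted l ->
  nth J l 0 * INR (S J) <= lsum l.
Proof.
  intros H0 Hs. destruct (lprod_skipn l (S J) 0) as [_ E]. rewrite E.
  assert (Hsk : 0 <= lsum (skipn (S J) l)).
  { apply lsum_nonneg. rewrite Forall_forall in *. intros x Hx. apply H0.
    rewrite <- (firstn_skipn (S J) l). apply in_or_app; auto. }
  assert (Hp : forall n, (n <= S J)%nat -> nth J l 0 * INR n <= psum (fun j => nth j l 0) n).
  { assert (Hm : forall k j, nth (j + k) l 0 <= nth j l 0).
    { induction k as [|k IH]; intros j; [rewrite Nat.add_0_r; lra|]. rewrite Nat.add_succ_r.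
      specialize (Hs (j + k)%nat). specialize (IH j). lra. }
    induction n as [|n IH]; intros Hn; [simpl; lra|].
    rewrite S_INR. simpl psum. specialize (IH ltac:(lia)).
    specialize (Hm (J - n)%nat n). replace (n + (J - n))%nat with J in Hm by lia. lra. }
  specialize (Hp (S J) (le_n _)). lra.
Qed.

Lemma Cprod_n_bound (u : nat -> R) (J : nat) (z : C) : (forall j, 0 <= u j) ->
  Cmod (Cprod_n (fun j => 1 + RtoC (u j) * z)%C J) <= exp (Cmod z * psum u J).
Proof.
  intros Hu. induction J as [|J IH]; simpl.
  - rewrite Cmod_1, Rmult_0_r, exp_0. lra.
  - rewrite Cmod_mult, Rmult_plus_distr_l, exp_plus.
    apply Rmult_le_compat; auto using Cmod_ge_0.
    eapply Rle_trans; [apply Cmod_triangle|]. rewrite Cmod_1, Cmod_mult, Cmod_RtoC_nonneg by auto.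
    pose proof (exp_ineq1_le (Cmod z * u J)). lra.
Qed.

(** After J factors all parameters are at most S / (J + 1), so replacing their product by an
    exponential costs O(1 / (J + 1)), uniformly over all lists with sum at most S. *)
Lemma lprod_head_exp (l : list R) (J : nat) (S : R) (z : C) : List.Forall (Rle 0) l -> lsorted l -> lsum l <= S ->
  Cmod (lprod l z - Cprod_n (fun j => 1 + RtoC (nth j l 0) * z)%C J *
     Cexp (RtoC (lsum l - psum (fun j => nth j l 0) J) * z)) <=
  6 * Cmod z ^ 2 * S * S * exp (Cmod z * S) * exp (Cmod z * S) / INR (J + 1).
Proof.
  intros H0 Hs HS. destruct (lprod_skipn l J z) as [E1 E2].
  pose proof (lsum_nonneg l H0) as Hl0. pose proof (Cmod_ge_0 z) as Hz.
  assert (Hsk : List.Forall (Rle 0) (skipn J l)).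
  { rewrite Forall_forall in *. intros x Hx. apply H0.
    rewrite <- (firstn_skipn J l). apply in_or_app; auto. }
  pose proof (lsum_nonneg _ Hsk) as Hk0.
  assert (Hp0 : 0 <= psum (fun j => nth j l 0) J).
  { clear - H0. induction J; simpl; [lra|]. pose proof (nth_nonneg l J H0). lra. }
  rewrite E1. replace (lsum l - psum (fun j => nth j l 0) J) with (lsum (skipn J l)) by lra.
  match goal with |- Cmod (?p * ?a - ?p * ?b)%C <= _ => replace (p * a - p * b)%C with (p * (a - b))%C by ring end.
  rewrite Cmod_mult.
  assert (Hm : nth J l 0 <= S / INR (J + 1)).
  { pose proof (lsorted_nth_le l J H0 Hs). replace (J + 1)%nat with (Datatypes.S J) by lia.
    assert (0 < INR (Datatypes.S J)) by (apply lt_0_INR; lia).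
    apply Rmult_le_reg_r with (INR (Datatypes.S J)); auto. unfold Rdiv. rewrite Rmult_assoc, Rinv_l; lra. }
  pose proof (nth_nonneg l J H0) as Hn0.
  assert (B1 := Cprod_n_bound (fun j => nth j l 0) J z (fun j => nth_nonneg l j H0)).
  assert (B2 : Cmod (lprod (skipn J l) z - Cexp (RtoC (lsum (skipn J l)) * z)) <=
    6 * Cmod z ^ 2 * nth J l 0 * lsum (skipn J l) * exp (Cmod z * lsum (skipn J l))).
  { apply lprod_exp; auto. rewrite Forall_forall in *. intros x Hx. split; auto.
    apply lsorted_skipn; auto. }
  assert (Hexp : forall x, x <= S -> exp (Cmod z * x) <= exp (Cmod z * S)).
  { intros x Hx. assert (Hle : Cmod z * x <= Cmod z * S) by (apply Rmult_le_compat_l; auto).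
    destruct Hle as [Hlt|Heq]; [left; apply exp_increasing; auto|rewrite Heq; lra]. }
  pose proof (Hexp (psum (fun j => nth j l 0) J) ltac:(lra)) as X1.
  pose proof (Hexp (lsum (skipn J l)) ltac:(lra)) as X2.
  set (e := exp (Cmod z * S)) in *. assert (He : 0 < e) by apply exp_pos.
  assert (Hz2 : 0 <= 6 * Cmod z ^ 2) by (apply Rmult_le_pos; [lra|apply pow_le; auto]).
  apply Rle_trans with (e * (6 * Cmod z ^ 2 * (S / INR (J + 1)) * S * e)).
  - apply Rmult_le_compat; auto using Cmod_ge_0; [lra|].
    eapply Rle_trans; [apply B2|]. apply Rmult_le_compat; auto.
    + repeat apply Rmult_le_pos; auto; lra.
    + left; apply exp_pos.
    + apply Rmult_le_compat; auto; [|apply Rmult_le_compat_l; auto|lra]. apply Rmult_le_pos; auto.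
  - right. field. apply not_0_INR. lia.
Qed.

(** * Extraction of convergent subsequences *)

Section Cluster.
Variable u : nat -> nat -> R.
Variable S : R.
Hypothesis Hu : forall i j, 0 <= u i j <= S.

Definition cluster (g : list R) : Prop :=
  forall eps, 0 < eps -> forall N, exists i, (N <= i)%nat /\
    forall j, (j < length g)%nat -> Rabs (u i j - nth j g 0) < eps.

(** Bolzano-Weierstrass for one further coordinate: [E] collects the values that this coordinate
    reaches infinitely often along rows close to [g], so its supremum is a limit superior. *)
Lemma cluster_extend (g : list R) : cluster g -> exists L, cluster (g ++ L :: nil).
Proof.
  intros Hg.
  set (E := fun x => forall eps, 0 < eps -> forall N, exists i, (N <= i)%nat /\
     (forall j, (j < length g)%nat -> Rabs (u i j - nth j g 0) < eps) /\ x <= u i (length g)).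
  destruct (completeness E) as [L [HL1 HL2]].
  - exists S. intros x Hx. destruct (Hx 1 Rlt_0_1 O) as (i & _ & _ & H). specialize (Hu i (length g)). lra.
  - exists 0. intros eps He N. destruct (Hg eps He N) as (i & H1 & H2). exists i. split; auto. split; auto. apply Hu.
  - exists L. intros eps He N.
    assert (Hn : ~ E (L + eps / 2)).
    { intros H. specialize (HL1 _ H). lra. }
    assert (Hup : exists eps0 N0, 0 < eps0 /\ forall i, (N0 <= i)%nat ->
       (forall j, (j < length g)%nat -> Rabs (u i j - nth j g 0) < eps0) -> u i (length g) < L + eps / 2).
    { apply NNPP. intros H. apply Hn. intros e He' N'. apply NNPP. intros H'. apply H.
      exists e, N'. split; auto. intros i Hi Hj. apply Rnot_le_lt. intros Hle. apply H'. exists i. auto. }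
    destruct Hup as (e0 & N0 & He0 & Hup).
    assert (Hlow : exists x, E x /\ L - eps / 2 < x).
    { apply NNPP. intros H. assert (L <= L - eps / 2); [|lra]. apply HL2. intros x Hx.
      apply Rnot_lt_le. intros Hlt. apply H. exists x. auto. }
    destruct Hlow as (x & Hx & Hxl).
    destruct (Hx (Rmin eps e0) ltac:(apply Rmin_pos; auto) (Nat.max N N0)) as (i & Hi & Hj & Hxi).
    pose proof (Rmin_l eps e0). pose proof (Rmin_r eps e0).
    exists i. split; [lia|]. intros j Hjl. rewrite length_app in Hjl. simpl in Hjl.
    destruct (Nat.eq_dec j (length g)) as [->|Hne].
    + rewrite nth_middle.
      assert (u i (length g) < L + eps / 2).
      { apply Hup; [lia|]. intros j Hjg. specialize (Hj j Hjg). lra. }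
      apply Rabs_def1; lra.
    + rewrite app_nth1 by lia. specialize (Hj j ltac:(lia)). lra.
Qed.

(** The row [phi n] is within 1 / (n + 1) of the limit in the first n coordinates. Only [n <= phi n]
    is recorded, which is enough to pass limits at infinity to the selected rows. *)
Lemma diagonal_extraction : exists (phi : nat -> nat) (gamma : nat -> R),
  (forall n, (n <= phi n)%nat) /\
  forall j eps, 0 < eps -> exists N, forall n, (N <= n)%nat -> Rabs (u (phi n) j - gamma j) < eps.
Proof.
  destruct (fun_choice (fun (g : {g | cluster g}) (g' : {g | cluster g}) =>
     exists L, proj1_sig g' = proj1_sig g ++ L :: nil)) as [nx Hnx].
  { intros [g Hg]. destruct (cluster_extend g Hg) as [L HL].
    exists (exist _ (g ++ L :: nil) HL). exists L. auto. }
  assert (H0 : cluster nil). { intros eps He N. exists N. split; auto. simpl. intros j Hj. lia. }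
  set (G := fun n => Nat.iter n nx (exist _ nil H0)).
  assert (HG : forall n, exists L, proj1_sig (G (Datatypes.S n)) = proj1_sig (G n) ++ L :: nil) by (intros n; apply Hnx).
  assert (Hlen : forall n, length (proj1_sig (G n)) = n).
  { induction n as [|n IH]; auto. destruct (HG n) as [L HL]. rewrite HL, length_app, IH. simpl. lia. }
  set (gamma := fun j => nth j (proj1_sig (G (Datatypes.S j))) 0).
  assert (Hst : forall j k, nth j (proj1_sig (G (Datatypes.S j + k)%nat)) 0 = gamma j).
  { intros j. induction k as [|k IH]; [rewrite Nat.add_0_r; auto|].
    rewrite Nat.add_succ_r. destruct (HG (Datatypes.S j + k)%nat) as [L HL]. rewrite HL.
    rewrite app_nth1; auto. rewrite Hlen. lia. }
  assert (Hpos : forall n, 0 < / INR (Datatypes.S n)) by (intros; apply Rinv_0_lt_compat, lt_0_INR; lia).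
  destruct (fun_choice (fun (n : nat) i => (n <= i)%nat /\ forall j, (j < n)%nat ->
     Rabs (u i j - gamma j) < / INR (Datatypes.S n))) as [phi Hphi].
  { intros n. destruct (proj2_sig (G n) _ (Hpos n) n) as (i & Hi & Hj). exists i. split; auto.
    intros j Hjn. rewrite Hlen in Hj. specialize (Hj j Hjn).
    replace n with (Datatypes.S j + (n - Datatypes.S j))%nat in Hj at 1 by lia. rewrite Hst in Hj. auto. }
  exists phi, gamma. split; [apply Hphi|].
  intros j eps He. destruct (archimed_cor1 eps He) as (N & HN & HN0).
  exists (Nat.max N (Datatypes.S j)). intros n Hn. destruct (Hphi n) as [_ H].
  eapply Rlt_trans; [apply H; lia|]. eapply Rle_lt_trans; [|apply HN].
  apply Rinv_le_contravar; [apply lt_0_INR; auto|]. apply le_INR. lia.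
Qed.
End Cluster.

(** * Limits of products with nonpositive zeros *)

Lemma clim_ccont {T : Type} (F : (T -> Prop) -> Prop) {FF : Filter F} (f : C -> C) (u : T -> C) (l : C) :
  ccont f l -> clim F u l -> clim F (fun i => f (u i)) (f l).
Proof.
  intros Hf Hu eps He. destruct (proj1 (ccont_eps f l) Hf eps He) as (d & Hd & H).
  eapply filter_imp; [|apply (Hu d Hd)]. simpl. auto.
Qed.

Lemma clim_Cexp {T : Type} (F : (T -> Prop) -> Prop) {FF : Filter F} (u : T -> C) (l : C) :
  clim F u l -> clim F (fun i => Cexp (u i)) (Cexp l).
Proof. apply clim_ccont; auto. eapply cderiv_ccont, cderiv_Cexp. Qed.

Lemma clim_RtoC_seq (u : nat -> R) (x : R) :
  (forall eps, 0 < eps -> exists N, forall n, (N <= n)%nat -> Rabs (u n - x) < eps) ->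
  clim eventually (fun n => RtoC (u n)) (RtoC x).
Proof.
  intros H eps He. destruct (H eps He) as [N HN]. exists N. intros n Hn.
  rewrite <- RtoC_minus, Cmod_R. auto.
Qed.

Lemma clim_RtoC_le (u : nat -> R) (x y : R) : clim eventually (fun n => RtoC (u n)) (RtoC x) ->
  (forall n, u n <= y) -> x <= y.
Proof.
  intros H Hy. apply Rnot_lt_le. intros Hlt. destruct (H (x - y)) as [N HN]; [lra|].
  specialize (HN N (le_n _)). rewrite <- RtoC_minus, Cmod_R in HN. specialize (Hy N).
  apply Rabs_def2 in HN. lra.
Qed.

Lemma clim_RtoC_ge (u : nat -> R) (x y : R) : clim eventually (fun n => RtoC (u n)) (RtoC x) ->
  (forall n, y <= u n) -> y <= x.
Proof.
  intros H Hy. apply Rnot_lt_le. intros Hlt. destruct (H (y - x)) as [N HN]; [lra|].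
  specialize (HN N (le_n _)). rewrite <- RtoC_minus, Cmod_R in HN. specialize (Hy N).
  apply Rabs_def2 in HN. lra.
Qed.

Lemma clim_subseq (u : nat -> C) (l : C) (phi : nat -> nat) : (forall n, (n <= phi n)%nat) ->
  clim eventually u l -> clim eventually (fun n => u (phi n)) l.
Proof.
  intros Hphi H eps He. destruct (H eps He) as [N HN]. exists N. intros n Hn. apply HN.
  specialize (Hphi n). lia.
Qed.

Lemma clim_psum (u : nat -> nat -> R) (g : nat -> R) (J : nat) :
  (forall j, clim eventually (fun n => RtoC (u n j)) (RtoC (g j))) ->
  clim eventually (fun n => RtoC (psum (u n) J)) (RtoC (psum g J)).
Proof.
  intros H. induction J as [|J IH]; simpl.
  - apply clim_const; apply eventually_filter.
  - rewrite RtoC_plus. apply clim_ext with (fun n => RtoC (psum (u n) J) + RtoC (u n J))%C;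
      [apply eventually_filter|intros; rewrite RtoC_plus; auto|].
    apply clim_plus; auto; apply eventually_filter.
Qed.

Lemma clim_Cprod_n (u : nat -> nat -> R) (g : nat -> R) (z : C) (J : nat) :
  (forall j, clim eventually (fun n => RtoC (u n j)) (RtoC (g j))) ->
  clim eventually (fun n => Cprod_n (fun j => 1 + RtoC (u n j) * z)%C J) (Cprod_n (fun j => 1 + RtoC (g j) * z)%C J).
Proof.
  intros H. induction J as [|J IH]; simpl.
  - apply clim_const; apply eventually_filter.
  - apply clim_mult; auto; [apply eventually_filter|].
    apply clim_plus; [apply eventually_filter|apply clim_const; apply eventually_filter|].
    apply clim_mult; auto; [apply eventually_filter|apply clim_const; apply eventually_filter].
Qed.

Lemma psum_sum_n (g : nat -> R) (n : nat) : psum g (S n) = sum_n g n.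
Proof.
  induction n as [|n IH]; [rewrite sum_O; simpl; lra|]. rewrite sum_Sn, <- IH. reflexivity.
Qed.

Lemma inv_INR_small (K eps : R) : 0 <= K -> 0 < eps -> exists N, forall n, (N <= n)%nat -> K / INR (n + 1) < eps.
Proof.
  intros HK He. destruct (archimed_cor1 (eps / (K + 1))) as (N & HN & HN0).
  { apply Rdiv_lt_0_compat; lra. }
  exists N. intros n Hn. assert (HI : 0 < INR (n + 1)) by (apply lt_0_INR; lia).
  assert (Hle : INR N <= INR (n + 1)) by (apply le_INR; lia).
  assert (HNp : 0 < INR N) by (apply lt_0_INR; auto).
  assert (H1 : / INR (n + 1) <= / INR N) by (apply Rinv_le_contravar; auto).
  apply Rle_lt_trans with (K * (eps / (K + 1))).
  - unfold Rdiv at 1. apply Rmult_le_compat_l; lra.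
  - replace (K * (eps / (K + 1))) with (eps - eps / (K + 1)) by (field; lra).
    assert (0 < eps / (K + 1)) by (apply Rdiv_lt_0_compat; lra). lra.
Qed.

(* The largest parameters converge along a subsequence, and the product over the
   remaining ones, all small, approaches the exponential of their sum. *)
Theorem limit_product (l : nat -> list R) (S sigma : R) (q : C -> C) :
  (forall i, List.Forall (Rle 0) (l i) /\ lsorted (l i) /\ lsum (l i) <= S) ->
  clim eventually (fun i => RtoC (lsum (l i))) (RtoC sigma) ->
  (forall z, clim eventually (fun i => lprod (l i) z) (q z)) ->
  exists alpha gamma P, 0 <= alpha /\ (forall j, 0 <= gamma (Datatypes.S j) <= gamma j) /\
    ex_series gamma /\ (forall z, is_Cprod (fun j => 1 + RtoC (gamma j) * z)%C (P z)) /\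
    forall z, q z = (Cexp (RtoC alpha * z) * P z)%C.
Proof.
  intros Hl Hsig Hq.
  set (u := fun i j => nth j (l i) 0).
  assert (Hps : forall i J, psum (u i) J <= lsum (l i)).
  { intros i J. destruct (Hl i) as (H1 & _ & _). destruct (lprod_skipn (l i) J 0) as [_ E]. rewrite E.
    unfold u. assert (0 <= lsum (skipn J (l i))); [|lra]. apply lsum_nonneg.
    rewrite Forall_forall in *. intros x Hx. apply H1.
    rewrite <- (firstn_skipn J (l i)). apply in_or_app; auto. }
  assert (Hu0 : forall i j, 0 <= u i j) by (intros; apply nth_nonneg; apply Hl).
  assert (Hu : forall i j, 0 <= u i j <= S).
  { intros i j. split; auto. specialize (Hps i (Datatypes.S j)). simpl in Hps.
    assert (0 <= psum (u i) j). { clear - Hu0. induction j; simpl; [lra|]. specialize (Hu0 i j). lra. }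
    destruct (Hl i) as (_ & _ & H3). lra. }
  destruct (diagonal_extraction u S Hu) as (phi & gamma & Hphi & Hg).
  assert (HS0 : 0 <= S). { specialize (Hu O O). lra. }
  assert (Hg' : forall j, clim eventually (fun n => RtoC (u (phi n) j)) (RtoC (gamma j))).
  { intros j. apply clim_RtoC_seq. apply Hg. }
  pose proof (clim_subseq _ _ phi Hphi Hsig) as Hsig'.
  assert (Hg0 : forall j, 0 <= gamma j) by (intros j; eapply clim_RtoC_ge; [apply Hg'|intros; apply Hu0]).
  assert (Hgm : forall j, gamma (Datatypes.S j) <= gamma j).
  { intros j. assert (0 <= gamma j - gamma (Datatypes.S j)); [|lra].
    eapply (clim_RtoC_ge (fun n => u (phi n) j - u (phi n) (Datatypes.S j))).
    - rewrite RtoC_minus. apply clim_ext with (fun n => RtoC (u (phi n) j) - RtoC (u (phi n) (Datatypes.S j)))%C;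
        [apply eventually_filter|intros; rewrite RtoC_minus; auto|].
      apply clim_minus; auto; apply eventually_filter.
    - intros n. destruct (Hl (phi n)) as (_ & H & _). specialize (H j). unfold u. lra. }
  assert (Hgp : forall J, psum gamma J <= sigma).
  { intros J. assert (0 <= sigma - psum gamma J); [|lra].
    eapply (clim_RtoC_ge (fun n => lsum (l (phi n)) - psum (u (phi n)) J)).
    - rewrite RtoC_minus. apply clim_ext with (fun n => RtoC (lsum (l (phi n))) - RtoC (psum (u (phi n)) J))%C;
        [apply eventually_filter|intros; rewrite RtoC_minus; auto|].
      apply clim_minus; auto; [apply eventually_filter|]. apply (clim_psum (fun n => u (phi n))); auto.
    - intros n. specialize (Hps (phi n) J). lra. }
  assert (Hser : ex_finite_lim_seq (sum_n gamma)).
  { apply ex_finite_lim_seq_incr with sigma.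
    - intros n. rewrite sum_Sn. change (sum_n gamma n <= sum_n gamma n + gamma (Datatypes.S n)).
      specialize (Hg0 (Datatypes.S n)). lra.
    - intros n. rewrite <- psum_sum_n. apply Hgp. }
  destruct Hser as [Gam HGam].
  assert (HGs : clim eventually (fun J => RtoC (psum gamma J)) (RtoC Gam)).
  { apply clim_RtoC_seq. intros eps He. apply is_lim_seq_spec in HGam.
    destruct (HGam (mkposreal eps He)) as [N HN]. exists (Datatypes.S N). intros [|n] Hn; [lia|].
    rewrite psum_sum_n. apply HN. lia. }
  assert (HGle : Gam <= sigma) by (eapply clim_RtoC_le; [apply HGs|intros; apply Hgp]).
  (* The part of the limiting sum not captured by the individual limits gamma_j has dispersed into
     ever smaller parameters and reappears in the exponential. *)
  set (alpha := sigma - Gam).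
  (* The infinite product is defined as the limit divided by its exponential factor; convergence of
     the partial products to it is what remains to be shown. *)
  exists alpha, gamma, (fun z => q z * Cexp (- (RtoC alpha * z)))%C.
  split; [unfold alpha; lra|]. split; [intros; split; auto|]. split; [exists Gam; exact HGam|].
  assert (Hinv : forall w, (Cexp w * Cexp (- w))%C = RtoC 1).
  { intros w. rewrite <- Cexp_plus, Cplus_opp_r. apply Cexp_0. }
  split.
  2: { intros z. replace (Cexp (RtoC alpha * z) * (q z * Cexp (- (RtoC alpha * z))))%C
         with (q z * (Cexp (RtoC alpha * z) * Cexp (- (RtoC alpha * z))))%C by ring.
       rewrite Hinv. ring. }
  intros z. unfold is_Cprod. apply clim_filterlim; [apply eventually_filter|].
  set (K := 6 * Cmod z ^ 2 * S * S * exp (Cmod z * S) * exp (Cmod z * S)).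
  assert (HK : 0 <= K).
  { unfold K. repeat apply Rmult_le_pos; auto; try lra; try apply pow_le; try apply Cmod_ge_0; left; apply exp_pos. }
  (* The error 1 / (J + 1) is uniform in the row, so the rows are sent to their limit for fixed J,
     and J to infinity afterwards. *)
  assert (Hrep : forall J, Cmod (q z - Cprod_n (fun j => 1 + RtoC (gamma j) * z)%C J *
     Cexp (RtoC (sigma - psum gamma J) * z)) <= K / INR (J + 1)).
  { intros J. apply (clim_le eventually) with (u := fun n => (lprod (l (phi n)) z -
      Cprod_n (fun j => 1 + RtoC (u (phi n) j) * z)%C J *
      Cexp (RtoC (lsum (l (phi n)) - psum (u (phi n)) J) * z))%C).
    - apply clim_minus; [apply eventually_filter|apply (clim_subseq (fun i => lprod (l i) z)); auto|].
      apply clim_mult; [apply eventually_filter|apply (clim_Cprod_n (fun n => u (phi n))); auto|].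
      apply clim_Cexp; [apply eventually_filter|].
      apply clim_mult; [apply eventually_filter| |apply clim_const; apply eventually_filter].
      rewrite RtoC_minus. apply clim_ext with (fun n => RtoC (lsum (l (phi n))) - RtoC (psum (u (phi n)) J))%C;
        [apply eventually_filter|intros; rewrite RtoC_minus; auto|].
      apply clim_minus; auto; [apply eventually_filter|]. apply (clim_psum (fun n => u (phi n))); auto.
    - apply filter_forall. intros n. apply lprod_head_exp; apply Hl. }
  assert (L1 : clim eventually (fun J => Cprod_n (fun j => 1 + RtoC (gamma j) * z)%C J *
     Cexp (RtoC (sigma - psum gamma J) * z))%C (q z)).
  { intros eps He. destruct (inv_INR_small K eps HK He) as [N HN]. exists N. intros J HJ.
    rewrite Cmod_minus_sym. eapply Rle_lt_trans; [apply Hrep|auto]. }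
  assert (L2 : clim eventually (fun J => Cexp (- (RtoC (sigma - psum gamma J) * z))) (Cexp (- (RtoC alpha * z)))).
  { apply clim_Cexp; [apply eventually_filter|].
    replace (- (RtoC alpha * z))%C with ((RtoC sigma - RtoC Gam) * - z)%C by (unfold alpha; rewrite RtoC_minus; ring).
    apply clim_ext with (fun J => (RtoC sigma - RtoC (psum gamma J)) * - z)%C;
      [apply eventually_filter|intros; rewrite RtoC_minus; ring|].
    apply clim_mult; [apply eventually_filter| |apply clim_const; apply eventually_filter].
    apply clim_minus; auto; [apply eventually_filter|apply clim_const; apply eventually_filter]. }
  eapply clim_ext; [apply eventually_filter| |apply (clim_mult eventually _ _ _ _ L1 L2)].
  intros J. simpl. rewrite <- Cmult_assoc, Hinv. ring.
Qed.

(** * Exponential type *)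

Lemma exp_INR (k : nat) (x : R) : exp (INR k * x) = exp x ^ k.
Proof.
  induction k as [|k IH]; [simpl; rewrite Rmult_0_l, exp_0; auto|].
  rewrite S_INR, Rmult_plus_distr_r, exp_plus, IH, Rmult_1_l. simpl. ring.
Qed.

(** A weak Stirling bound n! e^n <= e n n^n, by induction from e <= (1 + 1 / n)^(n + 1). *)
Lemma fact_exp_bound (k : nat) : INR (fact (S k)) * exp (INR (S k)) <= exp 1 * INR (S k) * INR (S k) ^ (S k).
Proof.
  induction k as [|k IH].
  - simpl. lra.
  - set (n := INR (S k)) in *. assert (Hn : 0 < n) by (apply lt_0_INR; lia).
    assert (E : INR (S (S k)) = n + 1) by (apply S_INR).
    change (fact (S (S k))) with (S (S k) * fact (S k))%nat. rewrite mult_INR, E, exp_plus.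
    assert (H1 : exp 1 * n ^ (S (S k)) <= (n + 1) ^ (S (S k))).
    { assert (Hb : n / (n + 1) <= exp (- (/ (n + 1)))).
      { pose proof (exp_ineq1_le (- (/ (n + 1)))). replace (n / (n + 1)) with (1 + - / (n + 1)) by (field; lra). auto. }
      assert (Hp : (n / (n + 1)) ^ (S (S k)) <= exp (- (1))).
      { replace (- (1)) with (INR (S (S k)) * (- (/ (n + 1)))) by (rewrite E; field; lra).
        rewrite exp_INR. apply pow_incr. split; auto. left. apply Rdiv_lt_0_compat; lra. }
      unfold Rdiv in Hp. rewrite Rpow_mult_distr, pow_inv, exp_Ropp in Hp.
      pose proof (exp_pos 1). assert (0 < (n + 1) ^ S (S k)) by (apply pow_lt; lra).
      apply Rmult_le_compat_r with (r := exp 1 * (n + 1) ^ S (S k)) in Hp; [|apply Rmult_le_pos; lra].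
      replace (n ^ S (S k) * / (n + 1) ^ S (S k) * (exp 1 * (n + 1) ^ S (S k))) with (exp 1 * n ^ S (S k)) in Hp by (field; lra).
      replace (/ exp 1 * (exp 1 * (n + 1) ^ S (S k))) with ((n + 1) ^ S (S k)) in Hp by (field; lra). auto. }
    pose proof (exp_pos 1).
    replace ((n + 1) * INR (fact (S k)) * (exp n * exp 1)) with ((n + 1) * exp 1 * (INR (fact (S k)) * exp n)) by ring.
    apply Rle_trans with ((n + 1) * exp 1 * (exp 1 * n * n ^ S k)).
    + apply Rmult_le_compat_l; auto. apply Rmult_le_pos; lra.
    + replace ((n + 1) * exp 1 * (exp 1 * n * n ^ S k)) with ((n + 1) * exp 1 * (exp 1 * n ^ S (S k))) by (simpl; ring).
      replace (exp 1 * (n + 1) * (n + 1) ^ S (S k)) with ((n + 1) * exp 1 * (n + 1) ^ S (S k)) by ring.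
      apply Rmult_le_compat_l; auto. apply Rmult_le_pos; lra.
Qed.

(** Cauchy's estimate at radius k / b, which minimises exp (b r) / r^k. The Stirling bound then
    costs only a factor linear in k. *)
Lemma exp_type_coef (c : nat -> C) (b M : R) : 0 < b -> fastc c ->
  (forall z, Cmod (cps c z) <= M * exp (b * Cmod z)) ->
  forall k, INR (fact k) * Cmod (c k) <= 2 * M * exp 1 * INR (S k) * b ^ k.
Proof.
  intros Hb Hc HM k.
  assert (HM0 : 0 <= M).
  { specialize (HM 0). pose proof (Cmod_ge_0 (cps c 0)). pose proof (exp_pos (b * Cmod 0)).
    rewrite Cmod_0, Rmult_0_r, exp_0 in *. lra. }
  assert (He : 1 <= exp 1) by (pose proof (exp_ineq1_le 1); lra).
  destruct k as [|k].
  - simpl. pose proof (cps_cauchy c O 1 (M * exp b) Hc Rlt_0_1) as H.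
    specialize (HM 0). rewrite cps_0, Cmod_0, Rmult_0_r, exp_0 in HM by auto. nra.
  - set (n := INR (S k)) in *. assert (Hn : 0 < n) by (apply lt_0_INR; lia).
    assert (Hr : 0 < n / b) by (apply Rdiv_lt_0_compat; auto).
    pose proof (cps_cauchy c (S k) (n / b) (M * exp n) Hc Hr) as H.
    assert (H' : Cmod (c (S k)) * (n / b) ^ S k <= 2 * (M * exp n)).
    { apply H. intros w Hw. specialize (HM w). rewrite Hw in HM.
      replace (b * (n / b)) with n in HM by (field; lra). auto. }
    unfold Rdiv in H'. rewrite Rpow_mult_distr, pow_inv in H'.
    assert (Hbk : 0 < b ^ S k) by (apply pow_lt; auto). assert (Hnk : 0 < n ^ S k) by (apply pow_lt; auto).
    pose proof (fact_exp_bound k) as HF. fold n in HF.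
    assert (H2 : Cmod (c (S k)) <= 2 * M * exp n * b ^ S k / n ^ S k).
    { apply Rmult_le_reg_r with (n ^ S k * / b ^ S k); [apply Rmult_lt_0_compat; auto; apply Rinv_0_lt_compat; auto|].
      eapply Rle_trans; [apply H'|]. right. field. lra. }
    apply Rle_trans with (INR (fact (S k)) * (2 * M * exp n * b ^ S k / n ^ S k)).
    + apply Rmult_le_compat_l; auto. apply pos_INR.
    + replace (INR (fact (S k)) * (2 * M * exp n * b ^ S k / n ^ S k)) with
        ((INR (fact (S k)) * exp n) * (2 * M * b ^ S k / n ^ S k)) by (field; lra).
      apply Rle_trans with ((exp 1 * n * n ^ S k) * (2 * M * b ^ S k / n ^ S k)).
      * apply Rmult_le_compat_r; auto. apply Rmult_le_pos; [|left; apply Rinv_0_lt_compat; auto].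
        apply Rmult_le_pos; lra.
      * replace ((exp 1 * n * n ^ S k) * (2 * M * b ^ S k / n ^ S k)) with (2 * M * exp 1 * n * b ^ S k) by (field; lra).
        rewrite (S_INR (S k)). fold n. assert (0 <= 2 * M * exp 1 * b ^ S k).
        { apply Rmult_le_pos; [|lra]. apply Rmult_le_pos; lra. } nra.
Qed.

(** The quantity (k + 1) q^k is at most 1 + q + ... + q^k. This absorbs the linear loss of Cauchy's
    estimate into a slightly larger exponential type. *)
Lemma INR_pow_bounded (q : R) : 0 <= q < 1 -> exists K, 0 <= K /\ forall k, INR (S k) * q ^ k <= K.
Proof.
  intros Hq.
  exists (/ (1 - q)). split; [left; apply Rinv_0_lt_compat; lra|]. intros k.
  assert (H : forall k, INR (S k) * q ^ k * (1 - q) <= 1 - q ^ S k).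
  { clear k. induction k as [|k IH].
    - simpl. lra.
    - rewrite S_INR. simpl pow in *. assert (0 <= q ^ k) by (apply pow_le; lra).
      assert (q ^ k <= 1). { replace 1 with (1 ^ k) by apply pow1. apply pow_incr; lra. }
      pose proof (pos_INR (S k)).
      assert (INR (S k) * q ^ k * (1 - q) * q <= (1 - q * q ^ k) * q) by (apply Rmult_le_compat_r; lra).
      assert (q * q ^ k <= 1) by nra.
      assert (q * q ^ k * (1 - q) <= 1 * (1 - q)) by (apply Rmult_le_compat_r; lra).
      lra. }
  specialize (H k). assert (0 <= q ^ S k) by (apply pow_le; lra).
  apply Rmult_le_reg_r with (1 - q); [lra|]. rewrite Rinv_l by lra. lra.
Qed.

Lemma norm_E_finite (b : R) (f : C -> C) (N : R) :
  (forall k, Cmod (C_derive_n f k (RtoC 0)) / b ^ k <= N) -> Rbar_lt (norm_E b f) p_infty.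
Proof.
  intros H. unfold norm_E. set (v := fun k => Finite (Cmod (C_derive_n f k (RtoC 0)) / b ^ k)).
  pose proof (Sup_seq_correct v) as HS. destruct (Sup_seq v) as [s| |]; simpl; auto.
  destruct (HS N) as [n Hn]. simpl in Hn. specialize (H n). lra.
Qed.

Lemma norm_E_bound (b : R) (f : C -> C) : Rbar_lt (norm_E b f) p_infty ->
  exists N, forall k, Cmod (C_derive_n f k (RtoC 0)) / b ^ k <= N.
Proof.
  unfold norm_E. set (v := fun k => Finite (Cmod (C_derive_n f k (RtoC 0)) / b ^ k)).
  pose proof (Sup_seq_correct v) as HS. destruct (Sup_seq v) as [s| |]; simpl; intros Hlt; try tauto.
  - exists (s + 1). intros k. destruct (HS (mkposreal 1 Rlt_0_1)) as [H _]. specialize (H k). simpl in H. lra.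
  - exists 0. intros k. specialize (HS 0 k). simpl in HS. lra.
Qed.

Lemma cps_space_A (a : R) (c : nat -> C) : 0 <= a -> fastc c ->
  (forall b, a < b -> exists M, forall z, Cmod (cps c z) <= M * exp (b * Cmod z)) -> space_A a (cps c).
Proof.
  intros Ha Hc H. split; [apply cps_entire; auto|]. intros B HB.
  (* A type strictly between a and B leaves the ratio b / B < 1 to absorb the factor k + 1. *)
  set (b := (a + B) / 2). destruct (H b ltac:(unfold b; lra)) as [M HM].
  assert (Hb : 0 < b) by (unfold b; lra).
  pose proof (exp_type_coef c b M Hb Hc HM) as HC.
  assert (Hq : 0 <= b / B < 1).
  { split; [left; apply Rdiv_lt_0_compat; lra|]. apply Rmult_lt_reg_r with B; [lra|].
    unfold Rdiv. rewrite Rmult_assoc, Rinv_l by lra. unfold b; lra. }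
  destruct (INR_pow_bounded (b / B) Hq) as (K & HK0 & HK).
  assert (HM0 : 0 <= M).
  { specialize (HM 0). pose proof (Cmod_ge_0 (cps c 0)). rewrite Cmod_0, Rmult_0_r, exp_0 in *. lra. }
  apply norm_E_finite with (2 * M * exp 1 * K). intros k.
  rewrite C_derive_n_cps_0, Cmod_mult, Cmod_RtoC_nonneg by (auto; apply pos_INR).
  assert (0 < B ^ k) by (apply pow_lt; lra). pose proof (exp_pos 1).
  apply Rle_trans with (2 * M * exp 1 * INR (S k) * b ^ k / B ^ k).
  - apply Rmult_le_compat_r; [left; apply Rinv_0_lt_compat; auto|]. apply HC.
  - replace (2 * M * exp 1 * INR (S k) * b ^ k / B ^ k) with (2 * M * exp 1 * (INR (S k) * (b / B) ^ k)).
    + apply Rmult_le_compat_l; auto. apply Rmult_le_pos; lra.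
    + unfold Rdiv. rewrite Rpow_mult_distr, pow_inv. ring.
Qed.

Lemma space_A_cps (a : R) (f : C -> C) : space_A a f -> exists c, fastc c /\ f = cps c /\
  forall b, a < b -> 0 < b -> exists N, forall k, INR (fact k) * Cmod (c k) <= N * b ^ k.
Proof.
  intros [Hf Hn]. destruct (entire_taylor f Hf) as [Hc E].
  exists (tcoef f). split; auto. split; auto. intros b Hab Hb.
  destruct (norm_E_bound b f (Hn b Hab)) as [N HN]. exists N. intros k. specialize (HN k).
  rewrite E in HN. rewrite C_derive_n_cps_0, Cmod_mult, Cmod_RtoC_nonneg in HN by (auto; apply pos_INR).
  assert (Hp : 0 < b ^ k) by (apply pow_lt; auto).
  apply Rmult_le_reg_r with (/ b ^ k); [apply Rinv_0_lt_compat; auto|].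
  rewrite Rmult_assoc, (Rmult_assoc N), Rinv_r, Rmult_1_r, <- Rmult_assoc by lra. exact HN.
Qed.

Lemma term_le_Series (v : nat -> R) (k : nat) : (forall n, 0 <= v n) -> ex_series v -> v k <= Series v.
Proof.
  revert v. induction k as [|k IH]; intros v Hp Hex; rewrite Series_incr_1 by auto;
    assert (Hex' : ex_series (fun k => v (S k))) by (apply (ex_series_incr_1 (V := R_NormedModule) v); auto).
  - assert (0 <= Series (fun k => v (S k))); [|lra]. apply Series_nonneg; auto.
  - specialize (IH (fun k => v (S k)) (fun n => Hp (S n)) Hex'). specialize (Hp O). simpl in IH. lra.
Qed.

Lemma fact_coef_fastc (c : nat -> C) (b N : R) : 0 <= b ->
  (forall k, INR (fact k) * Cmod (c k) <= N * b ^ k) ->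
  fastc c /\ forall z, Cmod (cps c z) <= N * exp (b * Cmod z).
Proof.
  intros Hb H.
  assert (HN : 0 <= N). { specialize (H O). simpl in H. pose proof (Cmod_ge_0 (c O)). lra. }
  assert (Hk : forall k, Cmod (c k) <= N * b ^ k / INR (fact k)).
  { intros k. pose proof (INR_fact_lt_0 k). apply Rmult_le_reg_l with (INR (fact k)); auto.
    eapply Rle_trans; [apply H|]. right. field. lra. }
  assert (HE : forall x, is_series (fun k => N * ((b * x) ^ k / INR (fact k))) (N * exp (b * x))).
  { intros x. apply (is_series_scal (V := R_NormedModule) N).
    pose proof (is_exp_Reals (b * x)) as HP. apply is_pseries_R in HP.
    eapply is_series_ext; [|apply HP]. intros n. simpl. unfold Rdiv. ring. }
  assert (Hterm : forall k x, 0 <= x -> Cmod (c k) * x ^ k <= N * ((b * x) ^ k / INR (fact k))).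
  { intros k x Hx. rewrite Rpow_mult_distr.
    replace (N * (b ^ k * x ^ k / INR (fact k))) with (N * b ^ k / INR (fact k) * x ^ k) by (unfold Rdiv; ring).
    apply Rmult_le_compat_r; auto. apply pow_le; auto. }
  assert (Hpos : forall k x, 0 <= x -> 0 <= Cmod (c k) * x ^ k).
  { intros. apply Rmult_le_pos; [apply Cmod_ge_0|apply pow_le; auto]. }
  assert (Hf : fastc c).
  { intros r Hr. exists (N * exp (b * r)). intros k. eapply Rle_trans; [apply Hterm; lra|].
    pose proof (HE r) as HS.
    assert (Hp : forall n, 0 <= N * ((b * r) ^ n / INR (fact n))).
    { intros n. eapply Rle_trans; [apply (Hpos n r); lra|apply Hterm; lra]. }
    rewrite <- (is_series_unique _ _ HS).
    assert (Hex : ex_series (fun k => N * ((b * r) ^ k / INR (fact k)))) by (eexists; apply HS).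
    apply (term_le_Series (fun n => N * ((b * r) ^ n / INR (fact n)))); auto. }
  split; auto. intros z. pose proof (Cmod_ge_0 z).
  rewrite <- (is_series_unique _ _ (HE (Cmod z))).
  apply Cser_le; [|eexists; apply HE].
  intros k. rewrite Cmod_mult, Cmod_pow. apply Hterm; auto.
Qed.

(** * The heat semigroup on Taylor coefficients *)

(** The rising factorial (x)_m. In the coordinates [d k = k! c k], the power Delta_theta^m is a
    shift by m with the factor (theta + k)_m. *)
Fixpoint poch (x : R) (m : nat) : R :=
  match m with O => 1 | S m => poch x m * (x + INR m) end.

Lemma poch_shift (x : R) (m : nat) : poch x (S m) = x * poch (x + 1) m.
Proof.
  induction m as [|m IH]; [simpl; ring|].
  change (poch x (S (S m))) with (poch x (S m) * (x + INR (S m))).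
  rewrite IH, S_INR. simpl. ring.
Qed.

Lemma poch_nonneg (x : R) (m : nat) : 0 <= x -> 0 <= poch x m.
Proof.
  intros Hx. induction m as [|m IH]; simpl; [lra|]. apply Rmult_le_pos; auto.
  pose proof (pos_INR m). lra.
Qed.

Lemma poch_le (x y : R) (m : nat) : 0 <= x <= y -> poch x m <= poch y m.
Proof.
  intros Hx. induction m as [|m IH]; simpl; [lra|]. pose proof (pos_INR m).
  apply Rmult_le_compat; auto; [apply poch_nonneg; lra|lra|lra].
Qed.

Lemma INR_fact_S (m : nat) : INR (fact (S m)) = (INR m + 1) * INR (fact m).
Proof. change (fact (S m)) with (S m * fact m)%nat. rewrite mult_INR, S_INR. auto. Qed.

(** Multiplying the partial sum for exponent n + 1 by 1 - y gives the one for n minus a nonnegative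
    boundary term, so induction on n bounds every partial sum by (1 - y)^(-n). *)
Lemma binomial_partial (y : R) (n M : nat) : 0 <= y < 1 ->
  sum_n (fun m => poch (INR n) m / INR (fact m) * y ^ m) M * (1 - y) ^ n <= 1.
Proof.
  intros Hy. induction n as [|n IH].
  - assert (E : sum_n (fun m => poch (INR 0) m / INR (fact m) * y ^ m) M = 1).
    { induction M as [|M IH]; [rewrite sum_O; simpl; field|].
      rewrite sum_Sn, IH. rewrite poch_shift. simpl INR. rewrite Rmult_0_l.
      unfold plus; simpl. unfold Rdiv. ring. }
    rewrite E. simpl. lra.
  - eapply Rle_trans; [|apply IH]. simpl pow. rewrite <- Rmult_assoc.
    apply Rmult_le_compat_r; [apply pow_le; lra|].
    assert (E : forall M, sum_n (fun m => poch (INR (S n)) m / INR (fact m) * y ^ m) M * (1 - y) =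
      sum_n (fun m => poch (INR n) m / INR (fact m) * y ^ m) M - poch (INR (S n)) M / INR (fact M) * y ^ S M).
    { clear M IH. induction M as [|M IHM].
      - rewrite !sum_O. simpl. field.
      - rewrite !sum_Sn.
        change ((sum_n (fun m => poch (INR (S n)) m / INR (fact m) * y ^ m) M + poch (INR (S n)) (S M) / INR (fact (S M)) * y ^ S M) * (1 - y) =
          sum_n (fun m => poch (INR n) m / INR (fact m) * y ^ m) M + poch (INR n) (S M) / INR (fact (S M)) * y ^ S M
          - poch (INR (S n)) (S M) / INR (fact (S M)) * y ^ S (S M)).
        rewrite Rmult_plus_distr_r, IHM.
        rewrite (poch_shift (INR n)). change (poch (INR (S n)) (S M)) with (poch (INR (S n)) M * (INR (S n) + INR M)).
        rewrite !INR_fact_S, !S_INR.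
        pose proof (INR_fact_neq_0 M). pose proof (pos_INR M). simpl pow. field. lra. }
    rewrite E. assert (0 <= poch (INR (S n)) M / INR (fact M) * y ^ S M); [|lra].
    apply Rmult_le_pos; [|apply pow_le; lra]. apply Rmult_le_pos; [apply poch_nonneg, pos_INR|].
    left. apply Rinv_0_lt_compat, INR_fact_lt_0.
Qed.

Lemma bounded_series (v : nat -> R) (B : R) : (forall k, 0 <= v k) -> (forall n, sum_n v n <= B) ->
  ex_series v /\ Series v <= B.
Proof.
  intros Hv HB.
  destruct (ex_finite_lim_seq_incr (sum_n v) B) as [l Hl]; auto.
  { intros n. rewrite sum_Sn. change (sum_n v n <= sum_n v n + v (S n)). specialize (Hv (S n)). lra. }
  split; [exists l; exact Hl|].
  rewrite (is_series_unique v l Hl).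
  assert (H : Rbar_le l B); [|exact H].
  apply (is_lim_seq_le (sum_n v) (fun _ => B)); auto. apply is_lim_seq_const.
Qed.

(** The exponent is rounded up to an integer. For x = theta + k and n = T + k the majorant has a
    factor Q^T independent of k, so the exponential type is not enlarged. *)
Lemma binomial_series (x y : R) (n : nat) : 0 <= x <= INR n -> 0 <= y < 1 ->
  ex_series (fun m => poch x m / INR (fact m) * y ^ m) /\
  Series (fun m => poch x m / INR (fact m) * y ^ m) <= (/ (1 - y)) ^ n.
Proof.
  intros Hx Hy.
  assert (Hp : 0 < (1 - y) ^ n) by (apply pow_lt; lra).
  assert (Hf : forall m, 0 < / INR (fact m)) by (intros; apply Rinv_0_lt_compat, INR_fact_lt_0).
  assert (Hym : forall m, 0 <= y ^ m) by (intros; apply pow_le; lra).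
  assert (H0 : forall z m, 0 <= z -> 0 <= poch z m / INR (fact m) * y ^ m).
  { intros z m Hz. apply Rmult_le_pos; auto. apply Rmult_le_pos; [apply poch_nonneg; auto|]. specialize (Hf m). lra. }
  destruct (bounded_series (fun m => poch (INR n) m / INR (fact m) * y ^ m) ((/ (1 - y)) ^ n)) as [E1 E2].
  - intros m. apply H0. apply pos_INR.
  - intros M. apply Rmult_le_reg_r with ((1 - y) ^ n); auto.
    rewrite pow_inv, Rinv_l by lra. apply binomial_partial; auto.
  - assert (Hle : forall m, 0 <= poch x m / INR (fact m) * y ^ m <= poch (INR n) m / INR (fact m) * y ^ m).
    { intros m. split; [apply H0; lra|]. apply Rmult_le_compat_r; auto. specialize (Hf m).
      apply Rmult_le_compat_r; [lra|]. apply poch_le; auto. }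
    split; [apply ex_series_nonneg_le with (1 := Hle); exact E1|].
    eapply Rle_trans; [|exact E2]. apply Series_le; auto.
Qed.

(* In the coordinates [d k = k! c k] the operator [Delta_theta] sends [d] to
   [(theta + k) d (k + 1)], so this is [sum_m A m Delta_theta^m]. *)
Definition delta_series (A : nat -> R) (theta : R) (d : nat -> C) (k : nat) : C :=
  Cser (fun m => RtoC (A m * poch (theta + INR k) m) * d (k + m)%nat)%C.

Section Semigroup.
Variables (theta b N rho : R) (T : nat).
Hypothesis Htheta : 0 <= theta <= INR T.
Hypothesis Hb : 0 <= b.
Hypothesis Hrho : 0 <= rho.
Hypothesis Hrb : rho * b < 1.

Let Q := / (1 - rho * b).

Lemma Q_ge_1 : 1 <= Q.
Proof.
  unfold Q. assert (0 <= rho * b) by (apply Rmult_le_pos; auto).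
  replace 1 with (/ 1) by field. apply Rinv_le_contravar; lra.
Qed.

Lemma theta_plus_index (k : nat) : 0 <= theta + INR k <= INR (T + k).
Proof. rewrite plus_INR. pose proof (pos_INR k). lra. Qed.

Lemma rho_b_range : 0 <= rho * b < 1.
Proof. split; auto. apply Rmult_le_pos; auto. Qed.

Lemma delta_series_term (A : nat -> R) (d : nat -> C) (k m : nat) :
  (forall m, Rabs (A m) <= rho ^ m / INR (fact m)) -> (forall k, Cmod (d k) <= N * b ^ k) ->
  Cmod (RtoC (A m * poch (theta + INR k) m) * d (k + m)%nat) <=
  N * b ^ k * (poch (theta + INR k) m / INR (fact m) * (rho * b) ^ m).
Proof.
  intros HA Hd. rewrite Cmod_mult, Cmod_R, Rabs_mult.
  pose proof (poch_nonneg (theta + INR k) m (proj1 (theta_plus_index k))) as Hp.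
  rewrite (Rabs_right (poch _ _)) by lra.
  replace (N * b ^ k * (poch (theta + INR k) m / INR (fact m) * (rho * b) ^ m)) with
    (rho ^ m / INR (fact m) * poch (theta + INR k) m * (N * b ^ (k + m))).
  - apply Rmult_le_compat; auto using Cmod_ge_0.
    + apply Rmult_le_pos; auto using Rabs_pos.
    + apply Rmult_le_compat_r; auto.
  - rewrite pow_add, Rpow_mult_distr. unfold Rdiv. ring.
Qed.

Lemma delta_series_asum (A : nat -> R) (d : nat -> C) (k : nat) :
  (forall m, Rabs (A m) <= rho ^ m / INR (fact m)) -> (forall k, Cmod (d k) <= N * b ^ k) ->
  asum (fun m => RtoC (A m * poch (theta + INR k) m) * d (k + m)%nat)%C.
Proof.
  intros HA Hd. eapply asum_le; [intros m; apply delta_series_term; auto|].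
  apply (ex_series_scal (V := R_NormedModule)). eapply binomial_series; [apply theta_plus_index|apply rho_b_range].
Qed.

(** The binomial series contributes Q^(T + k), and its k-dependent part turns b^k into (b Q)^k. This
    is how the type b becomes b / (1 - rho b), for all weights dominated by rho^m / m!. *)
Lemma delta_series_bound (A : nat -> R) (d : nat -> C) (k : nat) :
  (forall m, Rabs (A m) <= rho ^ m / INR (fact m)) -> (forall k, Cmod (d k) <= N * b ^ k) ->
  Cmod (delta_series A theta d k) <= N * Q ^ T * (b * Q) ^ k.
Proof.
  intros HA Hd. destruct (binomial_series _ _ _ (theta_plus_index k) rho_b_range) as [E1 E2].
  assert (HN : 0 <= N). { specialize (Hd O). simpl in Hd. pose proof (Cmod_ge_0 (d O)). lra. }
  unfold delta_series. eapply Rle_trans; [apply Cser_le; [intros m; apply delta_series_term; auto|]|].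
  - apply (ex_series_scal (V := R_NormedModule)); auto.
  - rewrite Series_scal_l. fold Q in E2. rewrite pow_add in E2. rewrite Rpow_mult_distr.
    replace (N * Q ^ T * (b ^ k * Q ^ k)) with (N * b ^ k * (Q ^ T * Q ^ k)) by ring.
    apply Rmult_le_compat_l; auto. apply Rmult_le_pos; auto. apply pow_le; auto.
Qed.

Lemma heat_power_bound (r m_ : R) (m : nat) : Rabs r <= rho ->
  Rabs (r ^ m / INR (fact m)) <= rho ^ m / INR (fact m).
Proof.
  intros Hr. pose proof (INR_fact_lt_0 m). unfold Rdiv. rewrite Rabs_mult, (Rabs_right (/ _)).
  - apply Rmult_le_compat_r; [left; apply Rinv_0_lt_compat; auto|].
    rewrite <- RPow_abs. apply pow_incr. split; auto. apply Rabs_pos.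
  - apply Rle_ge. left. apply Rinv_0_lt_compat; auto.
Qed.

Lemma pow_taylor2_R (r h : R) (j : nat) : Rabs r <= rho -> Rabs (r + h) <= rho ->
  Rabs ((r + h) ^ (S (S j)) - r ^ (S (S j)) - INR (S (S j)) * h * r ^ (S j)) <=
  h ^ 2 * (INR (S (S j)) * INR (S j) * rho ^ j).
Proof.
  intros Hr Hh. induction j as [|j IH].
  - simpl. replace ((r + h) * ((r + h) * 1) - r * (r * 1) - (1 + 1) * h * (r * 1)) with (h ^ 2) by ring.
    rewrite Rabs_right by (apply Rle_ge, pow2_ge_0). pose proof (pow2_ge_0 h). simpl in *. lra.
  - replace ((r + h) ^ S (S (S j)) - r ^ S (S (S j)) - INR (S (S (S j))) * h * r ^ S (S j)) with
      ((r + h) * ((r + h) ^ (S (S j)) - r ^ (S (S j)) - INR (S (S j)) * h * r ^ (S j)) +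
       INR (S (S j)) * h ^ 2 * r ^ (S j)) by (rewrite (S_INR (S (S j))); simpl pow; ring).
    eapply Rle_trans; [apply Rabs_triang|]. rewrite !Rabs_mult.
    rewrite (Rabs_right (INR _)) by (apply Rle_ge, pos_INR).
    rewrite (Rabs_right (h ^ 2)) by (apply Rle_ge, pow2_ge_0).
    assert (Hrj : Rabs (r ^ S j) <= rho ^ S j).
    { rewrite <- RPow_abs. apply pow_incr. split; auto. apply Rabs_pos. }
    set (n := INR (S (S j))) in *. assert (Hn : 0 <= n) by apply pos_INR.
    assert (E1 : INR (S (S (S j))) = n + 1) by apply S_INR.
    assert (E2 : n = INR (S j) + 1) by apply S_INR.
    rewrite E1. replace (INR (S j)) with (n - 1) in IH by lra.
    pose proof (pow2_ge_0 h) as Hh2. assert (Hrp : 0 <= rho ^ S j) by (apply pow_le; auto).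
    assert (B1 : Rabs (r + h) * Rabs ((r + h) ^ (S (S j)) - r ^ (S (S j)) - n * h * r ^ (S j)) <=
       rho * (h ^ 2 * (n * (n - 1) * rho ^ j))).
    { apply Rmult_le_compat; auto using Rabs_pos. }
    assert (B2 : n * h ^ 2 * Rabs (r ^ S j) <= n * h ^ 2 * rho ^ S j).
    { apply Rmult_le_compat_l; auto. apply Rmult_le_pos; auto. }
    replace (rho * (h ^ 2 * (n * (n - 1) * rho ^ j))) with (h ^ 2 * rho ^ S j * (n * n) - n * h ^ 2 * rho ^ S j) in B1 by (simpl; ring).
    replace (h ^ 2 * ((n + 1) * n * rho ^ S j)) with (h ^ 2 * rho ^ S j * (n * n) + h ^ 2 * rho ^ S j * n) by ring.
    assert (0 <= h ^ 2 * rho ^ S j * n) by (apply Rmult_le_pos; auto; apply Rmult_le_pos; auto).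
    lra.
Qed.

Definition heat_weight (r : R) (m : nat) : R := r ^ m / INR (fact m).

Lemma heat_weight_bound (r : R) (m : nat) : Rabs r <= rho -> Rabs (heat_weight r m) <= rho ^ m / INR (fact m).
Proof. apply heat_power_bound. exact 0. Qed.

(** Since the derivative of r^(m + 1) / (m + 1)! is r^m / m!, the derivative of coordinate k is
    theta + k times coordinate k + 1. The quadratic remainder keeps the exact dependence on k needed
    for summing over k. *)
Lemma delta_series_taylor (d : nat -> C) (k : nat) (r h : R) : (forall k, Cmod (d k) <= N * b ^ k) ->
  Rabs r <= rho -> Rabs (r + h) <= rho ->
  Cmod (delta_series (heat_weight (r + h)) theta d k - delta_series (heat_weight r) theta d k -
     RtoC h * (RtoC (theta + INR k) * delta_series (heat_weight r) theta d (S k))) <=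
  h ^ 2 * (N * Q ^ T * ((INR (T + k) * (INR (T + k) + 1)) * (b * Q) ^ (S (S k)))).
Proof.
  intros Hd Hr Hh.
  assert (HN : 0 <= N). { specialize (Hd O). simpl in Hd. pose proof (Cmod_ge_0 (d O)). lra. }
  assert (HA1 := fun m => heat_weight_bound (r + h) m Hh). assert (HA2 := fun m => heat_weight_bound r m Hr).
  pose proof (delta_series_asum _ d k HA1 Hd) as S1. pose proof (delta_series_asum _ d k HA2 Hd) as S2.
  pose proof (delta_series_asum _ d (S k) HA2 Hd) as S3.
  set (x := theta + INR k) in *. assert (Hx : 0 <= x) by apply theta_plus_index.
  set (e := fun m => (RtoC (poch x m) * d (k + m)%nat)%C).
  assert (E3 : (RtoC x * delta_series (heat_weight r) theta d (S k))%C = Cser (fun m => RtoC (heat_weight r m) * e (S m))%C).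
  { unfold delta_series. rewrite <- Cser_scal by auto. apply Cser_ext. intros m. unfold e.
    replace (S k + m)%nat with (k + S m)%nat by lia. rewrite poch_shift.
    replace (theta + INR (S k)) with (x + 1) by (unfold x; rewrite S_INR; ring).
    rewrite !RtoC_mult. ring. }
  assert (S3' : asum (fun m => RtoC (heat_weight r m) * e (S m))%C).
  { eapply asum_ext; [|apply (asum_scal (RtoC x) _ S3)]. intros m. unfold e. simpl.
    replace (S (k + m))%nat with (k + S m)%nat by lia.
    change (poch x m * (x + INR m)) with (poch x (S m)). rewrite poch_shift.
    replace (theta + INR (S k)) with (x + 1) by (unfold x; rewrite S_INR; ring).
    replace (theta + match k with O => 1 | S _ => INR k + 1 end) with (x + 1) by (change (match k with O => 1 | S _ => INR k + 1 end) with (INR (S k)); unfold x; rewrite S_INR; ring).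
    rewrite !RtoC_mult. ring. }
  assert (S1' : asum (fun m => RtoC (heat_weight (r + h) m) * e m)%C).
  { eapply asum_ext; [|apply S1]. intros m. unfold e. rewrite RtoC_mult. ring. }
  assert (S2' : asum (fun m => RtoC (heat_weight r m) * e m)%C).
  { eapply asum_ext; [|apply S2]. intros m. unfold e. rewrite RtoC_mult. ring. }
  (* The terms m = 0 and m = 1 cancel. From m = 2 on, (x)_(j + 2) = x (x + 1) (x + 2)_j produces the
     factor quadratic in k and shifts the exponent of Q by two. *)
  assert (EE : (delta_series (heat_weight (r + h)) theta d k - delta_series (heat_weight r) theta d k -
     RtoC h * (RtoC x * delta_series (heat_weight r) theta d (S k)))%C =
     Cser (fun j => RtoC (heat_weight (r + h) (S (S j)) - heat_weight r (S (S j)) - h * heat_weight r (S j)) * e (S (S j)))%C).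
  { rewrite E3.
    replace (delta_series (heat_weight (r + h)) theta d k) with (Cser (fun m => RtoC (heat_weight (r + h) m) * e m)%C)
      by (apply Cser_ext; intros m; unfold e; fold x; rewrite RtoC_mult; ring).
    replace (delta_series (heat_weight r) theta d k) with (Cser (fun m => RtoC (heat_weight r m) * e m)%C)
      by (apply Cser_ext; intros m; unfold e; fold x; rewrite RtoC_mult; ring).
    rewrite (Cser_incr (fun m => RtoC (heat_weight (r + h) m) * e m)%C) by auto.
    rewrite (Cser_incr (fun m => RtoC (heat_weight (r + h) (S m)) * e (S m))%C) by (apply (asum_incr _ S1')).
    rewrite (Cser_incr (fun m => RtoC (heat_weight r m) * e m)%C) by auto.
    rewrite (Cser_incr (fun m => RtoC (heat_weight r (S m)) * e (S m))%C) by (apply (asum_incr _ S2')).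
    rewrite (Cser_incr (fun m => RtoC (heat_weight r m) * e (S m))%C) by auto.
    pose proof (asum_incr _ (asum_incr _ S1')) as T1. pose proof (asum_incr _ (asum_incr _ S2')) as T2.
    pose proof (asum_incr _ S3') as T3.
    rewrite (Cser_ext (fun j => RtoC (heat_weight (r + h) (S (S j)) - heat_weight r (S (S j)) - h * heat_weight r (S j)) * e (S (S j)))%C
      (fun j => (RtoC (heat_weight (r + h) (S (S j))) * e (S (S j)) - RtoC (heat_weight r (S (S j))) * e (S (S j))) -
        RtoC h * (RtoC (heat_weight r (S j)) * e (S (S j))))%C)
      by (intros; rewrite !RtoC_minus, RtoC_mult; ring).
    rewrite Cser_minus, Cser_minus, Cser_scal; auto; [|apply asum_minus; auto|apply asum_scal; auto].
    unfold heat_weight at 1 2 4 5 7. simpl pow. simpl fact. simpl INR.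
    rewrite !Rmult_1_r, !Rdiv_1_r. rewrite !RtoC_plus. ring. }
  rewrite EE.
  assert (Hx2 : 0 <= x + 2 <= INR (T + k + 2)).
  { rewrite plus_INR. simpl (INR 2). destruct (theta_plus_index k) as [_ Hk]. fold x in Hk. lra. }
  destruct (binomial_series _ _ _ Hx2 rho_b_range) as [F1 F2].
  eapply Rle_trans.
  - apply Cser_le with (b := fun j => h ^ 2 * (N * b ^ (S (S k)) * (x * (x + 1))) *
      (poch (x + 2) j / INR (fact j) * (rho * b) ^ j)).
    + intros j. unfold e. rewrite !Cmod_mult, !Cmod_R.
      pose proof (INR_fact_lt_0 j) as Hfj. pose proof (INR_fact_lt_0 (S (S j))) as Hfj2.
      assert (P1 : Rabs (heat_weight (r + h) (S (S j)) - heat_weight r (S (S j)) - h * heat_weight r (S j)) <= h ^ 2 * (rho ^ j / INR (fact j))).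
      { replace (heat_weight (r + h) (S (S j)) - heat_weight r (S (S j)) - h * heat_weight r (S j)) with
          (((r + h) ^ (S (S j)) - r ^ (S (S j)) - INR (S (S j)) * h * r ^ (S j)) / INR (fact (S (S j)))).
        - unfold Rdiv. rewrite Rabs_mult, (Rabs_right (/ _)) by (left; apply Rinv_0_lt_compat; auto).
          replace (h ^ 2 * (rho ^ j * / INR (fact j))) with
            (h ^ 2 * (INR (S (S j)) * INR (S j) * rho ^ j) * / INR (fact (S (S j)))).
          + apply Rmult_le_compat_r; [left; apply Rinv_0_lt_compat; auto|]. apply pow_taylor2_R; auto.
          + rewrite !INR_fact_S, !S_INR. pose proof (pos_INR j). field. lra.
        - unfold heat_weight. rewrite (INR_fact_S (S j)). rewrite (S_INR (S j)). pose proof (pos_INR (S j)).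
          pose proof (INR_fact_lt_0 (S j)). field. lra. }
      assert (Pp : poch x (S (S j)) = x * (x + 1) * poch (x + 2) j).
      { rewrite poch_shift, poch_shift. replace (x + 1 + 1) with (x + 2) by ring. ring. }
      rewrite (Rabs_right (poch _ _)) by (apply Rle_ge, poch_nonneg; auto).
      rewrite Pp. assert (Hp2 : 0 <= poch (x + 2) j) by (apply poch_nonneg; lra).
      replace (h ^ 2 * (N * b ^ S (S k) * (x * (x + 1))) * (poch (x + 2) j / INR (fact j) * (rho * b) ^ j)) with
        (h ^ 2 * (rho ^ j / INR (fact j)) * ((x * (x + 1) * poch (x + 2) j) * (N * b ^ (k + S (S j))))).
      * apply Rmult_le_compat; auto using Rabs_pos.
        { apply Rmult_le_pos; [|apply Cmod_ge_0]. apply Rmult_le_pos; auto. apply Rmult_le_pos; lra. }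
        apply Rmult_le_compat_l; auto. apply Rmult_le_pos; auto. apply Rmult_le_pos; lra.
      * replace (k + S (S j))%nat with (S (S k) + j)%nat by lia. rewrite pow_add, Rpow_mult_distr.
        unfold Rdiv. ring.
    + apply (ex_series_scal (V := R_NormedModule)); auto.
  - rewrite Series_scal_l. rewrite Rmult_assoc. pose proof (pow2_ge_0 h) as Hh2.
    apply Rmult_le_compat_l; auto.
    fold Q in F2. replace (T + k + 2)%nat with (T + S (S k))%nat in F2 by lia. rewrite pow_add in F2.
    rewrite Rpow_mult_distr.
    destruct (theta_plus_index k) as [_ Hk]. fold x in Hk.
    assert (Hbk : 0 <= N * b ^ S (S k)) by (apply Rmult_le_pos; auto; apply pow_le; auto).
    replace (N * Q ^ T * (INR (T + k) * (INR (T + k) + 1) * (b ^ S (S k) * Q ^ S (S k)))) with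
      (N * b ^ S (S k) * (INR (T + k) * (INR (T + k) + 1)) * (Q ^ T * Q ^ S (S k))) by ring.
    apply Rmult_le_compat; auto.
    + apply Rmult_le_pos; auto. apply Rmult_le_pos; lra.
    + apply Series_nonneg; auto. intros j. apply Rmult_le_pos; [|apply pow_le, rho_b_range].
      apply Rmult_le_pos; [apply poch_nonneg; lra|]. left. apply Rinv_0_lt_compat, INR_fact_lt_0.
    + apply Rmult_le_compat_l; auto. apply Rmult_le_compat; lra.
Qed.
End Semigroup.

Lemma Delta_cps (theta : R) (c : nat -> C) (z : C) : fastc c ->
  Defs.Delta theta (cps c) z = cps (fun k => RtoC ((theta + INR k) * INR (S k)) * c (S k))%C z.
Proof.
  intros Hc. unfold Defs.Delta. rewrite !C_derive_n_cps by auto. simpl Nat.iter.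
  pose proof (fastc_dc c Hc) as H1. pose proof (fastc_dc _ H1) as H2.
  unfold cps.
  pose proof (cps_asum _ z H1) as A1. pose proof (cps_asum _ z H2) as A2.
  rewrite <- Cser_scal by auto.
  assert (E2 : (z * Cser (fun k => dc (dc c) k * z ^ k))%C = Cser (fun k => RtoC (INR k) * (dc c k * z ^ k))%C).
  { rewrite <- Cser_scal by auto.
    assert (A3 : asum (fun k => RtoC (INR k) * (dc c k * z ^ k))%C).
    { unfold asum. apply ex_series_incr_1. eapply asum_ext; [|apply (asum_scal z _ A2)].
      intros k. unfold dc. simpl Cpow. ring. }
    rewrite (Cser_incr _ A3). simpl (INR 0).
    rewrite (Cser_ext (fun k => RtoC (INR (S k)) * (dc c (S k) * z ^ S k))%C (fun k => z * (dc (dc c) k * z ^ k))%C).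
    - ring.
    - intros k. unfold dc. simpl Cpow. ring. }
  rewrite E2.
  assert (A3 : asum (fun k => RtoC (INR k) * (dc c k * z ^ k))%C).
  { unfold asum. apply ex_series_incr_1. eapply asum_ext; [|apply (asum_scal z _ A2)].
    intros k. unfold dc. simpl Cpow. ring. }
  rewrite <- Cser_plus; auto; [|apply asum_scal; auto].
  apply Cser_ext. intros k. unfold dc. rewrite !RtoC_mult, RtoC_plus. ring.
Qed.

Lemma coef_space_A (a N : R) (c : nat -> C) : 0 <= a ->
  (forall k, INR (fact k) * Cmod (c k) <= N * a ^ k) -> space_A a (cps c).
Proof.
  intros Ha H. destruct (fact_coef_fastc c a N Ha H) as [Hc _].
  assert (HN : 0 <= N). { specialize (H O). simpl in H. pose proof (Cmod_ge_0 (c O)). lra. }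
  split; [apply cps_entire; auto|]. intros b Hb. apply norm_E_finite with N. intros k.
  rewrite C_derive_n_cps_0, Cmod_mult, Cmod_RtoC_nonneg by (auto; apply pos_INR).
  assert (Hbk : 0 < b ^ k) by (apply pow_lt; lra).
  assert (a ^ k <= b ^ k) by (apply pow_incr; lra).
  apply Rmult_le_reg_r with (b ^ k); auto. unfold Rdiv. rewrite Rmult_assoc, Rinv_l, Rmult_1_r by lra.
  eapply Rle_trans; [apply H|]. apply Rmult_le_compat_l; auto.
Qed.

Lemma norm_C_R (x : C) : @norm R_AbsRing C_R_NormedModule x = Cmod x.
Proof.
  destruct x as [x y]. change (sqrt (Rabs x ^ 2 + Rabs y ^ 2) = Cmod (x, y)).
  unfold Cmod. simpl fst. simpl snd. rewrite !pow2_abs. auto.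
Qed.

Lemma norm_time_remainder (u : R -> C) (s t : R) (l : C) :
  @norm R_AbsRing C_R_NormedModule (minus (minus (u s) (u t)) (scal (minus s t) l)) =
  Cmod (u s - u t - RtoC (s - t) * l).
Proof.
  rewrite norm_C_R. f_equal. destruct (u s) as [a1 a2], (u t) as [b1 b2], l as [l1 l2].
  unfold Cminus, Cplus, Copp, Cmult, RtoC; simpl. unfold minus, plus, opp, scal; simpl.
  unfold prod_plus, prod_opp, prod_scal; simpl. unfold plus, opp, scal; simpl. unfold mult; simpl.
  apply Re_Im_eq; unfold Re, Im; simpl; ring.
Qed.

Lemma quadratic_derive (u : R -> C) (t : R) (l : C) (K : R) : unit_time t ->
  (forall s, unit_time s -> Cmod (u s - u t - RtoC (s - t) * l) <= (s - t) ^ 2 * K) ->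
  is_derive_unit_time u t l.
Proof.
  intros Ht H. split.
  - apply (is_linear_scal_l (K := R_AbsRing) (V := C_R_NormedModule)).
  - intros x Hx.
    (* [filterdiff] quantifies over every limit point of the filter; separation of points of the
       line leaves only [t]. *)
    assert (Ext : x = t).
    { apply NNPP. intros Hne.
      assert (Hd : 0 < Rabs (x - t)) by (apply Rabs_pos_lt; lra).
      assert (HP : locally x (fun y => Rabs (y - x) < Rabs (x - t))).
      { exists (mkposreal _ Hd). intros y Hy. exact Hy. }
      apply Hx in HP. destruct HP as [e He]. specialize (He t (ball_center t e) Ht).
      rewrite Rabs_minus_sym in He. lra. }
    subst x. intros eps.
    assert (HK : 0 < Rabs K + 1) by (pose proof (Rabs_pos K); lra).
    assert (Hd : 0 < eps / (Rabs K + 1)) by (apply Rdiv_lt_0_compat; [apply cond_pos|auto]).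
    exists (mkposreal _ Hd). intros s Hs Hu.
    change (Rabs (s - t) < eps / (Rabs K + 1)) in Hs.
    change (@norm R_AbsRing C_R_NormedModule (minus (minus (u s) (u t)) (scal (minus s t) l)) <= eps * Rabs (s - t)).
    rewrite norm_time_remainder.
    eapply Rle_trans; [apply H; auto|].
    rewrite <- pow2_abs. pose proof (Rabs_pos (s - t)). pose proof (Rle_abs K).
    assert (Rabs (s - t) * (Rabs K + 1) <= eps).
    { apply Rmult_le_reg_r with (/ (Rabs K + 1)); [apply Rinv_0_lt_compat; auto|].
      rewrite Rmult_assoc, Rinv_r by lra. unfold Rdiv in Hs. lra. }
    assert (Rabs (s - t) ^ 2 * K <= Rabs (s - t) * (Rabs (s - t) * (Rabs K + 1))).
    { replace (Rabs (s - t) ^ 2 * K) with (Rabs (s - t) * (Rabs (s - t) * K)) by ring.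
      apply Rmult_le_compat_l; auto. apply Rmult_le_compat_l; lra. }
    nra.
Qed.

(** The Taylor coefficients of exp (r Delta_theta) applied to sum_k d_k z^k / k!, brought back from
    the coordinates d. *)
Definition heatc (theta : R) (d : nat -> C) (r : R) (k : nat) : C :=
  (RtoC (/ INR (fact k)) * delta_series (heat_weight r) theta d k)%C.

Lemma fact_inv_Cmod (k : nat) (x : C) :
  INR (fact k) * Cmod (RtoC (/ INR (fact k)) * x) = Cmod x.
Proof.
  pose proof (INR_fact_lt_0 k). rewrite Cmod_mult, Cmod_RtoC_nonneg; [field; lra|].
  left. apply Rinv_0_lt_compat; auto.
Qed.

Section Flow.
Variables (theta b N rho : R) (T : nat) (d : nat -> C).
Hypothesis Htheta : 0 <= theta <= INR T.
Hypothesis Hb : 0 <= b.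
Hypothesis Hrho : 0 <= rho.
Hypothesis Hrb : rho * b < 1.
Hypothesis Hd : forall k, Cmod (d k) <= N * b ^ k.

Let Q := / (1 - rho * b).

Lemma heatc_bound (r : R) (k : nat) : Rabs r <= rho ->
  INR (fact k) * Cmod (heatc theta d r k) <= N * Q ^ T * (b * Q) ^ k.
Proof.
  intros Hr. unfold heatc. rewrite fact_inv_Cmod. apply delta_series_bound; auto.
  intros m. apply heat_weight_bound; auto.
Qed.

Lemma bQ_nonneg : 0 <= b * Q.
Proof. apply Rmult_le_pos; auto. pose proof (Q_ge_1 b rho Hb Hrho Hrb). unfold Q. lra. Qed.

Lemma heatc_fastc (r : R) : Rabs r <= rho -> fastc (heatc theta d r).
Proof.
  intros Hr. apply (fact_coef_fastc _ (b * Q) (N * Q ^ T)); [apply bQ_nonneg|].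
  intros k. apply heatc_bound; auto.
Qed.

Lemma heat_growth (r : R) (z : C) : Rabs r <= rho ->
  Cmod (cps (heatc theta d r) z) <= N * Q ^ T * exp (b * Q * Cmod z).
Proof.
  intros Hr. apply (fact_coef_fastc _ (b * Q) (N * Q ^ T)); [apply bQ_nonneg|].
  intros k. apply heatc_bound; auto.
Qed.

Lemma heat_flow_taylor (z : C) : exists K, forall r h, Rabs r <= rho -> Rabs (r + h) <= rho ->
  Cmod (cps (heatc theta d (r + h)) z - cps (heatc theta d r) z -
    RtoC h * Defs.Delta theta (cps (heatc theta d r)) z) <= h ^ 2 * K.
Proof.
  pose proof bQ_nonneg as HbQ.
  assert (HN : 0 <= N). { specialize (Hd O). simpl in Hd. pose proof (Cmod_ge_0 (d O)). lra. }
  assert (HQ : 0 <= Q) by (pose proof (Q_ge_1 b rho Hb Hrho Hrb); unfold Q; lra).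
  (* The k-th term of the summed remainder. The quadratic factor is at most 2 * 4^(T + k), so an
     exponential series with four times the argument dominates. *)
  set (B := fun k => N * Q ^ T * ((INR (T + k) * (INR (T + k) + 1)) * (b * Q) ^ (S (S k))) * (/ INR (fact k) * Cmod z ^ k)).
  assert (HB : ex_series B).
  { pose proof (is_exp_Reals (4 * (b * Q) * Cmod z)) as HP. apply is_pseries_R in HP.
    apply ex_series_nonneg_le with (fun k => (N * Q ^ T * (2 * 4 ^ T * (b * Q) ^ 2)) * (/ INR (fact k) * (4 * (b * Q) * Cmod z) ^ k)).
    2: { apply (ex_series_scal (V := R_NormedModule)). eexists. apply HP. }
    intros k. pose proof (INR_fact_lt_0 k) as Hf. pose proof (Cmod_ge_0 z) as Hz.
    assert (Hfi : 0 < / INR (fact k)) by (apply Rinv_0_lt_compat; auto).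
    assert (Hzk : 0 <= Cmod z ^ k) by (apply pow_le; auto).
    assert (HQT : 0 <= Q ^ T) by (apply pow_le; auto).
    assert (HbQk : forall n, 0 <= (b * Q) ^ n) by (intros; apply pow_le; auto).
    pose proof (pos_INR (T + k)) as Hi.
    assert (Hi4 : INR (T + k) * (INR (T + k) + 1) <= 2 * (4 ^ T * 4 ^ k)).
    { rewrite <- pow_add. pose proof (INR_le_pow2 (T + k)) as H1.
      assert (1 <= 2 ^ (T + k)) by (apply pow_R1_Rle; lra).
      replace (4 ^ (T + k)) with (2 ^ (T + k) * 2 ^ (T + k)) by (rewrite <- Rpow_mult_distr; f_equal; lra).
      nra. }
    unfold B. split.
    - apply Rmult_le_pos; [|apply Rmult_le_pos; lra]. apply Rmult_le_pos; [apply Rmult_le_pos; auto|].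
      apply Rmult_le_pos; auto. apply Rmult_le_pos; lra.
    - rewrite !Rpow_mult_distr. rewrite <- !Rpow_mult_distr.
      replace (N * Q ^ T * (2 * 4 ^ T * (b * Q) ^ 2) * (/ INR (fact k) * (4 * (b * Q) * Cmod z) ^ k)) with
        (N * Q ^ T * (2 * (4 ^ T * 4 ^ k) * (b * Q) ^ S (S k)) * (/ INR (fact k) * Cmod z ^ k)).
      + apply Rmult_le_compat_r; [apply Rmult_le_pos; lra|]. apply Rmult_le_compat_l; [apply Rmult_le_pos; auto|].
        apply Rmult_le_compat_r; auto.
      + rewrite (Rpow_mult_distr (4 * (b * Q))), (Rpow_mult_distr 4). simpl pow. ring. }
  exists (Series B). intros r h Hr Hh.
  pose proof (heatc_fastc r Hr) as F1. pose proof (heatc_fastc (r + h) Hh) as F2.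
  rewrite Delta_cps by auto.
  pose proof (cps_asum _ z F1) as A1. pose proof (cps_asum _ z F2) as A2.
  assert (E : forall k, (RtoC ((theta + INR k) * INR (S k)) * heatc theta d r (S k) * z ^ k)%C =
     (RtoC (/ INR (fact k)) * (RtoC (theta + INR k) * delta_series (heat_weight r) theta d (S k)) * z ^ k)%C).
  { intros k. unfold heatc. f_equal. rewrite INR_fact_S.
    rewrite !Cmult_assoc. f_equal. rewrite <- !RtoC_mult. f_equal. rewrite S_INR.
    pose proof (INR_fact_lt_0 k). pose proof (pos_INR k). field. lra. }
  assert (A3 : asum (fun k => RtoC ((theta + INR k) * INR (S k)) * heatc theta d r (S k) * z ^ k)%C).
  { pose proof (fastc_dc _ F1) as G1. pose proof (fastc_dc _ G1) as G2.
    pose proof (cps_asum _ z G1) as X1. pose proof (cps_asum _ z G2) as X2.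
    assert (X3 : asum (fun k => RtoC (INR k) * (dc (heatc theta d r) k * z ^ k))%C).
    { unfold asum. apply ex_series_incr_1. eapply asum_ext; [|apply (asum_scal z _ X2)].
      intros k. unfold dc. simpl Cpow. ring. }
    eapply asum_ext; [|apply (asum_plus _ _ (asum_scal (RtoC theta) _ X1) X3)].
    intros k. cbv beta. unfold dc. rewrite RtoC_mult, RtoC_plus. ring. }
  unfold cps. rewrite <- Cser_scal by auto.
  rewrite <- Cser_minus by auto. rewrite <- Cser_minus; [|apply asum_minus; auto|apply asum_scal; auto].
  rewrite <- Series_scal_l.
  apply Cser_le; [|apply (ex_series_scal (V := R_NormedModule)); auto].
  intros k. rewrite E. unfold heatc.
  replace (RtoC (/ INR (fact k)) * delta_series (heat_weight (r + h)) theta d k * z ^ k -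
    RtoC (/ INR (fact k)) * delta_series (heat_weight r) theta d k * z ^ k -
    RtoC h * (RtoC (/ INR (fact k)) * (RtoC (theta + INR k) * delta_series (heat_weight r) theta d (S k)) * z ^ k))%C with
    (RtoC (/ INR (fact k)) * z ^ k * (delta_series (heat_weight (r + h)) theta d k - delta_series (heat_weight r) theta d k -
      RtoC h * (RtoC (theta + INR k) * delta_series (heat_weight r) theta d (S k))))%C by ring.
  pose proof (INR_fact_lt_0 k) as Hf.
  rewrite !Cmod_mult, Cmod_pow, (Cmod_RtoC_nonneg (/ _)) by (left; apply Rinv_0_lt_compat; auto).
  eapply Rle_trans; [apply Rmult_le_compat_l; [|apply (delta_series_taylor theta b N rho T); auto]|].
  - apply Rmult_le_pos; [left; apply Rinv_0_lt_compat; auto|apply pow_le, Cmod_ge_0].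
  - right. unfold B. fold Q. ring.
Qed.

Lemma delta_series_0 (k : nat) : delta_series (heat_weight 0) theta d k = d k.
Proof.
  assert (Hr : Rabs 0 <= rho) by (rewrite Rabs_R0; auto).
  unfold delta_series. rewrite Cser_incr.
  - rewrite Cser_0; [|intros m; unfold heat_weight; simpl; unfold Rdiv; rewrite !Rmult_0_l; ring].
    rewrite Nat.add_0_r. unfold heat_weight. simpl. rewrite Rdiv_1_r, Rmult_1_r. ring.
  - apply (delta_series_asum theta b N rho T); auto. intros; apply heat_weight_bound; auto.
Qed.
End Flow.

Lemma heat_initial (theta : R) (c : nat -> C) (b N rho : R) (T : nat) :
  0 <= theta <= INR T -> 0 <= b -> 0 <= rho -> rho * b < 1 ->
  (forall k, INR (fact k) * Cmod (c k) <= N * b ^ k) ->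
  forall k, heatc theta (fun k => RtoC (INR (fact k)) * c k)%C 0 k = c k.
Proof.
  intros HT Hb Hr Hrb Hc k. unfold heatc. rewrite (delta_series_0 theta b N rho T); auto.
  - rewrite Cmult_assoc, <- RtoC_mult, Rinv_l by apply INR_fact_neq_0. ring.
  - intros j. rewrite Cmod_mult, Cmod_RtoC_nonneg by apply pos_INR. apply Hc.
Qed.

Lemma nat_above (x : R) : exists T : nat, x <= INR T.
Proof.
  destruct (INR_unbounded x) as [n Hn]. exists n. lra.
Qed.

Lemma heat_solution (theta tau b N : R) (c : nat -> C) : 0 <= theta -> 0 <= tau -> 0 <= b -> tau * b < 1 ->
  (forall k, INR (fact k) * Cmod (c k) <= N * b ^ k) ->
  cauchy_solution tau theta (cps c)
    (fun t => cps (heatc theta (fun k => RtoC (INR (fact k)) * c k)%C (tau * t))).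
Proof.
  intros Hth Htau Hb Htb Hc. destruct (nat_above theta) as [T HT].
  assert (Hd : forall k, Cmod (RtoC (INR (fact k)) * c k) <= N * b ^ k).
  { intros k. rewrite Cmod_mult, Cmod_RtoC_nonneg by apply pos_INR. apply Hc. }
  set (d := fun k => (RtoC (INR (fact k)) * c k)%C) in *.
  assert (Ht : forall t, unit_time t -> Rabs (tau * t) <= tau).
  { intros t Ht. unfold unit_time in Ht. rewrite Rabs_right; [nra|]. apply Rle_ge, Rmult_le_pos; lra. }
  split; [|split].
  - exists (b * / (1 - tau * b)). split; [apply bQ_nonneg; auto|].
    intros t Hu. apply coef_space_A with (N * (/ (1 - tau * b)) ^ T); [apply bQ_nonneg; auto|].
    intros k. apply heatc_bound; auto.
  - intros t z Hu.
    destruct (heat_flow_taylor theta b N tau T d (conj Hth HT) Hb Htau Htb Hd z) as [K HK].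
    apply quadratic_derive with (tau ^ 2 * K); auto. intros s Hs.
    specialize (HK (tau * t) (tau * s - tau * t) (Ht t Hu)).
    replace (tau * t + (tau * s - tau * t)) with (tau * s) in HK by ring. specialize (HK (Ht s Hs)).
    replace ((s - t) ^ 2 * (tau ^ 2 * K)) with ((tau * s - tau * t) ^ 2 * K) by ring.
    rewrite Cmult_assoc, <- RtoC_mult. replace ((s - t) * tau) with (tau * s - tau * t) by ring. exact HK.
  - intros z. rewrite Rmult_0_r. f_equal. apply functional_extensionality. intros k.
    apply (heat_initial theta c b N tau T); auto.
Qed.

(** * Functions approximated by polynomials with nonpositive zeros *)

(** Besides pointwise convergence, the approximants share a bound of every type b > a. These bounds
    replace locally uniform convergence and pass to the limit. The predicate on lists is a
    parameter, since powers and the polynomial theorem need different ones. *)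
Definition approximated (simple : list R -> Prop) (a : R) (f : C -> C) : Prop :=
  entire f /\ exists (c : nat -> R) (l : nat -> list R),
    (forall i, 0 < c i /\ simple (l i)) /\
    (forall z, clim eventually (fun i => RtoC (c i) * lprod (l i) z)%C (f z)) /\
    (forall b, a < b -> exists M, forall i z, Cmod (RtoC (c i) * lprod (l i) z) <= M * exp (b * Cmod z)).

Definition nonneg_list (l : list R) : Prop := List.Forall (Rle 0) l.
Definition simple_list (l : list R) : Prop := NoDup l /\ List.Forall (Rlt 0) l.

Lemma simple_nonneg (l : list R) : simple_list l -> nonneg_list l.
Proof. intros [_ H]. eapply Forall_impl; [|apply H]. simpl. intros; lra. Qed.

Fixpoint rprod (l : list R) (x : R) : R :=
  match l with nil => 1 | cons g l => (1 + g * x) * rprod l x end.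

Lemma lprod_RtoC (l : list R) (x : R) : lprod l (RtoC x) = RtoC (rprod l x).
Proof. induction l as [|g l IH]; simpl; auto. rewrite IH, RtoC_mult, RtoC_plus, RtoC_mult. auto. Qed.

Lemma rprod_ge_1 (l : list R) (x : R) : nonneg_list l -> 0 <= x -> 1 <= rprod l x.
Proof.
  intros H Hx. induction H as [|g l Hg Hl IH]; simpl; [lra|].
  assert (0 <= g * x) by (apply Rmult_le_pos; auto). nra.
Qed.

Lemma lprod_le_rprod (l : list R) (z : C) : nonneg_list l -> Cmod (lprod l z) <= rprod l (Cmod z).
Proof.
  intros H. induction H as [|g l Hg Hl IH]; simpl.
  - rewrite Cmod_1; lra.
  - rewrite Cmod_mult. apply Rmult_le_compat; auto using Cmod_ge_0.
    eapply Rle_trans; [apply Cmod_triangle|]. rewrite Cmod_1, Cmod_mult, Cmod_RtoC_nonneg by auto. lra.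
Qed.

(** For nonnegative parameters the maximum of the product on a circle is attained at its positive
    point. Growth bounds thus become bounds on [rprod], which is monotone in the parameters. *)
Lemma rprod_growth (l : list R) (c M b : R) : 0 < c -> nonneg_list l ->
  (forall z, Cmod (RtoC c * lprod l z) <= M * exp (b * Cmod z)) ->
  forall x, 0 <= x -> c * rprod l x <= M * exp (b * x).
Proof.
  intros Hc Hl H x Hx. specialize (H (RtoC x)).
  rewrite lprod_RtoC, <- RtoC_mult, !Cmod_R in H.
  pose proof (rprod_ge_1 l x Hl Hx). rewrite (Rabs_right x), Rabs_right in H; auto; [|lra].
  apply Rle_ge, Rmult_le_pos; lra.
Qed.

Lemma avoid_list (l : list R) (a b : R) : a < b -> exists x, a < x < b /\ ~ In x l.
Proof.
  intros Hab.
  assert (H : exists b', a < b' <= b /\ forall x, a < x < b' -> ~ In x l).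
  { induction l as [|y l (b' & Hb' & IH)].
    - exists b. split; [lra|]. simpl. tauto.
    - destruct (Rlt_dec a y) as [Hy|Hy].
      + exists (Rmin b' y). pose proof (Rmin_l b' y). pose proof (Rmin_r b' y).
        split; [split; [apply Rmin_glb_lt; lra|lra]|].
        intros x Hx [E|E]; [lra|]. apply (IH x); auto. lra.
      + exists b'. split; auto. intros x Hx [E|E]; [lra|]. apply (IH x); auto. }
  destruct H as (b' & Hb' & H). exists ((a + b') / 2). split; [lra|]. apply H. lra.
Qed.

(** Each positive parameter is moved down by less than eps to a value not yet used, and zeros are
    dropped. Only decreasing parameters is what preserves the growth bounds. *)
Lemma perturb_list (l : list R) (eps : R) : 0 < eps -> nonneg_list l ->
  exists l', simple_list l' /\ (forall x, 0 <= x -> rprod l' x <= rprod l x) /\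
    lsum l' <= lsum l /\
    forall z, Cmod (lprod l' z - lprod l z) <= INR (length l) * eps * Cmod z * exp (Cmod z * lsum l).
Proof.
  intros He Hl. induction Hl as [|g l Hg Hl (l' & [ND P'] & IH1 & IH2 & IH3)].
  - exists nil. split; [split; constructor|]. split; [intros; simpl; lra|]. split; [simpl; lra|].
    intros z. simpl. unfold Cminus. rewrite Cplus_opp_r, Cmod_0. lra.
  - assert (Hs' : simple_list l') by (split; auto). pose proof (simple_nonneg _ Hs') as Hn'.
    destruct Hg as [Hg|Hg].
    + destruct (avoid_list l' (Rmax 0 (g - eps)) g) as (h & Hh & Hnin).
      { apply Rmax_lub_lt; lra. }
      pose proof (Rmax_l 0 (g - eps)). pose proof (Rmax_r 0 (g - eps)).
      exists (h :: l'). split; [split; constructor; auto; lra|]. split; [|split].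
      * intros x Hx. simpl. pose proof (rprod_ge_1 l' x Hn' Hx). specialize (IH1 x Hx).
        assert (0 <= h * x) by (apply Rmult_le_pos; lra).
        assert (h * x <= g * x) by (apply Rmult_le_compat_r; lra).
        apply Rmult_le_compat; lra.
      * simpl. lra.
      * intros z. simpl lprod. simpl lsum. pose proof (Cmod_ge_0 z) as Hz.
        replace ((1 + RtoC h * z) * lprod l' z - (1 + RtoC g * z) * lprod l z)%C with
          (RtoC (h - g) * z * lprod l' z + (1 + RtoC g * z) * (lprod l' z - lprod l z))%C
          by (rewrite RtoC_minus; ring).
        eapply Rle_trans; [apply Cmod_triangle|]. rewrite !Cmod_mult, Cmod_R.
        rewrite Rmult_plus_distr_l, exp_plus.
        assert (E1 : Cmod (lprod l' z) <= exp (Cmod z * lsum l)).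
        { eapply Rle_trans; [apply lprod_bound; auto|].
          assert (Hle : Cmod z * lsum l' <= Cmod z * lsum l) by (apply Rmult_le_compat_l; auto).
          destruct Hle as [Hlt|Heq]; [left; apply exp_increasing; auto|rewrite Heq; lra]. }
        assert (E2 : Cmod (1 + RtoC g * z) <= exp (Cmod z * g)).
        { eapply Rle_trans; [apply Cmod_triangle|]. rewrite Cmod_1, Cmod_mult, Cmod_RtoC_nonneg by lra.
          pose proof (exp_ineq1_le (Cmod z * g)). lra. }
        assert (E3 : 1 <= exp (Cmod z * g)).
        { pose proof (exp_ineq1_le (Cmod z * g)). assert (0 <= Cmod z * g) by (apply Rmult_le_pos; lra). lra. }
        assert (E4 : Rabs (h - g) <= eps) by (apply Rabs_le; lra).
        set (e1 := exp (Cmod z * g)) in *. set (e2 := exp (Cmod z * lsum l)) in *.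
        assert (He2 : 0 < e2) by apply exp_pos.
        replace (INR (length (g :: l))) with (INR (length l) + 1) by (simpl length; rewrite S_INR; auto).
        assert (T1 : Rabs (h - g) * Cmod z * Cmod (lprod l' z) <= eps * Cmod z * (e1 * e2)).
        { apply Rmult_le_compat; auto using Cmod_ge_0.
          - apply Rmult_le_pos; auto using Rabs_pos.
          - apply Rmult_le_compat_r; auto.
          - eapply Rle_trans; [apply E1|]. nra. }
        assert (T2 : Cmod (1 + RtoC g * z) * Cmod (lprod l' z - lprod l z) <=
          e1 * (INR (length l) * eps * Cmod z * e2)).
        { apply Rmult_le_compat; auto using Cmod_ge_0. }
        lra.
    + subst g. exists l'. split; auto. split; [|split].
      * intros x Hx. simpl. specialize (IH1 x Hx). lra.
      * simpl; lra.
      * intros z. simpl lprod. simpl lsum. replace ((1 + RtoC 0 * z) * lprod l z)%C with (lprod l z) by ring.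
        eapply Rle_trans; [apply IH3|]. rewrite Rplus_0_l.
        pose proof (Cmod_ge_0 z). pose proof (exp_pos (Cmod z * lsum l)).
        change (length (0 :: l)) with (S (length l)). rewrite S_INR.
        assert (0 <= eps * Cmod z * exp (Cmod z * lsum l)) by (apply Rmult_le_pos; [apply Rmult_le_pos|]; lra).
        lra.
Qed.

Lemma approximated_simple (a : R) (f : C -> C) : approximated nonneg_list a f -> approximated simple_list a f.
Proof.
  intros (Hf & c & l & Hcl & Hlim & Hgr). split; auto.
  (* Chosen so that the perturbation error, multiplied by [c i], is at most |z| / (i + 1) as soon as
     |z| <= i. *)
  set (eps := fun i : nat => / (c i * (INR (length (l i)) + 1) * exp (INR i * lsum (l i)) * (INR i + 1))).
  assert (Hcp : forall i, 0 < c i * (INR (length (l i)) + 1) * exp (INR i * lsum (l i)) * (INR i + 1)).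
  { intros i. pose proof (pos_INR i). pose proof (pos_INR (length (l i))). destruct (Hcl i) as [Hc _].
    apply Rmult_lt_0_compat; [|lra]. apply Rmult_lt_0_compat; [|apply exp_pos]. apply Rmult_lt_0_compat; lra. }
  assert (Heps : forall i, 0 < eps i) by (intros; apply Rinv_0_lt_compat; auto).
  destruct (fun_choice (fun i l' => simple_list l' /\ (forall x, 0 <= x -> rprod l' x <= rprod (l i) x) /\
    lsum l' <= lsum (l i) /\
    forall z, Cmod (lprod l' z - lprod (l i) z) <= INR (length (l i)) * eps i * Cmod z * exp (Cmod z * lsum (l i))))
    as [l' Hl'].
  { intros i. apply perturb_list; auto. apply Hcl. }
  exists c, l'. split; [|split].
  - intros i. split; [apply Hcl|apply Hl'].
  - intros z. apply clim_ext with (fun i => RtoC (c i) * lprod (l i) z + RtoC (c i) * (lprod (l' i) z - lprod (l i) z))%C;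
      [apply eventually_filter|intros; ring|].
    replace (f z) with (f z + 0)%C by ring. apply clim_plus; auto; [apply eventually_filter|].
    intros e He. destruct (inv_INR_small (Cmod z) e (Cmod_ge_0 z) He) as [N1 HN1].
    destruct (INR_unbounded (Cmod z)) as [N2 HN2].
    exists (Nat.max N1 N2). intros i Hi.
    specialize (HN1 i ltac:(lia)). assert (Hiz : Cmod z <= INR i).
    { assert (INR N2 <= INR i) by (apply le_INR; lia). lra. }
    match goal with |- Cmod (?u - _)%C < _ => replace (u - 0)%C with u by ring end.
    rewrite Cmod_mult. destruct (Hcl i) as [Hc Hn]. rewrite Cmod_RtoC_nonneg by lra.
    eapply Rle_lt_trans; [|apply HN1].
    destruct (Hl' i) as (_ & _ & _ & H).
    eapply Rle_trans; [apply Rmult_le_compat_l; [lra|apply H]|].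
    pose proof (lsum_nonneg _ Hn) as Hs. pose proof (Cmod_ge_0 z) as Hz. pose proof (pos_INR (length (l i))) as HL.
    assert (Hee : exp (Cmod z * lsum (l i)) <= exp (INR i * lsum (l i))).
    { assert (Hle : Cmod z * lsum (l i) <= INR i * lsum (l i)) by (apply Rmult_le_compat_r; auto).
      destruct Hle as [Hlt|Heq]; [left; apply exp_increasing; auto|rewrite Heq; lra]. }
    rewrite plus_INR. simpl (INR 1).
    set (L := INR (length (l i))) in *. set (E := exp (INR i * lsum (l i))) in *.
    assert (HE : 0 < E) by apply exp_pos. pose proof (pos_INR i) as Hip.
    apply Rle_trans with (c i * ((L + 1) * eps i * Cmod z * E)).
    + apply Rmult_le_compat_l; [lra|]. specialize (Heps i). apply Rmult_le_compat; auto.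
      * repeat apply Rmult_le_pos; auto; lra.
      * left; apply exp_pos.
      * apply Rmult_le_compat_r; auto. apply Rmult_le_compat_r; lra.
    + right. unfold eps. fold L E. field. repeat split; lra.
  - intros b Hb. destruct (Hgr b Hb) as [M HM]. exists M. intros i z.
    destruct (Hcl i) as [Hc Hn]. destruct (Hl' i) as (Hs' & Hr & _).
    rewrite Cmod_mult, Cmod_RtoC_nonneg by lra.
    eapply Rle_trans; [|apply (rprod_growth (l i) (c i) M b Hc Hn (HM i) (Cmod z) (Cmod_ge_0 z))].
    apply Rmult_le_compat_l; [lra|]. eapply Rle_trans; [apply lprod_le_rprod, simple_nonneg; auto|].
    apply Hr, Cmod_ge_0.
Qed.

Lemma approximated_growth (P : list R -> Prop) (a b : R) (f : C -> C) : approximated P a f -> a < b ->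
  exists M, forall z, Cmod (f z) <= M * exp (b * Cmod z).
Proof.
  intros (_ & c & l & _ & Hlim & Hgr) Hb. destruct (Hgr b Hb) as [M HM]. exists M. intros z.
  eapply (clim_le eventually); [apply Hlim|]. apply filter_forall. intros i. apply HM.
Qed.

Lemma approximated_space_A (P : list R -> Prop) (a : R) (f : C -> C) : 0 <= a -> approximated P a f -> space_A a f.
Proof.
  intros Ha H. destruct (entire_taylor f (proj1 H)) as [Hc E]. rewrite E. apply cps_space_A; auto.
  intros b Hb. rewrite <- E. eapply approximated_growth; eauto.
Qed.

Lemma fastc_scal (x : C) (c : nat -> C) : fastc c -> fastc (fun k => x * c k)%C.
Proof.
  intros H r Hr. destruct (H r Hr) as [M HM]. exists (Cmod x * M). intros k.
  rewrite Cmod_mult, Rmult_assoc. apply Rmult_le_compat_l; auto. apply Cmod_ge_0.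
Qed.

Lemma cps_scal (x : C) (c : nat -> C) (z : C) : fastc c -> cps (fun k => x * c k)%C z = (x * cps c z)%C.
Proof.
  intros H. unfold cps. rewrite <- Cser_scal by (apply cps_asum; auto). apply Cser_ext. intros; ring.
Qed.

Lemma approximated_coefs (a : R) (c : nat -> R) (l : nat -> list R) (d : nat -> C) :
  (forall i z, Cmod z = 1 -> Cmod (RtoC (c i) * lprod (l i) z) <= a) -> fastc d ->
  (forall z, clim eventually (fun i => RtoC (c i) * lprod (l i) z)%C (cps d z)) ->
  forall k, clim eventually (fun i => RtoC (c i) * RtoC (ecoef (l i) k))%C (d k).
Proof.
  intros Ha Hd Hlim. apply (cps_coef_clim eventually (fun i k => RtoC (c i) * RtoC (ecoef (l i) k))%C d a); auto.
  - apply filter_forall. intros i. apply fastc_scal, fastc_ecoef.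
  - apply filter_forall. intros i z Hz. rewrite cps_scal by apply fastc_ecoef.
    rewrite <- lprod_cps. apply Ha; auto.
  - intros z _. eapply clim_ext; [apply eventually_filter| |apply Hlim].
    intros i. simpl. rewrite cps_scal by apply fastc_ecoef. rewrite <- lprod_cps. auto.
Qed.

(** An Euler step of length 0 changes nothing but returns its parameters in decreasing order; the
    constant is 1 because both products equal 1 at 0. *)
Lemma simple_sort (l : list R) : simple_list l ->
  exists l', simple_list l' /\ lsorted l' /\ forall z, lprod l' z = lprod l z.
Proof.
  intros [H1 H2].
  destruct (PolyRoots.heat_ecoef (s := 0) (th := 0) H1 H2 (Rle_refl 0) (Rle_refl 0)) as (l' & c & [Hc ND P Hs HE]).
  assert (E : forall k, ecoef l k = c * ecoef l' k) by (intros k; rewrite <- HE; ring).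
  assert (Hc1 : c = 1). { specialize (E O). rewrite !ecoef_0 in E. lra. }
  exists l'. split; [split; auto|]. split; [exact Hs|]. intros z. rewrite !lprod_cps. f_equal.
  apply functional_extensionality. intros k. rewrite E, Hc1, Rmult_1_l. auto.
Qed.

Lemma approximated_laguerre (a : R) (f : C -> C) : approximated simple_list a f -> pos_at_0 f -> laguerre f.
Proof.
  intros (Hf & c & l & Hcl & Hlim & Hgr) (r & Hr & Hfr).
  destruct (entire_taylor f Hf) as [Hd Ed]. set (d := tcoef f) in *.
  destruct (Hgr (1 + a) ltac:(lra)) as [M HM].
  assert (Hco := approximated_coefs (M * exp ((1 + a) * 1)) c l d).
  assert (Hcoef : forall k, clim eventually (fun i => RtoC (c i) * RtoC (ecoef (l i) k))%C (d k)).
  { apply Hco; auto.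
    - intros i z Hz. rewrite <- Hz at 2. apply HM.
    - intros z. rewrite <- Ed. apply Hlim. }
  assert (Hd0 : d O = RtoC r). { rewrite <- (cps_0 d Hd), <- Ed. auto. }
  assert (Hc : clim eventually (fun i => RtoC (c i)) (RtoC r)).
  { rewrite <- Hd0. eapply clim_ext; [apply eventually_filter| |apply (Hcoef O)].
    intros i. simpl. rewrite ecoef_0. ring. }
  assert (Hrn : RtoC r <> RtoC 0) by (apply RtoC_neq; lra).
  assert (Hci : clim eventually (fun i => / RtoC (c i))%C (/ RtoC r)%C).
  { apply (clim_ccont eventually Cinv); try apply eventually_filter; auto.
    eapply cderiv_ccont, cderiv_inv; auto. }
  assert (Hcn : forall i, RtoC (c i) <> RtoC 0) by (intros i; apply RtoC_neq; destruct (Hcl i); lra).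
  assert (Hq : forall z, clim eventually (fun i => lprod (l i) z) (/ RtoC r * f z)%C).
  { intros z. eapply clim_ext; [apply eventually_filter| |apply (clim_mult eventually _ _ _ _ Hci (Hlim z))].
    intros i. simpl. field. auto. }
  (* The sum of the parameters is the coefficient of z after normalisation to value 1 at 0, so it
     converges, and this also supplies the uniform bound required by [limit_product]. *)
  assert (Hsum : clim eventually (fun i => RtoC (lsum (l i))) (/ RtoC r * d 1%nat)%C).
  { eapply clim_ext; [apply eventually_filter| |apply (clim_mult eventually _ _ _ _ Hci (Hcoef 1%nat))].
    intros i. simpl. rewrite <- ecoef_1. simpl. field. auto. }
  assert (Hreal : (/ RtoC r * d 1%nat)%C = RtoC (Re (/ RtoC r * d 1%nat)%C)).
  { set (s := (/ RtoC r * d 1%nat)%C) in *. apply (clim_unique eventually (fun i => RtoC (lsum (l i)))); auto.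
    intros e He. destruct (Hsum e He) as [N HN]. exists N. intros n Hn. specialize (HN n Hn).
    rewrite <- RtoC_minus, Cmod_R. eapply Rle_lt_trans; [|apply HN].
    eapply Rle_trans; [|apply re_le_Cmod]. rewrite Re_minus. simpl. lra. }
  set (sigma := Re (/ RtoC r * d 1%nat)%C) in *. rewrite Hreal in Hsum.
  (* From [N0] on the sums are at most sigma + 1; the sequence is restarted there. *)
  destruct (Hsum 1 Rlt_0_1) as [N0 HN0].
  destruct (fun_choice (fun i l' => simple_list l' /\ lsorted l' /\ forall z, lprod l' z = lprod (l i) z)) as [l' Hl'].
  { intros i. apply simple_sort. apply Hcl. }
  assert (Hs' : forall i, lsum (l' i) = lsum (l i)).
  { intros i. destruct (Hl' i) as (_ & _ & H).
    assert (E : cps (fun k => RtoC (ecoef (l' i) k)) = cps (fun k => RtoC (ecoef (l i) k))).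
    { apply functional_extensionality. intros z. rewrite <- !lprod_cps. auto. }
    rewrite <- !ecoef_1. apply RtoC_inj. apply (cps_inj _ _ (fastc_ecoef _) (fastc_ecoef _) E 1%nat). }
  destruct (limit_product (fun i => l' (N0 + i)%nat) (sigma + 1) sigma (fun z => / RtoC r * f z)%C)
    as (alpha & gamma & P & H1 & H2 & H3 & H4 & H5).
  - intros i. destruct (Hl' (N0 + i)%nat) as (A1 & A2 & A3). split; [apply simple_nonneg; auto|]. split; auto.
    rewrite Hs'. specialize (HN0 (N0 + i)%nat ltac:(lia)). rewrite <- RtoC_minus, Cmod_R in HN0.
    apply Rabs_def2 in HN0. lra.
  - apply (clim_subseq (fun i => RtoC (lsum (l' i))) _ (fun i => (N0 + i)%nat)); [intros; lia|].
    eapply clim_ext; [apply eventually_filter| |apply Hsum]. intros i. simpl. rewrite Hs'. auto.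
  - intros z. apply (clim_subseq (fun i => lprod (l' i) z) _ (fun i => (N0 + i)%nat)); [intros; lia|].
    eapply clim_ext; [apply eventually_filter| |apply Hq]. intros i. simpl. destruct (Hl' i) as (_ & _ & H). auto.
  - exists alpha. split; auto. exists (RtoC r), O, gamma, P. repeat split; auto; try apply H2.
    intros z. specialize (H5 z). simpl.
    replace (f z) with (RtoC r * (/ RtoC r * f z))%C by (field; auto). rewrite H5. ring.
Qed.

(** * Operations preserving the class *)

Lemma lprod_app (l m : list R) (z : C) : lprod (l ++ m) z = (lprod l z * lprod m z)%C.
Proof. induction l as [|g l IH]; simpl; [ring|]. rewrite IH. ring. Qed.

Lemma lprod_scale (k : R) (l : list R) (z : C) : lprod (map (Rmult k) l) z = lprod l (z * RtoC k).
Proof. induction l as [|g l IH]; simpl; auto. rewrite IH, RtoC_mult. ring. Qed.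

Lemma lprod_copies (l : list R) (n : nat) (z : C) : lprod (concat (repeat l n)) z = (lprod l z ^ n)%C.
Proof. induction n as [|n IH]; simpl; auto. rewrite lprod_app, IH. auto. Qed.

(** Rescaling multiplies the parameters by k and the power repeats the list delta times. The
    repetition is why this class must admit equal parameters. *)
Lemma approximated_rescaled_power (a k : R) (delta : nat) (f : C -> C) : 0 < k -> (1 <= delta)%nat ->
  approximated nonneg_list a f ->
  approximated nonneg_list (a * k * INR delta) (fun z => Cpow (f (z * RtoC k)%C) delta).
Proof.
  intros Hk Hdel (Hf & c & l & Hcl & Hlim & Hgr). split.
  - apply cderiv_entire. intros z. apply (cderiv_pow (fun z => f (z * RtoC k)%C)).
    destruct (entire_cderiv f (z * RtoC k)%C Hf) as [m Hm].
    eexists. apply (cderiv_comp f (fun z => z * RtoC k)%C); [|apply Hm].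
    apply cderiv_local with (fun z => RtoC k * z + 0)%C 1; [lra|intros; ring|apply cderiv_affine].
  - exists (fun i => c i ^ delta), (fun i => concat (repeat (map (Rmult k) (l i)) delta)).
    assert (E : forall i z, (RtoC (c i ^ delta) * lprod (concat (repeat (map (Rmult k) (l i)) delta)) z)%C =
       Cpow (RtoC (c i) * lprod (l i) (z * RtoC k)) delta).
    { intros i z. rewrite lprod_copies, lprod_scale, RtoC_pow, Cpow_mult_l. auto. }
    split; [|split].
    + intros i. destruct (Hcl i) as [Hc Hn]. split; [apply pow_lt; auto|].
      unfold nonneg_list in *. rewrite Forall_forall in *. intros x Hx.
      apply in_concat in Hx. destruct Hx as (y & Hy & Hxy). apply repeat_spec in Hy. subst y.
      apply in_map_iff in Hxy. destruct Hxy as (w & <- & Hw). apply Rmult_le_pos; [lra|auto].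
    + intros z. eapply clim_ext; [apply eventually_filter|intros i; symmetry; apply E|].
      apply clim_pow; [apply eventually_filter|]. apply Hlim.
    + intros B HB. assert (Hdp : 0 < INR delta) by (apply lt_0_INR; lia).
      assert (Hkd : 0 < k * INR delta) by (apply Rmult_lt_0_compat; auto).
      destruct (Hgr (B / (k * INR delta))) as [M HM].
      { apply Rmult_lt_reg_r with (k * INR delta); auto. unfold Rdiv. rewrite Rmult_assoc, Rinv_l; lra. }
      exists (M ^ delta). intros i z. rewrite E, Cmod_pow.
      eapply Rle_trans; [apply pow_incr; split; [apply Cmod_ge_0|apply HM]|].
      rewrite Rpow_mult_distr, <- exp_INR, Cmod_mult, (Cmod_RtoC_nonneg k) by lra.
      right. do 2 f_equal. field. lra.
Qed.

(* The operator [1 + s Delta_theta] on coefficient sequences; its iterates are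
   the Euler scheme for the exponential of [Delta_theta]. *)
Definition euler_step (s theta : R) (p : nat -> R) (k : nat) : R :=
  p k + s * ((INR k + 1) * (INR k + theta) * p (S k)).

Lemma euler_step_iter_roots (s theta : R) (l : list R) (n : nat) : 0 <= s -> 0 <= theta -> simple_list l ->
  exists c l', 0 < c /\ simple_list l' /\ forall k, Nat.iter n (euler_step s theta) (ecoef l) k = c * ecoef l' k.
Proof.
  intros Hs Ht Hl. induction n as [|n (c & l' & Hc & [ND P] & E)]; simpl.
  - exists 1, l. split; [lra|]. split; auto. intros; ring.
  - destruct (PolyRoots.heat_ecoef (s := s) (th := theta) ND P Hs Ht) as (l2 & c2 & [Hc2 ND2 P2 _ E2]).
    exists (c * c2), l2. split; [apply Rmult_lt_0_compat; auto|]. split; [split; auto|].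
    intros k. unfold euler_step. rewrite !E. replace (c * c2 * ecoef l2 k) with (c * (c2 * ecoef l2 k)) by ring. rewrite <- E2. ring.
Qed.

Fixpoint falling (x : R) (m : nat) : R :=
  match m with O => 1 | S m => falling x m * (x - INR m) end.

Lemma falling_succ (x : R) (m : nat) : falling (x + 1) (S m) = (x + 1) * falling x m.
Proof.
  induction m as [|m IH]; [simpl; ring|].
  change (falling (x + 1) (S (S m))) with (falling (x + 1) (S m) * (x + 1 - INR (S m))).
  rewrite IH, S_INR. simpl. ring.
Qed.

Lemma falling_bound (n m : nat) : 0 <= falling (INR n) m <= INR n ^ m.
Proof.
  assert (Hz : forall m, (n < m)%nat -> falling (INR n) m = 0).
  { induction m0 as [|m0 IH]; [lia|]. intros Hm. simpl. destruct (Nat.eq_dec m0 n) as [->|Hne]; [ring|].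
    rewrite IH by lia. ring. }
  induction m as [|m IH]; simpl; [lra|].
  destruct (Compare_dec.le_lt_dec m n) as [Hmn|Hmn].
  - apply le_INR in Hmn. pose proof (pos_INR m).
    split; [apply Rmult_le_pos; lra|]. rewrite (Rmult_comm (INR n)). apply Rmult_le_compat; lra.
  - rewrite (Hz m Hmn), Rmult_0_l. split; [lra|]. apply Rmult_le_pos; [apply pos_INR|apply pow_le, pos_INR].
Qed.

(** The coefficient binomial(n, m) s^m of Delta_theta^m in (1 + s Delta_theta)^n. It is at most (n
    s)^m / m!, so Euler iterates with n s <= rho obey the same estimates as the exponential. *)
Definition euler_weight (n : nat) (s : R) (m : nat) : R := falling (INR n) m / INR (fact m) * s ^ m.

Lemma euler_weight_bound (n : nat) (s : R) (m : nat) : 0 <= s -> 0 <= euler_weight n s m <= (INR n * s) ^ m / INR (fact m).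
Proof.
  intros Hs. unfold euler_weight. pose proof (falling_bound n m) as Hf.
  assert (H1 : 0 < / INR (fact m)) by (apply Rinv_0_lt_compat, INR_fact_lt_0).
  assert (H2 : 0 <= s ^ m) by (apply pow_le; auto).
  split; [apply Rmult_le_pos; auto; apply Rmult_le_pos; lra|].
  rewrite Rpow_mult_distr. unfold Rdiv.
  replace (INR n ^ m * s ^ m * / INR (fact m)) with (INR n ^ m * / INR (fact m) * s ^ m) by ring.
  apply Rmult_le_compat_r; auto. apply Rmult_le_compat_r; lra.
Qed.

Lemma euler_weight_succ (n : nat) (s : R) (m : nat) : euler_weight (S n) s (S m) = euler_weight n s (S m) + s * euler_weight n s m.
Proof.
  unfold euler_weight. rewrite S_INR, falling_succ. simpl falling. rewrite INR_fact_S. simpl pow.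
  pose proof (INR_fact_lt_0 m). pose proof (pos_INR m). field. lra.
Qed.

(** Induction on n through Pascal's rule [euler_weight_succ]: a step adds to coordinate k the
    shifted series, whose m-th term is aligned with term m + 1. *)
Lemma euler_step_iter_delta_series (s theta b N rho : R) (T : nat) (p : nat -> R) (n : nat) :
  0 <= theta <= INR T -> 0 <= b -> 0 <= s -> rho * b < 1 -> INR n * s <= rho ->
  (forall k, INR (fact k) * Rabs (p k) <= N * b ^ k) ->
  forall k, RtoC (INR (fact k) * Nat.iter n (euler_step s theta) p k) =
    delta_series (euler_weight n s) theta (fun k => RtoC (INR (fact k) * p k)) k.
Proof.
  intros HT Hb Hs Hrb Hn Hp.
  assert (Hd : forall k, Cmod (RtoC (INR (fact k) * p k)) <= N * b ^ k).
  { intros k. rewrite Cmod_R, Rabs_mult, Rabs_right by (apply Rle_ge, pos_INR). apply Hp. }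
  set (d := fun k => RtoC (INR (fact k) * p k)) in *.
  induction n as [|n IH]; intros k.
  - unfold delta_series. assert (Hr : 0 <= rho) by (simpl in Hn; lra).
    rewrite Cser_incr.
    + rewrite Cser_0.
      * rewrite Nat.add_0_r. unfold euler_weight. simpl. rewrite Rdiv_1_r, !Rmult_1_r. unfold d. ring.
      * intros m. unfold euler_weight.
        replace (falling (INR 0) (S m)) with 0; [unfold Rdiv; rewrite !Rmult_0_l; ring|].
        clear. induction m as [|m IH]; [simpl; ring|]. change (0 = falling (INR 0) (S m) * (INR 0 - INR (S m))). rewrite <- IH. ring.
    + apply (delta_series_asum theta b N rho T); auto. intros m.
      destruct (euler_weight_bound 0 s m Hs) as [E1 E2]. rewrite Rabs_right by lra.
      eapply Rle_trans; [apply E2|]. apply Rmult_le_compat_r; [left; apply Rinv_0_lt_compat, INR_fact_lt_0|].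
      apply pow_incr. simpl. lra.
  - assert (Hn' : INR n * s <= rho) by (rewrite S_INR in Hn; lra).
    specialize (IH Hn'). pose proof (pos_INR n) as Hnp.
    assert (Hr : 0 <= rho) by nra.
    assert (HA : forall m, Rabs (euler_weight n s m) <= rho ^ m / INR (fact m)).
    { intros m. destruct (euler_weight_bound n s m Hs) as [E1 E2]. rewrite Rabs_right by lra.
      eapply Rle_trans; [apply E2|]. apply Rmult_le_compat_r; [left; apply Rinv_0_lt_compat, INR_fact_lt_0|].
      apply pow_incr. split; auto. apply Rmult_le_pos; auto. }
    assert (HA' : forall m, Rabs (euler_weight (S n) s m) <= rho ^ m / INR (fact m)).
    { intros m. destruct (euler_weight_bound (S n) s m Hs) as [E1 E2]. rewrite Rabs_right by lra.
      eapply Rle_trans; [apply E2|]. apply Rmult_le_compat_r; [left; apply Rinv_0_lt_compat, INR_fact_lt_0|].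
      apply pow_incr. split; auto. apply Rmult_le_pos; auto. apply pos_INR. }
    pose proof (delta_series_asum theta b N rho T HT Hb Hr Hrb (euler_weight n s) d k HA Hd) as S1.
    pose proof (delta_series_asum theta b N rho T HT Hb Hr Hrb (euler_weight n s) d (S k) HA Hd) as S2.
    pose proof (delta_series_asum theta b N rho T HT Hb Hr Hrb (euler_weight (S n) s) d k HA' Hd) as S3.
    set (x := theta + INR k) in *.
    change (Nat.iter (S n) (euler_step s theta) p k) with (euler_step s theta (Nat.iter n (euler_step s theta) p) k).
    unfold euler_step at 1.
    replace (RtoC (INR (fact k) * (Nat.iter n (euler_step s theta) p k + s * ((INR k + 1) * (INR k + theta) * Nat.iter n (euler_step s theta) p (S k))))) with
      (RtoC (INR (fact k) * Nat.iter n (euler_step s theta) p k) + RtoC (s * x) * RtoC (INR (fact (S k)) * Nat.iter n (euler_step s theta) p (S k)))%C.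
    2: { rewrite <- RtoC_mult, <- RtoC_plus. f_equal. rewrite INR_fact_S. unfold x. ring. }
    rewrite !IH. unfold delta_series. fold x.
    rewrite (Cser_incr _ S1), (Cser_incr _ S3). rewrite <- Cser_scal by auto.
    rewrite <- Cplus_assoc, <- Cser_plus; [|apply (asum_incr _ S1)|apply asum_scal; auto].
    f_equal. apply Cser_ext. intros m. rewrite euler_weight_succ.
    replace (S k + m)%nat with (k + S m)%nat by lia.
    replace (theta + INR (S k)) with (x + 1) by (unfold x; rewrite S_INR; ring).
    rewrite (poch_shift x). rewrite !RtoC_mult, !RtoC_plus, !RtoC_mult. ring.
Qed.

Lemma euler_weight_clim (s : R) (m : nat) :
  clim eventually (fun i => RtoC (euler_weight (S i) (s / INR (S i)) m)) (RtoC (heat_weight s m)).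
Proof.
  assert (H : forall m, clim eventually (fun i => RtoC (falling (INR (S i)) m / INR (S i) ^ m)) (RtoC 1)).
  { clear m. induction m as [|m IH].
    - eapply clim_ext; [apply eventually_filter| |apply clim_const; apply eventually_filter].
      intros i. simpl. rewrite Rdiv_1_r. auto.
    - assert (H1 : clim eventually (fun i => RtoC (1 - INR m / INR (S i))) (RtoC 1)).
      { apply clim_RtoC_seq. intros e He. destruct (inv_INR_small (INR m) e (pos_INR m) He) as [N HN].
        exists N. intros n Hn. specialize (HN n Hn). replace (n + 1)%nat with (S n) in HN by lia.
        replace (1 - INR m / INR (S n) - 1) with (- (INR m / INR (S n))) by ring.
        rewrite Rabs_Ropp, Rabs_right; auto. apply Rle_ge, Rmult_le_pos; [apply pos_INR|].
        left. apply Rinv_0_lt_compat, lt_0_INR; lia. }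
      replace (RtoC 1) with (RtoC 1 * RtoC 1)%C by ring.
      eapply clim_ext; [apply eventually_filter| |apply (clim_mult eventually _ _ _ _ IH H1)].
      intros i. cbv beta. rewrite <- RtoC_mult. f_equal. simpl falling. simpl pow.
      assert (INR (S i) <> 0) by (apply not_0_INR; lia).
      assert (INR (S i) ^ m <> 0) by (apply pow_nonzero; auto).
      change (match i with O => 1 | S _ => INR i + 1 end) with (INR (S i)). field. auto. }
  unfold heat_weight. replace (RtoC (s ^ m / INR (fact m))) with (RtoC 1 * RtoC (s ^ m / INR (fact m)))%C by ring.
  eapply clim_ext; [apply eventually_filter| |apply (clim_mult eventually _ _ _ _ (H m)
    (clim_const eventually (RtoC (s ^ m / INR (fact m)))))].
  intros i. cbv beta. rewrite <- RtoC_mult. f_equal. unfold euler_weight.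
  assert (INR (S i) <> 0) by (apply not_0_INR; lia).
  unfold Rdiv. rewrite Rpow_mult_distr, pow_inv. ring.
Qed.

Lemma growth_coefs (b1 b M : R) : 0 < b1 < b -> exists N, forall c, fastc c ->
  (forall z, Cmod (cps c z) <= M * exp (b1 * Cmod z)) -> forall k, INR (fact k) * Cmod (c k) <= N * b ^ k.
Proof.
  intros Hb.
  assert (Hq : 0 <= b1 / b < 1).
  { split; [left; apply Rdiv_lt_0_compat; lra|]. apply Rmult_lt_reg_r with b; [lra|].
    unfold Rdiv. rewrite Rmult_assoc, Rinv_l; lra. }
  destruct (INR_pow_bounded (b1 / b) Hq) as (K & HK0 & HK).
  exists (2 * M * exp 1 * K). intros c Hc HM k.
  assert (HM0 : 0 <= M).
  { specialize (HM 0). pose proof (Cmod_ge_0 (cps c 0)). rewrite Cmod_0, Rmult_0_r, exp_0 in HM. lra. }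
  eapply Rle_trans; [apply (exp_type_coef c b1 M (proj1 Hb) Hc HM)|].
  assert (Hbk : 0 < b ^ k) by (apply pow_lt; lra).
  replace (2 * M * exp 1 * INR (S k) * b1 ^ k) with (2 * M * exp 1 * (INR (S k) * (b1 / b) ^ k) * b ^ k).
  - apply Rmult_le_compat_r; [lra|]. apply Rmult_le_compat_l; auto.
    pose proof (exp_pos 1). apply Rmult_le_pos; lra.
  - unfold Rdiv. rewrite Rpow_mult_distr, pow_inv. field. lra.
Qed.

Lemma euler_step_iter_scal (s theta a : R) (p : nat -> R) (n k : nat) :
  Nat.iter n (euler_step s theta) (fun k => a * p k) k = a * Nat.iter n (euler_step s theta) p k.
Proof.
  revert k. induction n as [|n IH]; intros k; simpl; auto. unfold euler_step at 1 3. rewrite !IH. ring.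
Qed.

(** A diagonal scheme: the i-th polynomial undergoes i + 1 Euler steps of length s / (i + 1), so
    that a single limit in i replaces both the approximation and the Euler scheme. Zeros stay simple
    and negative at each step, and the total time s keeps all weights below s^m / m!. *)
Lemma approximated_heat (beta alpha s theta : R) (c0 : nat -> C) : 0 <= beta -> 0 <= theta -> 0 <= s ->
  (forall B, alpha < B -> exists b, beta < b /\ s * b < 1 /\ b * / (1 - s * b) <= B) ->
  fastc c0 -> approximated simple_list beta (cps c0) ->
  approximated simple_list alpha (cps (heatc theta (fun k => RtoC (INR (fact k)) * c0 k)%C s)).
Proof.
  intros Hbeta Hth Hs HB Hc0 (Hent & c & l & Hcl & Hlim & Hgr).
  destruct (nat_above theta) as [T HT]. assert (HT' : 0 <= theta <= INR T) by lra.
  set (p := fun i k => c i * ecoef (l i) k).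
  assert (Ep : forall i z, cps (fun k => RtoC (p i k)) z = (RtoC (c i) * lprod (l i) z)%C).
  { intros i z. rewrite lprod_cps, <- cps_scal by apply fastc_ecoef. f_equal.
    apply functional_extensionality. intros k. unfold p. apply RtoC_mult. }
  assert (Hpf : forall i, fastc (fun k => RtoC (p i k))).
  { intros i r Hr. destruct (fastc_scal (RtoC (c i)) _ (fastc_ecoef (l i)) r Hr) as [M HM]. exists M.
    intros k. unfold p. rewrite RtoC_mult. apply HM. }
  assert (Hpb : forall b, beta < b -> exists N, forall i k, INR (fact k) * Rabs (p i k) <= N * b ^ k).
  { intros b Hb. destruct (Hgr ((beta + b) / 2) ltac:(lra)) as [M HM].
    destruct (growth_coefs ((beta + b) / 2) b M ltac:(lra)) as [N HN]. exists N. intros i k.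
    rewrite <- Cmod_R. apply (HN (fun k => RtoC (p i k))); auto. intros z. rewrite Ep. apply HM. }
  assert (Hpc : forall k, clim eventually (fun i => RtoC (p i k)) (c0 k)).
  { destruct (Hgr (beta + 1) ltac:(lra)) as [M HM]. intros k.
    eapply clim_ext; [apply eventually_filter| |
      apply (approximated_coefs (M * exp ((beta + 1) * 1)) c l c0)]; auto.
    - intros i. unfold p. simpl. symmetry. apply RtoC_mult.
    - intros i z Hz. rewrite <- Hz at 2. apply HM. }
  set (sig := fun i : nat => s / INR (S i)).
  assert (HSi : forall i, 0 < INR (S i)) by (intros; apply lt_0_INR; lia).
  assert (Hsig : forall i, 0 <= sig i).
  { intros i. apply Rmult_le_pos; auto. left. apply Rinv_0_lt_compat; auto. }
  assert (HnS : forall i, INR (S i) * sig i = s).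
  { intros i. unfold sig. field. specialize (HSi i). lra. }
  set (d := fun i k => RtoC (INR (fact k) * p i k)).
  set (d0 := fun k => (RtoC (INR (fact k)) * c0 k)%C).
  destruct (fun_choice (fun i (q : R * list R) => 0 < fst q /\ simple_list (snd q) /\
     forall k, Nat.iter (S i) (euler_step (sig i) theta) (ecoef (l i)) k = fst q * ecoef (snd q) k)) as [q Hq].
  { intros i. destruct (euler_step_iter_roots (sig i) theta (l i) (S i) (Hsig i) Hth (proj2 (Hcl i)))
      as (c' & l' & H1 & H2 & H3). exists (c', l'). auto. }
  assert (EA : forall i m, euler_weight (S i) (sig i) m <= s ^ m / INR (fact m) /\ 0 <= euler_weight (S i) (sig i) m).
  { intros i m. destruct (euler_weight_bound (S i) (sig i) m (Hsig i)) as [E1 E2]. rewrite HnS in E2. auto. }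
  assert (HA : forall i m, Rabs (euler_weight (S i) (sig i) m) <= s ^ m / INR (fact m)).
  { intros i m. destruct (EA i m). rewrite Rabs_right; lra. }
  set (cf := fun i => c i * fst (q i)). set (lf := fun i => snd (q i)).
  assert (Hdb : forall b, beta < b -> exists N, (forall i k, Cmod (d i k) <= N * b ^ k) /\ (forall k, Cmod (d0 k) <= N * b ^ k)).
  { intros b Hb. destruct (Hpb b Hb) as [N HN]. exists N.
    assert (H1 : forall i k, Cmod (d i k) <= N * b ^ k).
    { intros i k. unfold d. rewrite Cmod_R, Rabs_mult, Rabs_right by (apply Rle_ge, pos_INR). auto. }
    split; auto. intros k. apply (clim_le eventually (fun i => d i k)).
    - eapply clim_ext; [apply eventually_filter| |
        apply (clim_mult eventually _ _ _ _ (clim_const eventually (RtoC (INR (fact k)))) (Hpc k))].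
      intros i. simpl. unfold d. symmetry. apply RtoC_mult.
    - apply filter_forall. auto. }
  assert (Hq' : forall b, beta < b -> s * b < 1 -> forall i k,
    (RtoC (cf i) * RtoC (ecoef (lf i) k))%C = (RtoC (/ INR (fact k)) * delta_series (euler_weight (S i) (sig i)) theta (d i) k)%C).
  { intros b Hb Hsb i k. destruct (Hpb b Hb) as [N HN].
    rewrite <- (euler_step_iter_delta_series (sig i) theta b N s T (p i) (S i)); auto; [|lra|rewrite HnS; lra].
    unfold p. rewrite euler_step_iter_scal. destruct (Hq i) as (_ & _ & E). rewrite E.
    unfold cf, lf. rewrite <- !RtoC_mult. f_equal. field. apply INR_fact_neq_0. }
  assert (Hgf : forall B, alpha < B -> exists M b', 0 <= b' <= B /\
     (forall i k, INR (fact k) * Cmod (RtoC (cf i) * RtoC (ecoef (lf i) k)) <= M * b' ^ k) /\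
     (forall k, INR (fact k) * Cmod (heatc theta d0 s k) <= M * b' ^ k)).
  { intros B HB'. destruct (HB B HB') as (b & Hb & Hsb & HbB). destruct (Hdb b Hb) as (N & HN & HN0).
    exists (N * (/ (1 - s * b)) ^ T), (b * / (1 - s * b)). split; [split; auto; apply bQ_nonneg; auto; lra|]. split.
    - intros i k. rewrite (Hq' b Hb Hsb), fact_inv_Cmod. apply delta_series_bound; auto. lra.
    - intros k. apply heatc_bound; auto; [lra|]. rewrite Rabs_right; lra. }
  assert (Hfl : forall i, cps (fun k => RtoC (cf i) * RtoC (ecoef (lf i) k))%C = (fun z => RtoC (cf i) * lprod (lf i) z)%C).
  { intros i. apply functional_extensionality. intros z. rewrite lprod_cps. apply cps_scal. apply fastc_ecoef. }
  split; [|exists cf, lf; split; [|split]].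
  - destruct (Hgf (alpha + 1) ltac:(lra)) as (M & b' & Hb' & _ & H2).
    apply cps_entire. apply (fact_coef_fastc _ b' M); auto. tauto.
  - intros i. destruct (Hq i) as (H1 & H2 & _). split; auto. apply Rmult_lt_0_compat; auto. apply Hcl.
  - intros z. destruct (Hgf (alpha + 1) ltac:(lra)) as (M & b' & [Hb' _] & H1 & H2).
    destruct (HB (alpha + 1) ltac:(lra)) as (b & Hb & Hsb & _). destruct (Hdb b Hb) as (N & HN & HN0).
    eapply clim_ext; [apply eventually_filter|intros i; rewrite <- (equal_f (Hfl i) z); reflexivity|].
    assert (HE : ex_series (fun k => M * (/ INR (fact k) * (b' * Cmod z) ^ k))).
    { apply (ex_series_scal (V := R_NormedModule)).
      pose proof (is_exp_Reals (b' * Cmod z)) as HP. apply is_pseries_R in HP. eexists. apply HP. }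
    assert (Hterm : forall x k, INR (fact k) * Cmod x <= M * b' ^ k ->
      Cmod (x * z ^ k) <= M * (/ INR (fact k) * (b' * Cmod z) ^ k)).
    { intros x k Hx. pose proof (INR_fact_lt_0 k) as Hfk. rewrite Cmod_mult, Cmod_pow, Rpow_mult_distr.
      replace (M * (/ INR (fact k) * (b' ^ k * Cmod z ^ k))) with (/ INR (fact k) * (M * b' ^ k) * Cmod z ^ k) by ring.
      apply Rmult_le_compat_r; [apply pow_le, Cmod_ge_0|].
      apply Rmult_le_reg_l with (INR (fact k)); auto. rewrite <- Rmult_assoc, Rinv_r, Rmult_1_l by lra. auto. }
    (* Dominated convergence in the Taylor index, with an exponential series as majorant. *)
    apply (Cser_dominated eventually (fun i k => RtoC (cf i) * RtoC (ecoef (lf i) k) * z ^ k)%C _ _ HE).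
    + apply filter_forall. intros i k. apply Hterm. auto.
    + intros k. apply Hterm. auto.
    + intros k. apply clim_mult; [apply eventually_filter| |apply clim_const; apply eventually_filter].
      eapply clim_ext; [apply eventually_filter|intros i; symmetry; apply (Hq' b Hb Hsb i k)|].
      apply clim_scal; [apply eventually_filter|].
      destruct (binomial_series _ _ _ (theta_plus_index theta T HT' k) (rho_b_range b s ltac:(lra) Hs Hsb)) as [BS _].
      (* Dominated convergence in the power m of Delta_theta, with the binomial series as majorant;
         weights and coefficients converge separately. *)
      apply (Cser_dominated eventually (fun i m => RtoC (euler_weight (S i) (sig i) m * poch (theta + INR k) m) * d i (k + m)%nat)%C
        _ (fun m => N * b ^ k * (poch (theta + INR k) m / INR (fact m) * (s * b) ^ m))).
      * apply (ex_series_scal (V := R_NormedModule)); auto.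
      * apply filter_forall. intros i m. apply (delta_series_term theta b N s T); auto.
      * intros m. apply (delta_series_term theta b N s T); auto. intros m'. apply (heat_weight_bound s). rewrite Rabs_right; lra.
      * intros m. apply clim_mult; [apply eventually_filter| |].
        { rewrite RtoC_mult. apply clim_ext with (fun i => RtoC (euler_weight (S i) (sig i) m) * RtoC (poch (theta + INR k) m))%C;
            [apply eventually_filter|intros; rewrite RtoC_mult; auto|].
          apply clim_mult; [apply eventually_filter| |apply clim_const; apply eventually_filter].
          apply euler_weight_clim. }
        { unfold d, d0. apply clim_ext with (fun i => RtoC (INR (fact (k + m))) * RtoC (p i (k + m)%nat))%C;
            [apply eventually_filter|intros; rewrite RtoC_mult; auto|].
          apply clim_scal; [apply eventually_filter|]. apply Hpc. }
  - intros B HB'. destruct (Hgf B HB') as (M & b' & [Hb1 Hb2] & H1 & _).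
    exists M. intros i z.
    destruct (fact_coef_fastc _ b' M Hb1 (H1 i)) as [_ H3]. specialize (H3 z). rewrite (equal_f (Hfl i) z) in H3.
    eapply Rle_trans; [apply H3|].
    assert (HM : 0 <= M). { specialize (H1 O O). simpl in H1. pose proof (Cmod_ge_0 (RtoC (cf 0%nat) * RtoC (ecoef (lf 0%nat) 0))). lra. }
    apply Rmult_le_compat_l; auto. pose proof (Cmod_ge_0 z).
    assert (Hle : b' * Cmod z <= B * Cmod z) by (apply Rmult_le_compat_r; auto).
    destruct Hle as [Hlt|Heq]; [left; apply exp_increasing; auto|rewrite Heq; lra].
Qed.

(** * Laguerre functions are limits of polynomials *)

Fixpoint partial_rprod (g : nat -> R) (n : nat) (x : R) : R :=
  match n with O => 1 | S n => partial_rprod g n x * (1 + g n * x) end.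

Section Products.
Variable g : nat -> R.
Hypothesis Hg : forall j, 0 <= g j.

Lemma partial_rprod_ge_1 (n : nat) (x : R) : 0 <= x -> 1 <= partial_rprod g n x.
Proof.
  intros Hx. induction n as [|n IH]; simpl; [lra|].
  assert (0 <= g n * x) by (apply Rmult_le_pos; auto). nra.
Qed.

Lemma partial_rprod_mono (n k : nat) (x : R) : 0 <= x -> partial_rprod g n x <= partial_rprod g (n + k) x.
Proof.
  intros Hx. induction k as [|k IH]; [rewrite Nat.add_0_r; lra|]. rewrite Nat.add_succ_r. simpl.
  pose proof (partial_rprod_ge_1 (n + k) x Hx). assert (0 <= g (n + k)%nat * x) by (apply Rmult_le_pos; auto). nra.
Qed.

Lemma partial_rprod_tail (n k : nat) (x : R) : 0 <= x ->
  partial_rprod g (n + k) x <= partial_rprod g n x * exp (x * (psum g (n + k) - psum g n)).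
Proof.
  intros Hx. induction k as [|k IH].
  - rewrite Nat.add_0_r. rewrite Rminus_diag, Rmult_0_r, exp_0. lra.
  - rewrite Nat.add_succ_r. simpl.
    replace (x * (psum g (n + k) + g (n + k)%nat - psum g n)) with
      (x * (psum g (n + k) - psum g n) + g (n + k)%nat * x) by ring.
    rewrite exp_plus, <- Rmult_assoc. pose proof (partial_rprod_ge_1 (n + k) x Hx).
    pose proof (exp_ineq1_le (g (n + k)%nat * x)).
    assert (0 <= g (n + k)%nat * x) by (apply Rmult_le_pos; auto).
    apply Rmult_le_compat; lra.
Qed.

(** A polynomial has exponential type 0: each factor in turn is absorbed by half of the remaining
    exponent. *)
Lemma partial_rprod_head (n : nat) (eta : R) : 0 < eta -> exists K, forall x, 0 <= x -> partial_rprod g n x <= K * exp (eta * x).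
Proof.
  revert eta. induction n as [|n IH]; intros eta He.
  - exists 1. intros x Hx. simpl. pose proof (exp_ineq1_le (eta * x)).
    assert (0 <= eta * x) by (apply Rmult_le_pos; lra). lra.
  - destruct (IH (eta / 2) ltac:(lra)) as [K HK].
    exists (K * (1 + 2 * g n / eta)). intros x Hx. simpl.
    replace (eta * x) with (eta / 2 * x + eta / 2 * x) by field. rewrite exp_plus.
    replace (K * (1 + 2 * g n / eta) * (exp (eta / 2 * x) * exp (eta / 2 * x))) with
      ((K * exp (eta / 2 * x)) * ((1 + 2 * g n / eta) * exp (eta / 2 * x))) by ring.
    pose proof (partial_rprod_ge_1 n x Hx). specialize (HK x Hx).
    assert (0 <= g n * x) by (apply Rmult_le_pos; auto).
    apply Rmult_le_compat; try lra.
    pose proof (exp_ineq1_le (eta / 2 * x)). assert (0 <= eta / 2 * x) by (apply Rmult_le_pos; lra).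
    assert (Hd : 0 <= 2 * g n / eta).
    { apply Rmult_le_pos; [specialize (Hg n); lra|]. left. apply Rinv_0_lt_compat; auto. }
    apply Rle_trans with ((1 + 2 * g n / eta) * (1 + eta / 2 * x)); [|apply Rmult_le_compat_l; lra].
    replace ((1 + 2 * g n / eta) * (1 + eta / 2 * x)) with (1 + 2 * g n / eta + eta / 2 * x + g n * x) by (field; lra).
    lra.
Qed.

(** Summable parameters give exponential type 0, uniformly in the number of factors: a finite head
    costs eta / 2, and a tail with parameter sum below eta / 2 costs the other half. *)
Lemma partial_rprod_growth (eta : R) : 0 < eta -> ex_series g -> exists K, forall n x, 0 <= x -> partial_rprod g n x <= K * exp (eta * x).
Proof.
  intros He Hs. pose proof (Series_correct g Hs) as HS.
  assert (HS' : is_lim_seq (sum_n g) (Series g)) by exact HS.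
  assert (Hle : forall n, psum g n <= Series g).
  { intros [|n].
    - simpl. apply Series_nonneg; auto.
    - rewrite psum_sum_n. apply (is_lim_seq_incr_compare (sum_n g)); auto.
      intros m. rewrite sum_Sn. change (sum_n g m <= sum_n g m + g (S m)). specialize (Hg (S m)). lra. }
  apply is_lim_seq_spec in HS'. destruct (HS' (mkposreal (eta / 2) ltac:(lra))) as [J HJ].
  specialize (HJ J (le_n _)). simpl in HJ. rewrite <- psum_sum_n in HJ.
  apply Rabs_def2 in HJ.
  destruct (partial_rprod_head (S J) (eta / 2) ltac:(lra)) as [K HK]. exists K. intros n x Hx.
  assert (H1 : partial_rprod g (S J) x * exp (x * (eta / 2)) <= K * exp (eta * x)).
  { replace (eta * x) with (eta / 2 * x + x * (eta / 2)) by field. rewrite exp_plus, <- Rmult_assoc.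
    apply Rmult_le_compat_r; [left; apply exp_pos|auto]. }
  eapply Rle_trans; [|apply H1].
  (* Enlarging the product to n + J + 1 factors avoids comparing n with J. *)
  eapply Rle_trans; [apply (partial_rprod_mono n (S J) x Hx)|]. rewrite Nat.add_comm.
  eapply Rle_trans; [apply partial_rprod_tail; auto|].
  apply Rmult_le_compat_l; [pose proof (partial_rprod_ge_1 (S J) x Hx); lra|].
  specialize (Hle (S J + n)%nat).
  assert (Hxx : x * (psum g (S J + n) - psum g (S J)) <= x * (eta / 2)) by (apply Rmult_le_compat_l; lra).
  destruct Hxx as [Hlt|Heq]; [left; apply exp_increasing; auto|rewrite Heq; lra].
Qed.

Lemma lprod_map_seq (n : nat) (z : C) : lprod (map g (seq 0 n)) z = Cprod_n (fun j => 1 + RtoC (g j) * z)%C n.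
Proof.
  induction n as [|n IH]; auto. rewrite seq_S, map_app, lprod_app, IH. simpl. ring.
Qed.

Lemma rprod_map_seq (n : nat) (z : C) : Cmod (Cprod_n (fun j => 1 + RtoC (g j) * z)%C n) <= partial_rprod g n (Cmod z).
Proof.
  induction n as [|n IH]; simpl; [rewrite Cmod_1; lra|]. rewrite Cmod_mult.
  apply Rmult_le_compat; auto using Cmod_ge_0. eapply Rle_trans; [apply Cmod_triangle|].
  rewrite Cmod_1, Cmod_mult, Cmod_RtoC_nonneg by auto. lra.
Qed.
End Products.

Lemma lsum_repeat (x : R) (n : nat) : lsum (repeat x n) = INR n * x.
Proof. induction n as [|n IH]; [simpl; ring|]. rewrite S_INR. simpl. rewrite IH. ring. Qed.

Lemma Cprod_n_one (n : nat) : Cprod_n (fun _ => RtoC 1) n = RtoC 1.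
Proof. induction n as [|n IH]; simpl; auto. rewrite IH. ring. Qed.

Lemma laguerre_approximated (alpha : R) (f : C -> C) : laguerre_with alpha f -> pos_at_0 f ->
  0 <= alpha /\ approximated nonneg_list alpha f.
Proof.
  intros (Hf & c & m & g & P & Ha & Hg & Hs & HP & Hrep) (r & Hr & Hfr).
  assert (Hg0 : forall j, 0 <= g j).
  { intros j. destruct (Hg j) as [H1 H2]. lra. }
  assert (HP' : forall z, clim eventually (Cprod_n (fun j => 1 + RtoC (g j) * z)%C) (P z)).
  { intros z. apply clim_filterlim; [apply eventually_filter|]. apply HP. }
  assert (HP0 : P (RtoC 0) = RtoC 1).
  { apply (clim_unique eventually _ _ _ (HP' (RtoC 0))).
    eapply clim_ext; [apply eventually_filter| |apply clim_const; apply eventually_filter].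
    intros n. replace (fun j => 1 + RtoC (g j) * 0)%C with (fun _ : nat => RtoC 1).
    - symmetry. apply Cprod_n_one.
    - apply functional_extensionality. intros j. ring. }
  pose proof (Hrep (RtoC 0)) as H0. rewrite HP0, Hfr in H0.
  replace (RtoC alpha * 0)%C with (RtoC 0) in H0 by ring. rewrite Cexp_0 in H0.
  (* A positive value at 0 excludes the factor z^m with m > 0 and forces the constant to equal that
     value. *)
  destruct m as [|m].
  2: { exfalso. simpl in H0. assert (E : RtoC r = RtoC 0) by (rewrite H0; ring).
       apply RtoC_inj in E. lra. }
  assert (Hc : c = RtoC r) by (rewrite H0; simpl; ring).
  split; auto. split; auto.
  set (x := fun i : nat => alpha / INR (S i)).
  assert (HSi : forall i, 0 < INR (S i)) by (intros; apply lt_0_INR; lia).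
  assert (Hx : forall i, 0 <= x i).
  { intros i. apply Rmult_le_pos; auto. left. apply Rinv_0_lt_compat; auto. }
  assert (Hxs : forall i, lsum (repeat (x i) (S i)) = alpha).
  { intros i. rewrite lsum_repeat. unfold x. field. specialize (HSi i). lra. }
  assert (Hrn : forall i, nonneg_list (repeat (x i) (S i))).
  { intros i. unfold nonneg_list. rewrite Forall_forall. intros y Hy. apply repeat_spec in Hy. subst; auto. }
  (* The first i factors of the product, together with i + 1 equal factors 1 + alpha z / (i + 1) for
     the exponential. The latter have parameter sum alpha, hence growth of type alpha. *)
  exists (fun _ => r), (fun i => map g (seq 0 i) ++ repeat (x i) (S i)). split; [|split].
  - intros i. split; auto. unfold nonneg_list in *. rewrite Forall_app. split; auto.
    rewrite Forall_forall. intros y Hy. apply in_map_iff in Hy. destruct Hy as (j & <- & _). auto.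
  - intros z. rewrite Hrep, Hc. simpl Cpow.
    replace (RtoC r * 1 * Cexp (RtoC alpha * z) * P z)%C with (RtoC r * (P z * Cexp (RtoC alpha * z)))%C by ring.
    apply clim_scal; [apply eventually_filter|].
    apply clim_ext with (fun i => Cprod_n (fun j => 1 + RtoC (g j) * z)%C i * lprod (repeat (x i) (S i)) z)%C;
      [apply eventually_filter|intros i; rewrite lprod_app, lprod_map_seq; reflexivity|].
    apply clim_mult; auto; [apply eventually_filter|].
    pose proof (Cmod_ge_0 z) as Hz.
    assert (HK : 0 <= 6 * Cmod z ^ 2 * alpha * alpha * exp (Cmod z * alpha)).
    { repeat apply Rmult_le_pos; auto; try lra; try apply pow_le; auto. left; apply exp_pos. }
    intros e He. destruct (inv_INR_small _ e HK He) as [N HN]. exists N. intros i Hi.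
    specialize (HN i Hi). replace (i + 1)%nat with (S i) in HN by lia.
    eapply Rle_lt_trans; [|apply HN].
    pose proof (lprod_exp (repeat (x i) (S i)) (x i) z (Hx i)) as HL. rewrite Hxs in HL.
    eapply Rle_trans; [apply HL|].
    + rewrite Forall_forall. intros y Hy. apply repeat_spec in Hy. subst. specialize (Hx i). lra.
    + right. unfold x. field. specialize (HSi i). lra.
  - intros b Hb. destruct (partial_rprod_growth g Hg0 (b - alpha) ltac:(lra) Hs) as [K HK].
    exists (r * K). intros i z. rewrite lprod_app, lprod_map_seq, !Cmod_mult, Cmod_RtoC_nonneg by lra.
    rewrite Rmult_assoc. apply Rmult_le_compat_l; [lra|].
    replace (b * Cmod z) with ((b - alpha) * Cmod z + Cmod z * alpha) by ring. rewrite exp_plus, <- Rmult_assoc.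
    apply Rmult_le_compat; auto using Cmod_ge_0.
    + eapply Rle_trans; [apply rprod_map_seq; auto|]. apply HK, Cmod_ge_0.
    + rewrite <- (Hxs i). apply lprod_bound. apply Hrn.
Qed.

(** * Uniqueness *)

(** A form of Cousin's lemma by bisection: if an additive property failed on [a, b], it would fail
    on nested intervals shrinking to a point x, against its validity on all short intervals around
    x. *)
Lemma interval_induction (a b : R) (P : R -> R -> Prop) : a <= b ->
  (forall x, a <= x <= b -> exists d, 0 < d /\ forall p q, a <= p <= x -> x <= q <= b -> q - p < d -> P p q) ->
  (forall p m q, a <= p <= m -> m <= q <= b -> P p m -> P m q -> P p q) -> P a b.
Proof.
  intros Hab Hloc Hadd. apply NNPP. intros HP.
  set (L := b - a).
  assert (P2 : forall n, 0 < 2 ^ n) by (intros; apply pow_lt; lra).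
  assert (Hh : forall n, L / 2 ^ S n = L / 2 ^ n / 2).
  { intros n. simpl. field. apply Rgt_not_eq, P2. }
  assert (HL : forall n, 0 <= L / 2 ^ n).
  { intros n. apply Rmult_le_pos; [unfold L; lra|]. left. apply Rinv_0_lt_compat; auto. }
  set (good := fun n x => a <= x /\ x + L / 2 ^ n <= b /\ ~ P x (x + L / 2 ^ n)).
  destruct (fun_choice (fun (q : nat * R) y => good (fst q) (snd q) ->
     (y = snd q \/ y = snd q + L / 2 ^ (fst q) / 2) /\ good (S (fst q)) y)) as [nx Hnx].
  { intros [n x]. simpl. destruct (classic (good n x)) as [(H1 & H2 & H3)|H]; [|exists 0; tauto].
    specialize (HL n).
    destruct (classic (P x (x + L / 2 ^ n / 2))) as [H4|H4].
    - exists (x + L / 2 ^ n / 2). intros _. split; auto. unfold good. rewrite Hh.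
      replace (x + L / 2 ^ n / 2 + L / 2 ^ n / 2) with (x + L / 2 ^ n) by lra.
      split; [lra|]. split; [lra|]. intros H5. apply H3.
      apply Hadd with (x + L / 2 ^ n / 2); [lra|lra|exact H4|exact H5].
    - exists x. intros _. split; auto. unfold good. rewrite Hh. split; [lra|]. split; [lra|exact H4]. }
  set (u := fix u (n : nat) : R := match n with O => a | S n => nx (n, u n) end).
  assert (Hg : forall n, good n (u n)).
  { induction n as [|n IH].
    - unfold good. simpl. replace (a + L / 1) with b by (unfold L; field). split; [lra|]. split; [lra|auto].
    - apply (Hnx (n, u n)). auto. }
  destruct (dichotomy_limit u L) as [x Hx]; [unfold L; lra| |].
  { intros n. apply (Hnx (n, u n)). apply Hg. }
  destruct (Hloc x) as (d & Hd & Hpq).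
  { specialize (Hx O). simpl in Hx. unfold L in Hx. lra. }
  destruct (pow2_large L d Hd) as [n Hn]. destruct (Hg n) as (H1 & H2 & H3). specialize (Hx n).
  apply H3. apply Hpq; lra.
Qed.

(** * Derivatives in time relative to an interval *)

Definition rderiv (p q : R) (u : R -> C) (t : R) (l : C) : Prop :=
  forall eps, 0 < eps -> exists d, 0 < d /\ forall s, p <= s <= q -> Rabs (s - t) < d ->
    Cmod (u s - u t - RtoC (s - t) * l) <= eps * Rabs (s - t).

Lemma rderiv_sub (p q p' q' : R) (u : R -> C) (t : R) (l : C) : p <= p' -> q' <= q ->
  rderiv p q u t l -> rderiv p' q' u t l.
Proof.
  intros Hp Hq H eps He. destruct (H eps He) as (d & Hd & Hs). exists d. split; auto.
  intros s Hs1. apply Hs. lra.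
Qed.

Lemma rderiv_cont (p q : R) (u : R -> C) (t : R) (l : C) : rderiv p q u t l ->
  forall eps, 0 < eps -> exists d, 0 < d /\ forall s, p <= s <= q -> Rabs (s - t) < d -> Cmod (u s - u t) < eps.
Proof.
  intros H eps He. destruct (H 1 Rlt_0_1) as (d & Hd & Hs). pose proof (Cmod_ge_0 l).
  exists (Rmin d (eps / (Cmod l + 2))). split; [apply Rmin_pos; auto; apply Rdiv_lt_0_compat; lra|].
  intros s Hs1 Hs2. pose proof (Rmin_l d (eps / (Cmod l + 2))). pose proof (Rmin_r d (eps / (Cmod l + 2))).
  specialize (Hs s Hs1 ltac:(lra)).
  replace (u s - u t)%C with ((u s - u t - RtoC (s - t) * l) + RtoC (s - t) * l)%C by ring.
  eapply Rle_lt_trans; [apply Cmod_triangle|]. rewrite Cmod_mult, Cmod_R.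
  assert (Rabs (s - t) * (Cmod l + 2) < eps).
  { apply Rmult_lt_reg_r with (/ (Cmod l + 2)); [apply Rinv_0_lt_compat; lra|].
    rewrite Rmult_assoc, Rinv_r by lra. unfold Rdiv in *. lra. }
  pose proof (Rabs_pos (s - t)). nra.
Qed.

Lemma rderiv_plus (p q : R) (u v : R -> C) (t : R) (l m : C) : rderiv p q u t l -> rderiv p q v t m ->
  rderiv p q (fun s => u s + v s)%C t (l + m)%C.
Proof.
  intros Hu Hv eps He. destruct (Hu (eps / 2) ltac:(lra)) as (d1 & Hd1 & H1).
  destruct (Hv (eps / 2) ltac:(lra)) as (d2 & Hd2 & H2).
  exists (Rmin d1 d2). split; [apply Rmin_pos; auto|]. intros s Hs Hst.
  pose proof (Rmin_l d1 d2). pose proof (Rmin_r d1 d2).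
  replace (u s + v s - (u t + v t) - RtoC (s - t) * (l + m))%C with
    ((u s - u t - RtoC (s - t) * l) + (v s - v t - RtoC (s - t) * m))%C by ring.
  eapply Rle_trans; [apply Cmod_triangle|].
  specialize (H1 s Hs ltac:(lra)). specialize (H2 s Hs ltac:(lra)). lra.
Qed.

Lemma rderiv_const (p q : R) (c : C) (t : R) : rderiv p q (fun _ => c) t (RtoC 0).
Proof.
  intros eps He. exists 1. split; [lra|]. intros s _ _.
  replace (c - c - RtoC (s - t) * 0)%C with (RtoC 0) by ring. rewrite Cmod_0.
  apply Rmult_le_pos; [lra|apply Rabs_pos].
Qed.

Lemma rderiv_mult (p q : R) (u v : R -> C) (t : R) (l m : C) : rderiv p q u t l -> rderiv p q v t m ->
  rderiv p q (fun s => u s * v s)%C t (l * v t + u t * m)%C.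
Proof.
  intros Hu Hv eps He.
  set (K := Cmod (v t) + 1 + Cmod l + Cmod (u t) + 1).
  pose proof (Cmod_ge_0 (v t)). pose proof (Cmod_ge_0 l). pose proof (Cmod_ge_0 (u t)).
  assert (HK : 0 < K) by (unfold K; lra).
  assert (HeK : 0 < eps / K) by (apply Rdiv_lt_0_compat; auto).
  destruct (Hu _ HeK) as (d1 & Hd1 & H1'). destruct (Hv _ HeK) as (d2 & Hd2 & H2').
  destruct (rderiv_cont p q v t m Hv (Rmin 1 (eps / K))) as (d3 & Hd3 & H3'); [apply Rmin_pos; lra|].
  exists (Rmin d1 (Rmin d2 d3)). split; [repeat apply Rmin_pos; auto|]. intros s Hs Hst.
  pose proof (Rmin_l d1 (Rmin d2 d3)). pose proof (Rmin_r d1 (Rmin d2 d3)).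
  pose proof (Rmin_l d2 d3). pose proof (Rmin_r d2 d3).
  specialize (H1' s Hs ltac:(lra)). specialize (H2' s Hs ltac:(lra)). specialize (H3' s Hs ltac:(lra)).
  pose proof (Rmin_l 1 (eps / K)). pose proof (Rmin_r 1 (eps / K)).
  replace (u s * v s - u t * v t - RtoC (s - t) * (l * v t + u t * m))%C with
    ((u s - u t - RtoC (s - t) * l) * v s + (RtoC (s - t) * l * (v s - v t) +
      u t * (v s - v t - RtoC (s - t) * m)))%C by ring.
  eapply Rle_trans; [apply Cmod_triangle|]. rewrite Cmod_mult.
  eapply Rle_trans; [apply Rplus_le_compat_l; apply Cmod_triangle|]. rewrite !Cmod_mult, Cmod_R.
  pose proof (Cmod_le_sub (v s) (v t)). set (e := eps / K) in *. set (r := Rabs (s - t)) in *.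
  assert (Hr : 0 <= r) by apply Rabs_pos.
  assert (B1 : Cmod (u s - u t - RtoC (s - t) * l) * Cmod (v s) <= e * r * (Cmod (v t) + 1)).
  { apply Rmult_le_compat; auto using Cmod_ge_0; lra. }
  assert (B2 : r * Cmod l * Cmod (v s - v t) <= r * Cmod l * e).
  { apply Rmult_le_compat_l; [apply Rmult_le_pos; auto|lra]. }
  assert (B3 : Cmod (u t) * Cmod (v s - v t - RtoC (s - t) * m) <= Cmod (u t) * (e * r)).
  { apply Rmult_le_compat_l; auto. }
  replace eps with (e * K) by (unfold e; field; lra). unfold K.
  assert (0 <= e * r) by (apply Rmult_le_pos; lra). lra.
Qed.

Lemma rderiv_linear (p q a b t : R) : rderiv p q (fun s => RtoC (a * s + b)) t (RtoC a).
Proof.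
  intros eps He. exists 1. split; [lra|]. intros s _ _.
  rewrite <- RtoC_mult, <- !RtoC_minus.
  replace (a * s + b - (a * t + b) - (s - t) * a) with 0 by ring. rewrite Cmod_0.
  apply Rmult_le_pos; [lra|apply Rabs_pos].
Qed.

Lemma rderiv_ext (p q : R) (u v : R -> C) (t : R) (l m : C) : (forall s, u s = v s) -> l = m ->
  rderiv p q u t l -> rderiv p q v t m.
Proof.
  intros E -> H eps He. destruct (H eps He) as (d & Hd & Hs). exists d; split; auto.
  intros s. rewrite <- !E. apply Hs.
Qed.

(** No continuity of the derivative is assumed, so integration is replaced by interval induction
    with the slope K + eps. *)
Lemma mean_value (p q K : R) (u u' : R -> C) :
  (forall t, p <= t <= q -> rderiv p q u t (u' t) /\ Cmod (u' t) <= K) ->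
  forall x y, p <= x <= q -> p <= y <= q -> Cmod (u y - u x) <= K * Rabs (y - x).
Proof.
  intros H.
  assert (H1 : forall x y, p <= x <= y -> y <= q -> Cmod (u y - u x) <= K * (y - x)).
  { intros x y Hx Hy. apply Rnot_lt_le. intros Hlt.
    destruct (Rle_lt_or_eq_dec x y (proj2 Hx)) as [Hxy|Hxy].
    2: { subst y. unfold Cminus in Hlt. rewrite Cplus_opp_r, Cmod_0 in Hlt. lra. }
    (* Half of the excess slope, so that K + eps still lies below the slope supposed to occur. *)
    set (eps := (Cmod (u y - u x) - K * (y - x)) / (2 * (y - x))).
    assert (He : 0 < eps) by (apply Rdiv_lt_0_compat; lra).
    assert (HP : Cmod (u y - u x) <= (K + eps) * (y - x)).
    { apply (interval_induction x y (fun a b => Cmod (u b - u a) <= (K + eps) * (b - a))); [lra| |].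
      - intros t Ht. destruct (H t ltac:(lra)) as [Hd HK]. destruct (Hd eps He) as (d & Hdp & Hds).
        exists d. split; auto. intros a b Ha Hb Hab.
        assert (Hone : forall s, p <= s <= q -> Rabs (s - t) < d -> Cmod (u s - u t) <= (K + eps) * Rabs (s - t)).
        { intros s Hs Hst. specialize (Hds s Hs Hst).
          replace (u s - u t)%C with ((u s - u t - RtoC (s - t) * u' t) + RtoC (s - t) * u' t)%C by ring.
          eapply Rle_trans; [apply Cmod_triangle|]. rewrite Cmod_mult, Cmod_R.
          pose proof (Rabs_pos (s - t)). assert (Rabs (s - t) * Cmod (u' t) <= Rabs (s - t) * K) by (apply Rmult_le_compat_l; auto).
          lra. }
        pose proof (Hone a ltac:(lra) ltac:(apply Rabs_def1; lra)) as A1.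
        pose proof (Hone b ltac:(lra) ltac:(apply Rabs_def1; lra)) as A2.
        rewrite Rabs_left1 in A1 by lra. rewrite Rabs_right in A2 by lra.
        rewrite Cmod_minus_sym in A1. pose proof (Cmod_sub_triangle (u b) (u t) (u a)). lra.
      - intros a m b _ _ Ha Hb. pose proof (Cmod_sub_triangle (u b) (u m) (u a)). lra. }
    assert (eps * (y - x) = (Cmod (u y - u x) - K * (y - x)) / 2) by (unfold eps; field; lra).
    lra. }
  intros x y Hx Hy. destruct (Rle_dec x y) as [Hxy|Hxy].
  - rewrite Rabs_right by lra. apply H1; lra.
  - rewrite Rabs_left by lra. rewrite Cmod_minus_sym. eapply Rle_trans; [apply H1; lra|]. lra.
Qed.

Lemma fastc_Delta (theta : R) (c : nat -> C) : 0 <= theta -> fastc c ->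
  fastc (fun k => RtoC ((theta + INR k) * INR (S k)) * c (S k))%C.
Proof.
  intros Hth Hc r Hr. destruct (fastc_dc _ Hc (2 * r) ltac:(lra)) as [M HM].
  destruct (nat_above theta) as [T HT]. exists (2 ^ T * M). intros k. specialize (HM k).
  assert (Hle : theta + INR k <= 2 ^ T * 2 ^ k).
  { rewrite <- pow_add. pose proof (INR_le_pow2 (T + k)) as HH. rewrite plus_INR in HH. lra. }
  pose proof (pos_INR k). rewrite RtoC_mult, <- Cmult_assoc. fold (dc c k).
  rewrite Cmod_mult, Cmod_RtoC_nonneg by lra. rewrite Rpow_mult_distr in HM.
  assert (0 <= 2 ^ T) by (apply pow_le; lra).
  apply Rle_trans with (2 ^ T * 2 ^ k * (Cmod (dc c k) * r ^ k)).
  - rewrite Rmult_assoc. apply Rmult_le_compat_r; auto. apply Rmult_le_pos; [apply Cmod_ge_0|apply pow_le; lra].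
  - replace (2 ^ T * 2 ^ k * (Cmod (dc c k) * r ^ k)) with (2 ^ T * (Cmod (dc c k) * (2 ^ k * r ^ k))) by ring.
    apply Rmult_le_compat_l; auto.
Qed.

(** * Evolution of Taylor coefficients *)

Section Evolution.
Variables (tau theta : R).
Hypothesis Htheta : 0 <= theta.

Definition solves (p q : R) (w : R -> C -> C) : Prop :=
  forall t, p <= t <= q -> entire (w t) /\
    forall z, rderiv p q (fun s => w s z) t (RtoC tau * Defs.Delta theta (w t) z)%C.

Definition bounded_on (p q b N : R) (w : R -> C -> C) : Prop :=
  forall t z, p <= t <= q -> Cmod (w t z) <= N * exp (b * Cmod z).

Definition dcoef (f : C -> C) (k : nat) : C := (RtoC (INR (fact k)) * tcoef f k)%C.

Lemma solves_sub (p q p' q' : R) (w : R -> C -> C) : p <= p' -> q' <= q -> solves p q w -> solves p' q' w.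
Proof.
  intros Hp Hq H t Ht. destruct (H t ltac:(lra)) as [H1 H2]. split; auto.
  intros z. eapply rderiv_sub; [| |apply H2]; auto.
Qed.

Lemma dcoef_Cmod (f : C -> C) (k : nat) : Cmod (dcoef f k) = INR (fact k) * Cmod (tcoef f k).
Proof. unfold dcoef. rewrite Cmod_mult, Cmod_RtoC_nonneg by apply pos_INR. auto. Qed.

(** Passing from growth to coefficients doubles the type, to absorb the linear factor in Cauchy's
    estimate. [N'] depends only on b and N, which makes the later bounds uniform in time. *)
Lemma dcoef_bound (b N : R) : 0 < b -> exists N', forall f, entire f ->
  (forall z, Cmod (f z) <= N * exp (b * Cmod z)) -> forall k, Cmod (dcoef f k) <= N' * (2 * b) ^ k.
Proof.
  intros Hb. destruct (growth_coefs b (2 * b) N ltac:(lra)) as [N' HN']. exists N'.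
  intros f Hf Hg k. rewrite dcoef_Cmod. destruct (entire_taylor f Hf) as [Hc E].
  apply HN'; auto. rewrite <- E. auto.
Qed.

Lemma Delta_bound (b N : R) : 0 < b -> exists K, forall f, entire f ->
  (forall k, Cmod (dcoef f k) <= N * b ^ k) -> forall z, Cmod z = 1 -> Cmod (Defs.Delta theta f z) <= K.
Proof.
  intros Hb. destruct (nat_above theta) as [T HT].
  exists (2 ^ T * N * b * exp (2 * b)). intros f Hf Hd z Hz.
  destruct (entire_taylor f Hf) as [Hc E]. rewrite E. rewrite Delta_cps by auto.
  replace (2 * b) with (2 * b * Cmod z) by (rewrite Hz; ring).
  assert (HN : 0 <= N). { specialize (Hd O). simpl in Hd. pose proof (Cmod_ge_0 (dcoef f O)). lra. }
  apply (fact_coef_fastc (fun k => RtoC ((theta + INR k) * INR (S k)) * tcoef f (S k))%C (2 * b) (2 ^ T * N * b)); [lra|].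
  intros k. specialize (Hd (S k)). rewrite dcoef_Cmod, INR_fact_S in Hd.
  pose proof (pos_INR k) as Hk. pose proof (pos_INR (fact k)) as Hf0.
  rewrite Cmod_mult, Cmod_RtoC_nonneg.
  2: { apply Rmult_le_pos; [lra|apply pos_INR]. }
  rewrite S_INR.
  replace (INR (fact k) * ((theta + INR k) * (INR k + 1) * Cmod (tcoef f (S k)))) with
    ((theta + INR k) * ((INR k + 1) * INR (fact k) * Cmod (tcoef f (S k)))) by ring.
  assert (H2 : theta + INR k <= 2 ^ T * 2 ^ k).
  { rewrite <- pow_add. pose proof (INR_le_pow2 (T + k)) as HH. rewrite plus_INR in HH. lra. }
  replace (2 ^ T * N * b * (2 * b) ^ k) with ((2 ^ T * 2 ^ k) * (N * b ^ S k)) by (rewrite Rpow_mult_distr; simpl; ring).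
  apply Rmult_le_compat; auto; [lra|].
  apply Rmult_le_pos; [|apply Cmod_ge_0]. apply Rmult_le_pos; lra.
Qed.

(* The difference quotients in time have Taylor coefficients bounded uniformly
   (mean value inequality and Cauchy estimates), so pointwise convergence gives
   convergence of each coefficient. *)
Lemma dcoef_rderiv (p q b N : R) (w : R -> C -> C) : 0 < b -> solves p q w -> bounded_on p q b N w ->
  forall t k, p <= t <= q ->
  rderiv p q (fun s => dcoef (w s) k) t (RtoC (tau * (theta + INR k)) * dcoef (w t) (S k))%C.
Proof.
  intros Hb Hs Hbd t k Ht.
  destruct (dcoef_bound b N Hb) as [N' HN'].
  destruct (Delta_bound (2 * b) N' ltac:(lra)) as [K HK].
  (* Punctured neighbourhoods of t within [p, q]. For p = q this filter is improper, and the
     coefficient lemma asks only for a filter. *)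
  set (F := within (fun s => p <= s <= q /\ s <> t) (locally t)).
  assert (FF : Filter F) by (apply within_filter, locally_filter).
  set (c := fun s k => (RtoC (/ (s - t)) * (tcoef (w s) k - tcoef (w t) k))%C).
  set (d := fun k => (RtoC tau * (RtoC ((theta + INR k) * INR (S k)) * tcoef (w t) (S k)))%C).
  destruct (Hs t Ht) as [Et Dt]. destruct (entire_taylor _ Et) as [Ft Ewt].
  assert (Hc : forall s, p <= s <= q -> fastc (c s)).
  { intros s Hs'. apply fastc_scal. apply fastc_minus; auto. apply entire_taylor. apply Hs; auto. }
  assert (Hd0 : fastc (fun k => RtoC ((theta + INR k) * INR (S k)) * tcoef (w t) (S k))%C) by (apply fastc_Delta; auto).
  assert (Hd : fastc d) by (apply fastc_scal; auto).
  assert (Ecps : forall s z, p <= s <= q -> cps (c s) z = (RtoC (/ (s - t)) * (w s z - w t z))%C).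
  { intros s z Hs'. destruct (entire_taylor _ (proj1 (Hs s Hs'))) as [Fs Ews].
    unfold c. rewrite (cps_scal (RtoC (/ (s - t))) (fun k => tcoef (w s) k - tcoef (w t) k)%C) by (apply fastc_minus; auto).
    rewrite cps_minus by auto. rewrite <- Ews, <- Ewt. auto. }
  assert (Ed : forall z, cps d z = (RtoC tau * Defs.Delta theta (w t) z)%C).
  { intros z. unfold d. rewrite cps_scal by auto. rewrite <- Delta_cps by auto. rewrite <- Ewt. auto. }
  assert (Hlim : forall k, clim F (fun s => c s k) (d k)).
  { apply (cps_coef_clim F c d (Rabs tau * K)); auto.
    - unfold F, within. apply filter_forall. intros s [Hs1 _]. apply Hc; auto.
    - unfold F, within. apply filter_forall. intros s [Hs1 Hst] z Hz. rewrite Ecps by auto. rewrite Cmod_mult, Cmod_R.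
      assert (Hne : s - t <> 0) by lra. rewrite Rabs_inv.
      pose proof (mean_value p q (Rabs tau * K) (fun s => w s z) (fun t => RtoC tau * Defs.Delta theta (w t) z)%C) as MV.
      assert (HMV : Cmod (w s z - w t z) <= Rabs tau * K * Rabs (s - t)).
      { apply MV; auto. intros r Hr. split; [apply Hs; auto|]. rewrite Cmod_mult, Cmod_R.
        apply Rmult_le_compat_l; [apply Rabs_pos|]. apply HK; auto; [apply Hs; auto|].
        apply HN'; [apply Hs; auto|]. intros z'. apply Hbd; auto. }
      assert (Hp : 0 < Rabs (s - t)) by (apply Rabs_pos_lt; auto).
      apply Rmult_le_reg_l with (Rabs (s - t)); auto. rewrite <- Rmult_assoc, Rinv_r, Rmult_1_l; lra.
    - intros z _ eps He. destruct (Dt z (eps / 2) ltac:(lra)) as (dl & Hdl & Hds).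
      exists (mkposreal dl Hdl). intros s Hsd [Hs1 Hst]. rewrite Ecps, Ed by auto.
      change (Rabs (s - t) < dl) in Hsd. specialize (Hds s Hs1 Hsd).
      assert (Hne : s - t <> 0) by lra. assert (Hp : 0 < Rabs (s - t)) by (apply Rabs_pos_lt; auto).
      assert (Hnc : RtoC (s - t) <> RtoC 0) by (apply RtoC_neq; auto).
      replace (RtoC (/ (s - t)) * (w s z - w t z) - RtoC tau * Defs.Delta theta (w t) z)%C with
        (RtoC (/ (s - t)) * (w s z - w t z - RtoC (s - t) * (RtoC tau * Defs.Delta theta (w t) z)))%C
        by (rewrite RtoC_inv by auto; field; auto).
      rewrite Cmod_mult, Cmod_R, Rabs_inv.
      apply Rmult_lt_reg_l with (Rabs (s - t)); auto. rewrite <- Rmult_assoc, Rinv_r, Rmult_1_l by lra. nra. }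
  intros eps He. pose proof (INR_fact_lt_0 k) as Hfk.
  destruct (Hlim k (eps / INR (fact k))) as [dl Hdl]; [apply Rdiv_lt_0_compat; auto|].
  exists dl. split; [apply cond_pos|]. intros s Hs1 Hst.
  destruct (Req_dec s t) as [->|Hne].
  { replace (dcoef (w t) k - dcoef (w t) k - RtoC (t - t) * (RtoC (tau * (theta + INR k)) * dcoef (w t) (S k)))%C
      with (RtoC 0) by (rewrite Rminus_diag; ring). rewrite Cmod_0. apply Rmult_le_pos; [lra|apply Rabs_pos]. }
  specialize (Hdl s Hst (conj Hs1 Hne)).
  assert (Hnc : RtoC (s - t) <> RtoC 0) by (apply RtoC_neq; lra).
  replace (dcoef (w s) k - dcoef (w t) k - RtoC (s - t) * (RtoC (tau * (theta + INR k)) * dcoef (w t) (S k)))%C with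
    (RtoC (INR (fact k)) * RtoC (s - t) * (c s k - d k))%C.
  - rewrite !Cmod_mult, !Cmod_R, (Rabs_right (INR _)) by (apply Rle_ge; lra).
    apply Rle_trans with (INR (fact k) * Rabs (s - t) * (eps / INR (fact k))).
    + apply Rmult_le_compat_l; [apply Rmult_le_pos; [lra|apply Rabs_pos]|lra].
    + right. field. lra.
  - unfold c, d, dcoef. rewrite INR_fact_S, !RtoC_mult, RtoC_inv, S_INR by lra. field. auto.
Qed.
End Evolution.

Lemma rderiv_heat_weight (p q tau t s : R) (m : nat) :
  rderiv p q (fun s => RtoC (heat_weight (tau * (t - s)) (S m))) s (RtoC (- tau * heat_weight (tau * (t - s)) m)).
Proof.
  revert s. induction m as [|m IH]; intros s.
  - apply rderiv_ext with (fun s => RtoC (- tau * s + tau * t)) (RtoC (- tau)).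
    + intros r. f_equal. unfold heat_weight. simpl. field.
    + f_equal. unfold heat_weight. simpl. field.
    + apply rderiv_linear.
  - pose proof (rderiv_mult p q _ _ s _ _ (IH s)
      (rderiv_linear p q (- tau / INR (S (S m))) (tau * t / INR (S (S m))) s)) as H.
    assert (Hn : INR (S (S m)) <> 0) by (apply not_0_INR; lia).
    assert (Hm : INR (S m) <> 0) by (apply not_0_INR; lia).
    assert (Hf : INR (fact m) <> 0) by apply INR_fact_neq_0.
    assert (E : forall y n, heat_weight y (S n) = heat_weight y n * (y / INR (S n))).
    { intros y n. unfold heat_weight. rewrite INR_fact_S, S_INR. simpl pow.
      pose proof (INR_fact_lt_0 n). pose proof (pos_INR n). field. lra. }
    eapply rderiv_ext; [| |apply H].
    + intros r. cbv beta. rewrite <- RtoC_mult. f_equal. rewrite (E _ (S m)). field. auto.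
    + rewrite <- !RtoC_mult, <- RtoC_plus. f_equal. rewrite (E _ m).
      rewrite (S_INR (S m)), (S_INR m) in *. field. lra.
Qed.

Section Evolution.
Variables (tau theta : R).
Hypothesis Htheta : 0 <= theta.

(** Coefficients of the difference are transported to time t by exp ((t - s) tau Delta_theta). On
    coordinates of size (2 b)^k this series converges when |tau| |t - t0| 2 b < 1, so only the
    distance from [t0] has to be small, in either direction. *)
Lemma local_unique (b N1 N2 p q t0 : R) (w1 w2 : R -> C -> C) : 0 < b ->
  solves tau theta p q w1 -> solves tau theta p q w2 ->
  bounded_on p q b N1 w1 -> bounded_on p q b N2 w2 -> p <= t0 <= q ->
  (forall z, w1 t0 z = w2 t0 z) ->
  forall t, p <= t <= q -> Rabs tau * Rabs (t - t0) * (2 * b) <= / 2 -> forall z, w1 t z = w2 t z.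
Proof.
  intros Hb S1 S2 B1 B2 Ht0 E0 t Ht Hsmall.
  destruct (dcoef_bound b N1 Hb) as [M1 HM1]. destruct (dcoef_bound b N2 Hb) as [M2 HM2].
  set (E := fun s k => (dcoef (w1 s) k + RtoC (-1) * dcoef (w2 s) k)%C).
  set (N := M1 + M2).
  assert (HE : forall s k, p <= s <= q -> Cmod (E s k) <= N * (2 * b) ^ k).
  { intros s k Hs. unfold E, N. eapply Rle_trans; [apply Cmod_triangle|].
    rewrite Cmod_mult, Cmod_R. replace (Rabs (-1)) with 1 by (rewrite Rabs_left; lra).
    pose proof (HM1 (w1 s) (proj1 (S1 s Hs)) (fun z => B1 s z Hs) k).
    pose proof (HM2 (w2 s) (proj1 (S2 s Hs)) (fun z => B2 s z Hs) k). lra. }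
  assert (HD : forall s k, p <= s <= q ->
    rderiv p q (fun s => E s k) s (RtoC (tau * (theta + INR k)) * E s (S k))%C).
  { intros s k Hs. unfold E.
    pose proof (dcoef_rderiv tau theta Htheta p q b N1 w1 Hb S1 B1 s k Hs) as D1.
    pose proof (dcoef_rderiv tau theta Htheta p q b N2 w2 Hb S2 B2 s k Hs) as D2.
    eapply rderiv_ext; [intros; reflexivity| |apply (rderiv_plus _ _ _ _ _ _ _ D1
      (rderiv_mult _ _ _ _ _ _ _ (rderiv_const p q (RtoC (-1)) s) D2))]. ring. }
  assert (HE0 : forall k, E t0 k = RtoC 0).
  { intros k. unfold E. replace (w1 t0) with (w2 t0); [ring|].
    apply functional_extensionality. intros z. auto. }
  assert (HEt : forall k, E t k = RtoC 0).
  { intros k. set (x := theta + INR k). pose proof (pos_INR k) as Hk. assert (Hx : 0 <= x) by (unfold x; lra).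
    (* [phi M s] is a partial sum of the coefficient [k] of [exp ((t - s) tau Delta_theta) (E s)];
       its derivative telescopes to a single term, small for large [M]. *)
    set (phi := fix phi (M : nat) (s : R) : C := match M with O => E s k
      | S M' => (phi M' s + RtoC (heat_weight (tau * (t - s)) M * poch x M) * E s (k + M)%nat)%C end).
    assert (Hphi : forall M s, p <= s <= q ->
      rderiv p q (phi M) s (RtoC (heat_weight (tau * (t - s)) M * poch x (S M) * tau) * E s (k + S M)%nat)%C).
    { induction M as [|M IH]; intros s Hs.
      - eapply rderiv_ext; [intros; reflexivity| |apply (HD s k Hs)].
        replace (k + 1)%nat with (S k) by lia. f_equal. f_equal. unfold heat_weight. simpl. fold x. field.
      - pose proof (rderiv_mult _ _ _ _ _ _ _ (rderiv_mult _ _ _ _ _ _ _ (rderiv_heat_weight p q tau t s M)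
          (rderiv_const p q (RtoC (poch x (S M))) s)) (HD s (k + S M)%nat Hs)) as D1.
        eapply rderiv_ext; [| |apply (rderiv_plus _ _ _ _ _ _ _ (IH s Hs) D1)].
        + intros r. cbv beta. simpl phi. rewrite RtoC_mult. auto.
        + cbv beta. replace (k + S (S M))%nat with (S (k + S M)) by lia.
          change (poch x (S (S M))) with (poch x (S M) * (x + INR (S M))).
          rewrite plus_INR. unfold x. rewrite !RtoC_mult, RtoC_opp, !RtoC_plus. ring. }
    assert (Pt : forall M, phi M t = E t k).
    { induction M as [|M IH]; auto. simpl phi. rewrite IH, Rminus_diag, Rmult_0_r.
      unfold heat_weight. rewrite pow_ne_zero by lia. unfold Rdiv. rewrite !Rmult_0_l. ring. }
    assert (P0 : forall M, phi M t0 = RtoC 0).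
    { induction M as [|M IH]; [apply HE0|]. simpl phi. rewrite IH, HE0. ring. }
    set (rho := Rabs tau * Rabs (t - t0)) in *.
    assert (Hrho : 0 <= rho) by (apply Rmult_le_pos; apply Rabs_pos).
    assert (HN : 0 <= N). { specialize (HE t0 O Ht0). simpl in HE. pose proof (Cmod_ge_0 (E t0 O)). lra. }
    set (C0 := Rabs tau * N * (2 * b) ^ (S k) * x).
    assert (HC0 : 0 <= C0).
    { unfold C0. apply Rmult_le_pos; auto. apply Rmult_le_pos; [apply Rmult_le_pos; auto using Rabs_pos|].
      apply pow_le; lra. }
    set (term := fun M => poch (x + 1) M / INR (fact M) * (rho * (2 * b)) ^ M).
    assert (HK : forall M s, Rmin t t0 <= s <= Rmax t t0 ->
      Cmod (RtoC (heat_weight (tau * (t - s)) M * poch x (S M) * tau) * E s (k + S M)%nat) <= C0 * term M).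
    { intros M s Hs.
      assert (Hsp : p <= s <= q).
      { unfold Rmin, Rmax in Hs. destruct (Rle_dec t t0); lra. }
      assert (Hy : Rabs (tau * (t - s)) <= rho).
      { rewrite Rabs_mult. apply Rmult_le_compat_l; [apply Rabs_pos|].
        unfold Rmin, Rmax in Hs. unfold Rabs. destruct (Rle_dec t t0), (Rcase_abs (t - s)), (Rcase_abs (t - t0)); lra. }
      rewrite Cmod_mult, Cmod_R, !Rabs_mult.
      pose proof (heat_weight_bound rho (tau * (t - s)) M Hy) as HA.
      rewrite (Rabs_right (poch _ _)) by (apply Rle_ge, poch_nonneg; auto).
      rewrite poch_shift.
      replace (C0 * term M) with (rho ^ M / INR (fact M) * (x * poch (x + 1) M) * Rabs tau * (N * (2 * b) ^ (k + S M))).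
      - apply Rmult_le_compat; auto using Cmod_ge_0.
        + apply Rmult_le_pos; [apply Rmult_le_pos|]; auto using Rabs_pos. apply Rmult_le_pos; auto. apply poch_nonneg; lra.
        + apply Rmult_le_compat_r; [apply Rabs_pos|]. apply Rmult_le_compat_r; auto.
          apply Rmult_le_pos; auto. apply poch_nonneg; lra.
      - unfold C0, term. replace (k + S M)%nat with (S k + M)%nat by lia. rewrite pow_add, (Rpow_mult_distr rho).
        unfold Rdiv. ring. }
    assert (Hle : forall M, Cmod (E t k) <= C0 * term M * Rabs (t - t0)).
    { intros M.
      pose proof (mean_value (Rmin t t0) (Rmax t t0) (C0 * term M) (phi M)
        (fun s => RtoC (heat_weight (tau * (t - s)) M * poch x (S M) * tau) * E s (k + S M)%nat)%C) as MV.
      assert (Hsub : p <= Rmin t t0 /\ Rmax t t0 <= q).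
      { unfold Rmin, Rmax. destruct (Rle_dec t t0); lra. }
      replace (E t k) with (phi M t - phi M t0)%C by (rewrite Pt, P0; ring).
      apply MV.
      - intros s Hs. split; [|apply HK; auto].
        eapply rderiv_sub; [| |apply Hphi]; lra.
      - split; [apply Rmin_r|apply Rmax_r].
      - split; [apply Rmin_l|apply Rmax_l]. }
    apply Cmod_small_eq. intros eps Heps. replace (E t k - 0)%C with (E t k) by ring.
    destruct (nat_above (x + 1)) as [n Hn].
    destruct (binomial_series (x + 1) (rho * (2 * b)) n) as [Hser _]; [lra| |].
    { split; [apply Rmult_le_pos; lra|lra]. }
    apply ex_series_lim_0 in Hser. apply is_lim_seq_spec in Hser.
    set (K := C0 * Rabs (t - t0)). assert (HK0 : 0 <= K) by (apply Rmult_le_pos; auto using Rabs_pos).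
    assert (HeK : 0 < eps / (K + 1)) by (apply Rdiv_lt_0_compat; lra).
    destruct (Hser (mkposreal _ HeK)) as [M HM]. specialize (HM M (le_n _)). simpl in HM.
    rewrite Rminus_0_r in HM. fold (term M) in HM. pose proof (Rle_abs (term M)).
    eapply Rle_trans; [apply (Hle M)|].
    replace (C0 * term M * Rabs (t - t0)) with (K * term M) by (unfold K; ring).
    apply Rle_trans with (K * (eps / (K + 1))); [apply Rmult_le_compat_l; lra|].
    replace (K * (eps / (K + 1))) with (eps - eps / (K + 1)) by (field; lra). lra. }
  intros z.
  destruct (entire_taylor _ (proj1 (S1 t Ht))) as [_ T1]. destruct (entire_taylor _ (proj1 (S2 t Ht))) as [_ T2].
  rewrite T1, T2. f_equal. apply functional_extensionality. intros k.
  specialize (HEt k). unfold E, dcoef in HEt.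
  assert (Hn : RtoC (INR (fact k)) <> RtoC 0) by (apply RtoC_neq, INR_fact_neq_0).
  replace (tcoef (w1 t) k) with (/ RtoC (INR (fact k)) * (RtoC (INR (fact k)) * tcoef (w1 t) k +
    RtoC (-1) * (RtoC (INR (fact k)) * tcoef (w2 t) k)) + tcoef (w2 t) k)%C.
  - rewrite HEt. ring.
  - field. auto.
Qed.

(** Growth of type b gives coordinates of size (2 b)^k, and the smallness condition makes Q at most
    2; hence the type 4 b and the factor 2^T. The bound [N2] is common to all initial values with
    the same b and N, and time runs both ways. *)
Lemma evolve (b N : R) : 0 < b -> exists N2, 0 <= N2 /\ forall (y : C -> C) (t0 eps : R), entire y ->
  (forall z, Cmod (y z) <= N * exp (b * Cmod z)) -> 0 <= eps -> Rabs tau * eps * (2 * b) <= / 2 ->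
  exists v, solves tau theta (t0 - eps) (t0 + eps) v /\ bounded_on (t0 - eps) (t0 + eps) (4 * b) N2 v /\
    forall z, v t0 z = y z.
Proof.
  intros Hb. destruct (dcoef_bound b N Hb) as [N' HN']. destruct (nat_above theta) as [T HT].
  exists (Rabs N' * 2 ^ T). split; [apply Rmult_le_pos; [apply Rabs_pos|apply pow_le; lra]|].
  intros y t0 eps Hy Hg Heps Hsmall.
  set (rho := Rabs tau * eps) in *. assert (Hrho : 0 <= rho) by (apply Rmult_le_pos; auto; apply Rabs_pos).
  pose proof (HN' y Hy Hg) as Hd. assert (Hrb : rho * (2 * b) < 1) by lra. assert (H2b : 0 <= 2 * b) by lra.
  assert (HT' : 0 <= theta <= INR T) by lra.
  assert (HN0 : 0 <= N'). { specialize (Hd O). simpl in Hd. pose proof (Cmod_ge_0 (dcoef y O)). lra. }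
  assert (Hr : forall s, t0 - eps <= s <= t0 + eps -> Rabs (tau * (s - t0)) <= rho).
  { intros s Hs. rewrite Rabs_mult. apply Rmult_le_compat_l; [apply Rabs_pos|]. apply Rabs_le; lra. }
  assert (HQ : 0 < / (1 - rho * (2 * b)) <= 2).
  { split; [apply Rinv_0_lt_compat; lra|]. replace 2 with (/ / 2) at 2 by field. apply Rinv_le_contravar; lra. }
  exists (fun s => cps (heatc theta (dcoef y) (tau * (s - t0)))). split; [|split].
  - intros t Ht. split; [apply cps_entire; apply (heatc_fastc theta (2 * b) N' rho T); auto|].
    intros z. destruct (heat_flow_taylor theta (2 * b) N' rho T (dcoef y) HT' H2b Hrho Hrb Hd z) as [K HK].
    intros e He. pose proof (pow2_ge_0 tau). pose proof (Rabs_pos K).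
    assert (HX : 0 <= tau ^ 2 * Rabs K) by (apply Rmult_le_pos; auto).
    exists (e / (tau ^ 2 * Rabs K + 1)). split; [apply Rdiv_lt_0_compat; lra|].
    intros s Hs Hst. specialize (HK (tau * (t - t0)) (tau * (s - t)) (Hr t Ht)).
    replace (tau * (t - t0) + tau * (s - t)) with (tau * (s - t0)) in HK by ring.
    specialize (HK (Hr s Hs)). rewrite Cmult_assoc, <- RtoC_mult, (Rmult_comm (s - t) tau).
    eapply Rle_trans; [apply HK|]. pose proof (Rle_abs K).
    pose proof (Rabs_pos (s - t)) as Hab.
    assert (Hq : Rabs (s - t) * (tau ^ 2 * Rabs K + 1) <= e).
    { apply Rmult_le_reg_r with (/ (tau ^ 2 * Rabs K + 1)); [apply Rinv_0_lt_compat; lra|].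
      rewrite Rmult_assoc, Rinv_r by lra. unfold Rdiv in Hst. lra. }
    replace ((tau * (s - t)) ^ 2 * K) with (tau ^ 2 * K * (s - t) ^ 2) by ring.
    rewrite <- (pow2_abs (s - t)).
    assert (tau ^ 2 * K * Rabs (s - t) ^ 2 <= tau ^ 2 * Rabs K * Rabs (s - t) ^ 2).
    { apply Rmult_le_compat_r; [apply pow_le; auto|]. apply Rmult_le_compat_l; auto. }
    assert (Rabs (s - t) * (Rabs (s - t) * (tau ^ 2 * Rabs K + 1)) <= Rabs (s - t) * e) by (apply Rmult_le_compat_l; auto).
    pose proof (pow2_ge_0 (Rabs (s - t))). lra.
  - intros t z Ht. eapply Rle_trans; [apply (heat_growth theta (2 * b) N' rho T); auto|].
    pose proof (Cmod_ge_0 z).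
    assert (Hexp : exp (2 * b * / (1 - rho * (2 * b)) * Cmod z) <= exp (4 * b * Cmod z)).
    { assert (Hle : 2 * b * / (1 - rho * (2 * b)) * Cmod z <= 4 * b * Cmod z).
      { apply Rmult_le_compat_r; auto. nra. }
      destruct Hle as [Hlt|Heq]; [left; apply exp_increasing; auto|rewrite Heq; lra]. }
    apply Rmult_le_compat; auto.
    + apply Rmult_le_pos; auto. apply pow_le; lra.
    + left; apply exp_pos.
    + rewrite (Rabs_right N') by lra. apply Rmult_le_compat_l; auto. apply pow_incr. lra.
  - intros z. rewrite Rminus_diag, Rmult_0_r.
    destruct (entire_taylor y Hy) as [_ E]. apply eq_trans with (cps (tcoef y) z); [|rewrite <- E; auto]. f_equal. apply functional_extensionality. intros k.
    unfold heatc. rewrite (delta_series_0 theta (2 * b) N' rho T); auto. unfold dcoef.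
    rewrite Cmult_assoc, <- RtoC_mult, Rinv_l by apply INR_fact_neq_0. ring.
Qed.

(** The type 4 b is what the local evolution of data of type b attains, so bounds obtained from it
    fit this notion. *)
Definition loc_bounded (b : R) (w : R -> C -> C) (t : R) : Prop :=
  exists d M, 0 < d /\ forall s, 0 <= s <= 1 -> Rabs (s - t) < d ->
    forall z, Cmod (w s z) <= M * exp (4 * b * Cmod z).

(* [w] agrees on [(c, t]] with the backward evolution of [w t], which extends
   continuously to [c]; its value there is [w c], whose forward evolution is
   controlled by [N] alone. *)
Lemma gap_bound (b N eps : R) : 0 < b -> 0 <= eps -> Rabs tau * eps * (8 * b) <= / 2 ->
  exists N2, 0 <= N2 /\ forall w, solves tau theta 0 1 w ->
  (forall t, 0 <= t <= 1 -> exists Nt, forall z, Cmod (w t z) <= Nt * exp (b * Cmod z)) ->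
  forall c t, 0 <= c < t -> t <= 1 -> t - c <= eps ->
  (forall z, Cmod (w c z) <= N * exp (b * Cmod z)) ->
  (forall s, c < s <= t -> loc_bounded b w s) ->
  forall z, Cmod (w t z) <= N2 * exp (4 * b * Cmod z).
Proof.
  intros Hb Heps Hsm. destruct (evolve b N Hb) as (N2 & HN2 & Hev). exists N2. split; auto.
  intros w Hw Htype c t Hc Ht Htc Hwc Hloc.
  assert (Hsm2 : Rabs tau * eps * (2 * b) <= / 2).
  { pose proof (Rabs_pos tau). assert (0 <= Rabs tau * eps) by (apply Rmult_le_pos; auto). nra. }
  assert (Hsm3 : forall r s, Rabs (r - s) <= eps -> Rabs tau * Rabs (r - s) * (2 * (4 * b)) <= / 2).
  { intros r s Hrs. replace (2 * (4 * b)) with (8 * b) by ring. eapply Rle_trans; [|apply Hsm].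
    apply Rmult_le_compat_r; [lra|]. apply Rmult_le_compat_l; auto. apply Rabs_pos. }
  destruct (Htype t ltac:(lra)) as [Nt HNt].
  destruct (evolve b Nt Hb) as (N3 & HN3 & Hev3).
  destruct (Hev3 (w t) t eps (proj1 (Hw t ltac:(lra))) HNt Heps Hsm2) as (u & Su & Bu & Eu).
  destruct (Hev (w c) c eps (proj1 (Hw c ltac:(lra))) Hwc Heps Hsm2) as (v & Sv & Bv & Ev).
  assert (H4b : 0 < 4 * b) by lra.
  assert (Hwu : forall c', c < c' <= t -> forall z, w c' z = u c' z).
  { intros c' Hc'.
    apply (interval_induction c' t (fun p q => (forall z, w q z = u q z) -> forall z, w p z = u p z)); [lra| | |].
    - intros x Hx. destruct (Hloc x ltac:(lra)) as (d & M & Hd & HM).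
      exists (Rmin d eps). split.
      { apply Rmin_pos; auto. destruct Heps; auto. subst eps. lra. }
      intros p q Hp Hq Hpq Hq0. pose proof (Rmin_l d eps). pose proof (Rmin_r d eps).
      apply (local_unique (4 * b) M N3 p q q w u); auto; try lra.
      + eapply solves_sub; [| |apply Hw]; lra.
      + eapply solves_sub; [| |apply Su]; lra.
      + intros s z Hs. apply HM; [lra|apply Rabs_def1; lra].
      + intros s z Hs. apply Bu; lra.
      + apply Hsm3. apply Rabs_le; lra.
    - intros p m q _ _ H1 H2 H3. auto.
    - auto. }
  assert (Hcu : forall z, w c z = u c z).
  { intros z. apply Cmod_small_eq. intros e He.
    destruct (rderiv_cont _ _ _ _ _ (proj2 (Hw c ltac:(lra)) z) (e / 2) ltac:(lra)) as (d1 & Hd1 & H1).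
    destruct (rderiv_cont _ _ _ _ _ (proj2 (Su c ltac:(lra)) z) (e / 2) ltac:(lra)) as (d2 & Hd2 & H2).
    set (h := Rmin (Rmin d1 d2) (t - c)).
    assert (Hh : 0 < h) by (repeat apply Rmin_pos; lra).
    assert (h <= Rmin d1 d2) by apply Rmin_l. assert (h <= t - c) by apply Rmin_r.
    pose proof (Rmin_l d1 d2). pose proof (Rmin_r d1 d2).
    specialize (H1 (c + h / 2) ltac:(lra) ltac:(apply Rabs_def1; lra)).
    specialize (H2 (c + h / 2) ltac:(lra) ltac:(apply Rabs_def1; lra)).
    rewrite (Hwu (c + h / 2) ltac:(lra) z) in H1.
    pose proof (Cmod_sub_triangle (w c z) (u (c + h / 2) z) (u c z)) as HT.
    rewrite (Cmod_minus_sym (w c z) (u (c + h / 2) z)) in HT. lra. }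
  intros z. rewrite <- (Eu z).
  rewrite (local_unique (4 * b) N3 N2 c t c u v); auto; try lra.
  - apply Bv. lra.
  - eapply solves_sub; [| |apply Su]; lra.
  - eapply solves_sub; [| |apply Sv]; lra.
  - intros s z' Hs. apply Bu; lra.
  - intros s z' Hs. apply Bv; lra.
  - intros z'. rewrite <- Hcu, Ev. auto.
  - apply Hsm3. apply Rabs_le; lra.
Qed.
End Evolution.

(** * Time reversal and the set of bad times *)

Lemma rderiv_reverse (u : R -> C) (t : R) (l : C) : rderiv 0 1 u (1 - t) l ->
  rderiv 0 1 (fun s => u (1 - s)) t (- l)%C.
Proof.
  intros H eps He. destruct (H eps He) as (d & Hd & Hs). exists d; split; auto.
  intros s Hs1 Hst. specialize (Hs (1 - s) ltac:(lra)).
  replace (1 - s - (1 - t)) with (- (s - t)) in Hs by ring. rewrite Rabs_Ropp in Hs. specialize (Hs Hst).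
  replace (u (1 - s)%R - u (1 - t)%R - RtoC (s - t) * - l)%C with (u (1 - s)%R - u (1 - t)%R - RtoC (- (s - t)) * l)%C
    by (rewrite RtoC_opp; ring). auto.
Qed.

Lemma solves_reverse (tau theta : R) (w : R -> C -> C) : solves tau theta 0 1 w ->
  solves (- tau) theta 0 1 (fun s => w (1 - s)).
Proof.
  intros H t Ht. destruct (H (1 - t) ltac:(lra)) as [H1 H2]. split; auto. intros z.
  eapply rderiv_ext; [intros; reflexivity| |apply (rderiv_reverse (fun s => w s z) t); apply H2].
  rewrite RtoC_opp. ring.
Qed.

(** If no piece of F lay in a single [G n], one could choose nested intervals centred in F whose
    n-th successor avoids [G n]. Their common point lies in [0, 1], hence in some [G n], a
    contradiction. *)
Lemma baire_interval (F : R -> Prop) (G : nat -> R -> Prop) :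
  (exists x, F x) -> (forall x, F x -> 0 <= x <= 1) ->
  (forall x, 0 <= x <= 1 -> exists n, G n x) ->
  (forall n x, 0 <= x <= 1 -> ~ G n x -> exists d, 0 < d /\ forall y, 0 <= y <= 1 -> Rabs (y - x) < d -> ~ G n y) ->
  exists n x d, F x /\ 0 < d /\ forall y, F y -> Rabs (y - x) < d -> G n y.
Proof.
  intros [x0 Hx0] HF HG Hopen. apply NNPP. intros Hno.
  assert (H : forall n x d, F x -> 0 < d -> exists y, F y /\ Rabs (y - x) < d /\ ~ G n y).
  { intros n x d Hx Hd. apply NNPP. intros H1. apply Hno. exists n, x, d. split; auto. split; auto.
    intros y Hy Hyx. apply NNPP. intros H2. apply H1. exists y. auto. }
  destruct (fun_choice (fun (s : nat * (R * R)) (s' : R * R) => F (fst (snd s)) -> 0 < snd (snd s) ->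
    F (fst s') /\ 0 < snd s' /\ snd s' <= snd (snd s) / 2 /\ Rabs (fst s' - fst (snd s)) < snd (snd s) / 2 /\
    forall r, 0 <= r <= 1 -> Rabs (r - fst s') <= snd s' -> ~ G (fst s) r)) as [nx Hnx].
  { intros [n [x d]]. simpl. destruct (classic (F x /\ 0 < d)) as [[Hx Hd]|Hn]; [|exists (0, 0); tauto].
    destruct (H n x (d / 2) Hx ltac:(lra)) as (y & Hy & Hyx & HGy).
    destruct (Hopen n y (HF y Hy) HGy) as (d' & Hd' & Hd'').
    exists (y, Rmin (d / 2) (d' / 2)). intros _ _. simpl.
    pose proof (Rmin_l (d / 2) (d' / 2)). pose proof (Rmin_r (d / 2) (d' / 2)).
    split; auto. split; [apply Rmin_pos; lra|]. split; auto. split; auto.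
    intros r Hr Hry. apply Hd''; auto. lra. }
  set (st := fix st (n : nat) : R * R := match n with O => (x0, 1) | S n => nx (n, st n) end).
  assert (Hst : forall n, F (fst (st n)) /\ 0 < snd (st n)).
  { induction n as [|n [IH1 IH2]]; [simpl; split; auto; lra|].
    destruct (Hnx (n, st n) IH1 IH2) as (H1 & H2 & _). auto. }
  assert (Hstep : forall n, snd (st (S n)) <= snd (st n) / 2 /\ Rabs (fst (st (S n)) - fst (st n)) < snd (st n) / 2 /\
    forall r, 0 <= r <= 1 -> Rabs (r - fst (st (S n))) <= snd (st (S n)) -> ~ G n r).
  { intros n. destruct (Hst n) as [H1 H2]. destruct (Hnx (n, st n) H1 H2) as (_ & _ & H3). exact H3. }
  set (lo := fun n => fst (st n) - snd (st n)). set (hi := fun n => fst (st n) + snd (st n)).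
  assert (Hlo : forall n, lo n <= lo (S n)).
  { intros n. destruct (Hstep n) as (H1 & H2 & _). apply Rabs_def2 in H2. unfold lo. lra. }
  assert (Hhi : forall n, hi (S n) <= hi n).
  { intros n. destruct (Hstep n) as (H1 & H2 & _). apply Rabs_def2 in H2. unfold hi. lra. }
  assert (Hhik : forall n k, hi (k + n)%nat <= hi n).
  { intros n. induction k as [|k IH]; [simpl; lra|]. specialize (Hhi (k + n)%nat). simpl. lra. }
  assert (Hlh : forall n, lo n <= hi n) by (intros n; destruct (Hst n); unfold lo, hi; lra).
  destruct (ex_finite_lim_seq_incr lo (hi O)) as [L HL]; auto.
  { intros n. specialize (Hlh n). specialize (Hhik O n). rewrite Nat.add_0_r in Hhik. lra. }
  assert (HLb : forall n, lo n <= L <= hi n).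
  { intros n. split; [apply is_lim_seq_incr_compare; auto|].
    assert (HL' : is_lim_seq (fun k => lo (k + n)%nat) L) by (apply is_lim_seq_incr_n with (N := n) in HL; auto).
    assert (Hr : Rbar_le L (hi n)); [|exact Hr].
    apply (is_lim_seq_le (fun k => lo (k + n)%nat) (fun _ => hi n)); auto; [|apply is_lim_seq_const].
    intros k. specialize (Hlh (k + n)%nat). specialize (Hhik n k). lra. }
  assert (Hd : forall n, snd (st n) <= 1 / 2 ^ n).
  { induction n as [|n IH]; [simpl; lra|]. destruct (Hstep n) as [H1 _].
    replace (1 / 2 ^ S n) with (1 / 2 ^ n / 2) by (simpl; field; apply pow_nonzero; lra). lra. }
  assert (HL01 : 0 <= L <= 1).
  { split; apply Rnot_lt_le; intros Hlt.
    - destruct (pow2_large 1 (- L) ltac:(lra)) as [n Hn]. specialize (Hd n). specialize (HLb n).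
      destruct (Hst n) as [H1 _]. specialize (HF _ H1). unfold lo, hi in HLb. lra.
    - destruct (pow2_large 1 (L - 1) ltac:(lra)) as [n Hn]. specialize (Hd n). specialize (HLb n).
      destruct (Hst n) as [H1 _]. specialize (HF _ H1). unfold lo, hi in HLb. lra. }
  destruct (HG L HL01) as [n Hn]. destruct (Hstep n) as (_ & _ & H3). apply (H3 L HL01); auto.
  specialize (HLb (S n)). unfold lo, hi in HLb. apply Rabs_le; lra.
Qed.

Definition exp_type (b : R) (w : R -> C -> C) : Prop :=
  forall t, 0 <= t <= 1 -> exists N, forall z, Cmod (w t z) <= N * exp (b * Cmod z).

Lemma loc_bounded_open (b : R) (w : R -> C -> C) (t : R) : loc_bounded b w t ->
  exists d, 0 < d /\ forall s, Rabs (s - t) < d -> loc_bounded b w s.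
Proof.
  intros (d & M & Hd & HM). exists (d / 2). split; [lra|]. intros s Hs.
  exists (d / 2), M. split; [lra|]. intros r Hr Hrs. apply HM; auto.
  replace (r - t) with ((r - s) + (s - t)) by ring. eapply Rle_lt_trans; [apply Rabs_triang|]. lra.
Qed.

Lemma loc_bounded_reverse (b : R) (w : R -> C -> C) (t : R) :
  loc_bounded b (fun s => w (1 - s)) (1 - t) -> loc_bounded b w t.
Proof.
  intros (d & M & Hd & HM). exists d, M. split; auto. intros s Hs Hst z.
  specialize (HM (1 - s) ltac:(lra)). replace (1 - (1 - s)) with s in HM by ring. apply HM.
  replace (1 - s - (1 - t)) with (- (s - t)) by ring. rewrite Rabs_Ropp. auto.
Qed.

(** The supremum of the points of F in [x, t] belongs to F, the complement of F being open. *)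
Lemma last_point (F : R -> Prop) (x t : R) :
  (forall s, ~ F s -> exists d, 0 < d /\ forall r, Rabs (r - s) < d -> ~ F r) ->
  x <= t -> F x -> ~ F t -> exists c, x <= c < t /\ F c /\ forall s, c < s <= t -> ~ F s.
Proof.
  intros Hop Hxt Hx Ht.
  destruct (completeness (fun s => x <= s <= t /\ F s)) as [c [Hub Hlub]].
  - exists t. intros s [Hs _]. lra.
  - exists x. split; auto. lra.
  - assert (Hxc : x <= c) by (apply Hub; split; auto; lra).
    assert (Hct : c <= t) by (apply Hlub; intros s [Hs _]; lra).
    assert (HF : F c).
    { apply NNPP. intros Hn. destruct (Hop c Hn) as (d & Hd & Hr).
      assert (c <= c - d / 2); [|lra]. apply Hlub. intros s [Hs HFs].
      apply Rnot_lt_le. intros Hlt. apply (Hr s); auto.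
      pose proof (Hub s (conj Hs HFs)). apply Rabs_def1; lra. }
    exists c. split; [|split; auto].
    + destruct Hct as [|E]; [lra|]. subst c. tauto.
    + intros s Hs HFs. assert (s <= c); [apply Hub; split; auto; lra|lra].
Qed.

Section Locally_bounded.
Variables (theta b : R).
Hypothesis Htheta : 0 <= theta.
Hypothesis Hb : 0 < b.

(** The last bad time before t is still within d of x, so the bound N holds there, and no bad time
    separates it from t; [gap_bound] then applies with a constant depending on N alone. *)
Lemma bound_after (tau N eps : R) : 0 <= eps -> Rabs tau * eps * (8 * b) <= / 2 ->
  exists N2, forall w x d, solves tau theta 0 1 w -> exp_type b w -> d <= eps -> 0 <= x ->
    ~ loc_bounded b w x ->
    (forall y, 0 <= y <= 1 -> ~ loc_bounded b w y -> Rabs (y - x) < d ->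
      forall z, Cmod (w y z) <= N * exp (b * Cmod z)) ->
    forall t, x <= t <= 1 -> t - x < d -> loc_bounded b w t ->
    forall z, Cmod (w t z) <= N2 * exp (4 * b * Cmod z).
Proof.
  intros He Hs. destruct (gap_bound tau theta Htheta b N eps Hb He Hs) as (N2 & _ & H2). exists N2.
  intros w x d Hw Hty Hd Hx0 Hx HN t Ht Htd Htl.
  destruct (last_point (fun s => ~ loc_bounded b w s) x t) as (c & Hc & Hcb & Hcl); auto; [|lra|].
  { intros s Hn. apply NNPP in Hn. destruct (loc_bounded_open b w s Hn) as (d' & Hd' & Hr).
    exists d'. split; auto. }
  apply (H2 w Hw Hty c t); try lra.
  - apply HN; auto; [lra|]. apply Rabs_def1; lra.
  - intros s Hsc. apply NNPP, Hcl; auto.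
Qed.

(* Otherwise Baire's theorem gives a relatively open part of the closed set of
   bad times on which a single bound holds; [bound_after], forwards and
   backwards in time, carries it across the gaps. *)
Lemma solves_loc_bounded (tau : R) (w : R -> C -> C) : solves tau theta 0 1 w -> exp_type b w ->
  forall t, 0 <= t <= 1 -> loc_bounded b w t.
Proof.
  intros Hw Hty. apply NNPP. intros Hno.
  destruct (baire_interval (fun t => 0 <= t <= 1 /\ ~ loc_bounded b w t)
    (fun n t => forall z, Cmod (w t z) <= INR n * exp (b * Cmod z))) as (n & x & d & [Hx01 Hx] & Hd & HG).
  { apply not_all_ex_not in Hno. destruct Hno as [t Ht]. exists t. tauto. }
  { tauto. }
  { intros t Ht. destruct (Hty t Ht) as [N HN]. destruct (nat_above N) as [n Hn]. exists n. intros z.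
    eapply Rle_trans; [apply HN|]. apply Rmult_le_compat_r; [left; apply exp_pos|lra]. }
  { intros n t Ht HG. apply not_all_ex_not in HG. destruct HG as [z Hz]. apply Rnot_le_lt in Hz.
    destruct (rderiv_cont _ _ _ _ _ (proj2 (Hw t Ht) z) (Cmod (w t z) - INR n * exp (b * Cmod z)) ltac:(lra))
      as (d & Hd & Hc).
    exists d. split; auto. intros y Hy Hyt HG. specialize (Hc y Hy Hyt). specialize (HG z).
    rewrite Cmod_minus_sym in Hc. pose proof (Cmod_sub_triangle (w t z) (w y z) (RtoC 0)) as HT.
    replace (w t z - 0)%C with (w t z) in HT by ring. replace (w y z - 0)%C with (w y z) in HT by ring. lra. }
  (* This makes |tau| eps (8 b) at most 1/2, the smallness for solutions of type 4 b; adding 1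
     covers [tau = 0]. *)
  set (eps := / (16 * b * (Rabs tau + 1))).
  pose proof (Rabs_pos tau) as Hta.
  assert (Hden : 0 < 16 * b * (Rabs tau + 1)) by (apply Rmult_lt_0_compat; lra).
  assert (Heps : 0 < eps) by (apply Rinv_0_lt_compat; auto).
  assert (Hsm : Rabs tau * eps * (8 * b) <= / 2).
  { assert (E : (Rabs tau + 1) * eps * (8 * b) = / 2) by (unfold eps; field; lra).
    rewrite <- E. apply Rmult_le_compat_r; [lra|]. apply Rmult_le_compat_r; lra. }
  assert (Hsm' : Rabs (- tau) * eps * (8 * b) <= / 2) by (rewrite Rabs_Ropp; auto).
  destruct (bound_after tau (INR n) eps) as [N2 HN2]; auto; [lra|].
  destruct (bound_after (- tau) (INR n) eps) as [N3 HN3]; auto; [lra|].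
  set (d' := Rmin d eps).
  assert (Hd' : 0 < d') by (apply Rmin_pos; auto).
  assert (Hdd : d' <= d) by apply Rmin_l. assert (Hde : d' <= eps) by apply Rmin_r.
  (* A bound near the bad time x is the contradiction sought. The three constants serve bad times,
     good times after x and good times before x. *)
  apply Hx. exists d', (INR n + Rabs N2 + Rabs N3). split; auto. intros s Hs Hsx z.
  pose proof (exp_pos (4 * b * Cmod z)) as Hp. pose proof (pos_INR n).
  pose proof (Rle_abs N2). pose proof (Rle_abs N3). pose proof (Rabs_pos N2). pose proof (Rabs_pos N3).
  destruct (classic (loc_bounded b w s)) as [Hl|Hl].
  - destruct (Rle_dec x s) as [Hxs|Hxs].
    + apply Rle_trans with (N2 * exp (4 * b * Cmod z)); [|apply Rmult_le_compat_r; lra].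
      apply (HN2 w x d'); auto; try lra.
      * intros y Hy Hyl Hyx. apply HG; auto; lra.
      * apply Rabs_def2 in Hsx. lra.
    + apply Rle_trans with (N3 * exp (4 * b * Cmod z)); [|apply Rmult_le_compat_r; lra].
      replace s with (1 - (1 - s)) by ring.
      apply (HN3 (fun s => w (1 - s)) (1 - x) d' (solves_reverse tau theta w Hw)); try lra.
      * intros t Ht. apply Hty. lra.
      * intros HH. apply loc_bounded_reverse in HH. auto.
      * intros y Hy Hyl Hyx. apply HG.
        -- split; [lra|]. intros HH. apply Hyl. apply loc_bounded_reverse.
           replace (fun s0 : R => w (1 - (1 - s0))) with w; auto.
           apply functional_extensionality. intros r. f_equal. ring.
        -- replace (1 - y - x) with (- (y - (1 - x))) by ring. rewrite Rabs_Ropp. lra.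
      * apply Rabs_def2 in Hsx. lra.
      * apply loc_bounded_reverse. replace (fun s0 : R => w (1 - (1 - s0))) with w.
        -- replace (1 - (1 - s)) with s by ring. auto.
        -- apply functional_extensionality. intros r. f_equal. ring.
  - apply Rle_trans with (INR n * exp (4 * b * Cmod z)); [|apply Rmult_le_compat_r; lra].
    eapply Rle_trans; [apply HG; [auto|lra]|]. apply Rmult_le_compat_l; auto.
    pose proof (Cmod_ge_0 z).
    assert (Hle : b * Cmod z <= 4 * b * Cmod z) by (apply Rmult_le_compat_r; lra).
    destruct Hle as [Hlt|Heq]; [left; apply exp_increasing; auto|rewrite <- Heq; lra].
Qed.

(** Vanishing propagates over short intervals around each time, by comparison with the zero solution
    under the local bound; interval induction chains these steps from 0 to t. *)
Lemma solves_zero (tau : R) (w : R -> C -> C) : solves tau theta 0 1 w -> exp_type b w ->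
  (forall z, w 0 z = RtoC 0) -> forall t z, 0 <= t <= 1 -> w t z = RtoC 0.
Proof.
  intros Hw Hty H0 t z Ht. revert z.
  apply (interval_induction 0 t (fun p q => (forall z, w p z = RtoC 0) -> forall z, w q z = RtoC 0)); auto; [lra|].
  intros x Hx. destruct (solves_loc_bounded tau w Hw Hty x ltac:(lra)) as (d & M & Hd & HM).
  set (eps := / (16 * b * (Rabs tau + 1))).
  pose proof (Rabs_pos tau) as Hta.
  assert (Hden : 0 < 16 * b * (Rabs tau + 1)) by (apply Rmult_lt_0_compat; lra).
  assert (Heps : 0 < eps) by (apply Rinv_0_lt_compat; auto).
  exists (Rmin d eps). split; [apply Rmin_pos; auto|]. intros p q Hp Hq Hpq H1.
  pose proof (Rmin_l d eps). pose proof (Rmin_r d eps).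
  assert (Hz : fastc (fun _ => RtoC 0)).
  { intros r Hr. exists 0. intros k. rewrite Cmod_0. lra. }
  assert (Ez : forall y, cps (fun _ => RtoC 0) y = RtoC 0).
  { intros y. unfold cps. apply Cser_0. intros k. ring. }
  assert (Sz : solves tau theta p q (fun _ => cps (fun _ => RtoC 0))).
  { intros s Hs. split; [apply cps_entire; auto|]. intros y.
    eapply rderiv_ext; [intros; reflexivity| |apply rderiv_const].
    rewrite Delta_cps by auto. unfold cps. rewrite Cser_0; [ring|]. intros k. ring. }
  intros y. rewrite <- (Ez y).
  apply (local_unique tau theta Htheta (4 * b) M 0 p q p w (fun _ => cps (fun _ => RtoC 0))); auto; try lra.
  - eapply solves_sub; [| |apply Hw]; lra.
  - intros s y' Hs. apply HM; [lra|apply Rabs_def1; lra].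
  - intros s y' Hs. rewrite Ez, Cmod_0. lra.
  - intros y'. rewrite Ez. auto.
  - rewrite (Rabs_right (q - p)) by lra.
    assert (E : (Rabs tau + 1) * eps * (2 * (4 * b)) = / 2) by (unfold eps; field; lra).
    rewrite <- E. apply Rmult_le_compat_r; [lra|]. apply Rmult_le_compat; lra.
Qed.
End Locally_bounded.

Lemma is_derive_unit_time_rderiv (u : R -> C) (t : R) (l : C) : is_derive_unit_time u t l -> rderiv 0 1 u t l.
Proof.
  intros [_ H] eps He.
  destruct (H t (fun P HP => filter_imp _ _ (fun x Hx _ => Hx) HP) (mkposreal eps He)) as [d Hd].
  exists d. split; [apply cond_pos|]. intros s Hs Hst. specialize (Hd s Hst Hs).
  change (@norm R_AbsRing C_R_NormedModule (minus (minus (u s) (u t)) (scal (minus s t) l)) <= eps * Rabs (s - t)) in Hd.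
  rewrite norm_time_remainder in Hd. exact Hd.
Qed.

Lemma solves_minus (tau theta p q : R) (v w : R -> C -> C) : 0 <= theta -> solves tau theta p q v -> solves tau theta p q w ->
  solves tau theta p q (fun t z => v t z - w t z)%C.
Proof.
  intros Hth Hv Hw t Ht. destruct (Hv t Ht) as [Ev Dv]. destruct (Hw t Ht) as [Ew Dw].
  destruct (entire_taylor _ Ev) as [Fv Tv]. destruct (entire_taylor _ Ew) as [Fw Tw].
  assert (E : (fun z => v t z - w t z)%C = cps (fun k => tcoef (v t) k - tcoef (w t) k)%C).
  { apply functional_extensionality. intros z. rewrite cps_minus by auto. rewrite <- Tv, <- Tw. auto. }
  assert (Hm : fastc (fun k => tcoef (v t) k - tcoef (w t) k)%C) by (apply fastc_minus; auto).
  assert (Fd : forall c, fastc c -> fastc (fun k => RtoC ((theta + INR k) * INR (S k)) * c (S k))%C).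
  { intros c Hc. apply fastc_Delta; auto. }
  split; [rewrite E; apply cps_entire; auto|]. intros z.
  eapply rderiv_ext; [| |apply (rderiv_plus _ _ _ _ _ _ _ (Dv z) (rderiv_mult _ _ _ _ _ _ _ (rderiv_const p q (RtoC (-1)) t) (Dw z)))].
  - intros s. simpl. ring.
  - rewrite E, Delta_cps by auto.
    replace (fun k => RtoC ((theta + INR k) * INR (S k)) * (tcoef (v t) (S k) - tcoef (w t) (S k)))%C with
      (fun k => RtoC ((theta + INR k) * INR (S k)) * tcoef (v t) (S k) -
        RtoC ((theta + INR k) * INR (S k)) * tcoef (w t) (S k))%C
      by (apply functional_extensionality; intros; ring).
    rewrite cps_minus by auto. rewrite <- !Delta_cps by auto. rewrite <- Tv, <- Tw. ring.
Qed.

Lemma cauchy_solution_solves (tau theta : R) (init : C -> C) (f : R -> C -> C) : cauchy_solution tau theta init f ->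
  solves tau theta 0 1 f /\ exists a, forall b, a < b -> exp_type b f.
Proof.
  intros ((a & Ha & HA) & HD & _). split.
  - intros t Ht. split; [apply (HA t Ht)|]. intros z. apply is_derive_unit_time_rderiv, HD; auto.
  - exists a. intros b Hb t Ht. destruct (space_A_cps a (f t) (HA t Ht)) as (c & Hc & E & HN).
    destruct (HN b Hb ltac:(lra)) as [N HN']. exists N. rewrite E. apply fact_coef_fastc; auto. lra.
Qed.

Lemma cauchy_solution_unique (tau theta : R) (init : C -> C) (f h : R -> C -> C) : 0 <= theta ->
  cauchy_solution tau theta init f -> cauchy_solution tau theta init h ->
  forall t z, unit_time t -> h t z = f t z.
Proof.
  intros Hth Hf Hh t z Ht.
  destruct (cauchy_solution_solves _ _ _ _ Hf) as (Sf & a1 & Tf).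
  destruct (cauchy_solution_solves _ _ _ _ Hh) as (Sh & a2 & Th).
  (* The two solutions may belong to spaces with different a; their difference is of this common
     type. *)
  set (b := Rabs a1 + Rabs a2 + 1).
  pose proof (Rle_abs a1). pose proof (Rle_abs a2). pose proof (Rabs_pos a1). pose proof (Rabs_pos a2).
  apply Ceq_minus.
  apply (solves_zero theta b Hth ltac:(unfold b; lra) tau (fun t z => h t z - f t z)%C); auto.
  - apply solves_minus; auto.
  - intros s Hs. destruct (Tf b ltac:(unfold b; lra) s Hs) as [N1 H1']. destruct (Th b ltac:(unfold b; lra) s Hs) as [N2 H2'].
    exists (N2 + N1). intros y. eapply Rle_trans; [apply Cmod_minus_le|]. rewrite Rmult_plus_distr_r.
    apply Rplus_le_compat; auto.
  - intros y. destruct Hf as (_ & _ & E1). destruct Hh as (_ & _ & E2). rewrite E1, E2. ring.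
Qed.

(** * The iteration *)

Lemma ecoef_nonneg (l : list R) (k : nat) : nonneg_list l -> 0 <= ecoef l k.
Proof.
  intros Hl. revert k. induction Hl as [|g l Hg Hl IH]; intros k; simpl.
  - destruct k; lra.
  - destruct k as [|k]; [rewrite Rmult_0_r, Rplus_0_r; auto|].
    pose proof (IH (S k)). pose proof (Rmult_le_pos g (ecoef l k) Hg (IH k)). lra.
Qed.

Lemma clim_nonneg (u : nat -> R) (l : C) : (forall i, 0 <= u i) -> clim eventually (fun i => RtoC (u i)) l ->
  exists e, 0 <= e /\ l = RtoC e.
Proof.
  intros Hu Hl.
  assert (H : forall eps, 0 < eps -> Rabs (Im l) <= eps /\ - eps <= Re l).
  { intros eps He. destruct (Hl eps He) as [n Hn]. specialize (Hn n (le_n n)). specialize (Hu n).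
    pose proof (re_le_Cmod (RtoC (u n) - l)) as H1. pose proof (Im_le_Cmod (RtoC (u n) - l)) as H2.
    destruct l as [x y]. simpl in *. apply Rabs_le_between in H1. apply Rabs_le_between in H2.
    split; [apply Rabs_le|]; lra. }
  assert (HI : Im l = 0).
  { destruct (Req_dec (Im l) 0) as [|Hn]; auto. pose proof (Rabs_pos_lt _ Hn).
    destruct (H (Rabs (Im l) / 2) ltac:(lra)). lra. }
  exists (Re l). split.
  - apply Rnot_lt_le. intros Hlt. destruct (H (- Re l / 2) ltac:(lra)). lra.
  - destruct l as [x y]. simpl in *. subst y. auto.
Qed.

Lemma approximated_coef_nonneg (a : R) (d : nat -> C) : fastc d -> approximated nonneg_list a (cps d) ->
  forall k, exists e, 0 <= e /\ d k = RtoC e.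
Proof.
  intros Hd (_ & c & l & Hcl & Hlim & Hgr) k. destruct (Hgr (a + 1) ltac:(lra)) as [M HM].
  apply (clim_nonneg (fun i => c i * ecoef (l i) k)).
  - intros i. destruct (Hcl i) as [Hc Hl]. apply Rmult_le_pos; [lra|apply ecoef_nonneg; auto].
  - apply (clim_ext eventually (fun i => (RtoC (c i) * RtoC (ecoef (l i) k))%C)).
    + intros i. rewrite RtoC_mult. auto.
    + apply (approximated_coefs (M * exp ((a + 1) * 1)) c l); auto.
      intros i z Hz. specialize (HM i z). rewrite Hz in HM. exact HM.
Qed.

Lemma Cser_nonneg (a : nat -> C) : asum a -> (forall k, exists e, 0 <= e /\ a k = RtoC e) ->
  exists e, 0 <= e /\ Cser a = RtoC e.
Proof.
  intros Ha Hn. exists (Series (fun k => Cmod (a k))).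
  assert (E : forall k, a k = RtoC (Cmod (a k))).
  { intros k. destruct (Hn k) as (e & He & ->). rewrite Cmod_RtoC_nonneg; auto. }
  split.
  - apply Series_nonneg; auto. intros k. apply Cmod_ge_0.
  - unfold Cser, RtoC. f_equal.
    + apply Series_ext. intros k. rewrite (E k) at 1. auto.
    + rewrite (Series_ext _ (fun k => 0 * Cmod (a k))) by (intros k; rewrite (E k) at 1; simpl; ring).
      rewrite Series_scal_l. ring.
Qed.

(** Keeps the evolved function positive at 0: all terms are nonnegative and the term m = 0 is the
    positive initial value. *)
Lemma delta_series_pos (r theta : R) (d : nat -> C) : 0 <= r -> 0 <= theta ->
  asum (fun m => RtoC (heat_weight r m * poch (theta + INR 0) m) * d (0 + m)%nat)%C ->
  (forall k, exists e, 0 <= e /\ d k = RtoC e) -> (exists e, 0 < e /\ d O = RtoC e) ->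
  exists e, 0 < e /\ delta_series (heat_weight r) theta d 0 = RtoC e.
Proof.
  intros Hr Hth Hs Hd (e0 & He0 & E0). unfold delta_series. rewrite Cser_incr by auto.
  destruct (Cser_nonneg (fun m => RtoC (heat_weight r (S m) * poch (theta + INR 0) (S m)) * d (0 + S m)%nat)%C) as (e & He & E).
  - apply (ex_series_incr_1 (V := R_NormedModule)) in Hs. exact Hs.
  - intros k. destruct (Hd (0 + S k)%nat) as (e & He & E). exists (heat_weight r (S k) * poch (theta + INR 0) (S k) * e).
    split; [|rewrite E, <- RtoC_mult; auto].
    apply Rmult_le_pos; auto. apply Rmult_le_pos; [|apply poch_nonneg; simpl; lra].
    unfold heat_weight. apply Rmult_le_pos; [apply pow_le; auto|]. left. apply Rinv_0_lt_compat, INR_fact_lt_0.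
  - exists (e0 + e). split; [lra|]. rewrite E. change (0 + 0)%nat with O. rewrite E0. unfold heat_weight. simpl.
    rewrite Rdiv_1_r, Rmult_1_r, RtoC_plus. ring.
Qed.

Definition heat_flow (tau theta : R) (v : C -> C) (t : R) : C -> C :=
  cps (heatc theta (fun k => RtoC (INR (fact k)) * tcoef v k)%C (tau * t)).

(** The condition [beta <= alpha * (1 - tau * beta)] says that the type beta / (1 - tau beta)
    reached at time 1 is at most alpha; earlier times produce smaller types. *)
Lemma heat_flow_approximated (alpha beta tau theta : R) (v : C -> C) : 0 <= theta -> 0 <= tau -> 0 <= beta ->
  tau * beta < 1 -> beta <= alpha * (1 - tau * beta) -> approximated nonneg_list beta v -> pos_at_0 v ->
  cauchy_solution tau theta v (heat_flow tau theta v) /\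
  forall t, unit_time t -> approximated simple_list alpha (heat_flow tau theta v t) /\
    pos_at_0 (heat_flow tau theta v t).
Proof.
  intros Hth Htau Hbeta Htb Hab Hv Hv0.
  destruct (entire_taylor v (proj1 Hv)) as [Hc Ev].
  assert (Ha : 0 <= alpha).
  { apply Rnot_lt_le. intros Hlt. assert (0 < (- alpha) * (1 - tau * beta)) by (apply Rmult_lt_0_compat; lra). lra. }
  assert (Hb : exists b, beta < b /\ tau * b < 1).
  (* Half of the available margin, divided by tau + 1 so that [tau = 0] is included. *)
  { set (x := (1 - tau * beta) / (2 * (tau + 1))).
    assert (Hx : 0 < x) by (apply Rdiv_lt_0_compat; lra).
    assert (Ex : (tau + 1) * x = (1 - tau * beta) / 2) by (unfold x; field; lra).
    exists (beta + x). split; lra. }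
  destruct Hb as (b & Hb & Htb').
  destruct (approximated_growth _ beta ((beta + b) / 2) v Hv ltac:(lra)) as [M HM].
  destruct (growth_coefs ((beta + b) / 2) b M ltac:(lra)) as [N HN].
  assert (HcN : forall k, INR (fact k) * Cmod (tcoef v k) <= N * b ^ k).
  { apply HN; auto. rewrite <- Ev. auto. }
  assert (HdN : forall k, Cmod (RtoC (INR (fact k)) * tcoef v k) <= N * b ^ k).
  { intros k. rewrite Cmod_mult, Cmod_RtoC_nonneg by apply pos_INR. auto. }
  destruct (nat_above theta) as [T HT]. assert (HT' : 0 <= theta <= INR T) by lra.
  assert (Hb0 : 0 <= b) by lra.
  split.
  { rewrite Ev at 1. apply heat_solution with b N; auto. }
  intros t Ht. unfold unit_time in Ht. set (s := tau * t).
  assert (Hs : 0 <= s <= tau).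
  { unfold s. split; [apply Rmult_le_pos; lra|]. rewrite <- (Rmult_1_r tau) at 2. apply Rmult_le_compat_l; lra. }
  assert (Hrs : Rabs s <= tau) by (rewrite Rabs_right; lra).
  split.
  - apply (approximated_heat beta alpha s theta (tcoef v)); auto; try lra.
    + intros B HB. assert (HsB : 0 <= s * B) by (apply Rmult_le_pos; lra).
      assert (Hsb : s * beta <= tau * beta) by (apply Rmult_le_compat_r; lra).
      assert (Hi : 0 < / (1 + s * B)) by (apply Rinv_0_lt_compat; lra).
      assert (EB : B * / (1 + s * B) * (1 + s * B) = B) by (field; lra).
      assert (E1 : 1 - s * (B * / (1 + s * B)) = / (1 + s * B)) by (field; lra).
      (* The solution b of b / (1 - s b) = B. The inequality beta < b amounts to beta < B (1 - s
         beta). *)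
      exists (B * / (1 + s * B)). split; [|split].
      * apply Rmult_lt_reg_r with (1 + s * B); [lra|]. rewrite EB.
        assert (alpha * (1 - tau * beta) <= alpha * (1 - s * beta)) by (apply Rmult_le_compat_l; lra).
        assert (alpha * (1 - s * beta) < B * (1 - s * beta)) by (apply Rmult_lt_compat_r; lra). lra.
      * lra.
      * rewrite E1. right. field. lra.
    + rewrite <- Ev. apply approximated_simple; auto.
  - unfold pos_at_0, heat_flow. fold s.
    assert (Hpos : exists e, 0 < e /\ delta_series (heat_weight s) theta (fun k => RtoC (INR (fact k)) * tcoef v k)%C 0 = RtoC e).
    { apply delta_series_pos; try lra.
      - exact (delta_series_asum theta b N tau T HT' Hb0 Htau Htb' (heat_weight s) _ 0%nat (fun m => heat_weight_bound tau s m Hrs) HdN).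
      - intros k. destruct (approximated_coef_nonneg beta (tcoef v) Hc) with k as (e & He & E); [rewrite <- Ev; auto|].
        exists (INR (fact k) * e). rewrite E, RtoC_mult. split; auto. apply Rmult_le_pos; auto. apply pos_INR.
      - destruct Hv0 as (e & He & E). exists e. split; auto. rewrite Ev, cps_0 in E by auto.
        rewrite E. simpl. ring. }
    destruct Hpos as (e & He & E). exists e. split; auto. rewrite cps_0.
    + unfold heatc. rewrite E. simpl. rewrite Rinv_1. ring.
    + apply (heatc_fastc theta b N tau T); auto.
Qed.

Theorem theorem1p1 (lambda : R) (delta : nat) (g : C -> C) (alpha tau : R)
  (hlambda : 0 < lambda) (hdelta : (2 <= delta)%nat)
  (hg : laguerre_with alpha g) (hg0 : pos_at_0 g)
  (htau : interval_I lambda delta alpha tau)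
  (theta : R) (htheta : 0 <= theta) :
  exists f : nat -> R -> C -> C,
    (forall z : C, f 0%nat 1 z = g z) /\
    forall n : nat, (1 <= n)%nat ->
      cauchy_solution tau theta (rescaled_power lambda delta (f (n - 1)%nat 1)) (f n) /\
      (forall t : R, unit_time t -> laguerre_plus_in alpha (f n t)) /\
      (forall h : R -> C -> C,
         cauchy_solution tau theta (rescaled_power lambda delta (f (n - 1)%nat 1)) h ->
         forall (t : R) (z : C), unit_time t -> h t z = f n t z).
Proof.
  destruct (laguerre_approximated alpha g hg hg0) as [Ha Hg].
  destruct htau as [Htau HI].
  set (P := Rpower (INR delta) lambda) in *. set (kap := Rpower (INR delta) (-1 - lambda)).
  assert (HD : 2 <= INR delta) by (apply (le_INR 2); auto).
  assert (HP : 1 < P).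
  { unfold P. rewrite <- (Rpower_O (INR delta)) by lra. apply Rpower_lt; lra. }
  assert (Hkap : 0 < kap) by apply exp_pos.
  (* Rescaling by delta^(-1 - lambda) and taking the power delta multiplies the type by
     delta^(-lambda) = 1 / P. *)
  assert (EP : kap * INR delta * P = 1).
  { unfold kap, P. rewrite <- (Rpower_1 (INR delta)) at 2 by lra. rewrite <- !Rpower_plus.
    replace (-1 - lambda + 1 + lambda) with 0 by ring. apply Rpower_O. lra. }
  (* The interval for tau is restricted only when alpha > 0; for alpha = 0 the inequality reduces to
     P >= 1. *)
  assert (Hta : tau * alpha <= P - 1).
  { destruct Ha as [Ha|<-]; [|lra]. apply Rle_trans with ((P - 1) / alpha * alpha).
    - apply Rmult_le_compat_r; [lra|auto].
    - right. field. lra. }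
  set (beta := alpha * kap * INR delta).
  assert (Hbeta : 0 <= beta) by (unfold beta; apply Rmult_le_pos; [apply Rmult_le_pos|]; lra).
  assert (EbP : beta * P = alpha) by (unfold beta; rewrite <- (Rmult_1_r alpha) at 2; rewrite <- EP; ring).
  (* Equivalent to 1 <= P (1 - tau beta). It yields both tau beta < 1 and, multiplied by beta, the
     inequality beta <= alpha (1 - tau beta). *)
  assert (Htb1 : tau * beta * P <= P - 1) by (rewrite Rmult_assoc, EbP; auto).
  assert (Htb : tau * beta < 1).
  { apply Rmult_lt_reg_r with P; lra. }
  assert (Hab : beta <= alpha * (1 - tau * beta)).
  { rewrite <- EbP at 1. rewrite Rmult_assoc. rewrite <- (Rmult_1_r beta) at 1. apply Rmult_le_compat_l; auto. lra. }
  (* Stage 0 is constant in time, so its value at time 1 is [g] and the recursion has a uniform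
     form. *)
  set (f := fix f (n : nat) : R -> C -> C := match n with
    | O => fun _ => g
    | S n => heat_flow tau theta (rescaled_power lambda delta (f n 1)) end).
  assert (Hpow : forall u, approximated nonneg_list alpha u -> pos_at_0 u ->
    approximated nonneg_list beta (rescaled_power lambda delta u) /\ pos_at_0 (rescaled_power lambda delta u)).
  { intros u Hu (r & Hr & Er). split.
    - apply (approximated_rescaled_power alpha kap delta u Hkap); auto. lia.
    - exists (r ^ delta). split; [apply pow_lt; auto|]. unfold rescaled_power.
      rewrite Cmult_0_l, Er, RtoC_pow. auto. }
  assert (Hstep : forall n, approximated nonneg_list alpha (f n 1) /\ pos_at_0 (f n 1)).
  { induction n as [|n [IH1 IH2]]; [split; auto|]. destruct (Hpow _ IH1 IH2) as [V1 V2].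
    destruct (heat_flow_approximated alpha beta tau theta _ htheta Htau Hbeta Htb Hab V1 V2) as [_ Hf].
    destruct (Hf 1) as [H1 H2]; [unfold unit_time; lra|]. split; auto.
    (* The flow returns distinct positive parameters; they are weakened to nonnegative ones, the
       form that the next power requires. *)
    destruct H1 as (H3 & c & l & Hcl & H4). split; auto. exists c, l. split; auto.
    intros i. split; [apply Hcl|apply simple_nonneg, Hcl]. }
  exists f. split; auto. intros [|n] Hn; [lia|]. simpl Nat.sub. rewrite Nat.sub_0_r.
  destruct (Hstep n) as [F1 F2]. destruct (Hpow _ F1 F2) as [V1 V2].
  destruct (heat_flow_approximated alpha beta tau theta _ htheta Htau Hbeta Htb Hab V1 V2) as [Hs Hf].
  split; [exact Hs|]. split.
  - intros t Ht. destruct (Hf t Ht) as [H1 H2]. split; [split; auto|].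
    + apply (approximated_laguerre alpha); auto.
    + apply (approximated_space_A simple_list); auto.
  - intros h Hh t z Ht. apply (cauchy_solution_unique tau theta _ (f (S n)) h htheta Hs Hh); auto.
Qed.
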